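(* Let $0<\gamma<1/6$, $u_0\in UC(\mathbb R^d)$, and let $A(y,t,\omega):=\sum_{i=1}^m a^i(y)\xi^i(t,\omega)$, where $a^i\in C^{0,1}(\mathbb T^d)$ for $i=1,\dots,m$, $\sum_{i=1}^m a^i\,y^i\neq0$ on $\mathbb T^d$ whenever $y^1,\dots,y^m\in\{-1,1\}$, and the random vectors $\big((\xi^1,\dots,\xi^m)$ restricted to $[k,k+1)\big)_{k=0}^\infty$ are constant on each $[k,k+1)$, independent in $k$, and uniformly distributed over $\{-1,1\}^m$. Let $u^\varepsilon$ solve \[ u^\varepsilon_t+\frac1{\varepsilon^\gamma}A\Big(\frac x\varepsilon,\frac t{\varepsilon^{2\gamma}},\omega\Big)|Du^\varepsilon|=0\ \text{ in }\mathbb R^d\times(0,\infty),\quad u^\varepsilon(\cdot,0)=u_0. \] Then there exist $\overline{\mathbf A}\in C(S^{d-1},\mathbb R^{2^{m-1}})$ and a Brownian motion $\mathbf B:[0,\infty)\times\Omega\to\mathbb R^{2^{m-1}}$ such that, as $\varepsilon\to0$, $u^\varepsilon$ converges locally uniformly and in distribution to the stochastic viscosity solution $\overline u$ of \[ d\overline u+\overline{\mathbf A}\Big(\frac{D\overline u}{|D\overline u|}\Big)|D\overline u|\circ d\mathbf B=0\ \text{ in }\mathbb R^d\times(0,\infty),\quad\overline u(\cdot,0)=u_0. \]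
   Context: $\mathbb T^d$ is the torus ($\mathbb Z^d$-periodic functions), $S^{d-1}$ the unit sphere, $C^{0,1}$ Lipschitz functions. With $\overline{\mathbf A}=(\overline A^1,\dots,\overline A^M)$, $\mathbf B=(B^1,\dots,B^M)$, the limit equation means $d\overline u+\sum_j\overline A^j(D\overline u/|D\overline u|)|D\overline u|\circ dB^j=0$. Stochastic viscosity solutions are defined pathwise as continuous extensions to continuous paths of the classical viscosity solution operator for $C^1$ driving paths. The equation for $u^\varepsilon$ is a classical viscosity problem with piecewise constant time dependence. Convergence in distribution is in $C(\mathbb R^d\times[0,\infty))$ with the local uniform topology. *)

(* Defs.v *)
From HB Require Import structures.
From mathcomp Require Import all_boot all_order all_algebra.
From mathcomp Require Import all_classical all_reals all_analysis.
Set Implicit Arguments. Unset Strict Implicit. Unset Printing Implicit Defensive.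
Import Order.TTheory GRing.Theory Num.Theory.
Import numFieldNormedType.Exports.
Local Open Scope classical_set_scope.
Local Open Scope ring_scope.

Section Defs.
Variable R : realType.

Definition enorm {d : nat} (v : 'rV[R]_d) : R := Num.sqrt (\sum_i v ord0 i ^+ 2).

Definition unif_cont {d : nat} (f : 'rV[R]_d -> R) : Prop :=
  forall e : R, 0 < e -> exists2 del : R, 0 < del &
    forall x y, enorm (x - y) < del -> `|f x - f y| < e.

(* C^{0,1}(T^d): Lipschitz and Z^d-periodic *)
Definition lipschitz_fun {d : nat} (f : 'rV[R]_d -> R) : Prop :=
  exists L : R, forall x y, `|f x - f y| <= L * enorm (x - y).
Definition Zd_periodic {d : nat} (f : 'rV[R]_d -> R) : Prop :=
  forall x (j : 'I_d), f (x + delta_mx 0 j) = f x.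

Definition C1 {d : nat} (phi : 'rV[R]_d * R -> R) : Prop :=
  (forall z, differentiable phi z) /\ (forall v, continuous (fun z => 'd phi z v)).
Definition grad {d : nat} (phi : 'rV[R]_d * R -> R) (z : 'rV[R]_d * R) : 'rV[R]_d :=
  \row_i 'd phi z (delta_mx 0 i, 0).
Definition dtime {d : nat} (phi : 'rV[R]_d * R -> R) (z : 'rV[R]_d * R) : R :=
  'd phi z (0, 1).

Definition visc_sol {d : nat} (H : 'rV[R]_d -> R -> 'rV[R]_d -> R)
    (u : 'rV[R]_d -> R -> R) (I : set R) : Prop :=
  forall (phi : 'rV[R]_d * R -> R) x0 t0, C1 phi -> I t0 ->
  ((exists2 r : R, 0 < r & forall x t, enorm (x - x0) < r -> `|t - t0| < r ->
       u x t - phi (x, t) <= u x0 t0 - phi (x0, t0)) ->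
     dtime phi (x0, t0) + H x0 t0 (grad phi (x0, t0)) <= 0) /\
  ((exists2 r : R, 0 < r & forall x t, enorm (x - x0) < r -> `|t - t0| < r ->
       u x t - phi (x, t) >= u x0 t0 - phi (x0, t0)) ->
     dtime phi (x0, t0) + H x0 t0 (grad phi (x0, t0)) >= 0).

Definition uc_class {d : nat} (u0 : 'rV[R]_d -> R) (u : 'rV[R]_d -> R -> R) : Prop :=
  {within [set z : 'rV[R]_d * R | 0 <= z.2], continuous (fun z => u z.1 z.2)} /\
  (forall x, u x 0 = u0 x) /\
  (forall T : R, 0 < T -> forall e : R, 0 < e -> exists2 del : R, 0 < del &
     forall x y s t, 0 <= s <= T -> 0 <= t <= T -> enorm (x - y) < del ->
       `|s - t| < del -> `|u x s - u y t| < e).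

Definition loc_unif_cvg {d : nat} (f : nat -> 'rV[R]_d -> R -> R)
    (g : 'rV[R]_d -> R -> R) : Prop :=
  forall r e : R, 0 < r -> 0 < e -> exists N : nat, forall n, (N <= n)%N ->
    forall x t, enorm x <= r -> 0 <= t <= r -> `|f n x t - g x t| < e.

Definition path_loc_unif_cvg {M : nat} (z : nat -> 'I_M -> R -> R)
    (zeta : 'I_M -> R -> R) : Prop :=
  forall T e : R, 0 < T -> 0 < e -> exists N : nat, forall n, (N <= n)%N ->
    forall j t, 0 <= t <= T -> `|z n j t - zeta j t| < e.
Definition C1_path {M : nat} (zeta : 'I_M -> R -> R) : Prop :=
  forall j, (forall t, derivable (zeta j) t 1) /\ continuous (derive1 (zeta j)).

Definition limit_H {d M : nat} (Abar : 'rV[R]_d -> 'I_M -> R)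
    (zeta : 'I_M -> R -> R) : 'rV[R]_d -> R -> 'rV[R]_d -> R :=
  fun x t p => \sum_j Abar ((enorm p)^-1 *: p) j * enorm p * derive1 (zeta j) t.

(* stochastic (pathwise) viscosity solution for a continuous driving path zeta:
   ubar is the value at zeta of the continuous extension of the classical solution
   operator, i.e. the local uniform limit of the classical solutions driven by any
   C^1 paths converging locally uniformly to zeta. *)
Definition stoch_visc_sol {d M : nat} (Abar : 'rV[R]_d -> 'I_M -> R)
    (u0 : 'rV[R]_d -> R) (zeta : 'I_M -> R -> R) (ubar : 'rV[R]_d -> R -> R) : Prop :=
  forall (z : nat -> 'I_M -> R -> R) (v : nat -> 'rV[R]_d -> R -> R),
    (forall n, C1_path (z n)) -> path_loc_unif_cvg z zeta ->
    (forall n, uc_class u0 (v n) /\ visc_sol (limit_H Abar (z n)) (v n) [set t | 0 < t]) ->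
    loc_unif_cvg v ubar.

Definition brownian_motion {dO : measure_display} {Omega : measurableType dO}
    (P : probability Omega R) {M : nat} (B : 'I_M -> R -> Omega -> R) : Prop :=
  (forall j t, measurable_fun setT (B j t)) /\
  {ae P, forall w, forall j, B j 0 w = 0 /\
      {within [set t : R | 0 <= t], continuous (fun t => B j t w)}} /\
  (forall (n : nat) (t : nat -> R) (A : nat -> 'I_M -> set R),
     t 0%N = 0 -> (forall k, (k < n)%N -> t k < t k.+1) ->
     (forall k j, measurable (A k j)) ->
     P [set w | forall k j, (k < n)%N -> B j (t k.+1) w - B j (t k) w \in A k j] =
     (\prod_(k < n) \prod_(j < M)
        fine (normal_prob 0 (Num.sqrt (t k.+1 - t k)) (A k j)))%:E).

Definition cont_on_half {d : nat} (f : 'rV[R]_d -> R -> R) : Prop :=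
  {within [set z : 'rV[R]_d * R | 0 <= z.2], continuous (fun z => f z.1 z.2)}.
Definition bdd_cont_functional {d : nat} (F : ('rV[R]_d -> R -> R) -> R) : Prop :=
  (exists C : R, forall g, cont_on_half g -> `|F g| <= C) /\
  (forall f, cont_on_half f -> forall e : R, 0 < e ->
     exists r del : R, [/\ 0 < r, 0 < del &
       forall g, cont_on_half g ->
         (forall x t, enorm x <= r -> 0 <= t <= r -> `|g x t - f x t| < del) ->
         `|F g - F f| < e]).

End Defs.

(* Main.v *)
(* The letters [(xi k i)_i] are split into their first sign [s_k] and a pattern [J_k] among
   [2 ^ m.-1]; pattern [j] gives a speed [c_j] of constant sign, so that its reachable sets are
   those of a controllable front. Their support functions are almost additive in time, hence
   grow like an even sublinear [H_j]; during one time step the true flow is close to the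
   Hopf-Lax flow of [H_j] run for the signed time [s_k], and since [gamma < 1/4] the errors
   of all steps add up to [o(1)]. The Hopf-Lax flows depend continuously, in sup norm, on the
   driving path (comparison with a penalisation made of the flows themselves), so [u eps] is,
   up to [o(1)], a continuous function of the random walk with steps [s_k] in direction [J_k].
   Brownian motion is built on [Omega] itself from the bits of the letters, and Donsker's theorem
   follows from characteristic functions and moment bounds; test functionals are reduced to
   Lipschitz ones by inf-convolution. *)

Require Import Defs.
From HB Require Import structures.
From mathcomp Require Import all_boot all_order all_algebra.
From mathcomp Require Import all_classical all_reals all_analysis.
From mathcomp Require Import ring lra zify measurable_realfun.
Set Implicit Arguments. Unset Strict Implicit. Unset Printing Implicit Defensive.
Import Order.TTheory GRing.Theory Num.Theory.
Import numFieldNormedType.Exports.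
Local Open Scope classical_set_scope.
Local Open Scope ring_scope.

(** In one time step the front travels for the microscopic time t = eps^(gamma-1). A reachable set
    need not be convex whereas the effective one is, so an effective velocity is followed by
    switching directions in stages of length T; this costs O(t/T + sqrt(t/T) T + T), that is t^(2/3)
    for T near t^(1/3). Over eps^(-2 gamma) steps the errors total eps * eps^(2(gamma-1)/3) *
    eps^(-2 gamma) = eps^((1-4 gamma)/3), whence the threshold 1/4. The errors merely add up because
    each effective flow commutes with translations, hence keeps the Lipschitz constant of the data,
    and each true flow is a contraction in sup norm. For the dependence on the path, a quadratic
    penalisation of x-y would leave an error of the size of the total variation of the difference of
    the paths; the Hopf formula instead gives a test function that solves the equation driven by
    this difference, so that the Hamiltonians cancel exactly. Convergence is asserted in law only,
    so the Brownian motion is not coupled with the walk. *)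

Lemma eq_le_imp (R: realType) (x y: R): x = y -> x<=y. Proof. by move=> ->. Qed.

(** * Euclidean geometry of row vectors and first-order expansions *)

Section Vectors.
Variables (R: realType) (d: nat).
Local Notation V:= 'rV[R]_d.
Implicit Types (x y: V) (a b: R).

Definition dot x y: R:= \sum_i x ord0 i*y ord0 i.

Lemma dotC x y: dot x y = dot y x.
Proof. by apply: eq_bigr => i _; rewrite mulrC. Qed.

Lemma dotDl x y (z: V): dot (x+y) z = dot x z+dot y z.
Proof. by rewrite -big_split; apply: eq_bigr => i _; rewrite mxE mulrDl. Qed.

Lemma dotDr x y (z: V): dot z (x+y) = dot z x+dot z y.
Proof. by rewrite dotC dotDl !(dotC z). Qed.

Lemma dotZl a x y: dot (a *: x) y = a*dot x y.
Proof. by rewrite mulr_sumr; apply: eq_bigr => i _; rewrite mxE mulrA. Qed.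

Lemma dotZr a x y: dot x (a *: y) = a*dot x y.
Proof. by rewrite dotC dotZl dotC. Qed.

Lemma dotNl x y: dot (- x) y = - dot x y.
Proof. by rewrite -scaleN1r dotZl mulN1r. Qed.

Lemma dotNr x y: dot x (- y) = - dot x y.
Proof. by rewrite dotC dotNl dotC. Qed.

Lemma dotBl x y (z: V): dot (x-y) z = dot x z-dot y z.
Proof. by rewrite dotDl dotNl. Qed.

Lemma dotBr x y (z: V): dot z (x-y) = dot z x-dot z y.
Proof. by rewrite dotDr dotNr. Qed.

Lemma dot0l x: dot 0 x = 0.
Proof. by rewrite -(scale0r 0) dotZl mul0r. Qed.

Lemma dot0r x: dot x 0 = 0.
Proof. by rewrite dotC dot0l. Qed.

Lemma dotxx_ge0 x: 0<=dot x x.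
Proof. by apply: sumr_ge0 => i _; rewrite -expr2 sqr_ge0. Qed.

Lemma dot_delta x i: dot x (delta_mx 0 i) = x ord0 i.
Proof.
rewrite /dot (bigD1 i)//= mxE !eqxx mulr1 big1 ?addr0// => j ji.
by rewrite mxE (negbTE ji) andbF mulr0.
Qed.

Lemma enormE x: enorm x = Num.sqrt (dot x x).
Proof. by congr Num.sqrt; apply: eq_bigr => i _; rewrite expr2. Qed.

Lemma enorm_ge0 x: 0<=enorm x.
Proof. exact: sqrtr_ge0. Qed.
Hint Resolve enorm_ge0: core.

Lemma enorm_sqr x: enorm x^+2 = dot x x.
Proof. by rewrite enormE sqr_sqrtr// dotxx_ge0. Qed.

Lemma enorm0: enorm (0: V) = 0.
Proof. by rewrite enormE dot0l sqrtr0. Qed.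

Lemma enormZ a x: enorm (a *: x) = `|a| * enorm x.
Proof. by rewrite !enormE dotZl dotZr mulrA -expr2 sqrtrM ?sqr_ge0// sqrtr_sqr. Qed.

Lemma enormN x: enorm (- x) = enorm x.
Proof. by rewrite -scaleN1r enormZ normrN1 mul1r. Qed.

Lemma enormBC x y: enorm (x-y) = enorm (y-x).
Proof. by rewrite -enormN opprB. Qed.

Lemma enorm_coord x i: `|x ord0 i| <= enorm x.
Proof.
rewrite -sqrtr_sqr /enorm ler_sqrt; last by apply: sumr_ge0 => j _; exact: sqr_ge0.
by rewrite (bigD1 i)//= lerDl; apply: sumr_ge0 => j _; exact: sqr_ge0.
Qed.

Lemma enorm_eq0 x: enorm x = 0 -> x = 0.
Proof.
move=> x0; apply/rowP => i; rewrite mxE; apply/eqP; rewrite -normr_eq0 eq_le normr_ge0 andbT.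
by rewrite -x0 enorm_coord.
Qed.

Lemma dot_le x y: dot x y<=enorm x*enorm y.
Proof.
have:= dotxx_ge0 (enorm y *: x-enorm x *: y).
rewrite dotBl !dotBr !(dotZl, dotZr) -!enorm_sqr (dotC y x).
have:= enorm_ge0 x; have:= enorm_ge0 y.
rewrite le_eqVlt => /orP[/eqP/esym/enorm_eq0->|y0]; first by rewrite dot0r enorm0 mulr0.
rewrite le_eqVlt => /orP[/eqP/esym/enorm_eq0->|x0]; first by move=> _; rewrite dot0l enorm0 mul0r.
set e:= enorm x*enorm y => h; have e0: 0<e by rewrite mulr_gt0.
suff: 0<=e*(e-dot x y) by rewrite pmulr_rge0// subr_ge0.
rewrite /e; move: h; rewrite /e; nra.
Qed.

Lemma dot_norm x y: `|dot x y| <= enorm x*enorm y.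
Proof.
rewrite ler_norml dot_le andbT lerNl -dotNl.
by apply: le_trans (dot_le _ _) _; rewrite enormN.
Qed.

Lemma enormD x y: enorm (x+y)<=enorm x+enorm y.
Proof.
rewrite -(@ler_pXn2r _ 2)// ?nnegrE ?addr_ge0// enorm_sqr dotDl !dotDr.
rewrite sqrrD -!enorm_sqr (dotC y x); have:= dot_le x y; lra.
Qed.

Lemma enormB x y: enorm (x-y)<=enorm x+enorm y.
Proof. by apply: le_trans (enormD _ _) _; rewrite enormN. Qed.

Lemma enorm_trian y x (z: V): enorm (x-z)<=enorm (x-y)+enorm (y-z).
Proof. by rewrite -{1}(subrK y x) -addrA enormD. Qed.

Lemma enorm_dist x y: `|enorm x-enorm y| <= enorm (x-y).
Proof.
rewrite ler_norml lerNl opprB !lerBlDr; apply/andP; split.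
 by have:= enormD (y-x) x; rewrite subrK enormBC.
by have:= enormD (x-y) y; rewrite subrK.
Qed.

Lemma enorm_le_sum x: enorm x<=\sum_i `|x ord0 i|.
Proof.
have s0: 0<=\sum_i `|x ord0 i| by apply: sumr_ge0.
rewrite -(ger0_norm s0) -sqrtr_sqr /enorm ler_sqrt ?sqr_ge0//.
rewrite expr2 mulr_sumr; apply: ler_sum => i _.
rewrite -real_normK ?num_real// expr2 ler_wpM2r// (bigD1 i)//= lerDl.
exact: sumr_ge0.
Qed.

Lemma mxnorm_coord x i: `|x ord0 i| <= `|x|.
Proof.
have /mapP[j Hj ->]: `|x ord0 i| \in [seq `|x k.1 k.2| | k: 'I_1 * 'I_d].
 by apply/mapP; exists (ord0, i) => //=; rewrite mem_enum.
by rewrite [leRHS]/Num.norm /= mx_normrE; apply/bigmax_geP; right => /=; exists j.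
Qed.

Lemma mxnorm_le_enorm x: `|x| <= enorm x.
Proof.
rewrite [leLHS]/Num.norm /= mx_normrE; apply/bigmax_leP; split => // -[i j] _ /=.
by rewrite ord1 enorm_coord.
Qed.

Lemma enorm_le_mxnorm x: enorm x<=d%:R * `|x|.
Proof.
apply: le_trans (enorm_le_sum _) _.
apply: (@le_trans _ _ (\sum_(i<d) `|x|)); first by apply: ler_sum => i _; exact: mxnorm_coord.
by rewrite sumr_const card_ord mulr_natl.
Qed.

(** The topology of [V] comes from the sup norm of matrices; the factor [d%:R+1] compares it with
    the Euclidean norm and stays positive when [d = 0]. *)
Lemma near_enorm x (P: V -> Prop) :
 (\forall y \near x, P y) <-> exists2 r: R, 0<r & forall y, enorm (y-x)<r -> P y.
Proof.
split.
 move=> /nbhs_normP[r /= r0 rP]; exists r => // y yr; apply: rP => /=.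
 by rewrite distrC (le_lt_trans (mxnorm_le_enorm _)).
move=> [r r0 rP]; apply/nbhs_normP; exists (r/(d%:R+1)); first by rewrite /= divr_gt0// ltr_wpDl.
move=> y /=; rewrite distrC => yr; apply: rP.
apply: le_lt_trans (enorm_le_mxnorm _) _.
have d0: 0<d%:R+1 :> R by rewrite ltr_wpDl.
apply: (@le_lt_trans _ _ ((d%:R+1) * `|y-x|)); first by rewrite ler_wpM2r// lerDl.
by rewrite mulrC -ltr_pdivlMr.
Qed.

Lemma near_enorm2 x (t: R) (P: V*R -> Prop) :
 (\forall z \near (x, t), P z) <->
 exists2 r: R, 0<r & forall y s, enorm (y-x)<r -> `|s-t| < r -> P (y, s).
Proof.
split.
 move=> /nbhs_ballP[r /= r0 rP]; exists r => // y s yr sr; apply: rP; split => /=.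
  rewrite -ball_normE/= distrC; exact: le_lt_trans (mxnorm_le_enorm _) _.
 by rewrite -ball_normE/= distrC.
move=> [r r0 rP]; have d1: 0<d%:R+1 :> R by rewrite ltr_wpDl.
apply/nbhs_ballP; exists (r/(d%:R+1)); first by rewrite /= divr_gt0.
move=> [y s] [/=]; rewrite -!ball_normE/= ![`|_-y|]distrC ![`|_-s|]distrC => yr sr; apply: rP.
 apply: le_lt_trans (enorm_le_mxnorm _) _.
 apply: (@le_lt_trans _ _ ((d%:R+1) * `|y-x|)); first by rewrite ler_wpM2r// lerDl.
 by rewrite mulrC -ltr_pdivlMr.
by apply: lt_le_trans sr _; rewrite ler_pdivrMr// ler_peMr ?(ltW r0)// lerDr ler0n.
Qed.

Lemma cont_enormP (f: V -> R) x: {for x, continuous f} <->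
 forall e: R, 0<e -> exists2 r: R, 0<r & forall y, enorm (y-x)<r -> `|f y-f x| < e.
Proof.
split=> [cf e e0|H].
 have /cvgrPdist_lt/(_ _ e0):= cf; move=> /near_enorm[r r0 rP]; exists r => // y /rP.
 by rewrite distrC.
apply/(@cvgrPdist_lt _ _ _ (nbhs x)) => e /H[r r0 rP]; apply/near_enorm; exists r => // y /rP.
by rewrite distrC.
Qed.

Lemma cont_enorm2P (f: V*R -> R) x t: {for (x, t), continuous f} <->
 forall e: R, 0<e -> exists2 r: R, 0<r &
  forall y s, enorm (y-x)<r -> `|s-t| < r -> `|f (y, s)-f (x, t)| < e.
Proof.
split=> [cf e e0|H].
 have /cvgrPdist_lt/(_ _ e0):= cf; move=> /near_enorm2[r r0 rP]; exists r => // y s yr /(rP _ _ yr).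
 by rewrite distrC.
apply/(@cvgrPdist_lt _ _ _ (nbhs (x, t))) => e /H[r r0 rP]; apply/near_enorm2; exists r => // y s yr /(rP _ _ yr).
by rewrite distrC.
Qed.

Lemma closed_ball_compact (r: R): compact [set x: V | enorm x<=r].
Proof.
apply: bounded_closed_compact.
 exists r; split; first exact: num_real.
 by move=> M rM x /= xr; apply: le_trans (mxnorm_le_enorm _) _; exact: le_trans xr (ltW rM).
have -> : [set x: V | enorm x<=r] = @enorm R d @^-1` [set y | y<=r] by [].
apply: closed_comp; last exact: closed_le.
move=> x _; apply/cont_enormP => e e0; exists e => // y; exact: le_lt_trans (enorm_dist _ _).
Qed.

Lemma pairnorm_fst x (s: R): `|x| <= `|(x, s)|.
Proof. by rewrite prod_normE/= num_le_max lexx. Qed.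

Lemma pairnorm_snd x (s: R): `|s| <= `|(x, s)|.
Proof. by rewrite prod_normE/= num_le_max lexx orbT. Qed.

Lemma pairnorm_le x (s: R): `|(x, s)| <= enorm x + `|s|.
Proof.
rewrite prod_normE/= num_ge_max.
by rewrite (le_trans (mxnorm_le_enorm _)) ?lerDl//= lerDr enorm_ge0.
Qed.

(* First-order expansion of [phi] at [(x, t)], in terms of the Euclidean norm. *)
Definition fo_exp (phi: V*R -> R) x (t: R) (p: V) (q: R): Prop :=
 forall e: R, 0<e -> exists2 r: R, 0<r &
  forall y s, enorm (y-x)<r -> `|s-t| < r ->
   `|phi (y, s)-phi (x, t)-dot p (y-x)-q*(s-t)| <= e*(enorm (y-x) + `|s-t|).

Lemma diff_gradE (phi: V*R -> R) (z: V*R) v (s: R) :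
 'd phi z (v, s) = dot (grad phi z) v+dtime phi z*s.
Proof.
have -> : (v, s) = \sum_i (v ord0 i *: (delta_mx 0 i, 0))+s *: (0, 1) :> V*R.
 apply: injective_projections => /=.
  rewrite (big_morph fst (fun _ _ => erefl) erefl)/= scaler0 addr0.
  by rewrite {1}(row_sum_delta v).
 rewrite (big_morph snd (fun _ _ => erefl) erefl)/= big1 ?add0r; last by move=> i _; rewrite scaler0.
 by rewrite /GRing.scale/= mulr1.
rewrite linearD linear_sum/= linearZ/=; congr (_+_); last by rewrite mulrC.
by apply: eq_bigr => i _; rewrite linearZ/= mxE mulrC.
Qed.

Lemma C1_fo_exp (phi: V*R -> R) x t: C1 phi ->
 fo_exp phi x t (grad phi (x, t)) (dtime phi (x, t)).
Proof.
move=> [dphi _] e e0; have [_ /eqaddoP H]:= (diff_locallyP _ _).1 (dphi (x, t)).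
have /near_enorm2[r r0 rP]:= H _ e0.
exists r => // y s yr sr.
have:= rP (y-x) (s-t); rewrite !subr0 => /(_ yr sr).
rewrite !fctE /= /shift /=.
have -> : (y-x, s-t)+(x, t) = (y, s) by congr pair => /=; rewrite subrK.
rewrite diff_gradE !opprD !addrA => /le_trans; apply.
by rewrite ler_wpM2l ?(ltW e0)// pairnorm_le.
Qed.

(** Converts expansions with continuous coefficients back into the class [C1] of the definition of
    viscosity solutions, so that test functions can be built from expansions without computing
    differentials. *)
Lemma fo_exp_C1 (phi: V*R -> R) (g: V*R -> V) (q: V*R -> R) :
 (forall x t, fo_exp phi x t (g (x, t)) (q (x, t))) ->
 (forall v, continuous (fun z: V*R => dot (g z) v)) -> continuous q ->
 [/\ C1 phi, forall w, grad phi w = g w & forall w, dtime phi w = q w].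
Proof.
move=> H cg cq.
pose df (z: V*R) (w: V*R): R:= dot (g z) w.1+q z*w.2.
have dfD z: linear (df z: V*R -> R).
 move=> a [v s] [w r]; rewrite /df/= dotDr dotZr.
 by rewrite /GRing.scale/=; ring.
pose DF z: {linear (V*R)%type -> R} := HB.pack (df z)
 (GRing.isLinear.Build R (V*R)%type R *:%R (df z) (dfD z)).
have DFE z w: DF z w = df z w by [].
have cDF z: continuous (DF z: V*R -> R).
 case=> x t; apply/cont_enorm2P => e e0; pose C:= enorm (g z) + `|q z| + 1.
 have C0: 0<C by rewrite ltr_wpDl// addr_ge0.
 exists (e/C); first by rewrite divr_gt0.
 move=> y s yr sr; rewrite !DFE /df/=.
 have -> : dot (g z) y+q z*s-(dot (g z) x+q z * t) = dot (g z) (y-x)+q z*(s-t).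
  by rewrite dotBr; ring.
 apply: le_lt_trans (ler_normD _ _) _; rewrite normrM.
 apply: le_lt_trans (lerD (dot_norm _ _) (lexx _)) _.
 move: yr sr; rewrite !ltr_pdivlMr// => yr sr.
 have:= enorm_ge0 (y-x); have:= normr_ge0 (s-t); have:= enorm_ge0 (g z); have:= normr_ge0 (q z).
 by move: yr sr; rewrite /C; nra.
have core (z: V*R) e: 0<e ->
  \forall w \near (0: V*R), `|phi (w+z)-(phi z+DF z w)| <= e * `|w|.
 move=> e0; case: z => x t.
 have d1: 0<d%:R+1 :> R by rewrite ltr_wpDl.
 have [r r0 rP]:= H x t (e/(d%:R+1)) (divr_gt0 e0 d1).
 apply/near_enorm2; exists r => // y s; rewrite !subr0 => yr sr.
 have -> : (y, s)+(x, t) = (y+x, s+t) by [].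
 have:= rP (y+x) (s+t); rewrite !addrK => /(_ yr sr).
 rewrite DFE /df/= !opprD !addrA => /le_trans; apply.
 rewrite mulrAC ler_pdivrMr// -mulrA ler_wpM2l ?(ltW e0)//.
 rewrite mulrDr mulr1 lerD//.
  apply: le_trans (enorm_le_mxnorm _) _; rewrite mulrC ler_wpM2r//.
  exact: pairnorm_fst.
 exact: pairnorm_snd.
have dE z: 'd phi z = DF z :> (V*R -> R).
 by apply: diff_unique; [exact: cDF|apply/eqaddoP => e /(core z)].
split.
- split=> [z|v].
  by apply/diff_locallyP; rewrite dE; split; [exact: cDF|apply/eqaddoP => e /(core z)].
 rewrite (_: (fun z => _) = (fun z => dot (g z) v.1+q z*v.2)); last first.
  by apply/funext => z; rewrite dE.
 by move=> z; apply: cvgD; [exact: cg|apply: cvgMl; exact: cq].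
- by move=> z; apply/rowP => i; rewrite mxE dE DFE /df/= mulr0 addr0 dot_delta.
- by move=> z; rewrite /dtime dE DFE /df/= dot0r mulr1 add0r.
Qed.

End Vectors.
#[global] Hint Extern 0 (is_true (_<=enorm _)) => solve [apply: enorm_ge0]: core.

(** * Test functions with explicit derivatives *)

Section Comparison.
Variables (R: realType) (d: nat).
Local Notation V:= 'rV[R]_d.

(** Carrying the gradient and the time derivative as data lets sums, products and shifts of test
    functions be formed with their derivatives at hand. *)
Definition C1with (phi: V*R -> R) (g: V*R -> V) (q: V*R -> R): Prop :=
 [/\ forall x t, fo_exp phi x t (g (x, t)) (q (x, t)),
   forall v, continuous (fun z: V*R => dot (g z) v) & continuous q].

Definition visc_sub (H: V -> R -> V -> R) (u: V -> R -> R) (I: set R): Prop :=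
 forall phi g q x0 t0, C1with phi g q -> I t0 ->
 (exists2 r: R, 0<r & forall x t, enorm (x-x0)<r -> `|t-t0| < r ->
   u x t-phi (x, t)<=u x0 t0-phi (x0, t0)) ->
  q (x0, t0)+H x0 t0 (g (x0, t0))<=0.

Definition visc_super (H: V -> R -> V -> R) (u: V -> R -> R) (I: set R): Prop :=
 forall phi g q x0 t0, C1with phi g q -> I t0 ->
 (exists2 r: R, 0<r & forall x t, enorm (x-x0)<r -> `|t-t0| < r ->
   u x t-phi (x, t) >= u x0 t0-phi (x0, t0)) ->
  q (x0, t0)+H x0 t0 (g (x0, t0)) >= 0.

Lemma visc_sol_sub H u I: visc_sol H u I -> visc_sub H u I.
Proof.
move=> vu phi g q x0 t0 [fo cg cq] It0 mx; have [C gE qE]:= fo_exp_C1 fo cg cq.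
by have:= (vu phi x0 t0 C It0).1 mx; rewrite gE qE.
Qed.

Lemma visc_sol_super H u I: visc_sol H u I -> visc_super H u I.
Proof.
move=> vu phi g q x0 t0 [fo cg cq] It0 mx; have [C gE qE]:= fo_exp_C1 fo cg cq.
by have:= (vu phi x0 t0 C It0).2 mx; rewrite gE qE.
Qed.

Lemma fo_exp_cont (phi: V*R -> R) x t p q: fo_exp phi x t p q ->
 {for (x, t), continuous phi}.
Proof.
move=> H; apply/cont_enorm2P => e e0; have [r r0 rP]:= H 1 ltr01.
pose C:= enorm p + `|q| + 2; have C0: 0<C by rewrite /C ltr_wpDl// addr_ge0.
exists (Num.min r (e/C/2)); first by rewrite lt_min r0 !divr_gt0.
move=> y s; rewrite !lt_min => /andP[yr yC] /andP[sr sC].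
have:= rP y s yr sr; have:= dot_norm p (y-x); have:= normrM q (s-t).
move: yC sC; rewrite ltr_pdivlMr// ltr_pdivlMr// => yC; rewrite ltr_pdivlMr// ltr_pdivlMr// => sC.
set A:= phi _-phi _; set D:= dot _ _; set Q:= q*_ => qE; rewrite ler_norml => /andP[d1 d2].
have /andP[]: - `|Q| <= Q <= `|Q| by rewrite -ler_norml.
rewrite qE mul1r => q1 q2; rewrite ler_norml => /andP[a1 a2].
have:= enorm_ge0 (y-x); have:= normr_ge0 (s-t); have:= enorm_ge0 p; have:= normr_ge0 q.
move: yC sC; rewrite /C => yC sC h1 h2 h3 h4; rewrite ltr_norml; apply/andP; split; nra.
Qed.

Lemma fo_expD (phi psi: V*R -> R) x t p p' q q' :
 fo_exp phi x t p q -> fo_exp psi x t p' q' ->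
 fo_exp (fun z => phi z+psi z) x t (p+p') (q+q').
Proof.
move=> h1 h2 e e0; have e2: 0<e/2 by rewrite divr_gt0.
have [r1 r10 r1P]:= h1 _ e2; have [r2 r20 r2P]:= h2 _ e2.
exists (Num.min r1 r2); first by rewrite lt_min r10.
move=> y s; rewrite !lt_min => /andP[y1 y2] /andP[s1 s2].
have:= r1P _ _ y1 s1; have:= r2P _ _ y2 s2; rewrite dotDl.
set a:= enorm _+_; rewrite !ler_norml => /andP[? ?] /andP[? ?]; apply/andP; split; lra.
Qed.

Lemma fo_expZ (c: R) (phi: V*R -> R) x t p q :
 fo_exp phi x t p q -> fo_exp (fun z => c * phi z) x t (c *: p) (c*q).
Proof.
move=> h e e0; have C0: 0 < `|c| + 1 by rewrite ltr_wpDl.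
have [r r0 rP]:= h _ (divr_gt0 e0 C0); exists r => // y s yr sr.
have -> : c * phi (y, s)-c * phi (x, t)-dot (c *: p) (y-x)-c*q*(s-t) =
 c*(phi (y, s)-phi (x, t)-dot p (y-x)-q*(s-t)) by rewrite dotZl; ring.
rewrite normrM; apply: le_trans (ler_wpM2l (normr_ge0 _) (rP _ _ yr sr)) _.
rewrite mulrA ler_wpM2r ?(addr_ge0 (enorm_ge0 _))// mulrCA ger_pMr// ler_pdivrMr// mul1r lerDl//.
Qed.

Lemma C1withD phi psi g g' q q': C1with phi g q -> C1with psi g' q' ->
 C1with (fun z => phi z+psi z) (fun z => g z+g' z) (fun z => q z+q' z).
Proof.
move=> [a1 b1 c1] [a2 b2 c2]; split.
- by move=> x t; exact: fo_expD.
- move=> v z; rewrite (_: (fun z => _) = (fun z => dot (g z) v+dot (g' z) v)).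
  by apply: cvgD; [exact: b1|exact: b2].
 by apply/funext => w; rewrite dotDl.
- by move=> z; apply: cvgD; [exact: c1|exact: c2].
Qed.

Lemma C1withZ (c: R) phi g q: C1with phi g q ->
 C1with (fun z => c * phi z) (fun z => c *: g z) (fun z => c*q z).
Proof.
move=> [a1 b1 c1]; split.
- by move=> x t; exact: fo_expZ.
- move=> v z; rewrite (_: (fun z => _) = (fun z => c*dot (g z) v)).
  by apply: cvgMr; exact: b1.
 by apply/funext => w; rewrite dotZl.
- by move=> z; apply: cvgMr; exact: c1.
Qed.

Lemma C1with_shift (c: V) phi g q: C1with phi g q ->
 C1with (fun z => phi (z.1-c, z.2)) (fun z => g (z.1-c, z.2)) (fun z => q (z.1-c, z.2)).
Proof.
move=> [a1 b1 c1].
have E (y x: V): y-c-(x-c) = y-x by rewrite opprB addrA subrK.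
split.
- move=> x t e e0; have [r r0 rP]:= a1 (x-c) t e e0; exists r => // y s yr sr.
 by have:= rP (y-c) s; rewrite E; apply.
- move=> v [x t]; apply/cont_enorm2P => e e0.
 have /cont_enorm2P/(_ _ e0)[r r0 rP]:= b1 v (x-c, t); exists r => // y s yr sr.
 by apply: rP => //; rewrite E.
- move=> [x t]; apply/cont_enorm2P => e e0.
 have /cont_enorm2P/(_ _ e0)[r r0 rP]:= c1 (x-c, t); exists r => // y s yr sr.
 by apply: rP => //; rewrite E.
Qed.

(** The test function seen by the second space variable when variables are doubled: [Phi] takes the
    time of the first solution, which is frozen here, so the time derivative is 0. *)
Lemma C1with_reflect (c: V) (t0: R) phi g q: C1with phi g q ->
 C1with (fun z => phi (c-z.1, t0)) (fun z => - g (c-z.1, t0)) (fun=> 0).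
Proof.
move=> [a1 b1 _].
have E (y x: V): c-y-(c-x) = x-y by rewrite opprB [_+(x-c)]addrC addrA subrK.
split.
- move=> x t e e0; have [r r0 rP]:= a1 (c-x) t0 e e0; exists r => // y s yr sr /=.
 have:= rP (c-y) t0; rewrite E subrr normr0 enormBC !addr0 mulr0 => /(_ yr r0).
 rewrite dotNl opprK mul0r !subr0 -[y-x]opprB dotNr => /le_trans; apply.
 by rewrite ler_wpM2l ?(ltW e0)// enormN lerDl.
- move=> v [x t]; apply/cont_enorm2P => e e0.
 have /cont_enorm2P/(_ _ e0)[r r0 rP]:= b1 v (c-x, t0); exists r => // y s yr sr /=.
 by rewrite !dotNl -opprD normrN; apply: rP; rewrite ?subrr ?normr0// E enormBC.
- by move=> z; exact: cvg_cst.
Qed.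

Lemma C1with_time (th th': R -> R) :
 (forall t e: R, 0<e -> exists2 r: R, 0<r & forall s, `|s-t| < r ->
  `|th s-th t-th' t*(s-t)| <= e * `|s-t|) -> continuous th' ->
 C1with (fun z => th z.2) (fun=> 0) (fun z => th' z.2).
Proof.
move=> h c; split.
- move=> x t e e0; have [r r0 rP]:= h t e e0; exists r => // y s yr sr /=.
 rewrite dot0l subr0; apply: le_trans (rP _ sr) _.
 by rewrite ler_wpM2l ?(ltW e0)// lerDr.
- move=> v z; rewrite (_: (fun z => _) = fun=> 0); first exact: cvg_cst.
 by apply/funext => w; rewrite dot0l.
- by move=> z; apply: (@cvg_comp _ _ _ snd th' (nbhs z) (nbhs z.2)); [exact: cvg_snd|exact: c].
Qed.

Lemma C1with_time_quad (th th': R -> R) (C: R): 0<=C ->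
 (forall s t, `|th s-th t-th' t*(s-t)| <= C*(s-t)^+2) ->
 (forall s t, `|th' s-th' t| <= C * `|s-t|) ->
 C1with (fun z => th z.2) (fun=> 0) (fun z => th' z.2).
Proof.
move=> C0 h1 h2; have C1: 0<C+1 by rewrite ltr_wpDl.
apply: C1with_time.
 move=> t e e0; exists (e/(C+1)); first by rewrite divr_gt0.
 move=> s; rewrite ltr_pdivlMr// => sr; apply: le_trans (h1 _ _) _.
 rewrite -real_normK ?num_real// expr2 mulrA ler_wpM2r//.
 have:= normr_ge0 (s-t); nra.
move=> t; apply/cvgrPdist_lt => e e0.
apply/nbhs_normP; exists (e/(C+1)); first by rewrite /= divr_gt0.
move=> s /=; rewrite ltr_pdivlMr// => sr; apply: le_lt_trans (h2 _ _) _.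
have:= normr_ge0 (t-s); nra.
Qed.

(** A smooth substitute for the Euclidean norm: it exceeds the norm by at most [del] and its
    gradient has norm at most 1. *)
Definition jap (del: R) (x: V): R:= Num.sqrt (del^+2+dot x x).

Lemma jap_sqr del x: jap del x^+2 = del^+2+dot x x.
Proof. by rewrite sqr_sqrtr// addr_ge0 ?sqr_ge0// dotxx_ge0. Qed.

Lemma jap_ge0 del x: 0<=jap del x. Proof. exact: sqrtr_ge0. Qed.

Lemma jap_ge_enorm del x: enorm x<=jap del x.
Proof. by rewrite enormE ler_sqrt ?addr_ge0 ?sqr_ge0 ?dotxx_ge0// lerDr sqr_ge0. Qed.

Lemma jap_ge del x: 0<=del -> del<=jap del x.
Proof.
move=> d0; rewrite -{1}(ger0_norm d0) -sqrtr_sqr ler_sqrt ?addr_ge0 ?sqr_ge0 ?dotxx_ge0//.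
by rewrite lerDl dotxx_ge0.
Qed.

Lemma jap_le del x: 0<=del -> jap del x<=del+enorm x.
Proof.
move=> d0; rewrite -(@ler_pXn2r _ 2)// ?nnegrE ?jap_ge0 ?addr_ge0//.
rewrite jap_sqr -enorm_sqr; have:= enorm_ge0 x; nra.
Qed.

(** The lower bound is Cauchy-Schwarz for the vectors (del, x) and (del, y); the upper one is sqrt
    (a+b) <= sqrt a + b/(2 sqrt a), followed by [del<=jap del x]. *)
Lemma jap_expansion del x y: 0<del ->
 0<=jap del y-jap del x-dot x (y-x)/jap del x<=enorm (y-x)^+2/del.
Proof.
move=> d0; have J0: 0<jap del x by apply: lt_le_trans (jap_ge _ (ltW d0)).
have J'0:= jap_ge0 del y; have dJ:= jap_ge x (ltW d0).
have JJ:= jap_sqr del x; have J'J:= jap_sqr del y.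
have hE: dot (y-x) (y-x) = dot y y-2*dot x y+dot x x.
 by rewrite dotBl !dotBr (dotC y x); ring.
have nh:= enorm_sqr (y-x).
apply/andP; split.
 suff H: del^+2+dot x y<=jap del x*jap del y.
  rewrite subr_ge0 ler_pdivrMr// dotBr; nra.
 have [neg|pos]:= leP (del^+2+dot x y) 0; first by apply: le_trans neg _; rewrite mulr_ge0// ltW.
 rewrite -(@ler_pXn2r _ 2)// ?nnegrE ?(ltW pos) ?mulr_ge0 ?(ltW J0)//.
 rewrite exprMn JJ J'J.
 have c2: dot x y^+2<=dot x x*dot y y.
  rewrite -!enorm_sqr -exprMn -[leLHS]real_normK ?num_real//.
  by rewrite lerXn2r// ?nnegrE ?mulr_ge0// dot_norm.
 have: 0<=del^+2*dot (y-x) (y-x) by rewrite mulr_ge0 ?sqr_ge0 ?dotxx_ge0.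
 rewrite hE; nra.
have JE: jap del y<=jap del x+(dot x (y-x)/jap del x+enorm (y-x)^+2/(2*jap del x)).
 set a:= _ / _+_.
 have aE: jap del x*a = dot x (y-x)+enorm (y-x)^+2/2 by rewrite /a; field; rewrite gt_eqF.
 have Ja: 0<=jap del x+a.
  rewrite -(pmulr_rge0 _ J0) mulrDr aE -expr2 JJ nh hE dotBr.
  have:= dotxx_ge0 x; have:= dotxx_ge0 y; have:= sqr_ge0 del; lra.
 rewrite -(@ler_pXn2r _ 2)// ?nnegrE// J'J sqrrD JJ mulr2n.
 rewrite aE nh hE dotBr; have:= sqr_ge0 a; lra.
have JD: enorm (y-x)^+2/(2*jap del x)<=enorm (y-x)^+2/del.
 rewrite ler_wpM2l ?sqr_ge0// lef_pV2 ?posrE ?mulr_gt0//; lra.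
lra.
Qed.

Lemma dot_cont (v: V): continuous (fun z: V*R => dot z.1 v).
Proof.
move=> [x t]; apply/cont_enorm2P => e e0.
have v1: 0<enorm v+1 by rewrite ltr_wpDl// enorm_ge0.
exists (e/(enorm v+1)); first by rewrite divr_gt0.
move=> y s; rewrite ltr_pdivlMr// => yr _ /=; rewrite -dotBl.
apply: le_lt_trans (dot_norm _ _) _; have:= enorm_ge0 v; have:= enorm_ge0 (y-x); nra.
Qed.

Lemma C1with_jap del: 0<del ->
 C1with (fun z => jap del z.1) (fun z => (jap del z.1)^-1 *: z.1) (fun=> 0).
Proof.
move=> d0; have H: forall x t, fo_exp (fun z => jap del z.1) x t ((jap del x)^-1 *: x) 0.
 move=> x t e e0; exists (e*del); first by rewrite mulr_gt0.
 move=> y s yr sr /=; have /andP[l1 l2]:= jap_expansion x y d0.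
 rewrite mul0r subr0 dotZl [_^-1*_]mulrC ger0_norm//.
 apply: le_trans l2 _; rewrite ler_pdivrMr//.
 have:= enorm_ge0 (y-x); have:= normr_ge0 (s-t); rewrite expr2; nra.
split=> //; last by move=> z; exact: cvg_cst.
move=> v [x t].
rewrite (_: (fun z => _) = (fun z: V*R => (jap del z.1)^-1*dot z.1 v)); last first.
 by apply/funext => z; rewrite dotZl.
apply: cvgM; last exact: dot_cont.
apply: cvgV; last exact: fo_exp_cont (H x t).
by rewrite gt_eqF// (lt_le_trans d0)//= jap_ge// ltW.
Qed.

Lemma jap_grad_le del x: enorm ((jap del x)^-1 *: x)<=1.
Proof.
rewrite enormZ ger0_norm ?invr_ge0 ?jap_ge0//.
have [->|J0]:= eqVneq (jap del x) 0; first by rewrite invr0 mul0r.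
by rewrite mulrC ler_pdivrMr ?mul1r ?jap_ge_enorm// lt_def J0 jap_ge0.
Qed.

Definition UCstrip (u: V -> R -> R) (a b: R): Prop :=
 forall e: R, 0<e -> exists2 del: R, 0<del &
  forall x y s t, a<=s<=b -> a<=t<=b -> enorm (x-y)<del ->
   `|s-t| < del -> `|u x s-u y t| < e.

Lemma UCstrip_osc u a b: UCstrip u a b -> exists2 D: R, 0<=D &
 forall x s t, a<=s<=b -> a<=t<=b -> `|u x s-u x t| <= D.
Proof.
move=> /(_ 1 ltr01)[del d0 H].
have K n: forall x s t, a<=s<=b -> a<=t<=b -> `|s-t| < n.+1%:R*del ->
  `|u x s-u x t| <= n.+1%:R.
 elim: n => [|n IH] x s t sab tab; first by rewrite mul1r => st; apply/ltW/H; rewrite ?subrr ?enorm0.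
 move=> st; pose N: R:= n.+1%:R; have N0: 0<N by rewrite ltr0n.
 pose r:= s+(t-s)/(N+1).
 have NE: n.+2%:R = N+1 :> R by rewrite /N -natr1.
 have rt: r-t = (s-t)*(N/(N+1)) by rewrite /r; field; rewrite gt_eqF// ltr_wpDl// ltW.
 have sr: s-r = (s-t)/(N+1) by rewrite /r; field; rewrite gt_eqF// ltr_wpDl// ltW.
 have l01: 0<=(N+1)^-1<=1 by rewrite invr_ge0 invf_le1 ?ltr_wpDl ?addr_ge0 ?lerDr ?(ltW N0).
 have rab: a<=r<=b.
  move: sab tab l01; rewrite /r => /andP[? ?] /andP[? ?] /andP[? ?]; apply/andP; split; nra.
 rewrite -(subrKA (u x r)); apply: le_trans (ler_normD _ _) _; rewrite NE addrC lerD//.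
  apply: IH => //; rewrite rt normrM [`|N / _|]ger0_norm ?divr_ge0 ?addr_ge0 ?(ltW N0)//.
  rewrite mulrA ltr_pdivrMr ?ltr_wpDl ?(ltW N0)//; move: st; rewrite NE; rewrite -/N; nra.
 apply/ltW/H => //; rewrite ?subrr ?enorm0// sr normrM [`|_^-1|]ger0_norm.
  by rewrite ltr_pdivrMr ?ltr_wpDl ?(ltW N0)// mulrC -NE.
 by case/andP: l01.
pose n:= Num.truncn ((b-a)/del); exists n.+1%:R => // x s t sab tab; apply: K => //.
rewrite -ltr_pdivrMr//; apply: le_lt_trans (truncnS_gt _); rewrite ler_pM2r ?invr_gt0//.
move: sab tab => /andP[? ?] /andP[? ?]; rewrite ler_norml; apply/andP; split; lra.
Qed.

Lemma max4 (f: V -> V -> R -> R -> R) (a b rho: R): a<=b -> 0<=rho ->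
 (forall x y t s, a<=t<=b -> a<=s<=b -> forall e: R, 0<e ->
  exists2 r: R, 0<r & forall x' y' t' s', a<=t'<=b -> a<=s'<=b ->
   enorm (x'-x)<r -> enorm (y'-y)<r -> `|t'-t| < r -> `|s'-s| < r ->
   `|f x' y' t' s'-f x y t s| < e) ->
 exists x y t s, [/\ enorm x<=rho, enorm y<=rho, a<=t<=b, a<=s<=b &
  forall x' y' t' s', enorm x'<=rho -> enorm y'<=rho -> a<=t'<=b -> a<=s'<=b ->
   f x' y' t' s'<=f x y t s].
Proof.
move=> ab r0 cf.
pose B:= [set x: V | enorm x<=rho]; pose I:= [set` `[a, b]]: set R.
pose A:= (B `*` I) `*` (B `*` I).
have cA: compact A.
 by apply: compact_setX; apply: compact_setX; [exact: closed_ball_compact|exact: segment_compact|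
  exact: closed_ball_compact|exact: segment_compact].
have A0: A !=set0.
 by exists ((0, a), (0, a)); split; split; rewrite /B /I/= ?enorm0// in_itv/= lexx.
pose F (z: (V*R)*(V*R)):= f z.1.1 z.2.1 z.1.2 z.2.2.
have cF: {within A, continuous F}.
 apply/subspace_continuousP => -[[x t] [y s]] [[/= xB tI] [/= yB sI]].
 apply/cvgrPdist_lt => e e0; move: tI sI; rewrite /I/= !in_itv/= => tI sI.
 have [r r1 rP]:= cf x y t s tI sI e e0.
 rewrite /within/=.
 have n1: \forall z \near (x, t), enorm (z.1-x)<r /\ `|z.2-t| < r.
  by apply/near_enorm2; exists r.
 have n2: \forall z \near (y, s), enorm (z.1-y)<r /\ `|z.2-s| < r.
  by apply/near_enorm2; exists r.
 exists ([set w: V*R | enorm (w.1-x)<r /\ `|w.2-t| < r],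
   [set w: V*R | enorm (w.1-y)<r /\ `|w.2-s| < r]); first by split.
 move=> [[x' t'] [y' s']] /= [[? ?] [? ?]] [[_ /=]]; rewrite /I/= in_itv/= => t'I [_ /=].
 by rewrite in_itv/= => s'I; rewrite distrC; apply: rP.
have [[[x t] [y s]] ]:= compact_EVT_max A0 cA cF.
rewrite inE => -[[/= xB]]; rewrite /I/= in_itv/= => tI [/= yB]; rewrite in_itv/= => sI H.
exists x, y, t, s; split=> // x' y' t' s' x'B y'B t'I s'I.
by apply: (H ((x', t'), (y', s'))); rewrite inE; split; split; rewrite /I//= in_itv.
Qed.

End Comparison.

(** * The squared positive part, a C^1 barrier *)

Section PositivePart.
Variable R: realType.

Definition pos (s: R): R:= Num.max s 0.

Lemma pos_ge0 s: 0<=pos s. Proof. by rewrite /pos le_max lexx orbT. Qed.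

Lemma pos_quad s t: `|pos s^+2-pos t^+2-2 * pos t*(s-t)| <= (s-t)^+2.
Proof.
rewrite /pos; case: (leP s 0) => s0; case: (leP t 0) => t0; rewrite ler_norml !expr2.
- by rewrite !mulr0 !mul0r !subr0; have:= sqr_ge0 (s-t); rewrite expr2; lra.
- by apply/andP; split; nra.
- by rewrite !mulr0 !mul0r !subr0; apply/andP; split; nra.
- have -> : s*s-t * t-2 * t*(s-t) = (s-t)^+2 by ring.
 by rewrite -expr2 lexx andbT; have:= sqr_ge0 (s-t); lra.
Qed.

Lemma pos_lip s t: `|pos s-pos t| <= `|s-t|.
Proof.
rewrite /pos; case: (leP s 0) => s0; case: (leP t 0) => t0; rewrite ?subrr ?normr0//.
- by rewrite sub0r normrN gtr0_norm// ler0_norm; lra.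
- by rewrite subr0 gtr0_norm// ger0_norm; lra.
Qed.

End PositivePart.

(** * Continuity in the doubled variables *)

Section ContinuityOnStrip.
Variables (R: realType) (d: nat) (a b: R).
Local Notation V:= 'rV[R]_d.

Definition cont4 (f: V -> V -> R -> R -> R): Prop :=
 forall x y t s, a<=t<=b -> a<=s<=b -> forall e: R, 0<e ->
  exists2 r: R, 0<r & forall x' y' t' s', a<=t'<=b -> a<=s'<=b ->
   enorm (x'-x)<r -> enorm (y'-y)<r -> `|t'-t| < r -> `|s'-s| < r ->
   `|f x' y' t' s'-f x y t s| < e.

Lemma cont4D f g: cont4 f -> cont4 g -> cont4 (fun x y t s => f x y t s+g x y t s).
Proof.
move=> cf cg x y t s tI sI e e0; have e2: 0<e/2 by rewrite divr_gt0.
have [r r0 rP]:= cf x y t s tI sI _ e2; have [r' r'0 r'P]:= cg x y t s tI sI _ e2.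
exists (Num.min r r'); first by rewrite lt_min r0.
move=> x' y' t' s' t'I s'I; rewrite !lt_min => /andP[? ?] /andP[? ?] /andP[? ?] /andP[? ?].
rewrite opprD addrACA (splitr e); apply: le_lt_trans (ler_normD _ _) _.
by apply: ltrD; [exact: rP|exact: r'P].
Qed.

Lemma cont4N f: cont4 f -> cont4 (fun x y t s => - f x y t s).
Proof.
move=> cf x y t s tI sI e e0; have [r r0 rP]:= cf x y t s tI sI _ e0; exists r => //.
by move=> *; rewrite -opprD normrN; exact: rP.
Qed.

Lemma cont4_uc1 u: UCstrip u a b -> cont4 (fun x y t s => u x t).
Proof.
by move=> uc x y t s tI sI e /uc[r r0 rP]; exists r => // x' y' t' s' *; exact: rP.
Qed.

Lemma cont4_uc2 u: UCstrip u a b -> cont4 (fun x y t s => u y s).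
Proof.
by move=> uc x y t s tI sI e /uc[r r0 rP]; exists r => // x' y' t' s' *; exact: rP.
Qed.

Lemma cont4_diff (f: V*R -> R): continuous f -> cont4 (fun x y t s => f (x-y, t)).
Proof.
move=> cf x y t s tI sI e e0.
have /cont_enorm2P/(_ _ e0)[r r0 rP]:= cf (x-y, t).
exists (r/2); first by rewrite divr_gt0.
move=> x' y' t' s' _ _ xx yy tt _; apply: rP; last by lra.
have -> : x'-y'-(x-y) = (x'-x)-(y'-y) by rewrite !opprD !opprK addrACA.
by apply: le_lt_trans (enormB _ _) _; lra.
Qed.

Lemma cont4_sp1 (f: V -> R): continuous f -> cont4 (fun x y t s => f x).
Proof.
move=> cf x y t s tI sI e e0; have /cont_enormP/(_ _ e0)[r r0 rP]:= cf x.
by exists r => // x' y' t' s' *; exact: rP.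
Qed.

Lemma cont4_sp2 (f: V -> R): continuous f -> cont4 (fun x y t s => f y).
Proof.
move=> cf x y t s tI sI e e0; have /cont_enormP/(_ _ e0)[r r0 rP]:= cf y.
by exists r => // x' y' t' s' *; exact: rP.
Qed.

Lemma cont4_time (f: R -> R): continuous f -> cont4 (fun x y t s => f t).
Proof.
move=> cf x y t s tI sI e e0; have /cvgrPdist_lt/(_ _ e0)/nbhs_normP[r /= r0 rP]:= cf t.
by exists r => // x' y' t' s' *; rewrite distrC; apply: rP; rewrite /= distrC.
Qed.

Lemma cont4_dtime (f: R -> R): continuous f -> cont4 (fun x y t s => f (t-s)).
Proof.
move=> cf x y t s tI sI e e0; have /cvgrPdist_lt/(_ _ e0)/nbhs_normP[r /= r0 rP]:= cf (t-s).
exists (r/2); first by rewrite divr_gt0.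
move=> x' y' t' s' _ _ _ _ tt ss; rewrite distrC; apply: rP => /=.
have -> : t-s-(t'-s') = (s'-s)-(t'-t) by ring.
by apply: le_lt_trans (ler_normB _ _) _; lra.
Qed.

Lemma jap_cont del: 0<del -> continuous (@jap R d del).
Proof.
move=> d0 x; have [fo _ _]:= C1with_jap d d0.
have /cont_enorm2P H:= fo_exp_cont (fo x 0); apply/cont_enormP => e /H[r r0 rP].
by exists r => // y yr; apply: (rP y 0 yr); rewrite subrr normr0.
Qed.

End ContinuityOnStrip.

(** * Comparison principle by doubling of variables *)

Section ComparisonPrinciple.
Variables (R: realType) (d: nat).
Local Notation V:= 'rV[R]_d.

Section Penalised.
Variables (u1 u2: V -> R -> R) (Phi: V*R -> R) (g: V*R -> V) (q: V*R -> R).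
Variables (s0 s1 s' ka be eta La: R).
Hypotheses (s01: s0<s1) (uc1: UCstrip u1 s0 s1) (uc2: UCstrip u2 s0 s1).
Hypotheses (cPhi: C1with Phi g q) (be0: 0<be) (eta0: 0<eta) (La0: 0<=La).

(** The quadratic barrier after [s'] keeps the maximum away from the final time [s1]; unlike
    1/(s1-t) it is C^1 for all times. The slope [ka] provides the strict inequality. *)
Definition tpen (t: R): R:= ka*(t-s0)+La * pos (t-s')^+2.
Definition tpen' (t: R): R:= ka+La*(2 * pos (t-s')).

(** [Phi] already carries the penalisation in [x-y]; the [be] terms give compactness in space, and
    [eta] brings the two times together. *)
Definition Wpen x y t s:= u1 x t-u2 y s-Phi (x-y, t)-tpen t
 - (be*jap 1 x+be*jap 1 y)-(t-s)^+2/(2*eta).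

Lemma tpen_quad s t: `|tpen s-tpen t-tpen' t*(s-t)| <= La*(s-t)^+2.
Proof using La0.
have -> : tpen s-tpen t-tpen' t*(s-t) =
 La*(pos (s-s')^+2-pos (t-s')^+2-2 * pos (t-s')*(s-t)).
 by rewrite /tpen /tpen'; ring.
rewrite normrM ger0_norm// ler_wpM2l//.
by have:= pos_quad (s-s') (t-s'); rewrite opprB addrA subrK.
Qed.

Lemma tpen'_lip s t: `|tpen' s-tpen' t| <= 2*La * `|s-t|.
Proof using La0.
have -> : tpen' s-tpen' t = 2*La*(pos (s-s')-pos (t-s')) by rewrite /tpen'; ring.
rewrite normrM ger0_norm ?mulr_ge0// ler_wpM2l ?mulr_ge0//.
by have:= pos_lip (s-s') (t-s'); rewrite opprB addrA subrK.
Qed.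

Lemma C1with_tpen sh: C1with (fun z: V*R => tpen z.2+(z.2-sh)^+2/(2*eta)) (fun=> 0)
 (fun z => tpen' z.2+(z.2-sh)/eta).
Proof using La0 eta0.
have Ce: 0<=eta^-1+2*La by rewrite addr_ge0 ?mulr_ge0// invr_ge0 ltW.
have e0: eta != 0 by rewrite gt_eqF.
have ie: 0<eta^-1 by rewrite invr_gt0.
apply: (@C1with_time_quad _ _ (fun t => tpen t+(t-sh)^+2/(2*eta))
 (fun t => tpen' t+(t-sh)/eta) _ Ce) => s t /=.
 have -> : tpen s+(s-sh)^+2/(2*eta)-(tpen t+(t-sh)^+2/(2*eta)) -
  (tpen' t+(t-sh)/eta)*(s-t) =
  (tpen s-tpen t-tpen' t*(s-t))+(s-t)^+2/(2*eta) by field.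
 apply: le_trans (ler_normD _ _) _; rewrite (ger0_norm (divr_ge0 _ _)) ?sqr_ge0 ?mulr_ge0 ?(ltW eta0)//.
 apply: le_trans (lerD (tpen_quad s t) (lexx _)) _.
 rewrite invfM; move: (sqr_ge0 (s-t)) ie La0; nra.
have -> : tpen' s+(s-sh)/eta-(tpen' t+(t-sh)/eta) = (tpen' s-tpen' t)+(s-t)/eta by ring.
apply: le_trans (ler_normD _ _) _; apply: le_trans (lerD (tpen'_lip s t) (lexx _)) _.
by rewrite normrM (gtr0_norm ie); move: (normr_ge0 (s-t)) ie; nra.
Qed.

Lemma C1with_dtime (t0: R) :
 C1with (fun z: V*R => - ((t0-z.2)^+2/(2*eta))) (fun=> 0) (fun z => (t0-z.2)/eta).
Proof using eta0.
have ie: 0<eta^-1 by rewrite invr_gt0.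
have e0: eta != 0 by rewrite gt_eqF.
apply: (@C1with_time_quad _ _ (fun s => - ((t0-s)^+2/(2*eta)))
 (fun s => (t0-s)/eta) _ (ltW ie)) => s t /=.
 have -> : - ((t0-s)^+2/(2*eta)) - - ((t0-t)^+2/(2*eta))-(t0-t)/eta*(s-t)
   = - ((s-t)^+2/(2*eta)) by field.
 rewrite normrN (ger0_norm (divr_ge0 _ _)) ?sqr_ge0 ?mulr_ge0 ?(ltW eta0)//.
 by rewrite invfM; move: (sqr_ge0 (s-t)) ie; nra.
have -> : (t0-s)/eta-(t0-t)/eta = eta^-1 * - (s-t) by ring.
by rewrite normrM normrN (gtr0_norm ie).
Qed.

Lemma Wpen_cont: cont4 s0 s1 Wpen.
Proof using uc1 uc2 cPhi La0 be0.
have cj: continuous (fun x: V => be*jap 1 x).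
 move=> x; apply/cont_enormP => e e0.
 have /cont_enormP/(_ _ (divr_gt0 e0 be0))[r r0 rP]:= @jap_cont R d 1 ltr01 x.
 by exists r => // y /rP; rewrite ltr_pdivlMr// -mulrBr normrM (gtr0_norm be0) mulrC.
apply: cont4D; last first.
 apply: cont4N; apply: (@cont4_dtime _ _ _ _ (fun r => r^+2/(2*eta))) => r.
 by apply: cvgMl; apply: cvgM; exact: cvg_id.
apply: cont4D; last by apply: cont4N; apply: cont4D; [exact: cont4_sp1|exact: cont4_sp2].
apply: cont4D; last first.
 apply: cont4N; apply: cont4_time => t.
 have C1: 0 < `|tpen' t| + La+1 by rewrite ltr_wpDl// addr_ge0.
 apply/cvgrPdist_lt => e e0.
 apply/nbhs_normP; exists (Num.min 1 (e/(`|tpen' t| + La+1))) => /=.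
  by rewrite lt_min ltr01 divr_gt0.
 move=> s /=; rewrite lt_min ltr_pdivlMr// => /andP[ts1 ts2].
 have:= tpen_quad s t; have:= normrM (tpen' t) (s-t).
 have -> : (s-t)^+2 = `|t-s| ^+ 2 by rewrite distrC real_normK ?num_real.
 rewrite [`|s-t|]distrC [`|tpen t-_|]distrC => h1 h2.
 rewrite -(subrK (tpen' t*(s-t)) (tpen s-tpen t)).
 apply: le_lt_trans (ler_normD _ _) _; apply: le_lt_trans (lerD h2 (lexx _)) _; rewrite h1.
 have: La * `|t-s| ^+ 2<=La * `|t-s|.
  by rewrite ler_wpM2l// expr2 ler_piMr ?(ltW ts1).
 by have:= normr_ge0 (t-s); move: ts2; nra.
apply: cont4D; last first.
 apply: cont4N; apply: cont4_diff => -[x t]; have [fo _ _]:= cPhi; exact: fo_exp_cont (fo x t).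
by apply: cont4D; [exact: cont4_uc1|apply: cont4N; exact: cont4_uc2].
Qed.

(** Outside the ball of radius [rho] the [be] terms push [Wpen] below its value at [xb], [yb], so a
    maximum over the compact product is global. *)
Lemma Wpen_max (B w0: R) xb yb tb: s0<=tb<=s1 -> w0<=Wpen xb yb tb tb ->
 (forall x y t s, s0<=t<=s1 -> s0<=s<=s1 ->
  u1 x t-u2 y s-Phi (x-y, t)-tpen t<=B) ->
 exists xh yh th sh, [/\ s0<=th<=s1, s0<=sh<=s1 &
  forall x y t s, s0<=t<=s1 -> s0<=s<=s1 -> Wpen x y t s<=Wpen xh yh th sh].
Proof using uc1 uc2 cPhi La0 s01 be0 eta0.
move=> tbI wb WB.
pose rho:= Num.max (Num.max (enorm xb) (enorm yb)) ((B-w0)/be).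
have rhox: enorm xb<=rho by rewrite /rho !le_max lexx.
have rhoy: enorm yb<=rho by rewrite /rho !le_max lexx ?orbT.
have rhoD: B-w0<=be*rho.
 rewrite mulrC -ler_pdivrMr//; by rewrite /rho !le_max lexx ?orbT.
have rho1: 0<=rho by apply: le_trans (enorm_ge0 xb) rhox.
have [xh [yh [th [sh [xhr yhr thI shI H]]]]]:= max4 (ltW s01) rho1 Wpen_cont.
exists xh, yh, th, sh; split=> // x y t s tI sI.
have [xr|xr]:= leP (enorm x) rho; have [yr|yr]:= leP (enorm y) rho; first exact: H.
all: apply: le_trans _ (H _ _ _ _ rhox rhoy tbI tbI); apply: le_trans _ wb.
all: have:= WB x y t s tI sI; rewrite /Wpen => h.
all: have e1: 0<=(t-s)^+2/(2*eta) by rewrite divr_ge0 ?sqr_ge0 ?mulr_ge0 ?(ltW eta0).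
all: move: h e1 (jap_ge_enorm 1 x) (jap_ge_enorm 1 y) (enorm_ge0 x) (enorm_ge0 y) xr yr rhoD be0.
all: by move: (u1 x t-u2 y s-Phi (x-y, t)-tpen t) (_ / _) => X Y; nra.
Qed.

(** Subtract the two viscosity inequalities at the maximum: the terms [(th-sh)/eta] cancel, the
    barrier contributes a nonnegative slope, and the two gradients of size [be] cost [C*be] each. *)
Lemma Wpen_test (H1 H2: V -> R -> V -> R) (C: R) xh yh th sh :
 visc_sub H1 u1 [set t | s0<t<s1] -> visc_super H2 u2 [set t | s0<t<s1] -> 0<=C ->
 (forall x t p p', s0<t<s1 -> `|H1 x t p-H1 x t p'| <= C*enorm (p-p')) ->
 (forall x t p p', s0<t<s1 -> `|H2 x t p-H2 x t p'| <= C*enorm (p-p')) ->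
 s0<th<s1 -> s0<sh<s1 ->
 (forall x y t s, s0<=t<=s1 -> s0<=s<=s1 -> Wpen x y t s<=Wpen xh yh th sh) ->
 q (xh-yh, th)+ka+H1 xh th (g (xh-yh, th))-H2 yh sh (g (xh-yh, th))<=2*(C*be).
Proof using uc1 uc2 cPhi La0 s01 be0 eta0.
move=> vs1 vs2 C0 lip1 lip2 thO shO Wmax; set G:= g (xh-yh, th).
have [t0 t1]:= andP thO; have [r0 r1]:= andP shO.
have thI: s0<=th<=s1 by rewrite !ltW.
have shI: s0<=sh<=s1 by rewrite !ltW.
have c1:= C1withD (C1with_shift yh cPhi) (C1withD (C1withZ be (C1with_jap d (@ltr01 R))) (C1with_tpen sh)).
have c2:= C1withD (C1withZ (-1) (C1with_reflect xh th cPhi))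
 (C1withD (C1withZ (- be) (C1with_jap d (@ltr01 R))) (C1with_dtime th)).
have {}R1: q (xh-yh, th)+(be*0+(tpen' th+(th-sh)/eta)) +
  H1 xh th (G+(be *: ((jap 1 xh)^-1 *: xh)+0))<=0.
 apply: (vs1 _ _ _ xh th c1 thO); exists (Num.min (th-s0) (s1-th)) => /=; first by rewrite lt_min !subr_gt0 t0.
 move=> x t _; rewrite lt_min !ltr_norml => /andP[/andP[h1 h2] /andP[h3 h4]].
 have tI: s0<=t<=s1 by move: h1 h4; lra.
 by move: (Wmax x yh t sh tI shI); rewrite /Wpen; lra.
have {}R2: 0 <= -1*0+(- be*0+(th-sh)/eta) +
  H2 yh sh (-1 *: (- G)+(- be *: ((jap 1 yh)^-1 *: yh)+0)).
 apply: (vs2 _ _ _ yh sh c2 shO); exists (Num.min (sh-s0) (s1-sh)) => /=; first by rewrite lt_min !subr_gt0 r0.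
 move=> y s _; rewrite lt_min !ltr_norml => /andP[/andP[h1 h2] /andP[h3 h4]].
 have sI: s0<=s<=s1 by move: h1 h4; lra.
 by move: (Wmax xh y th s thI sI); rewrite /Wpen; lra.
have L1:= lip1 xh th (G+(be *: ((jap 1 xh)^-1 *: xh)+0)) G thO.
have L2:= lip2 yh sh (-1 *: (- G)+(- be *: ((jap 1 yh)^-1 *: yh)+0)) G shO.
have n1: enorm (G+(be *: ((jap 1 xh)^-1 *: xh)+0)-G)<=be.
 rewrite addr0 addrAC subrr add0r enormZ gtr0_norm//.
 by rewrite ger_pMr// jap_grad_le.
have n2: enorm (-1 *: (- G)+(- be *: ((jap 1 yh)^-1 *: yh)+0)-G)<=be.
 rewrite addr0 scaleN1r opprK addrAC subrr add0r enormZ normrN gtr0_norm//.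
 by rewrite ger_pMr// jap_grad_le.
have {}L1:= le_trans L1 (ler_wpM2l C0 n1); have {}L2:= le_trans L2 (ler_wpM2l C0 n2).
have La2: 0<=La*(2 * pos (th-s')) by rewrite mulr_ge0 ?mulr_ge0 ?pos_ge0.
move: L1 L2 La2 R1 R2; rewrite !ler_norml /tpen' => /andP[? ?] /andP[? ?]; lra.
Qed.

End Penalised.

(** Since [Phi] satisfies the doubled inequality for all [x] and [y], up to [kap], the maximum
    points need not approach the diagonal in space; only the two times must, and therefore a modulus
    in time is asked of [H2]. *)
Lemma comparison (u1 u2: V -> R -> R) (H1 H2: V -> R -> V -> R)
  (Phi: V*R -> R) (g: V*R -> V) (q: V*R -> R) (s0 s1 L Q C kap K0: R) :
 s0<s1 -> UCstrip u1 s0 s1 -> UCstrip u2 s0 s1 ->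
 visc_sub H1 u1 [set t | s0<t<s1] -> visc_super H2 u2 [set t | s0<t<s1] ->
 C1with Phi g q -> 0<=Q -> 0<=C -> 0<=kap ->
 (forall z t, s0<=t<=s1 -> enorm (g (z, t))<=L) ->
 (forall z t, s0<=t<=s1 -> Phi (z, s0)-Phi (z, t)<=Q*(t-s0)) ->
 (forall x t p p', s0<t<s1 -> `|H1 x t p-H1 x t p'| <= C*enorm (p-p')) ->
 (forall x t p p', s0<t<s1 -> `|H2 x t p-H2 x t p'| <= C*enorm (p-p')) ->
 (forall e: R, 0<e -> exists2 del: R, 0<del & forall y t s p, s0<t<s1 -> s0<s<s1 ->
  `|t-s| < del -> enorm p<=L -> `|H2 y t p-H2 y s p| <= e) ->
 (forall x y t, s0<t<s1 ->
  - kap<=q (x-y, t)+H1 x t (g (x-y, t))-H2 y t (g (x-y, t))) ->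
 (forall x y, u1 x s0-u2 y s0<=Phi (x-y, s0)+K0) ->
 forall x y t, s0<=t<s1 -> u1 x t-u2 y t<=Phi (x-y, t)+K0+kap*(t-s0).
Proof.
move=> s01 uc1 uc2 vs1 vs2 cPhi Q0 C0 kap0 gL PhiQ lip1 lip2 tc key init xb yb tb tbI.
rewrite leNgt; apply/negP => abs.
have /andP[tb0 tb1]:= tbI; have tbI': s0<=tb<=s1 by rewrite tb0 ltW.
have ss: s0<=s0<=s1 by rewrite lexx ltW.
have [th [th0 thE]]: exists th: R, 0<th /\
  u1 xb tb-u2 yb tb-Phi (xb-yb, tb)-K0-kap*(tb-s0) = 4 * th.
 exists ((u1 xb tb-u2 yb tb-Phi (xb-yb, tb)-K0-kap*(tb-s0))/4).
 by split; move: abs; clear; lra.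
have [T [TE T0]]: exists T: R, T = s1-s0 /\ 0<T by exists (s1-s0); split=> //; rewrite subr_gt0.
(* Of the excess [4 * th], the terms in [al] and [be] use up at most [th] each; the remaining
   [2 * th] exclude a maximum at the initial time. *)
have [al [al0 alE]]: exists al: R, 0<al /\ al*T = th.
 by exists (th/T); split; [rewrite divr_gt0|rewrite mulfVK ?gt_eqF].
have [D1 D10 osc1]:= UCstrip_osc uc1; have [D2 D20 osc2]:= UCstrip_osc uc2.
(* [u1-u2-Phi] exceeds [K0] by less than [D]. Hence a barrier that reaches [D] before [s1] forces
   [t<s1], and the choice of [eta] forces the times to differ by less than [rho]. *)
have [D [DE D0]]: exists D: R, D = D1+D2+Q*T+1 /\ 0<D.
 by exists (D1+D2+Q*T+1); split=> //; rewrite ltr_wpDl// !addr_ge0// mulr_ge0// ltW.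
have [s' [l [s'E lE l0]]]: exists s' l: R, [/\ tb<=s', l = s1-s' & 0<l].
 by exists ((tb+s1)/2), (s1-(tb+s1)/2); move: tb1; clear; split; lra.
have [La [La0 LaE]]: exists La: R, 0<La /\ La*(l/2)^+2 = D.
 exists (D/(l/2)^+2); split; first by rewrite divr_gt0// exprn_gt0// divr_gt0.
 by rewrite mulfVK// gt_eqF// exprn_gt0// divr_gt0.
have jx1: 1<=jap 1 xb by apply: jap_ge.
have jy1: 1<=jap 1 yb by apply: jap_ge.
have [be [be0 be1 be2]]: exists be: R, [/\ 0<be, be*(jap 1 xb+jap 1 yb)<=th & 8*(C*be)<=al].
 have J0: 0<jap 1 xb+jap 1 yb by move: jx1 jy1; clear; lra.
 have C1: 0<8*(C+1) by move: C0; clear; lra.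
 exists (Num.min (th/(jap 1 xb+jap 1 yb)) (al/(8*(C+1)))); split.
 - by rewrite lt_min !divr_gt0.
 - by rewrite -ler_pdivlMr// ge_min lexx.
 - set be:= Num.min _ _; have be0: 0<be by rewrite lt_min !divr_gt0.
  have: be*(8*(C+1))<=al by rewrite -ler_pdivlMr// ge_min lexx orbT.
  by move: be0 C0; clear; move: be => be; nra.
have al4: 0<al/4 by rewrite divr_gt0.
have th4: 0<th/4 by rewrite divr_gt0.
have [dH dH0 dHP]:= tc _ al4; have [d1 d10 d1P]:= uc1 _ th4; have [d2 d20 d2P]:= uc2 _ th4.
have [rho [rho0 rH r1 r2 [rl rQ]]]: exists rho: R,
  [/\ 0<rho, rho<=dH, rho<=d1, rho<=d2 & rho<=l/4 /\ Q*rho<=th/4].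
 have Q1: 0<4*(Q+1) by move: Q0; clear; lra.
 pose rho:= Num.min (Num.min dH d1) (Num.min d2 (Num.min (l/4) (th/(4*(Q+1))))).
 have rho0: 0<rho by rewrite /rho !lt_min dH0 d10 d20 !divr_gt0.
 exists rho; split=> //; rewrite /rho ?ge_min ?lexx ?orbT//; split=> //.
 rewrite -/rho; have: rho<=th/(4*(Q+1)) by rewrite /rho !ge_min lexx ?orbT.
 by rewrite ler_pdivlMr//; move: rho0; clear; move: rho => rho; nra.
have [eta [eta0 etaE]]: exists eta: R, 0<eta /\ D*(2*eta) = rho^+2/2.
 exists (rho^+2/(4*D)); split; first by rewrite divr_gt0 ?exprn_gt0 ?mulr_gt0.
 by field; rewrite gt_eqF.
pose ka:= kap+al; have ka0: 0<=ka by rewrite addr_ge0// ltW.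
have tpE t: tpen s0 s' ka La t = kap*(t-s0)+al*(t-s0)+La * pos (t-s')^+2.
 by rewrite /tpen /ka; ring.
have tp0 t: s0<=t -> 0<=kap*(t-s0)+al*(t-s0).
 by move=> st; rewrite -mulrDl mulr_ge0// subr_ge0.
have Lp t: 0<=La * pos (t-s')^+2 by rewrite mulr_ge0 ?sqr_ge0// ltW.
pose W:= Wpen u1 u2 Phi s0 s' ka be eta La.
have Wb: K0+2 * th<=W xb yb tb tb.
 rewrite /W /Wpen tpE subrr expr0n/= mul0r subr0.
 have -> : pos (tb-s') = 0 by apply/max_idPr; rewrite subr_le0.
 rewrite expr0n/= mulr0 addr0.
 have: al*(tb-s0)<=th by rewrite -alE ler_pM2l// TE; move: tb1; clear; lra.
 by move: be1 thE; clear; lra.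
have WB x y t s: s0<=t<=s1 -> s0<=s<=s1 -> u1 x t-u2 y s-Phi (x-y, t)<=K0+D-1.
 move=> tI sI.
 have:= osc1 x t s0 tI ss; have:= osc2 y s s0 sI ss; have a1:= PhiQ (x-y) t tI.
 have /andP[t0 t1]:= tI.
 rewrite !ler_norml => /andP[b1 b2] /andP[c1 c2].
 have Qt: Q*(t-s0)<=Q*T by rewrite ler_wpM2l// TE; move: t1; clear; lra.
 by move: (init x y) Qt a1 b1 b2 c1 c2; rewrite DE; clear; lra.
have [xh [yh [t [s [tI sI Wmax]]]]]: exists xh yh t s, [/\ s0<=t<=s1, s0<=s<=s1 &
  forall x y t' s', s0<=t'<=s1 -> s0<=s'<=s1 -> W x y t' s'<=W xh yh t s].
 apply: (Wpen_max s01 uc1 uc2 cPhi be0 eta0 (ltW La0) (B:= K0+D) (xb:= xb) (yb:= yb) tbI' Wb).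
 move=> x y t s tI sI; have:= WB x y t s tI sI; rewrite tpE.
 by have [h _]:= andP tI; move: (tp0 _ h) (Lp t); clear; lra.
have Wh: K0+2 * th<=W xh yh t s by apply: le_trans Wb (Wmax _ _ _ _ tbI' tbI').
have [t0 t1]:= andP tI; have [q0 q1]:= andP sI.
have jx0:= jap_ge0 1 xh; have jy0:= jap_ge0 1 yh.
have bej: 0<=be*jap 1 xh+be*jap 1 yh by rewrite -mulrDr mulr_ge0 ?addr_ge0// ltW.
have e1: 0<=(t-s)^+2/(2*eta) by rewrite divr_ge0 ?sqr_ge0// mulr_ge0// ltW.
move: Wh; rewrite /W /Wpen tpE => Wh.
have WhD:= WB xh yh t s tI sI; have tpt:= tp0 _ t0; have Lpt:= Lp t.
have ts: `|t-s| < rho.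
 rewrite -(@ltr_pXn2r _ 2)// ?nnegrE ?(ltW rho0)// real_normK ?num_real//.
 have: (t-s)^+2/(2*eta)<=D by move: WhD Wh bej tpt Lpt th0; clear; lra.
 rewrite ler_pdivrMr ?mulr_gt0// etaE => /le_lt_trans; apply.
 by rewrite ltr_pdivrMr// ltr_pMr ?exprn_gt0// ltr1n.
have tl: t<=s'+l/2.
 rewrite leNgt; apply/negP => tl.
 have pE: pos (t-s') = t-s' by apply/max_idPl; move: tl l0; clear; lra.
 have: La*(l/2)^+2<La * pos (t-s')^+2.
  by rewrite ltr_pM2l// pE ltr_pXn2r// ?nnegrE; move: tl l0; clear; lra.
 by rewrite LaE; move: WhD Wh bej tpt e1 th0; clear; lra.
have [ts1 ts2]: - rho<t-s /\ t-s<rho by move: ts; rewrite ltr_norml => /andP[].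
have t1': t<s1 by move: tl l0; rewrite lE; clear; lra.
have q1': s<s1 by move: tl rl ts1 l0; rewrite lE; clear; lra.
have t0': s0<t.
 rewrite lt_def t0 andbT; apply/eqP => tE.
 have:= d2P yh yh s s0 sI ss; rewrite subrr enorm0 => /(_ d20).
 rewrite -{1}tE distrC => /(_ (lt_le_trans ts r2)); rewrite ltr_norml => /andP[h1 h2].
 move: (init xh yh) Wh h1 h2 e1 tpt Lpt bej th0; rewrite tE; clear; lra.
have q0': s0<s.
 rewrite lt_def q0 andbT; apply/eqP => sE.
 have:= d1P xh xh t s0 tI ss; rewrite subrr enorm0 => /(_ d10).
 rewrite -{1}sE => /(_ (lt_le_trans ts r1)); rewrite ltr_norml => /andP[h1 h2].
 have h4:= PhiQ (xh-yh) t tI.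
 have h3: Q*(t-s0)<=Q*rho by rewrite ler_wpM2l// -sE ltW.
 move: (init xh yh) Wh h1 h2 h3 h4 e1 tpt Lpt bej th0 rQ; rewrite sE; clear; lra.
have tO: s0<t<s1 by rewrite t0'.
have sO: s0<s<s1 by rewrite q0'.
have:= Wpen_test s01 uc1 uc2 cPhi be0 eta0 (ltW La0) vs1 vs2 C0 lip1 lip2 tO sO Wmax.
set G:= g _.
have:= dHP yh t s G tO sO (lt_le_trans ts rH) (gL _ _ tI); rewrite ler_norml => /andP[h1 h2].
by move: (key xh yh t tO) h1 h2 be2 al0; rewrite -/G /ka; clear; lra.
Qed.

End ComparisonPrinciple.

(** * Uniform continuity with explicit constants *)

Section QuasiLipschitz.
Variables (R: realType) (d: nat).
Local Notation V:= 'rV[R]_d.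

(* Equivalent to uniform continuity, but stable under infima with explicit constants. *)
Definition qlip (v: V -> R): Prop :=
 forall e: R, 0<e -> exists2 L: R, 0<=L & forall x y, v x-v y<=e+L*enorm (x-y).

(** Walking from [x] to [y] in steps shorter than [del] costs at most [e] per step. *)
Lemma unif_cont_qlip v: unif_cont v -> qlip v.
Proof.
move=> uc e e0; have [del d0 H]:= uc e e0.
have K n: forall x y, enorm (x-y)<n.+1%:R*del -> `|v x-v y| <= n.+1%:R*e.
 elim: n => [|n IH] x y; first by rewrite !mul1r => /H/ltW.
 move=> xy; pose N: R:= n.+1%:R; have N0: 0<N by rewrite ltr0n.
 have N1: 0<N+1 by rewrite ltr_wpDl// ltW.
 have NE: n.+2%:R = N+1 :> R by rewrite /N -natr1.
 pose z:= x+(N+1)^-1 *: (y-x).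
 have xz: x-z = (N+1)^-1 *: (x-y) by rewrite /z opprD addrA subrr sub0r -scalerN opprB.
 have zy: z-y = (N/(N+1)) *: (x-y).
  have -> : N/(N+1) = 1-(N+1)^-1 by field; rewrite gt_eqF.
  by rewrite scalerBl scale1r -xz opprB [RHS]addrC addrA subrK.
 rewrite -(subrKA (v z)) NE mulrDl mul1r addrC; apply: le_trans (ler_normD _ _) _; apply: lerD.
  apply: IH; rewrite zy enormZ ger0_norm ?divr_ge0 ?(ltW N0) ?(ltW N1)//.
  move: xy; rewrite NE -/N => xy; rewrite mulrAC ltr_pdivrMr//.
  by rewrite -mulrA ltr_pM2l// mulrC.
 apply/ltW/H; rewrite xz enormZ ger0_norm ?invr_ge0 ?(ltW N1)//.
 by rewrite mulrC ltr_pdivrMr// mulrC -NE.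
exists (e/del); first by rewrite divr_ge0// ltW.
move=> x y; apply: le_trans (ler_norm _) _.
pose n:= Num.truncn (enorm (x-y)/del).
have xd: 0<=enorm (x-y)/del by rewrite divr_ge0 ?(ltW d0).
have:= K n x y; rewrite -ltr_pdivrMr// => /(_ (truncnS_gt _)) /le_trans; apply.
rewrite -natr1 mulrDl mul1r addrC lerD2l mulrAC -mulrA [leRHS]mulrC ler_pM2r//.
by have /andP[]:= truncn_itv xd.
Qed.

Lemma qlipN v: qlip v -> qlip (fun x => - v x).
Proof.
move=> ql e /ql[L L0 H]; exists L => // x y; have:= H y x.
by rewrite (enormBC y x) opprK; lra.
Qed.

End QuasiLipschitz.

(** * Hopf-Lax flows of controlled fronts *)

Section HopfLax.
Variables (R: realType) (d: nat).
Local Notation V:= 'rV[R]_d.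

(** [Q t x y] reads: [y] can be reached from [x] in time [t]. The axioms cover the oscillating
    fronts and the homogenised ones. [C'] does not depend on [t], so the modulus of an infimum over
    reachable points does not degrade with time; [rf_up] and [rf_low] say that [H] is the
    generator. *)
Record reach_family (Q: R -> V -> V -> Prop) (H: V -> V -> R) (C C': R): Prop:= ReachFamily {
 rf_C: 0<=C;
 rf_C': 0<=C';
 rf_bound: forall t x y, 0<=t -> Q t x y -> enorm (y-x)<=C * t;
 rf_comp: forall s t x y z, 0<=s -> 0<=t -> Q s x y -> Q t y z -> Q (s+t) x z;
 rf_split: forall s t x z, 0<=s -> 0<=t -> Q (s+t) x z -> exists2 y, Q s x y & Q t y z;
 rf_ne: forall t x, 0<=t -> exists y, Q t x y;
 rf_lip: forall t x x' y, 0<=t -> Q t x y ->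
  exists2 y', Q t x' y' & enorm (y-y')<=C'*enorm (x-x');
 rf_up: forall x p (e: R), 0<e -> exists2 h0: R, 0<h0 & forall h y, 0<=h -> h<h0 ->
  Q h x y -> - dot p (y-x)<=h*(H x p+e);
 rf_low: forall x p (e: R), 0<e -> exists2 h0: R, 0<h0 & forall h, 0<=h -> h<h0 ->
  exists2 y, Q h x y & h*(H x p-e) <= - dot p (y-x) }.

Definition infQ (Q: R -> V -> V -> Prop) (v: V -> R) (t: R) (x: V): R :=
 inf [set v y | y in [set y | Q t x y]].

Section Fixed.
Variables (Q: R -> V -> V -> Prop) (H: V -> V -> R) (C C': R).
Hypothesis rf: reach_family Q H C C'.

Lemma infQ_has v t x: qlip v -> 0<=t -> has_inf [set v y | y in [set y | Q t x y]].
Proof using rf.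
move=> ql t0; have [L L0 Lv]:= ql 1 ltr01; split.
 by have [y Qy]:= rf_ne rf x t0; exists (v y), y.
exists (v x-(1+L*(C * t))) => _ [y /= Qy <-].
have:= Lv x y; rewrite enormBC => h; have b:= rf_bound rf t0 Qy.
have: L*enorm (y-x)<=L*(C * t) by rewrite ler_wpM2l.
lra.
Qed.

Lemma infQ_le v t x y: qlip v -> 0<=t -> Q t x y -> infQ Q v t x<=v y.
Proof using rf. by move=> ql t0 Qy; apply: ge_inf; [exact: (infQ_has x ql t0).2|exists y]. Qed.

Lemma infQ_ge v t x (m: R): 0<=t -> (forall y, Q t x y -> m<=v y) -> m<=infQ Q v t x.
Proof using rf.
move=> t0 h; apply: lb_le_inf; last by move=> _ [y /= /h hy <-].
by have [y Qy]:= rf_ne rf x t0; exists (v y), y.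
Qed.

Lemma infQ_lt v t x (e: R): qlip v -> 0<=t -> 0<e -> exists2 y, Q t x y & v y<infQ Q v t x+e.
Proof using rf.
move=> ql t0 e0; have [_ [y /= Qy <-] yl]:= inf_adherent e0 (infQ_has x ql t0).
by exists y.
Qed.

Lemma infQ_mod v t (L e: R): qlip v -> 0<=t -> 0<=L -> (forall x y, v x-v y<=e+L*enorm (x-y)) ->
 forall x y, infQ Q v t x-infQ Q v t y<=e+L*C'*enorm (x-y).
Proof using rf.
move=> ql t0 L0 h x x'; rewrite lerBlDr -lerBlDl; apply: infQ_ge => // y' Qy'.
have [y Qy yy]:= rf_lip rf x t0 Qy'.
have:= infQ_le ql t0 Qy; have:= h y y'; rewrite (enormBC y) => h1 h2.
have: L*enorm (y'-y)<=L*(C'*enorm (x'-x)) by rewrite ler_wpM2l.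
rewrite (enormBC x') mulrA; lra.
Qed.

Lemma infQ_qlip v t: qlip v -> 0<=t -> qlip (infQ Q v t).
Proof using rf.
move=> ql t0 e e0; have [L L0 h]:= ql e e0; exists (L*C'); first by rewrite mulr_ge0// (rf_C' rf).
exact: infQ_mod.
Qed.

Lemma infQ_DPP v s t x: qlip v -> 0<=s -> 0<=t -> infQ Q v (s+t) x = infQ Q (infQ Q v t) s x.
Proof using rf.
move=> ql s0 t0; have ql':= infQ_qlip ql t0; have st0: 0<=s+t by rewrite addr_ge0.
apply/eqP; rewrite eq_le; apply/andP; split.
 apply: infQ_ge => // y Qy; apply: infQ_ge => // z Qz.
 by apply: infQ_le => //; exact: (rf_comp rf s0 t0 Qy Qz).
apply: infQ_ge => // z /(rf_split rf s0 t0)[y Qy Qz].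
by apply: le_trans (infQ_le ql' s0 Qy) _; exact: infQ_le.
Qed.

Lemma infQ_time v s t (L e: R): qlip v -> 0<=s -> 0<=t -> 0<=L ->
 (forall x y, v x-v y<=e+L*enorm (x-y)) ->
 forall x, `|infQ Q v (s+t) x-infQ Q v t x| <= e+L*C'*(C*s).
Proof using rf.
move=> ql s0 t0 L0 h x; rewrite infQ_DPP//; have ql':= infQ_qlip ql t0.
have md:= infQ_mod ql t0 L0 h; have LC: 0<=L*C' by rewrite mulr_ge0// (rf_C' rf).
have K y: Q s x y -> L*C'*enorm (y-x)<=L*C'*(C*s).
 by move=> Qy; rewrite ler_wpM2l// (rf_bound rf).
rewrite ler_norml; apply/andP; split.
 rewrite lerBrDr; apply: infQ_ge => // y Qy; have:= K y Qy; have:= md x y.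
 by rewrite enormBC; lra.
have [y Qy]:= rf_ne rf x s0.
have:= infQ_le ql' s0 Qy; have:= md y x; have:= K y Qy; lra.
Qed.

Lemma infQ_contr v v' t x (c: R): qlip v -> qlip v' -> 0<=t -> (forall y, v y<=v' y+c) ->
 infQ Q v t x<=infQ Q v' t x+c.
Proof using rf.
move=> ql ql' t0 h; rewrite -lerBlDr; apply: infQ_ge => // y Qy.
by have:= infQ_le ql t0 Qy; have:= h y; lra.
Qed.

(** By dynamic programming, [U] at time [tau] is the infimum of [U] at [tau-h] over the points
    reachable in time [lam*h]. The generator bounds and the expansion of [phi] then give both
    inequalities after division by [h]. *)
Lemma infQ_visc v (U: V -> R -> R) (lam t0 t1: R): qlip v -> 0<=lam ->
 (forall x t, t0<=t<=t1 -> U x t = infQ Q v (lam*(t-t0)) x) ->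
 visc_sol (fun x t p => lam*H x p) U [set t | t0<t<t1].
Proof using rf.
move=> ql lam0 UE phi x0 tau C1phi /= /andP[tau0 tau1].
have fo:= C1_fo_exp x0 tau C1phi; move: (grad _ _) (dtime _ _) fo => p q fo.
have C0:= rf_C rf.
have small (r: R): 0<r -> exists2 h1: R, 0<h1 &
  forall h: R, 0<h -> h<h1 -> [/\ h<r, C*(lam*h)<r, h<tau-t0 & lam*h<r].
 move=> r0; pose K:= C * lam+lam+1.
 have K0: 0<K by rewrite ltr_wpDl// addr_ge0// mulr_ge0.
 exists (Num.min (r/K) (tau-t0)); first by rewrite lt_min divr_gt0// subr_gt0.
 move=> h h0; rewrite lt_min ltr_pdivlMr// /K => /andP[hK ht].
 have a1: 0<=C * lam*h by rewrite !mulr_ge0// ltW.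
 have a2: 0<=lam*h by rewrite mulr_ge0// ltW.
 by split=> //; rewrite ?mulrA; lra.
have step h y: 0<h -> h<tau-t0 -> Q (lam*h) x0 y ->
  [/\ U x0 tau = infQ Q (fun z => U z (tau-h)) (lam*h) x0,
   qlip (fun z => U z (tau-h)) & enorm (y-x0)<=C*(lam*h)].
 move=> h0 ht Qy.
 have lh: 0<=lam*h by rewrite mulr_ge0// ltW.
 have UE': (fun z => U z (tau-h)) = infQ Q v (lam*(tau-h-t0)).
  by apply/funext => z; rewrite UE//; apply/andP; split; lra.
 have l0: 0<=lam*(tau-h-t0) by rewrite mulr_ge0//; lra.
 split; last exact: (rf_bound rf).
  rewrite UE' UE; last by rewrite !ltW.
  by rewrite -infQ_DPP//; congr infQ; ring.
 by rewrite UE'; exact: infQ_qlip.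
split=> -[r r0 rP].
- apply/ler_addgt0Pr => e' e'0; rewrite add0r.
 pose K:= lam+C * lam+1; have K0: 0<K by rewrite ltr_wpDl// addr_ge0// mulr_ge0.
 pose e: R:= e'/K; have e0: 0<e by rewrite divr_gt0.
 have [r1 r10 r1P]:= fo e e0; have [h0 h00 h0P]:= rf_low rf x0 p e0.
 have m0: 0<Num.min (Num.min r r1) h0 by rewrite !lt_min r0 r10.
 have [h1 h10 h1P]:= small _ m0.
 have [h [hh0 hh1]]: exists h: R, 0<h /\ h<h1 by exists (h1/2); split; lra.
 have []:= h1P h hh0 hh1; rewrite !lt_min => /andP[/andP[hr hr1] _] /andP[/andP[cr cr1] _] ht /andP[_ lh].
 have lh0: 0<=lam*h by rewrite mulr_ge0// ltW.
 have [y Qy yl]:= h0P (lam*h) lh0 lh.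
 have [E ql' yb]:= step h y hh0 ht Qy.
 have th: tau-h-tau = - h by ring.
 have:= rP y (tau-h) (le_lt_trans yb cr); rewrite th normrN gtr0_norm// => /(_ hr).
 have:= r1P y (tau-h) (le_lt_trans yb cr1); rewrite th normrN gtr0_norm// => /(_ hr1).
 have:= infQ_le ql' lh0 Qy; rewrite -E ler_norml => a1 /andP[a2 a3] a4.
 have eb: e*(enorm (y-x0)+h)<=e*(C*(lam*h)+h) by rewrite ler_wpM2l ?(ltW e0)// lerD2r.
 have: h*(q+lam*H x0 p)<=h*e'.
  have -> : e' = e*K by rewrite /e mulfVK// gt_eqF.
  rewrite /K; move: a1 a2 a3 a4 eb yl; clear; lra.
 by rewrite ler_pM2l.
- apply/ler_addgt0Pr => e' e'0.
 pose K:= lam+C * lam+2; have K0: 0<K by rewrite ltr_wpDl// addr_ge0// mulr_ge0.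
 pose e: R:= e'/K; have e0: 0<e by rewrite divr_gt0.
 have [r1 r10 r1P]:= fo e e0; have [h0 h00 h0P]:= rf_up rf x0 p e0.
 have m0: 0<Num.min (Num.min r r1) h0 by rewrite !lt_min r0 r10.
 have [h1 h10 h1P]:= small _ m0.
 have [h [hh0 hh1]]: exists h: R, 0<h /\ h<h1 by exists (h1/2); split; lra.
 have []:= h1P h hh0 hh1; rewrite !lt_min => /andP[/andP[hr hr1] _] /andP[/andP[cr cr1] _] ht /andP[_ lh].
 have lh0: 0<=lam*h by rewrite mulr_ge0// ltW.
 have [y0 Qy0]:= rf_ne rf x0 lh0.
 have [E ql' _]:= step h y0 hh0 ht Qy0.
 have [y Qy yl]:= infQ_lt x0 ql' lh0 (mulr_gt0 e0 hh0).
 have [_ _ yb]:= step h y hh0 ht Qy.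
 have yu:= h0P (lam*h) y lh0 lh Qy.
 have th: tau-h-tau = - h by ring.
 have:= rP y (tau-h) (le_lt_trans yb cr); rewrite th normrN gtr0_norm// => /(_ hr).
 have:= r1P y (tau-h) (le_lt_trans yb cr1); rewrite th normrN gtr0_norm// => /(_ hr1).
 rewrite -E in yl; rewrite ler_norml => /andP[a2 a3] a4.
 have eb: e*(enorm (y-x0)+h)<=e*(C*(lam*h)+h) by rewrite ler_wpM2l ?(ltW e0)// lerD2r.
 have: 0<=h*(q+lam*H x0 p+e').
  have -> : e' = e*K by rewrite /e mulfVK// gt_eqF.
  rewrite /K; move: yl a2 a3 a4 eb yu; clear; lra.
 by rewrite pmulr_rge0.
Qed.

End Fixed.

Lemma C1_C1with (phi: V*R -> R): C1 phi -> C1with phi (grad phi) (dtime phi).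
Proof.
move=> C1phi; split; first by move=> x t; exact: C1_fo_exp.
- move=> v; have [_ h]:= C1phi.
 rewrite (_: (fun z => _) = (fun z => 'd phi z (v, 0))); first exact: h.
 by apply/funext => z; rewrite diff_gradE mulr0 addr0.
- by have [_ h]:= C1phi; exact: h.
Qed.

Lemma visc_solN (H: V -> R -> V -> R) u I: visc_sol H u I ->
 visc_sol (fun x t p => - H x t (- p)) (fun x t => - u x t) I.
Proof.
move=> vu phi x0 t0 C1phi It0; have cw:= C1withZ (-1) (C1_C1with C1phi).
split=> -[r r0 rP].
- have:= visc_sol_super vu cw It0; rewrite /= => /(_ x0)h.
 have: 0 <= -1*dtime phi (x0, t0)+H x0 t0 (-1 *: grad phi (x0, t0)).
  by apply: h; exists r => // x t xr tr; have:= rP x t xr tr; lra.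
 by rewrite scaleN1r; lra.
- have:= visc_sol_sub vu cw It0; rewrite /= => /(_ x0)h.
 have: -1*dtime phi (x0, t0)+H x0 t0 (-1 *: grad phi (x0, t0))<=0.
  by apply: h; exists r => // x t xr tr; have:= rP x t xr tr; lra.
 by rewrite scaleN1r; lra.
Qed.

Lemma visc_sol_ext (H H': V -> R -> V -> R) u u' I I': (forall t, I' t -> I t) ->
 (forall x t p, I' t -> H x t p = H' x t p) ->
 (forall t, I' t -> exists2 r: R, 0<r & forall s x, `|s-t| < r -> u x s = u' x s) ->
 visc_sol H u I -> visc_sol H' u' I'.
Proof.
move=> II HH uu vu phi x0 t0 C1phi It0; have [r r0 rP]:= uu t0 It0.
have [h1 h2]:= vu phi x0 t0 C1phi (II _ It0); rewrite -HH//.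
have t00: `|t0-t0| < r by rewrite subrr normr0.
split=> -[r1 r10 r1P]; [apply: h1|apply: h2].
all: exists (Num.min r r1); first by rewrite lt_min r0.
all: by move=> x t; rewrite !lt_min => /andP[x1 x2] /andP[t1 t2]; rewrite !rP//; exact: r1P.
Qed.

(** For negative time the front is run on [- v] and the sign changed back, which amounts to a
    supremum over reachable points; for even [H] this solves the equation with the opposite sign. *)
Definition sgQ (Q: R -> V -> V -> Prop) (v: V -> R) (rho: R) (x: V): R :=
 if 0<=rho then infQ Q v rho x else-infQ Q (fun y => - v y) (- rho) x.

Section Signed.
Variables (Q: R -> V -> V -> Prop) (H: V -> V -> R) (C C': R).
Hypothesis rf: reach_family Q H C C'.
Hypothesis Heven: forall x p, H x (- p) = H x p.

Lemma sgQ_qlip v rho: qlip v -> qlip (sgQ Q v rho).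
Proof using rf.
move=> ql; rewrite /sgQ; case: leP => r0; first exact: (infQ_qlip rf).
by apply: qlipN; apply: (infQ_qlip rf); [exact: qlipN|lra].
Qed.

Lemma infQ0 v x: qlip v -> infQ Q v 0 x = v x.
Proof using rf.
move=> ql; have E y: Q 0 x y -> y = x.
 by move=> /(rf_bound rf (lexx _)); rewrite mulr0 => h; apply/eqP; rewrite -subr_eq0; apply/eqP/enorm_eq0/eqP; rewrite eq_le h/=.
have [y Qy]:= rf_ne rf x (lexx 0); have yx:= E _ Qy; rewrite yx in Qy.
apply/eqP; rewrite eq_le (infQ_le rf ql (lexx _) Qy)/=.
by apply: (infQ_ge rf) => // z /E ->.
Qed.

Lemma sgQ0 v x: qlip v -> sgQ Q v 0 x = v x.
Proof using rf. by move=> ql; rewrite /sgQ lexx infQ0. Qed.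

Lemma sgQ_contr v v' rho x (c: R): qlip v -> qlip v' -> (forall y, `|v y-v' y| <= c) ->
 `|sgQ Q v rho x-sgQ Q v' rho x| <= c.
Proof using rf.
move=> ql ql' h; have h1 y: v y<=v' y+c by have:= h y; rewrite ler_norml => /andP[? ?]; lra.
have h2 y: v' y<=v y+c by have:= h y; rewrite ler_norml => /andP[? ?]; lra.
rewrite /sgQ; case: (leP 0 rho) => r0.
 have:= infQ_contr rf x ql ql' r0 h1; have:= infQ_contr rf x ql' ql r0 h2.
 by rewrite ler_norml => *; apply/andP; split; lra.
have r1: 0 <= - rho by lra.
have h3 y: - v y <= - v' y+c by have:= h2 y; lra.
have h4 y: - v' y <= - v y+c by have:= h1 y; lra.
have:= infQ_contr rf x (qlipN ql) (qlipN ql') r1 h3; have:= infQ_contr rf x (qlipN ql') (qlipN ql) r1 h4.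
by rewrite ler_norml => *; apply/andP; split; lra.
Qed.

Lemma sgQ_mod v rho (L e: R): qlip v -> 0<=L -> (forall x y, v x-v y<=e+L*enorm (x-y)) ->
 forall x y, sgQ Q v rho x-sgQ Q v rho y<=e+L*C'*enorm (x-y).
Proof using rf.
move=> ql L0 h x y; rewrite /sgQ; case: (leP 0 rho) => r0; first exact: (infQ_mod rf).
have r1: 0 <= - rho by lra.
have h' x' y': - v x' - - v y'<=e+L*enorm (x'-y') by have:= h y' x'; rewrite (enormBC y'); lra.
by have:= infQ_mod rf (qlipN ql) r1 L0 h' y x; rewrite (enormBC y); lra.
Qed.

Lemma sgQ_time v (lam s t L e: R): qlip v -> 0<=s -> 0<=t -> 0<=L -> 0<=e ->
 (forall x y, v x-v y<=e+L*enorm (x-y)) ->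
 forall x, `|sgQ Q v (lam*s) x-sgQ Q v (lam * t) x| <= e+L*C'*(C*(`|lam| * `|s-t|)).
Proof using rf.
have key v' (l s' t': R): qlip v' -> 0<=l -> 0<=s' -> 0<=t' -> 0<=L ->
 (forall x y, v' x-v' y<=e+L*enorm (x-y)) ->
 forall x, `|infQ Q v' (l*s') x-infQ Q v' (l * t') x| <= e+L*C'*(C*(l * `|s'-t'|)).
 move=> ql l0 s0 t0 L0 h x; wlog st: s' t' s0 t0/t'<=s'.
  by move=> K; have [/K|/ltW/K]:= leP t' s'; [exact|rewrite distrC [`|t'-s'|]distrC; exact].
 have -> : l*s' = l*(s'-t')+l * t' by ring.
 by rewrite [`|s'-t'|]ger0_norm ?subr_ge0//; apply: (infQ_time rf) => //; rewrite mulr_ge0// subr_ge0.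
move=> ql s0 t0 L0 e0 h x; rewrite /sgQ.
have h' x' y': - v x' - - v y'<=e+L*enorm (x'-y') by have:= h y' x'; rewrite (enormBC y'); lra.
have [l0|l0]:= leP 0 lam; first by rewrite !mulr_ge0// (ger0_norm l0); exact: key.
have nl: 0 <= - lam by lra.
have E r: 0<=r -> (if 0<=lam*r then infQ Q v (lam*r) x else-infQ Q (fun y => - v y) (- (lam*r)) x)
  = - infQ Q (fun y => - v y) (- lam*r) x.
 rewrite le_eqVlt => /orP[/eqP<-|r0]; last by rewrite nmulr_rge0// leNgt r0/= mulNr.
 by rewrite !mulr0 lexx !infQ0 ?opprK//; exact: qlipN.
by rewrite !E// -opprD normrN (ltr0_norm l0); apply: key => //; exact: qlipN.
Qed.

Lemma sgQ_visc v (U: V -> R -> R) (lam t0 t1: R): qlip v ->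
 (forall x t, t0<=t<=t1 -> U x t = sgQ Q v (lam*(t-t0)) x) ->
 visc_sol (fun x t p => lam*H x p) U [set t | t0<t<t1].
Proof using rf Heven.
move=> ql UE; have [l0|l0]:= leP 0 lam.
 apply: (infQ_visc rf ql l0) => x t tI; rewrite UE// /sgQ mulr_ge0//.
 by case/andP: tI => ? ?; rewrite subr_ge0.
have nl: 0 <= - lam by lra.
have NE x t: t0<=t<=t1 -> - U x t = infQ Q (fun y => - v y) (- lam*(t-t0)) x.
 move=> tI; have [ta tb]:= andP tI; rewrite UE// /sgQ.
 have [tE|tt]:= eqVneq t t0; first by rewrite tE subrr !mulr0 lexx !infQ0//; exact: qlipN.
 have tp: 0<t-t0 by rewrite subr_gt0 lt_def tt.
 by rewrite nmulr_rge0// leNgt tp/= opprK mulNr.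
have:= visc_solN (infQ_visc rf (qlipN ql) nl NE).
apply: visc_sol_ext => // [x t p _|t _]; first by rewrite Heven mulNr opprK.
by exists 1 => // s x _; rewrite opprK.
Qed.

End Signed.
End HopfLax.

(** * Real induction, uniform continuity and derivatives by expansion *)

Section RealInduction.
Variable R: realType.

Lemma real_induction (a b: R) (P: R -> Prop): a<=b -> P a ->
 (forall t, a<=t<b -> P t -> exists2 r: R, 0<r & forall s, t<=s<=b -> s<t+r -> P s) ->
 (forall t, a<t<=b -> (forall s, a<=s<t -> P s) -> P t) ->
 forall t, a<=t<=b -> P t.
Proof.
move=> ab Pa Pr Pl.
pose G:= [set t | a<=t<=b /\ forall s, a<=s<=t -> P s].
have Ga: G a by split; [rewrite lexx|move=> s; rewrite -eq_le => /eqP <-].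
have Gs: has_sup G by split; [exists a|exists b => t [/andP[]]].
pose S:= sup G; have aS: a<=S by apply: ub_le_sup => //; exact: Gs.2.
have Sb: S<=b by apply: ge_sup; [exists a|move=> t [/andP[]]].
have PltS s: a<=s<S -> P s.
 move=> /andP[as_ sS]; have [t Gt st]:= sup_gt (ex_intro _ a Ga) sS.
 by case: Gt => _; apply; rewrite as_ ltW.
have PS: P S.
 have [->//|SA]:= eqVneq S a; apply: Pl => //.
 by rewrite lt_def SA aS.
have GS s: a<=s<=S -> P s.
 move=> /andP[as_]; rewrite le_eqVlt => /orP[/eqP->//|sS]; apply: PltS; by rewrite as_.
suff -> : b = S by exact: GS.
apply/eqP; rewrite eq_le Sb andbT leNgt; apply/negP => Sltb.
have [|r r0 rP]:= Pr S _ PS; first by rewrite aS.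
pose t:= Num.min b (S+r/2).
have tS: S<t by rewrite lt_min Sltb ltrDl divr_gt0.
have tb: t<=b by rewrite ge_min lexx.
suff: t<=S by rewrite leNgt tS.
apply: ub_le_sup; first exact: Gs.2.
split=> [|s /andP[as_ st]]; first by rewrite tb (le_trans aS)// ltW.
have [sS|sS]:= leP s S; first by apply: GS; rewrite as_.
apply: rP; first by rewrite ltW//= (le_trans st).
apply: le_lt_trans st _; rewrite /t; apply: (@le_lt_trans _ _ (S+r/2)); first by rewrite ge_min lexx orbT.
by rewrite ltrD2l ltr_pdivrMr// ltr_pMr// ltr1n.
Qed.

Lemma heine (f: R -> R) (a b: R): a<=b -> continuous f -> forall e: R, 0<e ->
 exists2 del: R, 0<del & forall x y, a<=x<=b -> a<=y<=b -> `|x-y| < del -> `|f x-f y| <= e.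
Proof.
move=> ab cf e e0; have e2: 0<e/2 by rewrite divr_gt0.
pose P t:= exists2 del: R, 0<del & forall x y, a<=x<=t -> a<=y<=t -> `|x-y| < del -> `|f x-f y| <= e.
have loc t: exists2 r: R, 0<r & forall x y, `|x-t| < r -> `|y-t| < r -> `|f x-f y| <= e.
 have /cvgrPdist_lt/(_ _ e2)/nbhs_normP[r /= r0 rP]:= cf t; exists r => // x y xt yt.
 have h1:= rP x; have h2:= rP y; rewrite /= in h1 h2.
 have {}h1: `|f t-f x| < e/2 by apply: h1; rewrite /= distrC.
 have {}h2: `|f t-f y| < e/2 by apply: h2; rewrite /= distrC.
 have -> : f x-f y = (f t-f y)-(f t-f x) by ring.
 by apply/ltW; apply: le_lt_trans (ler_normB _ _) _; lra.
have step t s r: a<=t -> P t -> `|s-t| < r -> (forall x y, `|x-t| < r -> `|y-t| < r -> `|f x-f y| <= e) ->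
  t<=s -> P s.
 move=> at_ [del d0 dP] st rP ts; pose r':= r - `|s-t|; have r'0: 0<r' by rewrite subr_gt0.
 exists (Num.min del r'); first by rewrite lt_min d0.
 move=> x y /andP[ax xs] /andP[ay ys]; rewrite lt_min => /andP[xy1].
 move: st; rewrite /r' ger0_norm ?subr_ge0// => st; rewrite ltr_norml => /andP[h1 h2].
 have [xt|xt]:= leP x t; have [yt|yt]:= leP y t; first by apply: dP; rewrite ?ax ?ay.
 1-3: by apply: rP; rewrite ltr_norml; move: ax ay xs ys xt yt h1 h2 st ts; clear => *; apply/andP; split; lra.
suff: P b by [].
apply: (@real_induction a b P) => //; last by rewrite ab lexx.
- exists 1 => // x y; rewrite -!eq_le => /eqP <- /eqP <- _; by rewrite subrr normr0 ltW.
- move=> t /andP[at_ tb] Pt; have [r r0 rP]:= loc t; exists r => // s /andP[ts sb] sr.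
 by apply: (step t s r) => //; rewrite ger0_norm ?subr_ge0//; lra.
- move=> t /andP[at_ tb] Ps; have [r r0 rP]:= loc t.
 pose s:= Num.max a (t-r/3).
 have sa: a<=s by rewrite le_max lexx.
 have st: s<t by rewrite gt_max at_ ltrBlDr ltrDl divr_gt0.
 have ts: t-s<=r/3 by rewrite lerBlDl -lerBlDr le_max lexx orbT.
 apply: (step s t (r/2)) => //; [by apply: Ps; rewrite sa| | |exact: ltW].
  by rewrite ger0_norm ?subr_ge0 ?(ltW st)//; lra.
 by move=> x y; rewrite !ltr_norml => /andP[? ?] /andP[? ?]; apply: rP; rewrite ltr_norml; apply/andP; split; lra.
Qed.

Definition has_exp (f f': R -> R): Prop :=
 forall t e: R, 0<e -> exists2 r: R, 0<r & forall s, `|s-t| < r ->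
  `|f s-f t-f' t*(s-t)| <= e * `|s-t|.

Lemma derivable_exp (f: R -> R): (forall t, derivable f t 1) -> has_exp f (derive1 f).
Proof.
move=> df t e e0; have /derivable_nbhsP/eqaddoP/(_ _ e0):= df t.
move=> /nbhs_normP[r /= r0 rP]; exists r => // s st.
have:= rP (s-t); rewrite /= sub0r normrN => /(_ st); rewrite !fctE /= /shift/=.
by rewrite /GRing.scale/= mulr1 subrK derive1E opprD addrA [_ * 'D_1 f t]mulrC.
Qed.

Lemma has_exp_cont f f': has_exp f f' -> continuous f.
Proof.
move=> h t; apply/cvgrPdist_lt => e e0; have [r r0 rP]:= h t 1 ltr01.
have K0: 0 < `|f' t| + 2 by rewrite ltr_wpDl.
apply/nbhs_normP; exists (Num.min r (e/(`|f' t| + 2))); first by rewrite /= lt_min r0 divr_gt0.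
move=> s /=; rewrite lt_min ltr_pdivlMr// distrC => /andP[sr sK].
have:= rP s sr; rewrite mul1r distrC => h1.
rewrite distrC -(subrK (f' t*(s-t)) (f s-f t)); apply: le_lt_trans (ler_normD _ _) _.
by rewrite normrM -normrN opprB; have:= normr_ge0 (f' t); have:= normr_ge0 (s-t); nra.
Qed.

(** Mean value inequality, by real induction on the bound with the slightly larger slope [B+e'],
    whose excess absorbs the remainder of the expansion. *)
Lemma has_exp_lip f f' (B a b: R): has_exp f f' -> (forall t, a<=t<=b -> `|f' t| <= B) ->
 forall s t, a<=s<=b -> a<=t<=b -> `|f s-f t| <= B * `|s-t|.
Proof.
move=> h fB s t; wlog st: s t/t<s.
 move=> K; case: (ltgtP t s) => [/K//|/K ts|->] sI tI; last by rewrite !subrr normr0 mulr0.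
 by rewrite distrC [`|s-t|]distrC; exact: ts.
move=> /andP[as_ sb] /andP[at_ tb].
apply/ler_addgt0Pr => e e0; pose e': R:= e/(s-t); have e'0: 0<e' by rewrite divr_gt0// subr_gt0.
pose P (r: R): Prop:= `|f r-f t| <= (B+e')*(r-t).
suff: P s by rewrite /P (@ger0_norm _ (s-t)) ?subr_ge0 ?(ltW st)// mulrDl /e' mulfVK// subr_eq0 gt_eqF.
have cf:= has_exp_cont h.
apply: (@real_induction t s P); rewrite ?(ltW st)//= ?lexx//.
- by rewrite /P !subrr normr0 mulr0.
- move=> r /andP[tr rs] Pr; have [q q0 qP]:= h r e' e'0; exists q => // r' /andP[rr' r's] rq.
 have rq': `|r'-r| < q by rewrite ger0_norm ?subr_ge0//; lra.
 have:= qP r' rq'; rewrite (@ger0_norm _ (r'-r)) ?subr_ge0// => h1.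
 have h2: `|f' r*(r'-r)| <= B*(r'-r).
  rewrite normrM (@ger0_norm _ (r'-r)) ?subr_ge0// ler_wpM2r ?subr_ge0//; apply: fB.
  by apply/andP; split; lra.
 rewrite /P; have -> : f r'-f t = (f r'-f r-f' r*(r'-r))+f' r*(r'-r)+(f r-f t) by ring.
 apply: le_trans (ler_normD _ _) _; apply: le_trans (lerD (ler_normD _ _) Pr) _.
 by have:= lerD h1 h2; lra.
- move=> r /andP[tr rs] Pr; rewrite /P; apply/ler_addgt0Pr => e1 e10.
 have /cvgrPdist_lt/(_ _ e10)/nbhs_normP[q /= q0 qP]:= cf r.
 pose r':= Num.max t (r-q/2).
 have tr': t<=r' by rewrite le_max lexx.
 have r'r: r'<r by rewrite gt_max tr ltrBlDr ltrDl divr_gt0.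
 have r'q: r-r'<=q/2 by rewrite lerBlDl -lerBlDr le_max lexx orbT.
 have:= Pr r'; rewrite tr' r'r => /(_ isT); rewrite /P => Pr'.
 have:= qP r'; rewrite /= ger0_norm ?subr_ge0 ?(ltW r'r)// => qr.
 have {}qr: `|f r-f r'| < e1 by apply: qr; lra.
 have -> : f r-f t = (f r'-f t)+(f r-f r') by ring.
 apply: le_trans (ler_normD _ _) _; apply: lerD (ltW qr); apply: le_trans Pr' _.
 have B0: 0<=B by apply: le_trans (fB t _) => //; rewrite at_.
 by rewrite ler_wpM2l ?addr_ge0 ?(ltW e'0)//; lra.
Qed.

Lemma cont_bounded (f: R -> R) (a b: R): a<=b -> continuous f ->
 exists2 B: R, 0<=B & forall t, a<=t<=b -> `|f t| <= B.
Proof.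
move=> ab cf; have cn: {within `[a, b], continuous (fun t => `|f t|)}.
 by apply: continuous_subspaceT => t; apply: cvg_norm; exact: cf.
have [c _ h]:= EVT_max ab cn; exists `|f c| => // t tI; apply: h; by rewrite in_itv.
Qed.

Lemma has_expB f f' g g': has_exp f f' -> has_exp g g' ->
 has_exp (fun t => f t-g t) (fun t => f' t-g' t).
Proof.
move=> hf hg t e e0; have e2: 0<e/2 by rewrite divr_gt0.
have [r r0 rP]:= hf t _ e2; have [q q0 qP]:= hg t _ e2.
exists (Num.min r q); first by rewrite lt_min r0.
move=> s; rewrite lt_min => /andP[/rP h1 /qP h2].
have -> : f s-g s-(f t-g t)-(f' t-g' t)*(s-t) =
 (f s-f t-f' t*(s-t))-(g s-g t-g' t*(s-t)) by ring.
by apply: le_trans (ler_normB _ _) _; lra.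
Qed.

(* A C^1 function which is nonnegative everywhere and is the identity above [2 r]. *)
Definition kappa (r e: R): R:= (pos (e+2*r)^+2-pos (e-2*r)^+2)/(8*r).
Definition kappa' (r e: R): R:= (pos (e+2*r)-pos (e-2*r))/(4*r).

Lemma pos_mono (x y: R): x<=y -> pos x<=pos y.
Proof. by move=> xy; rewrite /pos ge_max !le_max xy lexx ?orbT. Qed.

Lemma kappa_ge0 r e: 0<r -> 0<=kappa r e.
Proof.
move=> r0; rewrite /kappa divr_ge0//; last by rewrite mulr_ge0// ltW.
by rewrite subr_ge0 ler_pXn2r ?nnegrE ?pos_ge0//; apply: pos_mono; lra.
Qed.

Lemma kappa_id r e: 0<r -> 2*r<=e -> kappa r e = e /\ kappa' r e = 1.
Proof.
move=> r0 re; have p1: pos (e+2*r) = e+2*r by apply/max_idPl; lra.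
have p2: pos (e-2*r) = e-2*r by apply/max_idPl; lra.
by rewrite /kappa /kappa' p1 p2; split; field; rewrite gt_eqF.
Qed.

Lemma kappa_quad r a b: 0<r -> `|kappa r a-kappa r b-kappa' r b*(a-b)| <= (4*r)^-1*(a-b)^+2.
Proof.
move=> r0; have -> : kappa r a-kappa r b-kappa' r b*(a-b) =
 (8*r)^-1*((pos (a+2*r)^+2-pos (b+2*r)^+2-2 * pos (b+2*r)*(a-b)) -
 (pos (a-2*r)^+2-pos (b-2*r)^+2-2 * pos (b-2*r)*(a-b))).
 by rewrite /kappa /kappa'; field; rewrite gt_eqF.
have r8: 0<(8*r)^-1 by rewrite invr_gt0 mulr_gt0.
rewrite normrM gtr0_norm//.
have -> : (4*r)^-1*(a-b)^+2 = (8*r)^-1*(2*(a-b)^+2) by field; rewrite gt_eqF.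
rewrite ler_pM2l//; apply: le_trans (ler_normB _ _) _.
have:= pos_quad (a+2*r) (b+2*r); have:= pos_quad (a-2*r) (b-2*r).
have -> : a+2*r-(b+2*r) = a-b by ring.
have -> : a-2*r-(b-2*r) = a-b by ring.
by lra.
Qed.

Lemma kappa'_lip r a b: 0<r -> `|kappa' r a-kappa' r b| <= (2*r)^-1 * `|a-b|.
Proof.
move=> r0; have -> : kappa' r a-kappa' r b =
 (4*r)^-1*((pos (a+2*r)-pos (b+2*r))-(pos (a-2*r)-pos (b-2*r))).
 by rewrite /kappa'; ring.
have r4: 0<(4*r)^-1 by rewrite invr_gt0 mulr_gt0.
rewrite normrM gtr0_norm//.
have -> : (2*r)^-1 * `|a-b| = (4*r)^-1*(2 * `|a-b|) by field; rewrite gt_eqF.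
rewrite ler_pM2l//; apply: le_trans (ler_normB _ _) _.
have:= pos_lip (a+2*r) (b+2*r); have:= pos_lip (a-2*r) (b-2*r).
have -> : a+2*r-(b+2*r) = a-b by ring.
have -> : a-2*r-(b-2*r) = a-b by ring.
by lra.
Qed.

Lemma has_exp_kappa f f' (r c: R): 0<r -> has_exp f f' ->
 has_exp (fun t => kappa r (f t+c)) (fun t => kappa' r (f t+c)*f' t).
Proof.
move=> r0 h t e e0.
pose k:= kappa' r (f t+c); pose D:= `|f' t| + 1; have D0: 0<D by rewrite ltr_wpDl.
pose K:= (4*r)^-1; have K0: 0<K by rewrite invr_gt0 mulr_gt0.
pose A:= `|k| + 1; have A0: 0<A by rewrite ltr_wpDl.
pose e1:= Num.min 1 (e/(2*A)); have e10: 0<e1 by rewrite lt_min ltr01 divr_gt0// mulr_gt0.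
have [q q0 qP]:= h t e1 e10.
exists (Num.min q (e/(2*(K*D^+2)))).
 by rewrite lt_min q0 divr_gt0// !mulr_gt0// exprn_gt0.
move=> s; rewrite lt_min ltr_pdivlMr ?mulr_gt0 ?exprn_gt0// => /andP[sq sK].
have h1:= qP s sq.
have fs: `|f s-f t| <= D * `|s-t|.
 rewrite -(subrK (f' t*(s-t)) (f s-f t)); apply: le_trans (ler_normD _ _) _.
 rewrite normrM /D; have: e1 * `|s-t| <= 1 * `|s-t| by rewrite ler_wpM2r// ge_min lexx.
 by lra.
have -> : kappa r (f s+c)-kappa r (f t+c)-k*f' t*(s-t) =
 (kappa r (f s+c)-kappa r (f t+c)-k*(f s-f t))+k*(f s-f t-f' t*(s-t)) by ring.
have h2:= kappa_quad (f s+c) (f t+c) r0.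
have E: f s+c-(f t+c) = f s-f t by ring.
rewrite E -/k -/K in h2.
apply: le_trans (ler_normD _ _) _; rewrite (splitr e) mulrDl; apply: lerD.
 apply: le_trans h2 _; rewrite -real_normK ?num_real//.
 have: `|f s-f t| ^+ 2<=(D * `|s-t|)^+2 by rewrite ler_pXn2r ?nnegrE ?mulr_ge0// ltW.
 rewrite exprMn => h3; apply: le_trans (ler_wpM2l (ltW K0) h3) _.
 rewrite [X in K*(_*X)]expr2 !mulrA; apply: ler_wpM2r => //.
 by move: sK; set X:= `|s-t|; lra.
rewrite normrM; apply: le_trans (ler_wpM2l (normr_ge0 _) h1) _; rewrite mulrA; apply: ler_wpM2r => //.
apply: (@le_trans _ _ (A*e1)); first by rewrite ler_wpM2r ?(ltW e10)// lerDl.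
rewrite mulrC -ler_pdivlMr//; apply: (@le_trans _ _ (e/(2*A))); first by rewrite ge_min lexx orbT.
by rewrite invfM mulrA.
Qed.

Lemma kappa'_comp_cont f f' (r c: R): 0<r -> has_exp f f' -> continuous f' ->
 continuous (fun t => kappa' r (f t+c)*f' t).
Proof.
move=> r0 h cf' t; apply: cvgM; last exact: cf'.
have r2: 0<(2*r)^-1 by rewrite invr_gt0 mulr_gt0.
apply/cvgrPdist_lt => e e0.
have /cvgrPdist_lt/(_ _ (divr_gt0 e0 r2)):= @has_exp_cont _ _ h t.
apply: filterS => s; rewrite ltr_pdivlMr// => hs.
apply: le_lt_trans (kappa'_lip _ _ r0) _.
have -> : f t+c-(f s+c) = f t-f s by ring.
by rewrite mulrC.
Qed.

End RealInduction.

Lemma fin_min (R: realType) (M: nat) (P: 'I_M -> R -> Prop) :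
 (forall j, exists2 r: R, 0<r & P j r) ->
 (forall j r r', 0<r' -> r'<=r -> P j r -> P j r') -> exists2 r: R, 0<r & forall j, P j r.
Proof.
move=> ex mono; have [f fP]: exists f: 'I_M -> R, forall j, 0<f j /\ P j (f j).
 have ex' j: {r: R | 0<r /\ P j r} by apply: cid; have [r r0 Pr]:= ex j; exists r.
 by exists (fun j => sval (ex' j)) => j; case: (ex' j).
(* The default 1 keeps the minimum positive when [M = 0]. *)
pose r:= \big[Num.min/1]_j f j.
have r0: 0<r.
 rewrite /r; elim/big_ind: _ => //; first by move=> x y x0 y0; rewrite lt_min x0.
 by move=> j _; case: (fP j).
exists r => // j; have [f0 Pf]:= fP j; apply: mono Pf => //.
by rewrite /r (bigD1 j)//= ge_min lexx.
Qed.

(** * Sublinear Hamiltonians and the Hopf formula *)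

Record sublinear (R: realType) (d: nat) (H: 'rV[R]_d -> R) (C: R): Prop:= Sublinear {
 sl_add: forall p q, H (p+q)<=H p+H q;
 sl_scale: forall a p, 0<=a -> H (a *: p) = a*H p;
 sl_ge0: forall p, 0<=H p;
 sl_le: forall p, H p<=C*enorm p }.

Section Legendre.
Variables (R: realType) (d M: nat) (H: 'I_M -> 'rV[R]_d -> R) (C L del: R).
Local Notation V:= 'rV[R]_d.
Hypotheses (C0: 0<=C) (L0: 0<=L) (del0: 0<del) (sl: forall j, sublinear (H j) C).

Lemma sl_lip j p q: `|H j p-H j q| <= C*enorm (p-q).
Proof using sl.
have h p' q': H j p'-H j q'<=C*enorm (p'-q').
 have:= sl_add (sl j) (p'-q') q'; rewrite subrK; have:= sl_le (sl j) (p'-q'); lra.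
by rewrite ler_norml h andbT; have:= h q p; rewrite enormBC; lra.
Qed.

Lemma sl_bound j p: enorm p<=L -> 0<=H j p<=C*L.
Proof using C0 sl.
move=> pL; rewrite (sl_ge0 (sl j))/=; apply: le_trans (sl_le (sl j) p) _.
by rewrite ler_wpM2l.
Qed.

(** The integrand of the Hopf formula. Maximised over the ball of radius [L], it gives the flows of
    all [H j] run for the times [e j], started from [L*enorm x] up to [del]; the term in [del] makes
    it strongly concave, so that the maximum is C^1. *)
Definition Fe (x: V) (e: 'I_M -> R) (p: V): R :=
 dot p x-\sum_j H j p*e j-del*dot p p.

Lemma Fe_cont x e: continuous (Fe x e).
Proof using C0 sl del0.
move=> p; apply/cont_enormP => eps eps0.
pose K:= enorm x+C*\sum_j `|e j| + del*(2*enorm p+1).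
have K0: 0<=K.
 rewrite /K !addr_ge0 ?mulr_ge0 ?sumr_ge0 ?addr_ge0 ?mulr_ge0 ?(ltW del0)//.
have K1: 0<K+1 by rewrite ltr_wpDl.
exists (Num.min 1 (eps/(K+1))); first by rewrite lt_min ltr01 divr_gt0.
move=> q; rewrite lt_min ltr_pdivlMr// => /andP[q1 qK].
have E: Fe x e q-Fe x e p = dot (q-p) x-\sum_j (H j q-H j p)*e j-del*dot (q-p) (q+p).
 rewrite /Fe !dotBl !dotDr (dotC q p).
 have -> : \sum_j (H j q-H j p)*e j = \sum_j H j q*e j-\sum_j H j p*e j.
  by rewrite -sumrB; apply: eq_bigr => j _; rewrite mulrBl.
 by ring.
rewrite E; apply: le_lt_trans (ler_normB _ _) _; apply: le_lt_trans (lerD (ler_normB _ _) (lexx _)) _.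
have h1:= dot_norm (q-p) x.
have h2: `|\sum_j (H j q-H j p)*e j| <= enorm (q-p)*(C*\sum_j `|e j|).
 apply: le_trans (ler_norm_sum _ _ _) _; rewrite mulrA mulr_sumr; apply: ler_sum => j _.
 by rewrite normrM ler_wpM2r// mulrC sl_lip.
have h3: `|del*dot (q-p) (q+p)| <= enorm (q-p)*(del*(2*enorm p+1)).
 rewrite normrM gtr0_norm// mulrCA ler_pM2l//; apply: le_trans (dot_norm _ _) _.
 rewrite ler_wpM2l//; have:= enormD (q-p) (p+p); rewrite addrA subrK => /le_trans; apply.
 by have:= enormD p p; lra.
apply: le_lt_trans (lerD (lerD h1 h2) h3) _.
by move: qK; rewrite -!mulrDr -/K; have:= enorm_ge0 (q-p); lra.
Qed.

Lemma pstar_ex x e: exists p, enorm p<=L /\ forall q, enorm q<=L -> Fe x e q<=Fe x e p.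
Proof using C0 L0 sl del0.
have A0: [set p: V | enorm p<=L] !=set0 by exists 0; rewrite /= enorm0.
have cF: {within [set p: V | enorm p<=L], continuous (Fe x e)}.
 by apply: continuous_subspaceT; exact: Fe_cont.
have [p]:= compact_EVT_max A0 (@closed_ball_compact R d L) cF.
rewrite inE/= => pL h; exists p; split=> // q qL; apply: h; by rewrite inE.
Qed.

Definition pstar x e: V:= sval (cid (pstar_ex x e)).
Definition Psi x e: R:= Fe x e (pstar x e).

Lemma pstar_le x e: enorm (pstar x e)<=L.
Proof using. by rewrite /pstar; case: cid => p []. Qed.

Lemma Psi_max x e q: enorm q<=L -> Fe x e q<=Psi x e.
Proof using. by rewrite /Psi /pstar; case: cid => p /= [_]; apply. Qed.

(** Strong concavity tested at the midpoint of [q] and the maximiser; [0<=e j] makes the terms in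
    the convex [H j] concave. *)
Lemma Psi_strong x e q: (forall j, 0<=e j) -> enorm q<=L ->
 Fe x e q+del/2*enorm (q-pstar x e)^+2<=Psi x e.
Proof using.
move=> e0 qL; set p:= pstar x e; have pL: enorm p<=L by exact: pstar_le.
pose r:= 2^-1 *: (p+q).
have rL: enorm r<=L.
 rewrite enormZ ger0_norm//; have:= enormD p q; lra.
have Hr j: H j r<=(H j p+H j q)/2.
 by rewrite /r (sl_scale (sl j))// mulrC ler_pM2r//; exact: (sl_add (sl j)).
have S: \sum_j H j r*e j<=(\sum_j H j p*e j+\sum_j H j q*e j)/2.
 rewrite -big_split mulr_suml; apply: ler_sum => j _ /=.
 by rewrite -mulrDl mulrAC ler_wpM2r.
have:= Psi_max x e rL; rewrite /Psi -/p /Fe /r enorm_sqr !(dotZl, dotZr, dotDl, dotDr, dotNl, dotNr, dotBl, dotBr).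
rewrite (dotC q p); move: S; rewrite /r; lra.
Qed.

Lemma Fe_diff x x' e e' p p': (Fe x e p-Fe x' e' p)-(Fe x e p'-Fe x' e' p') =
 dot (p-p') (x-x')-\sum_j (H j p-H j p')*(e j-e' j).
Proof using.
rewrite /Fe !dotBl !dotBr.
have -> : \sum_j (H j p-H j p')*(e j-e' j) =
 (\sum_j H j p*e j-\sum_j H j p*e' j)-(\sum_j H j p'*e j-\sum_j H j p'*e' j).
 by rewrite -!sumrB; apply: eq_bigr => j _; ring.
by ring.
Qed.

Lemma Fe_diff_le x x' e e' p p': `|(Fe x e p-Fe x' e' p)-(Fe x e p'-Fe x' e' p')| <=
 enorm (p-p')*(enorm (x-x')+C*\sum_j `|e j-e' j|).
Proof using sl.
rewrite Fe_diff mulrDr; apply: le_trans (ler_normB _ _) _; apply: lerD; first exact: dot_norm.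
apply: le_trans (ler_norm_sum _ _ _) _; rewrite mulrA mulr_sumr; apply: ler_sum => j _.
by rewrite normrM ler_wpM2r// mulrC sl_lip.
Qed.

(** Add the strong concavity inequalities of the two problems, each tested at the maximiser of the
    other; what remains is linear in the change of [x] and [e]. *)
Lemma pstar_lip x x' e e': (forall j, 0<=e j) -> (forall j, 0<=e' j) ->
 del*enorm (pstar x e-pstar x' e')<=enorm (x-x')+C*\sum_j `|e j-e' j|.
Proof using.
move=> e0 e'0; set p:= pstar x e; set p':= pstar x' e'.
have h1:= Psi_strong x e0 (pstar_le x' e'); have h2:= Psi_strong x' e'0 (pstar_le x e).
rewrite -/p -/p' in h1 h2; rewrite (enormBC p') in h1.
have:= Fe_diff_le x x' e e' p p'; rewrite ler_norml => /andP[_ h3].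
move: h1 h2 h3; rewrite /Psi -/p -/p' => h1 h2 h3.
have [->|n0]:= eqVneq (enorm (p-p')) 0.
 by rewrite mulr0 addr_ge0// mulr_ge0// sumr_ge0.
have np: 0<enorm (p-p') by rewrite lt_def n0 enorm_ge0.
rewrite -(ler_pM2l np); move: h1 h2 h3; rewrite !expr2; clear; lra.
Qed.

(** Envelope theorem: each maximiser is tested in the other problem, and the remainder is controlled
    by the Lipschitz dependence of [pstar]. *)
Lemma Psi_exp x x' e e': (forall j, 0<=e j) -> (forall j, 0<=e' j) ->
 0<=Psi x' e'-Psi x e-dot (pstar x e) (x'-x)+\sum_j H j (pstar x e)*(e' j-e j)
  <= (enorm (x'-x)+C*\sum_j `|e' j-e j|)^+2/del.
Proof using.
move=> e0 e'0; set p:= pstar x e; set p':= pstar x' e'; set D:= enorm _+_.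
have E q: Fe x' e' q-Fe x e q = dot q (x'-x)-\sum_j H j q*(e' j-e j).
 rewrite /Fe dotBr; have -> : \sum_j H j q*(e' j-e j) = \sum_j H j q*e' j-\sum_j H j q*e j.
  by rewrite -sumrB; apply: eq_bigr => j _; rewrite mulrBr.
 by ring.
have h1:= Psi_max x' e' (pstar_le x e); have h2:= Psi_max x e (pstar_le x' e').
have Ep:= E p; rewrite -/p -/p' in h1 h2.
apply/andP; split; first by rewrite /Psi -/p in h1 *; lra.
have:= Fe_diff_le x' x e' e p' p; rewrite -/D ler_norml => /andP[_ h3].
have D0: 0<=D by rewrite /D addr_ge0// mulr_ge0// sumr_ge0.
have h4: enorm (p'-p)<=D/del.
 by rewrite ler_pdivlMr// mulrC; exact: pstar_lip.
have: enorm (p'-p)*D<=D/del*D by rewrite ler_wpM2r.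
have -> : D^+2/del = D/del*D by rewrite expr2 mulrAC.
by move: h2 h3; rewrite /Psi -/p -/p'; lra.
Qed.

Lemma Psi_lip_e x e e': `|Psi x e-Psi x e'| <= C*L*\sum_j `|e j-e' j|.
Proof using.
have h a b: Psi x a-Psi x b<=C*L*\sum_j `|a j-b j|.
 have:= Psi_max x b (pstar_le x a); set p:= pstar x a => h1.
 have: Fe x a p-Fe x b p = \sum_j H j p*(b j-a j).
  rewrite /Fe; have -> : \sum_j H j p*(b j-a j) = \sum_j H j p*b j-\sum_j H j p*a j.
   by rewrite -sumrB; apply: eq_bigr => j _; rewrite mulrBr.
  by ring.
 have: \sum_j H j p*(b j-a j)<=C*L*\sum_j `|a j-b j|.
  rewrite mulr_sumr; apply: ler_sum => j _; have /andP[H0 HL]:= sl_bound j (pstar_le x a).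
  apply: le_trans (ler_norm _) _; rewrite normrM ger0_norm// [`|b j-_|]distrC.
  by rewrite ler_wpM2r.
 by move: h1; rewrite {2}/Psi -/p; lra.
rewrite ler_norml h andbT lerNl opprB; apply: le_trans (h _ _) _.
by under eq_bigr do rewrite distrC.
Qed.

Lemma Psi_ge x e: (forall j, 0<=e j) ->
 L*enorm x-(C*L*\sum_j e j+del*L^+2)<=Psi x e.
Proof using.
move=> e0; pose p:= (L/enorm x) *: x.
have [x0|x0]:= eqVneq (enorm x) 0.
 have:= Psi_max x e (q:= 0); rewrite enorm0 => /(_ L0); rewrite /Fe !dot0l mulr0.
 have -> : \sum_j H j 0*e j = 0.
  by apply: big1 => j _; have:= sl_scale (sl j) 0 (lexx 0); rewrite scale0r mul0r => ->; rewrite mul0r.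
 have: 0<=C*L*\sum_j e j by rewrite !mulr_ge0// sumr_ge0.
 have: 0<=del*L^+2 by rewrite mulr_ge0 ?sqr_ge0 ?ltW.
 rewrite x0; lra.
have pL: enorm p = L.
 by rewrite enormZ ger0_norm ?divr_ge0// mulfVK.
have:= Psi_max x e (q:= p); rewrite pL lexx => /(_ isT) /(le_trans _); apply.
have -> : Fe x e p = L*enorm x-\sum_j H j p*e j-del*L^+2.
 by rewrite /Fe -(enorm_sqr p) pL /p dotZl -enorm_sqr expr2 mulrA mulfVK.
have: \sum_j H j p*e j<=C*L*\sum_j e j.
 rewrite mulr_sumr; apply: ler_sum => j _; rewrite ler_wpM2r//.
 by have /andP[]: 0<=H j p<=C*L by apply: sl_bound; rewrite pL.
by lra.
Qed.

Lemma Psi_0 e: (forall j, 0<=e j) -> Psi 0 e<=0.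
Proof using.
move=> e0; rewrite /Psi /Fe dot0r.
have: 0<=\sum_j H j (pstar 0 e)*e j by apply: sumr_ge0 => j _; rewrite mulr_ge0// (sl_ge0 (sl j)).
have: 0<=del*dot (pstar 0 e) (pstar 0 e) by rewrite mulr_ge0 ?dotxx_ge0// ltW.
lra.
Qed.

(** The time derivative says that [Psi] along [E] solves the equation with Hamiltonians [H j] driven
    by the path [E]. *)
Lemma C1with_Psi (E E': 'I_M -> R -> R): (forall j, has_exp (E j) (E' j)) ->
 (forall j, continuous (E' j)) -> (forall j t, 0<=E j t) ->
 C1with (fun z => Psi z.1 (E^~ z.2)) (fun z => pstar z.1 (E^~ z.2))
  (fun z => - \sum_j H j (pstar z.1 (E^~ z.2))*E' j z.2).
Proof using.
move=> hE cE E0.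
have pc x t (e: R): 0<e -> exists2 r: R, 0<r & forall y s, enorm (y-x)<r -> `|s-t| < r ->
  enorm (pstar y (E^~ s)-pstar x (E^~ t))<e.
 move=> e0; have m0: 0<e*del/(2*(C*M%:R+1)) by rewrite divr_gt0 ?mulr_gt0// ltr_wpDl// mulr_ge0.
 have ex j: exists2 r: R, 0<r & forall s, `|s-t| < r -> `|E j s-E j t| < e*del/(2*(C*M%:R+1)).
  have /cvgrPdist_lt/(_ _ m0)/nbhs_normP[r /= r0 rP]:= @has_exp_cont _ _ _ (hE j) t.
  by exists r => // s st; rewrite distrC; apply: rP; rewrite /= distrC.
 have [r r0 rP]:= @fin_min _ _ (fun j r => forall s, `|s-t| < r -> `|E j s-E j t| < e*del/(2*(C*M%:R+1)))
  ex (fun j r r' _ rr h s st => h s (lt_le_trans st rr)).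
 exists (Num.min r (e*del/2)); first by rewrite lt_min r0 divr_gt0// mulr_gt0.
 move=> y s; rewrite !lt_min => /andP[y1 y2] /andP[s1 s2].
 have:= pstar_lip y x (E0^~ s) (E0^~ t).
 have: C*\sum_j `|E j s-E j t| < e*del/2.
  apply: (@le_lt_trans _ _ (C*M%:R*(e*del/(2*(C*M%:R+1))))).
   rewrite -mulrA ler_wpM2l// mulr_natl -[M in _ *+ M]card_ord -sumr_const.
   by apply: ler_sum => j _; apply/ltW/rP.
  have X0: 0<=C*M%:R by rewrite mulr_ge0.
  rewrite mulrA ltr_pdivrMr ?mulr_gt0 ?ltr_wpDl//; set X:= C*M%:R in X0 *.
  have: 0<e*del by rewrite mulr_gt0.
  by move: (e*del) => ed; nra.
 move=> h1 h2; rewrite -(ltr_pM2l del0) [del*e]mulrC; lra.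
split.
- move=> x t e e0 /=; set p:= pstar x (E^~ t).
 pose D:= 1+C*\sum_j (`|E' j t| + 1).
 have S0: 0<=\sum_j (`|E' j t| + 1) by apply: sumr_ge0 => j _; rewrite addr_ge0.
 have D0: 0<D by rewrite /D ltr_wpDr// mulr_ge0.
 pose m:= Num.min 1 (e/(2*(C*L*M%:R+1))).
 have CLM: 0<C*L*M%:R+1 by rewrite ltr_wpDl// !mulr_ge0.
 have m0: 0<m by rewrite lt_min ltr01 divr_gt0// mulr_gt0.
 have [r r0 rP]:= @fin_min _ _ (fun j r => forall s, `|s-t| < r -> `|E j s-E j t-E' j t*(s-t)| <= m * `|s-t|)
  (fun j => hE j t m m0) (fun j r r' _ rr h s st => h s (lt_le_trans st rr)).
 pose r1:= e*del/(4*D^+2).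
 have r10: 0<r1 by rewrite divr_gt0 ?mulr_gt0 ?exprn_gt0.
 exists (Num.min r r1); first by rewrite lt_min r0.
 move=> y s; rewrite !lt_min => /andP[y1 y2] /andP[s1 s2].
 have /andP[l1 l2]:= Psi_exp x y (E0^~ t) (E0^~ s); rewrite -/p in l1 l2.
 set a:= enorm (y-x) + `|s-t|.
 have a0: 0<=a by rewrite addr_ge0.
 have a1: a<2*r1 by rewrite /a; lra.
 have m1: m<=1 by rewrite ge_min lexx.
 have m2: C*L*M%:R * m<=e/2.
  have: (C*L*M%:R+1) * m<=e/2.
   rewrite mulrC -ler_pdivlMr//; apply: (@le_trans _ _ (e/(2*(C*L*M%:R+1)))).
    by rewrite ge_min lexx orbT.
   by rewrite invfM mulrA.
  by have:= m0; lra.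
 have Da: enorm (y-x)+C*\sum_j `|E j s-E j t| <= D*a.
  have: C*\sum_j `|E j s-E j t| <= C*(\sum_j (`|E' j t| + 1)) * `|s-t|.
   rewrite -mulrA ler_wpM2l// mulr_suml; apply: ler_sum => j _.
   rewrite -(subrK (E' j t*(s-t)) (E j s-E j t)); apply: le_trans (ler_normD _ _) _.
   have:= rP j s s1; rewrite normrM mulrDl mul1r.
   have: m * `|s-t| <= 1 * `|s-t| by rewrite ler_wpM2r.
   by lra.
  have: 0<=C*(\sum_j (`|E' j t| + 1))*enorm (y-x) by rewrite !mulr_ge0.
  by rewrite /D /a; move: (normr_ge0 (s-t)); lra.
 have q1: (enorm (y-x)+C*\sum_j `|E j s-E j t|)^+2/del<=e/2*a.
  rewrite ler_pdivrMr//; apply: (@le_trans _ _ ((D*a)^+2)).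
   by rewrite ler_pXn2r ?nnegrE// ?addr_ge0 ?mulr_ge0 ?sumr_ge0 ?(ltW D0).
  have D2: 0<D^+2 by rewrite exprn_gt0.
  have: D^+2*a<=e*del/2.
   apply: (@le_trans _ _ (D^+2*(2*r1))); first by rewrite ler_pM2l// ltW.
   have -> : D^+2*(2*r1) = e*del/2 by rewrite /r1; field; rewrite gt_eqF.
   by [].
  by rewrite exprMn [a^+2]expr2 mulrA; move: a0; clear; move: (D^+2) => DD; nra.
 have q2: `|\sum_j H j p*(E j s-E j t-E' j t*(s-t))| <= e/2*a.
  apply: le_trans (ler_norm_sum _ _ _) _.
  apply: (@le_trans _ _ (\sum_(j<M) C*L*(m * `|s-t|))).
   apply: ler_sum => j _; have /andP[H0 HL]:= sl_bound j (pstar_le x (E^~ t)); rewrite -/p in H0 HL.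
   by rewrite normrM (ger0_norm H0) ler_pM// rP.
  rewrite sumr_const card_ord -[X in X<=_]mulr_natr.
  have -> : C*L*(m * `|s-t|)*M%:R = C*L*M%:R * m * `|s-t| by ring.
  apply: ler_pM => //; last by rewrite /a lerDr.
  by rewrite !mulr_ge0// ltW.
 have -> : Psi y (E^~ s)-Psi x (E^~ t)-dot p (y-x) - - (\sum_j H j p*E' j t)*(s-t) =
  (Psi y (E^~ s)-Psi x (E^~ t)-dot p (y-x)+\sum_j H j p*(E j s-E j t)) -
  \sum_j H j p*(E j s-E j t-E' j t*(s-t)).
  have -> : \sum_j H j p*(E j s-E j t-E' j t*(s-t)) =
   \sum_j H j p*(E j s-E j t)-(\sum_j H j p*E' j t)*(s-t).
   by rewrite mulr_suml -sumrB; apply: eq_bigr => j _; ring.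
  by ring.
 apply: le_trans (ler_normB _ _) _; rewrite (ger0_norm l1) (splitr e) mulrDl lerD//.
 exact: le_trans l2 q1.
- move=> v [x t]; apply/cont_enorm2P => e e0.
 have v1: 0<enorm v+1 by rewrite ltr_wpDl// enorm_ge0.
 have [r r0 rP]:= pc x t _ (divr_gt0 e0 v1); exists r => // y s y1 s1 /=.
 rewrite -dotBl; apply: le_lt_trans (dot_norm _ _) _.
 have:= rP y s y1 s1; rewrite ltr_pdivlMr//; have:= enorm_ge0 (pstar y (E^~ s)-pstar x (E^~ t)); nra.
- move=> z; apply: cvgN; apply: cvg_big => [|j _]; [exact: add_continuous|apply: cvgM; last first].
  by apply: (@cvg_comp _ _ _ snd (E' j) (nbhs z) (nbhs z.2)); [exact: cvg_snd|exact: cE].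
 case: z => x t; apply/cont_enorm2P => e e0.
 have CC: 0<C+1 by rewrite ltr_wpDl.
 have [r r0 rP]:= pc x t _ (divr_gt0 e0 CC); exists r => // y s y1 s1 /=.
 apply: le_lt_trans (sl_lip _ _ _) _.
 have:= rP y s y1 s1; rewrite ltr_pdivlMr//; have:= enorm_ge0 (pstar y (E^~ s)-pstar x (E^~ t)).
 by move: C0; nra.
Qed.

End Legendre.

(** * Stability of solutions in the driving path *)

Section PathStability.
Variables (R: realType) (d M: nat) (H: 'I_M -> 'rV[R]_d -> R) (C: R).
Local Notation V:= 'rV[R]_d.
Hypotheses (C0: 0<=C) (sl: forall j, sublinear (H j) C).

Definition C1p (y y': 'I_M -> R -> R): Prop:= forall j, has_exp (y j) (y' j) /\ continuous (y' j).
Definition limH (y': 'I_M -> R -> R) (x: V) (s: R) (p: V): R:= \sum_j H j p*y' j s.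

Lemma C1p_bound y y' (a b: R): a<=b -> C1p y y' ->
 exists2 B: R, 0<=B & forall t, a<=t<=b -> \sum_j `|y' j t| <= B.
Proof using.
move=> ab cy.
have ex j: exists B: R, 0<=B /\ forall t, a<=t<=b -> `|y' j t| <= B.
 by have [B B0 h]:= cont_bounded ab (cy j).2; exists B.
have [B hB]:= choice ex; exists (\sum_j B j); first by apply: sumr_ge0 => j _; case: (hB j).
by move=> t tI; apply: ler_sum => j _; case: (hB j) => _; exact.
Qed.

Lemma limH_lip y' x t p p' (B: R): \sum_j `|y' j t| <= B ->
 `|limH y' x t p-limH y' x t p'| <= C*B*enorm (p-p').
Proof using C0 sl.
move=> yB; rewrite /limH -sumrB; apply: le_trans (ler_norm_sum _ _ _) _.
apply: (@le_trans _ _ (\sum_j C*enorm (p-p') * `|y' j t|)).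
 by apply: ler_sum => j _; rewrite -mulrBl normrM ler_wpM2r// sl_lip.
by rewrite -mulr_sumr -[leRHS]mulrA [B*_]mulrC mulrA ler_wpM2l// mulr_ge0.
Qed.

Section Step.
Variables (L del: R).
Hypotheses (L0: 0<=L) (del0: 0<del).
Local Notation PSI:= (Psi C0 L0 del0 sl).

(** Along [E = y1-y2+h'] the time derivative of [Psi] cancels the difference of the two
    Hamiltonians, so [comparison] applies with [kap = 0]. The shift [h'] makes the times of the Hopf
    formula nonnegative on the strip, and [kappa] keeps them so outside it. *)
Lemma stab_step (s0 s1 h h' K0: R) y1 y1' y2 y2' u1 u2: s0<s1 ->
 C1p y1 y1' -> C1p y2 y2' -> UCstrip u1 s0 s1 -> UCstrip u2 s0 s1 ->
 visc_sub (limH y1') u1 [set t | s0<t<s1] ->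
 visc_super (limH y2') u2 [set t | s0<t<s1] -> h<h' ->
 (forall j t, s0<=t<=s1 -> `|y1 j t-y2 j t| <= h) ->
 (forall x y, u1 x s0-u2 y s0<=PSI (x-y) (fun j => y1 j s0-y2 j s0+h')+K0) ->
 forall x y t, s0<=t<s1 -> u1 x t-u2 y t<=PSI (x-y) (fun j => y1 j t-y2 j t+h')+K0.
Proof using.
move=> s01 c1 c2 uc1 uc2 vs1 vs2 hh' yh init.
(* [kappa r] is the identity above [2*r = h'-h], which is where [y1-y2+h'] stays on the strip. *)
pose r:= (h'-h)/2; have r0: 0<r by rewrite divr_gt0// subr_gt0.
pose E j t:= kappa r (y1 j t-y2 j t+h').
pose E' j t:= kappa' r (y1 j t-y2 j t+h')*(y1' j t-y2' j t).
have hB j:= has_expB (c1 j).1 (c2 j).1.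
have hE j: has_exp (E j) (E' j) by exact: has_exp_kappa.
have cd j: continuous (fun t => y1' j t-y2' j t).
 by move=> t; apply: cvgB; [exact: (c1 j).2|exact: (c2 j).2].
have cE j: continuous (E' j).
 by apply: (@kappa'_comp_cont _ (fun t => y1 j t-y2 j t)).
have E0 j t: 0<=E j t by exact: kappa_ge0.
have Eid j t: s0<=t<=s1 -> E j t = y1 j t-y2 j t+h' /\ E' j t = y1' j t-y2' j t.
 move=> tI; have:= yh j t tI; rewrite ler_norml => /andP[a1 a2].
 have [|e1 e2]:= @kappa_id _ r (y1 j t-y2 j t+h') r0; first by rewrite /r; lra.
 by rewrite /E /E' e1 e2 mul1r.
have EidE t: s0<=t<=s1 -> E^~ t = (fun j => y1 j t-y2 j t+h').
 by move=> tI; apply/funext => j; case: (Eid j t tI).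
have ss: s0<=s0<=s1 by rewrite lexx ltW.
have cPhi:= C1with_Psi C0 L0 del0 sl hE cE E0.
have [B1 B10 b1]:= C1p_bound (ltW s01) c1; have [B2 B20 b2]:= C1p_bound (ltW s01) c2.
have CB: 0<=C*(B1+B2) by rewrite mulr_ge0 ?addr_ge0.
have key:= @comparison R d u1 u2 (limH y1') (limH y2') _ _ _ s0 s1 L (C*L*(B1+B2)) (C*(B1+B2)) 0 K0
 s01 uc1 uc2 vs1 vs2 cPhi.
move=> x y t tI; have tI': s0<=t<=s1 by case/andP: tI => a1 /ltW a2; apply/andP.
suff: u1 x t-u2 y t<=PSI (x-y) (E^~ t)+K0+0*(t-s0) by rewrite mul0r addr0 EidE.
apply: key => //.
- by rewrite !mulr_ge0// addr_ge0.
- by move=> z r' _; exact: pstar_le.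
- move=> z r' r'I; apply: le_trans (ler_norm _) _; apply: le_trans (Psi_lip_e _ _ _ _ _ _ _) _.
 rewrite -[leRHS]mulrA ler_wpM2l ?mulr_ge0//.
 have [ra rb]:= andP r'I.
 apply: (@le_trans _ _ (\sum_j (`|y1 j s0-y1 j r'| + `|y2 j s0-y2 j r'|))).
  apply: ler_sum => j _; rewrite (Eid j s0 ss).1 (Eid j r' r'I).1.
  have -> : y1 j s0-y2 j s0+h'-(y1 j r'-y2 j r'+h') = (y1 j s0-y1 j r')-(y2 j s0-y2 j r') by ring.
  exact: ler_normB.
 have lip (y0 y0': 'I_M -> R -> R): C1p y0 y0' ->
  exists2 D: 'I_M -> R, (forall j r'', s0<=r''<=s1 -> `|y0' j r''| <= D j) & True.
  by move=> c; have ex j: exists B: R, forall t, s0<=t<=s1 -> `|y0' j t| <= B;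
   [have [B _ h0]:= cont_bounded (ltW s01) (c j).2; exists B|have [D hD]:= choice ex; exists D].
 have sumb (y0 y0': 'I_M -> R -> R) B: C1p y0 y0' -> (forall t, s0<=t<=s1 -> \sum_j `|y0' j t| <= B) ->
   \sum_j `|y0 j s0-y0 j r'| <= B*(r'-s0).
  move=> c hBt.
  (* The signs turn the sum of absolute increments into the increment of a single function, whose
     derivative is bounded by the sum [B]. *)
  pose sg j: R:= if 0<=y0 j r'-y0 j s0 then 1 else -1.
  have sg1 j: `|sg j| = 1 by rewrite /sg; case: ifP; rewrite ?normrN normr1.
  have sE j: `|y0 j s0-y0 j r'| = sg j*y0 j r'-sg j*y0 j s0.
   rewrite -mulrBr /sg distrC; case: ifP => [h0|/negbT]; first by rewrite mul1r ger0_norm.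
   by rewrite -ltNge => h0; rewrite mulN1r ltr0_norm.
  rewrite (eq_bigr _ (fun j _ => sE j)) sumrB.
  have hs: has_exp (fun t => \sum_j sg j*y0 j t) (fun t => \sum_j sg j*y0' j t).
   move=> t0 e e0; have m0: 0<e/(M%:R+1) by rewrite divr_gt0// ltr_wpDl.
   have [q q0 qP]:= @fin_min _ _ (fun j q => forall s, `|s-t0| < q ->
     `|y0 j s-y0 j t0-y0' j t0*(s-t0)| <= e/(M%:R+1) * `|s-t0|)
    (fun j => (c j).1 t0 _ m0) (fun j r1 r2 _ rr h0 s st => h0 s (lt_le_trans st rr)).
   exists q => // s sq.
   have -> : \sum_j sg j*y0 j s-\sum_j sg j*y0 j t0-(\sum_j sg j*y0' j t0)*(s-t0) =
    \sum_j sg j*(y0 j s-y0 j t0-y0' j t0*(s-t0)).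
    by rewrite mulr_suml -!sumrB; apply: eq_bigr => j _; ring.
   apply: le_trans (ler_norm_sum _ _ _) _.
   apply: (@le_trans _ _ (\sum_(j<M) e/(M%:R+1) * `|s-t0|)).
    by apply: ler_sum => j _; rewrite normrM sg1 mul1r qP.
   rewrite sumr_const card_ord -[leLHS]mulr_natr mulrAC ler_wpM2r//.
   by rewrite mulrAC ler_pdivrMr ?ltr_wpDl// ler_pM2l// lerDl.
  have:= @has_exp_lip _ _ _ B s0 s1 hs _ r' s0 r'I ss.
  rewrite (ger0_norm (_: 0<=r'-s0)) ?subr_ge0// => hl.
  apply: le_trans (ler_norm _) _; apply: hl => t0 t0I; apply: le_trans _ (hBt t0 t0I).
  apply: le_trans (ler_norm_sum _ _ _) _; apply: ler_sum => j _.
  by rewrite normrM sg1 mul1r.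
 rewrite big_split mulrDl; apply: lerD; first exact: (sumb _ _ _ c1 b1).
 exact: (sumb _ _ _ c2 b2).
- move=> x' t' p p' /andP[ta tb]; have tI'': s0<=t'<=s1 by rewrite !ltW.
 by apply: limH_lip; apply: le_trans (b1 _ tI'') _; rewrite lerDl.
- move=> x' t' p p' /andP[ta tb]; have tI'': s0<=t'<=s1 by rewrite !ltW.
 by apply: limH_lip; apply: le_trans (b2 _ tI'') _; rewrite lerDr.
- move=> e e0; have m0: 0<e/(C*L*M%:R+1) by rewrite divr_gt0// ltr_wpDl// !mulr_ge0.
 have [q q0 qP]:= @fin_min _ _ (fun j q => forall x y, s0<=x<=s1 -> s0<=y<=s1 -> `|x-y| < q ->
   `|y2' j x-y2' j y| <= e/(C*L*M%:R+1))
   (fun j => heine (ltW s01) (c2 j).2 m0)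
   (fun j r1 r2 _ rr h0 x' y' xI yI st => h0 x' y' xI yI (lt_le_trans st rr)).
 exists q => // y' t' s' p /andP[ta tb] /andP[sa sb] ts pL.
 rewrite /limH -sumrB; apply: le_trans (ler_norm_sum _ _ _) _.
 apply: (@le_trans _ _ (\sum_(j<M) C*L*(e/(C*L*M%:R+1)))).
  apply: ler_sum => j _; rewrite -mulrBr normrM; have /andP[H0 HL]:= sl_bound C0 sl j pL.
  by rewrite (ger0_norm H0) ler_pM// qP// ?ltW// (ltW ta) (ltW tb) ?(ltW sa) ?(ltW sb).
 rewrite sumr_const card_ord -[leLHS]mulr_natr.
 have -> : C*L*(e/(C*L*M%:R+1))*M%:R = e*(C*L*M%:R)/(C*L*M%:R+1) by ring.
 by rewrite ler_pdivrMr ?ltr_wpDl ?mulr_ge0// ler_pM2l// lerDl.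
- move=> x' y' t' /andP[ta tb]; have tI'': s0<=t'<=s1 by rewrite !ltW.
 rewrite /limH /= oppr0; set p:= pstar _ _ _ _ _ _.
 have -> : \sum_j H j p*E' j t' = \sum_j H j p*y1' j t'-\sum_j H j p*y2' j t'.
  by rewrite -sumrB; apply: eq_bigr => j _; rewrite (Eid j t' tI'').2 mulrBr.
 by rewrite opprB subrK subrr.
- by move=> x' y'; rewrite /= EidE.
Qed.

End Step.

(** Only a right neighbourhood of each time is involved, so that the driving path may have corners,
    as polygonal paths do. *)
Definition rsol (v: V -> R -> R) (z: 'I_M -> R -> R) (t: R): Prop :=
 exists r y y', [/\ 0<r, C1p y y', (forall j s, t<=s<=t+r -> y j s = z j s) &
  visc_sol (limH y') v [set s | t<s<t+r]].

Definition cont_path (z: 'I_M -> R -> R) (T: R): Prop :=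
 forall j t (e: R), 0<=t<=T -> 0<e -> exists2 r: R, 0<r &
  forall s, 0<=s<=T -> `|s-t| < r -> `|z j s-z j t| < e.

Lemma UCstrip_sub (u: V -> R -> R) (a b a' b': R): a<=a' -> b'<=b -> UCstrip u a b -> UCstrip u a' b'.
Proof using.
move=> aa bb uc e /uc[del d0 h]; exists del => // x y s t /andP[s1 s2] /andP[t1 t2]; apply: h.
 by rewrite (le_trans aa)// (le_trans s2).
by rewrite (le_trans aa)// (le_trans t2).
Qed.

Lemma visc_sol_mono (H1: V -> R -> V -> R) u I I': (forall t, I' t -> I t) -> visc_sol H1 u I -> visc_sol H1 u I'.
Proof using. by move=> II vu phi x0 t0 cp /II; exact: vu. Qed.

(** The bound by [PSI] plus [K0] holds initially by [Psi_ge], extends to the right by [stab_step]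
    and to limits of times by continuity. It is read off on the diagonal, where [Psi_0] applies;
    finally [h'] tends to [h] and [del] to 0. *)
Lemma stability (T h w L: R) u0 v1 v2 z1 z2: 0<=T -> 0<=h -> 0<=L ->
 UCstrip v1 0 T -> UCstrip v2 0 T -> (forall x, v1 x 0 = u0 x) -> (forall x, v2 x 0 = u0 x) ->
 (forall x y, u0 x-u0 y<=w+L*enorm (x-y)) ->
 cont_path z1 T -> cont_path z2 T ->
 (forall t, 0<=t<T -> rsol v1 z1 t) -> (forall t, 0<=t<T -> rsol v2 z2 t) ->
 (forall j t, 0<=t<=T -> `|z1 j t-z2 j t| <= h) ->
 forall x t, 0<=t<=T -> v1 x t-v2 x t<=w+C*L*M%:R*(2*h).
Proof using C0 sl.
move=> T0 h0 L0 uc1 uc2 i1 i2 wL cz1 cz2 r1 r2 zh x t tI.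
suff main h' del (del0: 0<del): h<h' -> v1 x t-v2 x t<=w+C*L*M%:R*(2*h')+del*L^+2.
 apply/ler_addgt0Pr => e e0.
 pose k:= 4*(C*L*M%:R+1); have CLM: 0<=C*L*M%:R by rewrite !mulr_ge0.
 have k0: 0<k by rewrite mulr_gt0// ltr_wpDl.
 have L2: 0<2*(L^+2+1) by rewrite mulr_gt0// ltr_wpDl// sqr_ge0.
 have:= main (h+e/k) (e/(2*(L^+2+1))); rewrite !divr_gt0// ltrDl divr_gt0// => /(_ isT isT) /le_trans; apply.
 have a1: C*L*M%:R*(2*(e/k))<=e/2.
  have -> : C*L*M%:R*(2*(e/k)) = e*(C*L*M%:R*2)/k by ring.
  by rewrite ler_pdivrMr// /k; move: CLM e0; set X:= C*L*M%:R; clear => X0 e0; nra.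
 have a2: e/(2*(L^+2+1))*L^+2<=e/2.
  by rewrite mulrAC ler_pdivrMr//; move: (sqr_ge0 L) e0; set X:= L^+2; clear => X0 e0; nra.
 by rewrite mulrDr mulrDr; lra.
move=> hh'; pose PSI:= Psi C0 L0 del0 sl.
pose K0:= w+C*L*M%:R*(2*h')+del*L^+2.
have E0 j s: 0<=s<=T -> 0<=z1 j s-z2 j s+h'<=2*h'.
 by move=> /(zh j s); rewrite ler_norml => /andP[? ?]; apply/andP; split; lra.
pose P s:= forall x y, v1 x s-v2 y s<=PSI (x-y) (fun j => z1 j s-z2 j s+h')+K0.
have TT: 0<=T<=T by rewrite lexx T0.
have: P t; last first.
 move=> /(_ x x); rewrite subrr => /le_trans; apply; rewrite gerDr.
 by apply: Psi_0 => j; case/andP: (E0 j t tI).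
apply: (@real_induction R 0 T P T0) => //.
- move=> x' y'; rewrite i1 i2; apply: le_trans (wL x' y') _.
 have I0: 0<=(0: R)<=T by rewrite lexx.
 have e0 j: 0<=z1 j 0-z2 j 0+h' by case/andP: (E0 j 0 I0).
 have:= Psi_ge C0 L0 del0 sl (x'-y') e0; rewrite -/PSI => g.
 have: C*L*\sum_j (z1 j 0-z2 j 0+h')<=C*L*(M%:R*(2*h')).
  rewrite ler_wpM2l ?mulr_ge0// mulr_natl -[M in _ *+ M]card_ord -sumr_const.
  by apply: ler_sum => j _; case/andP: (E0 j 0 I0).
 by rewrite mulrA /K0; move: g; set X:= PSI _ _; lra.
- move=> s /andP[s0 sT] Ps; have s01: 0<=s<T by rewrite s0.
 have [q1 [y1 [y1' [q10 c1 e1 vs1]]]]:= r1 s s01; have [q2 [y2 [y2' [q20 c2 e2 vs2]]]]:= r2 s s01.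
 pose q:= Num.min (Num.min q1 q2) (T-s).
 have q0: 0<q by rewrite /q !lt_min q10 q20 subr_gt0.
 have [qq1 qq2 qT]: [/\ q<=q1, q<=q2 & q<=T-s] by rewrite /q !ge_min !lexx ?orbT.
 have ye1 j r: s<=r<=s+q -> y1 j r = z1 j r.
  by move=> /andP[ra rb]; apply: e1; rewrite ra (le_trans rb)// lerD2l.
 have ye2 j r: s<=r<=s+q -> y2 j r = z2 j r.
  by move=> /andP[ra rb]; apply: e2; rewrite ra (le_trans rb)// lerD2l.
 have sq: s<s+q by rewrite ltrDl.
 have EE r: s<=r<=s+q -> (fun j => y1 j r-y2 j r+h') = (fun j => z1 j r-z2 j r+h').
  by move=> rI; apply/funext => j; rewrite ye1// ye2.
 exists q => // r /andP[sr rT] rq x' y'.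
 have rI: s<=r<=s+q by rewrite sr ltW.
 rewrite -EE//; apply: (@stab_step L del L0 del0 s (s+q) h h' K0 y1 y1' y2 y2' v1 v2) => //.
 + by apply: UCstrip_sub uc1 => //; lra.
 + by apply: UCstrip_sub uc2 => //; lra.
 + apply: visc_sol_sub; apply: visc_sol_mono vs1 => r' /= /andP[-> /lt_le_trans]; apply.
  by rewrite lerD2l.
 + apply: visc_sol_super; apply: visc_sol_mono vs2 => r' /= /andP[-> /lt_le_trans]; apply.
  by rewrite lerD2l.
 + move=> j r' r'I; rewrite ye1// ye2//; apply: zh; case/andP: r'I => ? ?; apply/andP; split; lra.
 + by rewrite (EE s) ?lexx ?(ltW sq).
 + by rewrite sr.
- move=> s /andP[s0 sT] Pr x' y'; apply/ler_addgt0Pr => e e0.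
 have sI: 0<=s<=T by rewrite ltW.
 have e4: 0<e/4 by rewrite divr_gt0.
 have [d1 d10 d1P]:= uc1 _ e4; have [d2 d20 d2P]:= uc2 _ e4.
 pose m:= e/(4*(C*L*M%:R+1)).
 have CLM: 0<=C*L*M%:R by rewrite !mulr_ge0.
 have m0: 0<m by rewrite /m divr_gt0// mulr_gt0// ltr_wpDl.
 have [q1 q10 q1P]:= @fin_min _ _ (fun j q => forall r, 0<=r<=T -> `|r-s| < q -> `|z1 j r-z1 j s| < m)
  (fun j => cz1 j s m sI m0) (fun j r1 r2 _ rr h0 r rI st => h0 r rI (lt_le_trans st rr)).
 have [q2 q20 q2P]:= @fin_min _ _ (fun j q => forall r, 0<=r<=T -> `|r-s| < q -> `|z2 j r-z2 j s| < m)
  (fun j => cz2 j s m sI m0) (fun j r1 r2 _ rr h0 r rI st => h0 r rI (lt_le_trans st rr)).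
 pose q:= Num.min (Num.min d1 d2) (Num.min q1 q2).
 have q0: 0<q by rewrite /q !lt_min d10 d20 q10.
 have [k1 k2 k3 k4]: [/\ q<=d1, q<=d2, q<=q1 & q<=q2] by rewrite /q !ge_min !lexx ?orbT.
 pose r:= Num.max 0 (s-q/2).
 have r0: 0<=r by rewrite le_max lexx.
 have rs: r<s by rewrite gt_max s0 ltrBlDr ltrDl divr_gt0.
 have sr: s-r<=q/2 by rewrite lerBlDl -lerBlDr le_max lexx orbT.
 have rI: 0<=r<=T by rewrite r0 ltW// (lt_le_trans rs).
 have nrs: `|r-s| < q by rewrite distrC ger0_norm ?subr_ge0 ?(ltW rs)//; lra.
 have nsr: `|s-r| < q by rewrite distrC.
 have h1:= d1P x' x' s r sI rI; rewrite subrr enorm0 in h1; have {}h1:= h1 d10 (lt_le_trans nsr k1).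
 have h2:= d2P y' y' s r sI rI; rewrite subrr enorm0 in h2; have {}h2:= h2 d20 (lt_le_trans nsr k2).
 have:= Pr r; rewrite r0 rs => /(_ isT x' y') h3.
 have h4:= Psi_lip_e C0 L0 del0 sl (x'-y') (fun j => z1 j r-z2 j r+h') (fun j => z1 j s-z2 j s+h').
 have h5: C*L*\sum_j `|z1 j r-z2 j r+h'-(z1 j s-z2 j s+h')| <= e/2.
  apply: (@le_trans _ _ (C*L*(M%:R*(2 * m)))).
   rewrite ler_wpM2l ?mulr_ge0// mulr_natl -[M in _ *+ M]card_ord -sumr_const; apply: ler_sum => j _.
   have -> : z1 j r-z2 j r+h'-(z1 j s-z2 j s+h') = (z1 j r-z1 j s)-(z2 j r-z2 j s) by ring.
   apply: le_trans (ler_normB _ _) _.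
   move: (q1P j r rI (lt_le_trans nrs k3)) (q2P j r rI (lt_le_trans nrs k4)); clear; lra.
  have -> : C*L*(M%:R*(2 * m)) = e*(C*L*M%:R*2)/(4*(C*L*M%:R+1)) by rewrite /m; ring.
  rewrite ler_pdivrMr ?mulr_gt0 ?ltr_wpDl//; move: CLM e0; set X:= C*L*M%:R; clear => X0 e0; nra.
 move: h1 h2 h3 h4 h5; rewrite -/PSI !ltr_norml ler_norml; clear => /andP[? ?] /andP[? ?] ? /andP[? ?] ?.
 lra.
Qed.

End PathStability.

(** * Comparison for front equations with Lipschitz speeds *)

Section SpeedComparison.
Variables (R: realType) (d: nat).
Local Notation V:= 'rV[R]_d.

Lemma C1withM (phi psi: V*R -> R) g g' q q': C1with phi g q -> C1with psi g' q' ->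
 C1with (fun z => phi z * psi z) (fun z => psi z *: g z+phi z *: g' z)
  (fun z => psi z*q z+phi z*q' z).
Proof.
move=> [a1 b1 c1] [a2 b2 c2].
have cphi: continuous phi by move=> [x t]; exact: fo_exp_cont (a1 x t).
have cpsi: continuous psi by move=> [x t]; exact: fo_exp_cont (a2 x t).
split.
- move=> x t e e0; pose p:= g (x, t); pose r:= q (x, t).
 pose A:= `|phi (x, t)| + `|psi (x, t)| + 1+(enorm p + `|r|).
 have A0: 0<A by rewrite /A ltr_wpDr ?addr_ge0// ltr_wpDl// addr_ge0.
 pose e1: R:= Num.min 1 (e/A); have e10: 0<e1 by rewrite lt_min ltr01 divr_gt0.
 have e11: e1<=1 by rewrite ge_min lexx.
 have e1A: e1*A<=e by rewrite -ler_pdivlMr// ge_min lexx orbT.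
 have [r1 r10 r1P]:= a1 x t e1 e10; have [r2 r20 r2P]:= a2 x t e1 e10.
 have /cont_enorm2P/(_ _ e10)[r3 r30 r3P]:= cpsi (x, t).
 exists (Num.min (Num.min r1 r2) r3); first by rewrite !lt_min r10 r20.
 move=> y s; rewrite !lt_min => /andP[/andP[y1 y2] y3] /andP[/andP[s1 s2] s3].
 have h1:= r1P y s y1 s1; have h2:= r2P y s y2 s2; have h3:= r3P y s y3 s3.
 rewrite -/p -/r in h1; set dphi:= dot p (y-x)+r*(s-t).
 have h4: `|dphi| <= (enorm p + `|r|)*(enorm (y-x) + `|s-t|).
  apply: le_trans (ler_normD _ _) _; rewrite normrM.
  have:= dot_norm p (y-x); have:= enorm_ge0 p; have:= normr_ge0 r.
  by have:= enorm_ge0 (y-x); have:= normr_ge0 (s-t); nra.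
 set a:= enorm (y-x) + `|s-t| in h1 h2 h4 *; have a0: 0<=a by rewrite addr_ge0.
 have -> : phi (y, s) * psi (y, s)-phi (x, t) * psi (x, t) -
  dot (psi (x, t) *: p+phi (x, t) *: g' (x, t)) (y-x) -
  (psi (x, t)*r+phi (x, t)*q' (x, t))*(s-t) =
  phi (x, t)*(psi (y, s)-psi (x, t)-dot (g' (x, t)) (y-x)-q' (x, t)*(s-t)) +
  psi (y, s)*(phi (y, s)-phi (x, t)-dot p (y-x)-r*(s-t)) +
  (psi (y, s)-psi (x, t))*dphi.
  by rewrite dotDl !dotZl /dphi; ring.
 have psiy: `|psi (y, s)| <= `|psi (x, t)| + 1.
  rewrite -(subrK (psi (x, t)) (psi (y, s))) addrC; apply: le_trans (ler_normD _ _) _.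
  by rewrite lerD2l; apply: le_trans (ltW h3) _.
 apply: le_trans (ler_normD _ _) _; apply: le_trans (lerD (ler_normD _ _) (lexx _)) _; rewrite !normrM.
 have t1:= ler_wpM2l (normr_ge0 (phi (x, t))) h2.
 have t2:= ler_pM (normr_ge0 _) (normr_ge0 _) psiy h1.
 have t3:= ler_pM (normr_ge0 _) (normr_ge0 _) (ltW h3) h4.
 apply: le_trans (lerD (lerD t1 t2) t3) _.
 apply: (@le_trans _ _ (e1*A*a)); last by rewrite ler_wpM2r.
 by rewrite /A; set B:= enorm p + `|r|; lra.
- move=> v z; rewrite (_: (fun z => _) = (fun z => psi z*dot (g z) v+phi z*dot (g' z) v)).
  by apply: cvgD; apply: cvgM; [exact: cpsi|exact: b1|exact: cphi|exact: b2].
 by apply/funext => w; rewrite dotDl !dotZl.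
- by move=> z; apply: cvgD; apply: cvgM; [exact: cpsi|exact: c1|exact: cphi|exact: c2].
Qed.

Lemma has_exp_expR (L La s0: R) :
 has_exp (fun t => L*expR (La*(t-s0))) (fun t => La*(L*expR (La*(t-s0)))).
Proof.
have h (t: R): is_derive t 1 (fun t => L*expR (La*(t-s0))) (La*(L*expR (La*(t-s0)))).
 have h1: is_derive t 1 (fun t => La*(t-s0)) La.
  by apply: is_derive_eq; rewrite /GRing.scale/= subr0 mulr1.
 have h2:= @is_derive1_comp R expR (fun t => La*(t-s0)) t _ _ (is_derive_expR _) h1.
 by apply: is_derive_eq; rewrite /GRing.scale/=; ring.
have df t: derivable (fun t => L*expR (La*(t-s0))) t 1 by have []:= h t.
have:= derivable_exp df; congr has_exp; apply/funext => t.
by rewrite derive1E; have [_ ->]:= h t.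
Qed.

(** The test function is [L*expR (La*(t-s0))] times [jap del (x-y)]: its growth rate [La] absorbs
    the variation of the speed between [x] and [y], while [eta] enters through [kap]. *)
Lemma speed_comparison (c1 c2: V -> R) u1 u2 (s0 s1 La A eta w L: R) :
 s0<s1 -> UCstrip u1 s0 s1 -> UCstrip u2 s0 s1 ->
 visc_sub (fun x t p => c1 x*enorm p) u1 [set t | s0<t<s1] ->
 visc_super (fun x t p => c2 x*enorm p) u2 [set t | s0<t<s1] ->
 0<=La -> 0<=A -> 0<=eta -> 0<=L ->
 (forall x y, `|c1 x-c1 y| <= La*enorm (x-y)) -> (forall x, `|c1 x| <= A) ->
 (forall x, `|c1 x-c2 x| <= eta) ->
 (forall x y, u1 x s0-u2 y s0<=w+L*enorm (x-y)) ->
 let L':= L*expR (La*(s1-s0)) in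
 forall x y t, s0<=t<=s1 -> u1 x t-u2 y t<=w+eta*L'*(s1-s0)+L'*enorm (x-y).
Proof.
move=> s01 uc1 uc2 vs1 vs2 La0 A0 eta0 L0 lip1 b1 c12 init L' x y.
have L'0: 0<=L' by rewrite mulr_ge0// expR_ge0.
pose th t:= L*expR (La*(t-s0)).
have th0 t: 0<=th t by rewrite mulr_ge0// expR_ge0.
have thm s t: s<=t -> th s<=th t.
 by move=> st; rewrite ler_wpM2l// ler_expR ler_wpM2l// lerD2r.
have ths0: th s0 = L by rewrite /th subrr mulr0 expR0 mulr1.
have cth: continuous (fun t => La * th t).
 by move=> t; apply: cvgMr; exact: (has_exp_cont (has_exp_expR L La s0)).
have main t: s0<=t<s1 -> u1 x t-u2 y t<=w+eta*L'*(s1-s0)+L'*enorm (x-y).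
 move=> tI; have [ta tb]:= andP tI; apply/ler_addgt0Pr => e e0.
 pose del:= e/(L'+1); have L'1: 0<L'+1 by rewrite ltr_wpDl.
 have del0: 0<del by rewrite divr_gt0.
 have cPhi:= C1withM (C1with_time d (has_exp_expR L La s0) cth) (C1with_jap d del0).
 have J0 z:= jap_ge0 (d:= d) del z.
 have tht: th t<=L' by apply: thm; rewrite ltW.
 have key: u1 x t-u2 y t<=th t*jap del (x-y)+w+eta*L'*(t-s0).
  apply: (@comparison R d u1 u2 _ _ _ _ _ s0 s1 L' 0 (A+eta) (eta*L') w s01 uc1 uc2 vs1 vs2 cPhi) => //=.
  + by rewrite addr_ge0.
  + by rewrite mulr_ge0.
  + move=> z t' /andP[_ t'1]; rewrite scaler0 add0r enormZ -/(th t') ger0_norm//.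
   apply: (@le_trans _ _ (th t'*1)); first by rewrite ler_wpM2l// ?jap_grad_le.
   by rewrite mulr1; exact: thm.
  + by move=> z t' /andP[t'0 t'1]; rewrite mul0r subr_le0 -/(th s0) -/(th t') ler_wpM2r// thm.
  + move=> x' t' p p' _; rewrite -mulrBr normrM; apply: ler_pM => //; last exact: enorm_dist.
   by apply: le_trans (b1 x') _; rewrite lerDl.
  + move=> x' t' p p' _; rewrite -mulrBr normrM; apply: ler_pM => //; last exact: enorm_dist.
   have -> : c2 x' = c1 x'-(c1 x'-c2 x') by ring.
   by apply: le_trans (ler_normB _ _) _; exact: lerD.
  + by move=> e' e'0; exists 1 => // *; rewrite subrr normr0 ltW.
  + move=> x' y' t' /andP[t'0 t'1]; rewrite scaler0 add0r mulr0 addr0.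
   set z:= x'-y'; rewrite -/(th t').
   have E: enorm (th t' *: ((jap del z)^-1 *: z)) = th t'*enorm ((jap del z)^-1 *: z).
    by rewrite enormZ ger0_norm.
   rewrite E; set G:= enorm ((jap del z)^-1 *: z).
   have G1: G<=1 by exact: jap_grad_le.
   have G0: 0<=G by exact: enorm_ge0.
   have zG: enorm z*G<=jap del z.
    apply: (@le_trans _ _ (enorm z)); first by rewrite ler_piMr.
    exact: jap_ge_enorm.
   have d12: - (La*enorm z+eta)<=c1 x'-c2 y'.
    have:= lip1 x' y'; have:= c12 y'; rewrite !ler_norml => /andP[? ?] /andP[? ?]; rewrite /z; lra.
   have tG: 0<=th t'*G by rewrite mulr_ge0.
   have p1: - (La*enorm z+eta)*(th t'*G)<=(c1 x'-c2 y')*(th t'*G) by rewrite ler_wpM2r.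
   have p2: La * th t'*(enorm z*G)<=La * th t'*jap del z by rewrite ler_wpM2l// mulr_ge0.
   have p3: eta*(th t'*G)<=eta*L'.
    rewrite ler_wpM2l//; apply: (@le_trans _ _ (th t'*1)); first by rewrite ler_wpM2l.
    by rewrite mulr1; apply: thm; exact: ltW.
   by move: p1 p2 p3; set X:= th t'; lra.
  + move=> x' y'; rewrite -/(th s0) ths0; apply: le_trans (init x' y') _; rewrite addrC lerD2r.
   by rewrite ler_wpM2l// jap_ge_enorm.
 apply: le_trans key _.
 have k1: th t*jap del (x-y)<=L'*(del+enorm (x-y)).
  by apply: ler_pM => //; exact: jap_le (ltW del0).
 have k2: L'*del<=e.
  by rewrite /del mulrCA ger_pMr// ler_pdivrMr// mul1r lerDl.
 have k3: eta*L'*(t-s0)<=eta*L'*(s1-s0).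
  by rewrite ler_wpM2l ?mulr_ge0//; lra.
 by rewrite mulrDr in k1; lra.
(* [comparison] stops short of the final time, which is reached by continuity. *)
move=> t /andP[ta]; rewrite le_eqVlt => /orP[/eqP ->|tb]; last by apply: main; rewrite ta.
apply/ler_addgt0Pr => e e0; have e2: 0<e/2 by rewrite divr_gt0.
have [d1 d10 d1P]:= uc1 _ e2; have [d2 d20 d2P]:= uc2 _ e2.
pose dd:= Num.min (Num.min d1 d2) (s1-s0).
have dd0: 0<dd by rewrite !lt_min d10 d20 subr_gt0.
have [k1 k2 k3]: [/\ dd<=d1, dd<=d2 & dd<=s1-s0] by rewrite /dd !ge_min !lexx ?orbT.
pose t':= s1-dd/2; have t'I: s0<=t'<s1 by rewrite /t'; apply/andP; split; lra.
have t'J: s0<=t'<=s1 by case/andP: t'I => ? /ltW ?; apply/andP.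
have sJ: s0<=s1<=s1 by rewrite lexx ltW.
have st: `|s1-t'| < dd by rewrite /t' ger0_norm; lra.
have h1:= d1P x x s1 t' sJ t'J; rewrite subrr enorm0 in h1; have {}h1:= h1 d10 (lt_le_trans st k1).
have h2:= d2P y y s1 t' sJ t'J; rewrite subrr enorm0 in h2; have {}h2:= h2 d20 (lt_le_trans st k2).
have:= main t' t'I; move: h1 h2; rewrite !ltr_norml => /andP[? ?] /andP[? ?]; lra.
Qed.

End SpeedComparison.

(** * Reachable sets of a front with positive periodic speed *)

Section ReachMetric.
Variables (R: realType) (d: nat) (c: 'rV[R]_d -> R) (cmin cmax Lc: R).
Local Notation V:= 'rV[R]_d.
Hypotheses (cmin0: 0<cmin) (cl: forall x, cmin<=c x) (cu: forall x, c x<=cmax).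
Hypotheses (Lc0: 0<=Lc) (clip: forall x y, `|c x-c y| <= Lc*enorm (x-y)).
Hypothesis cper: Zd_periodic c.

Local Notation K:= (Lc*cmax).

Lemma cmax0: 0<cmax.
Proof using cmin0 cl cu. by apply: lt_le_trans cmin0 _; apply: le_trans (cl 0) (cu 0). Qed.

Lemma K0: 0<=K.
Proof using -(clip cper). by rewrite mulr_ge0// ltW// cmax0. Qed.

(* The safety margin [K h] absorbs the variation of the speed along the segment; it makes
   steps both reversible and divisible. *)
Definition rstep (h: R) (x y: V): Prop :=
 [/\ 0<=h, enorm (y-x)<=h*(c x-K*h) & enorm (y-x)<=h*(c y-K*h)].

(** Chains of straight steps take the place of controlled trajectories, so that neither integrals
    nor differential equations are involved. *)
Inductive reach: R -> V -> V -> Prop :=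
| reach_nil x: reach 0 x x
| reach_cons h t x y z: rstep h x y -> reach t y z -> reach (h+t) x z.

Lemma reach_ge0 t x y: reach t x y -> 0<=t.
Proof using. by elim => // h t' x' y' z [h0 _ _] _ t0; rewrite addr_ge0. Qed.

Lemma reach_comp s t x y z: reach s x y -> reach t y z -> reach (s+t) x z.
Proof using.
move=> r; elim: r z => [x'|h s' x' y' z' st _ IH] z rz; first by rewrite add0r.
by rewrite -addrA; apply: reach_cons st _; exact: IH.
Qed.

Lemma reach1 h x y: rstep h x y -> reach h x y.
Proof using. by move=> st; rewrite -[h]addr0; apply: reach_cons st _; exact: reach_nil. Qed.

Lemma rstep_sym h x y: rstep h x y -> rstep h y x.
Proof using. by move=> [h0 a b]; split; rewrite // enormBC. Qed.

Lemma reach_sym t x y: reach t x y -> reach t y x.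
Proof using.
elim=> [x'|h t' x' y' z st _ IH]; first exact: reach_nil.
by rewrite addrC; apply: reach_comp IH _; apply/reach1/rstep_sym.
Qed.

(** At the intermediate point the speed is at least that of either endpoint minus [K] times the time
    separating them; for the far endpoint this is the margin released by shortening the step. *)
Lemma rstep_split s t x z: 0<=s -> 0<=t -> rstep (s+t) x z ->
 exists2 y, rstep s x y & rstep t y z.
Proof using -cper.
move=> s0 t0 [st0 ax az].
move: st0; rewrite le_eqVlt => /orP[/eqP st0|st0].
 have [sE tE]: s = 0 /\ t = 0 by split; lra.
 by exists x; [split; rewrite // sE mul0r subrr enorm0|split; rewrite // tE; move: ax az; rewrite -st0 !mul0r].
pose si:= enorm (z-x)/(s+t); have si0: 0<=si by rewrite divr_ge0// ltW.
have E: enorm (z-x) = (s+t)*si by rewrite /si mulrC mulfVK// gt_eqF.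
have [bx bz]: si<=c x-K*(s+t) /\ si<=c z-K*(s+t).
 by move: ax az; rewrite E !ler_pM2l.
pose l:= s/(s+t); have l0: 0<=l by rewrite divr_ge0// ltW.
pose y:= x+l *: (z-x).
have lE: 1-l = t/(s+t) by rewrite /l; field; rewrite gt_eqF.
have yx: y-x = l *: (z-x) by rewrite /y addrC addKr.
have zy: z-y = (1-l) *: (z-x) by rewrite scalerBl scale1r -yx opprB addrA subrK.
have nyx: enorm (y-x) = s*si.
 by rewrite yx enormZ ger0_norm// E /l; field; rewrite gt_eqF.
have nzy: enorm (z-y) = t*si.
 by rewrite zy lE enormZ ger0_norm ?divr_ge0// ?ltW// E; field; rewrite gt_eqF.
have sic: si<=cmax by have:= cu x; have: 0<=K*(s+t) by [rewrite mulr_ge0 ?K0// ltW]; lra.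
have Ls (r: R): 0<=r -> Lc*(r*si)<=K*r.
 by move=> r0; rewrite -mulrA [cmax*r]mulrC ler_wpM2l// ler_wpM2l.
have cyx: c x-K*s<=c y.
 by have:= clip y x; rewrite nyx ler_norml => /andP[h _]; have:= Ls s s0; lra.
have cyz: c z-K * t<=c y.
 by have:= clip z y; rewrite nzy ler_norml => /andP[_ h]; have:= Ls t t0; lra.
have Ks: 0<=K*s by rewrite mulr_ge0// K0.
have Kt: 0<=K * t by rewrite mulr_ge0// K0.
rewrite mulrDr in bx bz.
by exists y; split; rewrite // ?nyx ?nzy ler_wpM2l//; lra.
Qed.

Lemma reach_split_gen r x z: reach r x z -> forall s t, 0<=s -> 0<=t -> r = s+t ->
 exists2 y, reach s x y & reach t y z.
Proof using -cper.
elim=> [x' s t s0 t0 E|h r' x' y' z' st rr IH s t s0 t0 E].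
 have [-> ->]: s = 0 /\ t = 0 by split; lra.
 by exists x'; exact: reach_nil.
have [sh|hs]:= leP s h.
 have hs0: 0<=h-s by lra.
 have st': rstep (s+(h-s)) x' y' by rewrite addrC subrK.
 have [y a b]:= rstep_split s0 hs0 st'.
 exists y; first exact: reach1.
 have -> : t = (h-s)+r' by lra.
 exact: reach_cons b rr.
have sh0: 0<=s-h by lra.
have E': r' = s-h+t by lra.
have [y a b]:= IH (s-h) t sh0 t0 E'.
exists y => //; have -> : s = h+(s-h) by ring.
exact: reach_cons st a.
Qed.

Lemma reach_split s t x z: 0<=s -> 0<=t -> reach (s+t) x z ->
 exists2 y, reach s x y & reach t y z.
Proof using -cper. by move=> s0 t0 r; exact: (reach_split_gen r). Qed.

Lemma reach_bound t x y: reach t x y -> enorm (y-x)<=cmax * t.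
Proof using -(clip cper).
elim=> [x'|h t' x' y' z [h0 a _] _ IH]; first by rewrite subrr enorm0 mulr0.
apply: le_trans (enorm_trian y' _ _) _; rewrite mulrDr addrC; apply: lerD => //.
apply: le_trans a _; rewrite mulrC ler_wpM2r//.
by have:= cu x'; have: 0<=K*h by [rewrite mulr_ge0 ?K0]; lra.
Qed.

(** The bound by [cmax] would lose the local speed, which the generator bound [rf_up] has to see to
    first order in time. *)
Lemma reach_bound_loc t x y: reach t x y -> enorm (y-x)<=t*(c x+K * t).
Proof using -cper.
elim=> [x'|h t' x' y' z [h0 a _] r IH]; first by rewrite subrr enorm0 mul0r.
have t0:= reach_ge0 r.
apply: le_trans (enorm_trian y' _ _) _.
have Kh: 0<=K*h by rewrite mulr_ge0 ?K0.
have nh: enorm (y'-x')<=h*c x'.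
 by apply: le_trans a _; rewrite ler_wpM2l//; lra.
have cy: c y'<=c x'+K*h.
 have: enorm (y'-x')<=h*cmax by apply: le_trans nh _; rewrite ler_wpM2l.
 move=> n2; have:= clip y' x'; rewrite ler_norml => /andP[_ h2].
 have: Lc*enorm (y'-x')<=K*h by rewrite -mulrA [cmax*h]mulrC ler_wpM2l.
 by lra.
have t1: t'*c y'<=t'*(c x'+K*h) by rewrite ler_wpM2l.
have e1: 0<=K*h*h by rewrite mulr_ge0.
have e2: 0<=K*h * t' by rewrite mulr_ge0.
by rewrite !mulrDr !mulrDl in IH t1 *; lra.
Qed.

Lemma reach_line n (h: R) x (v: V): 0<=h -> K*h<=cmin/2 -> enorm v<=h*(cmin/2) ->
 reach (n%:R*h) x (x+n%:R *: v).
Proof using -(clip cper).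
move=> h0 Kh vh; elim: n x => [|n IH] x; first by rewrite mul0r scale0r addr0; exact: reach_nil.
rewrite -natr1 mulrDl mul1r addrC scalerDl scale1r [_+v]addrC addrA.
apply: (@reach_cons _ _ _ (x+v)); last exact: IH.
have E: x+v-x = v by rewrite addrC addKr.
by split; rewrite // E; apply: le_trans vh _; rewrite ler_wpM2l//;
 [have:= cl x; lra|have:= cl (x+v); lra].
Qed.

(** With steps so short that the margin is below [cmin/2], the speed [cmin/2] is admissible
    everywhere. *)
Lemma reach_travel t x y: 0<=t -> enorm (y-x)<=t*(cmin/2) -> reach t x y.
Proof using -(clip cper).
move=> t0 yx; pose n:= (Num.truncn (2*K * t/cmin)).+1.
have n0: 0<n%:R :> R by rewrite ltr0n.
have -> : t = n%:R*(t/n%:R) by rewrite mulrC mulfVK// gt_eqF.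
have -> : y = x+n%:R *: (n%:R^-1 *: (y-x)) by rewrite scalerA mulfV ?gt_eqF// scale1r addrC subrK.
apply: reach_line; first by rewrite divr_ge0// ltW.
 rewrite mulrA ler_pdivrMr//.
 have: 2*K * t/cmin<n%:R by apply: truncnS_gt.
 by rewrite ltr_pdivrMr//; lra.
rewrite enormZ ger0_norm ?invr_ge0 ?(ltW n0)//.
by rewrite mulrC -[leRHS]mulrA [_^-1*_]mulrC mulrA ler_pM2r ?invr_gt0.
Qed.

Lemma reach_stay t x: 0<=t -> reach t x x.
Proof using -(clip cper).
by move=> t0; apply: reach_travel => //; rewrite subrr enorm0 mulr_ge0// divr_ge0// ltW.
Qed.

Lemma reach_mono s t x y: s<=t -> reach s x y -> reach t x y.
Proof using -(clip cper).
move=> st r; have -> : t = s+(t-s) by ring.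
by apply: reach_comp r (reach_stay _ _); lra.
Qed.

Lemma reach_rf: reach_family reach (fun x p => c x*enorm p) cmax (cmax*(2/cmin)).
Proof using -cper.
have cm:= cmax0; have cm0:= ltW cm; split.
- exact: ltW.
- by rewrite mulr_ge0 ?divr_ge0// ltW.
- by move=> t x y t0 /reach_bound.
- by move=> s t x y z _ _; exact: reach_comp.
- by move=> s t x z; exact: reach_split.
- by move=> t x t0; exists x; exact: reach_stay.
(* Go from [x'] to [x] in time [de], follow the given path and stop [de] before the end; the piece
   left out has length at most [cmax*de]. *)
- move=> t x x' y t0 r; pose de:= 2/cmin*enorm (x-x').
 have de0: 0<=de by rewrite mulr_ge0// divr_ge0// ltW.
 have r1: reach de x' x.
  apply: reach_travel => //; rewrite /de; apply: eq_le_imp.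
  by field; rewrite gt_eqF.
 have r2: reach (t+de) x' y by rewrite addrC; exact: reach_comp r1 r.
 have [y' a b]:= reach_split t0 de0 r2; exists y' => //.
 by apply: le_trans (reach_bound b) _; rewrite /de !mulrA.
- move=> x p e e0; pose k:= K*enorm p+1.
 have k0: 0<k by rewrite ltr_wpDl// mulr_ge0// K0.
 exists (e/k); first by rewrite divr_gt0.
 move=> h y h0; rewrite ltr_pdivlMr// /k => hk /reach_bound_loc b.
 rewrite -dotNl; apply: le_trans (dot_le _ _) _; rewrite enormN.
 apply: le_trans (ler_wpM2l (enorm_ge0 p) b) _.
 rewrite mulrCA ler_wpM2l//; have:= enorm_ge0 p; have:= K0.
 by move: hk; set P:= enorm p; rewrite !mulrDr; lra.
- move=> x p e e0; pose k:= 2*K*(enorm p+1)+1.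
 have k0: 0<k by rewrite ltr_wpDl// !mulr_ge0// ?K0// addr_ge0.
 exists (Num.min (e/k) (c x/(2*K+1))).
  by rewrite lt_min !divr_gt0//; [exact: lt_le_trans (cl x)|rewrite ltr_wpDl// mulr_ge0// K0].
 move=> h h0; rewrite lt_min !ltr_pdivlMr//; last by rewrite ltr_wpDl// mulr_ge0// K0.
 move=> /andP[hk hc]; have Kp:= K0.
 (* One [K*h] is the margin of the step, the other the variation of the speed along it. *)
 pose si:= c x-2*K*h.
 have si0: 0<=si by rewrite /si; lra.
 have sic: si<=cmax by rewrite /si; have:= cu x; have: 0<=2*K*h by [rewrite !mulr_ge0]; lra.
 pose y:= x-(h*si/enorm p) *: p.
 have yx: y-x = - ((h*si/enorm p) *: p) by rewrite /y addrC addKr.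
 have q0: 0<=h*si/enorm p by rewrite !mulr_ge0// invr_ge0.
 have nyx: enorm (y-x)<=h*si.
  rewrite yx enormN enormZ ger0_norm//.
  have [->|p0]:= eqVneq (enorm p) 0; first by rewrite mulr0 mulr_ge0.
  by rewrite mulfVK.
 exists y.
  apply: reach1; split=> //; apply: (le_trans nyx); rewrite ler_wpM2l// /si.
   by have: 0<=K*h by [rewrite mulr_ge0]; lra.
  have:= clip y x; rewrite ler_norml => /andP[h1 _].
  have: Lc*enorm (y-x)<=K*h.
   rewrite -mulrA [cmax*h]mulrC ler_wpM2l//; apply: le_trans nyx _; exact: ler_wpM2l.
  by lra.
 rewrite yx dotNr opprK dotZr -enorm_sqr expr2.
 have [p0|p0]:= eqVneq (enorm p) 0.
  by rewrite p0 !mulr0 sub0r mulrN oppr_le0 mulr_ge0// ltW.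
 rewrite mulrA mulfVK// -mulrA ler_wpM2l// /si; set P:= enorm p.
 have:= enorm_ge0 p; rewrite -/P; move: hk; rewrite /k -/P => hk P0.
 have: 0<=2*K*h by rewrite !mulr_ge0.
 by nra.
Qed.

Definition period (k: V): Prop:= forall x, c (x+k) = c x.

Lemma period0: period 0. Proof using. by move=> x; rewrite addr0. Qed.

Lemma periodD k l: period k -> period l -> period (k+l).
Proof using. by move=> pk pl x; rewrite addrA pl pk. Qed.

Lemma periodN k: period k -> period (- k).
Proof using. by move=> pk x; rewrite -{2}(subrK k x) pk. Qed.

Lemma period_int (n: int) j: period (n%:~R *: delta_mx 0 j).
Proof using cper.
have nat n': period (n'%:R *: delta_mx 0 j).
 elim: n' => [|n' IH]; first by rewrite scale0r; exact: period0.
 by rewrite -natr1 scalerDl scale1r; apply: periodD IH _ => x; exact: cper.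
case: n => n; first by exact: nat.
by rewrite NegzE intrN scaleNr; apply: periodN; exact: nat.
Qed.

Lemma period_near x: exists2 k, period k & enorm (x-k)<=d%:R.
Proof using cper.
exists (\sum_j (Num.floor (x ord0 j))%:~R *: delta_mx 0 j).
 by elim/big_ind: _ => [|k l|j _]; [exact: period0|exact: periodD|exact: period_int].
apply: le_trans (enorm_le_sum _) _; rewrite -[leRHS]mul1r mulr_natr -[d in leRHS]card_ord -sumr_const.
apply: ler_sum => i _; rewrite !mxE.
have -> : (\sum_j ((Num.floor (x ord0 j))%:~R *: delta_mx 0 j: V)) ord0 i = (Num.floor (x ord0 i))%:~R.
 rewrite summxE (bigD1 i)//= !mxE !eqxx mulr1 big1 ?addr0// => j ji.
 by rewrite !mxE eqxx/= eq_sym (negbTE ji) mulr0.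
have:= floor_le (x ord0 i); have:= lt_succ_floor (x ord0 i); rewrite intrD => h1 h2.
by rewrite ger0_norm ?subr_ge0//; lra.
Qed.

Lemma reach_period t x y k: period k -> reach t x y -> reach t (x+k) (y+k).
Proof using.
move=> pk; elim=> [x'|h t' x' y' z [h0 a b] _ IH]; first exact: reach_nil.
apply: reach_cons IH; split=> //; rewrite !pk.
 by have -> : y'+k-(x'+k) = y'-x' by rewrite opprD addrACA subrr addr0.
by have -> : y'+k-(x'+k) = y'-x' by rewrite opprD addrACA subrr addr0.
Qed.

End ReachMetric.

(** * Homogenisation of a single front *)

Lemma reach_family_scale (R: realType) (d: nat) (Q: R -> 'rV[R]_d -> 'rV[R]_d -> Prop)
  (H: 'rV[R]_d -> 'rV[R]_d -> R) (C C' eps: R): 0<eps -> reach_family Q H C C' ->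
 reach_family (fun t x y => Q (t/eps) (eps^-1 *: x) (eps^-1 *: y)) (fun x p => H (eps^-1 *: x) p) C C'.
Proof.
move=> e0 rf; have ie: 0<eps^-1 by rewrite invr_gt0.
have en: eps != 0 by rewrite gt_eqF.
have nE (x y: 'rV[R]_d): enorm (y-x) = eps*enorm (eps^-1 *: y-eps^-1 *: x).
 by rewrite -scalerBr enormZ (gtr0_norm ie) mulrA mulfV// mul1r.
have t0 (t: R): 0<=t -> 0<=t/eps by move=> h; rewrite divr_ge0// ltW.
have K (y: 'rV[R]_d): eps^-1 *: (eps *: y) = y by rewrite scalerA mulVf// scale1r.
split.
- exact: rf_C rf.
- exact: rf_C' rf.
- move=> t x y tt q; rewrite nE; apply: le_trans (ler_wpM2l (ltW e0) (rf_bound rf (t0 _ tt) q)) _.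
 by rewrite mulrCA [eps*_]mulrC mulfVK.
- by move=> s t x y z ss tt q1 q2; rewrite mulrDl; exact: (rf_comp rf (t0 _ ss) (t0 _ tt) q1 q2).
- move=> s t x z ss tt; rewrite mulrDl => /(rf_split rf (t0 _ ss) (t0 _ tt))[y q1 q2].
 by exists (eps *: y); rewrite K.
- by move=> t x tt; have [y q]:= rf_ne rf (eps^-1 *: x) (t0 _ tt); exists (eps *: y); rewrite K.
- move=> t x x' y tt q; have [y' q' h]:= rf_lip rf (eps^-1 *: x') (t0 _ tt) q.
 exists (eps *: y'); rewrite ?K// (nE _ y) K (nE _ x); apply: le_trans (ler_wpM2l (ltW e0) h) _.
 by rewrite mulrCA.
- move=> x p e ee; have [h0 h00 h0P]:= rf_up rf (eps^-1 *: x) p ee.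
 exists (h0*eps); first by rewrite mulr_gt0.
 move=> h y hh hl q; have:= h0P (h/eps) _ (t0 _ hh) _ q; rewrite ltr_pdivrMr// => /(_ hl).
 rewrite -scalerBr dotZr => h1; have:= ler_wpM2l (ltW e0) h1.
 by rewrite mulrN !mulrA mulfV// mul1r [eps*h]mulrC mulfK.
- move=> x p e ee; have [h0 h00 h0P]:= rf_low rf (eps^-1 *: x) p ee.
 exists (h0*eps); first by rewrite mulr_gt0.
 move=> h hh hl; have [|y q hy]:= h0P (h/eps) (t0 _ hh); first by rewrite ltr_pdivrMr.
 exists (eps *: y); rewrite ?K//; have:= ler_wpM2l (ltW e0) hy.
 rewrite mulrN !mulrA [eps*h]mulrC mulfK// => /le_trans; apply.
 by rewrite !dotBr !dotZr mulrBr mulrA mulfV// mul1r.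
Qed.

Lemma nat_le_limit (R: realType) (a b K: R) :
 (forall n: nat, (0<n)%N -> n%:R*a<=n%:R*b+K) -> a<=b.
Proof.
move=> h; rewrite leNgt; apply/negP => ab; have ab0: 0<a-b by rewrite subr_gt0.
pose n:= (Num.truncn (`|K| / (a-b))).+1.
have: `|K| / (a-b)<n%:R by apply: truncnS_gt.
rewrite ltr_pdivrMr// mulrBr; have:= h n isT; have:= ler_norm K; lra.
Qed.

Lemma enorm_sqrD (R: realType) (d: nat) (e f: 'rV[R]_d) :
 enorm (e+f)^+2 = enorm e^+2+2*dot e f+enorm f^+2.
Proof. by rewrite !enorm_sqr dotDl !dotDr (dotC f e); ring. Qed.

(** Induction step of the greedy strategy: the cross term, at most [E*C], costs [C] per stage, while
    the squares [F^+2<=b^+2] accumulate only like the square root of the number of stages. *)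
Lemma greedy_alg (R: realType) (k: nat) (E F D C b: R): 0<=C -> 0<=b -> 0<=E -> 0<=F ->
 E<=k%:R*C+Num.sqrt k%:R*b -> F<=b -> D<=E*C ->
 E^+2+2*D+F^+2<=(k.+1%:R*C+Num.sqrt k.+1%:R*b)^+2.
Proof.
move=> C0 b0 E0 F0; set s:= Num.sqrt k%:R; set s':= Num.sqrt k.+1%:R => hE hF hD.
have s0: 0<=s by exact: sqrtr_ge0.
have sE: s^+2 = k%:R by rewrite sqr_sqrtr.
have s'E: s'^+2 = k%:R+1 by rewrite sqr_sqrtr// natr1.
have ss: s<=s' by rewrite ler_sqrt// ler_nat.
have f3: F^+2<=b^+2 by rewrite ler_pXn2r ?nnegrE.
move: s s' s0 sE s'E ss hE => s s' s0 sE s'E ss hE.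
have k1: 0<=k.+1%:R*C by rewrite mulr_ge0.
have B: (E+C)^+2<=(k.+1%:R*C+s*b)^+2.
 rewrite ler_pXn2r ?nnegrE ?addr_ge0 ?(mulr_ge0 s0 b0)//.
 by rewrite -natr1; move: hE; lra.
have G: k.+1%:R*C*(s*b)<=k.+1%:R*C*(s'*b) by rewrite ler_wpM2l// ler_wpM2r.
have H: s'^+2*b^+2 = s^+2*b^+2+b^+2 by rewrite sE s'E mulrDl mul1r.
have C2:= sqr_ge0 C.
move: B G H f3 hD C2; set q:= k.+1%:R*C; clear; rewrite !expr2; lra.
Qed.

Section Effective.
Variables (R: realType) (d: nat) (c: 'rV[R]_d -> R) (cmin cmax Lc: R).
Local Notation V:= 'rV[R]_d.
Hypotheses (cmin0: 0<cmin) (cl: forall x, cmin<=c x) (cu: forall x, c x<=cmax).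
Hypotheses (Lc0: 0<=Lc) (clip: forall x y, `|c x-c y| <= Lc*enorm (x-y)).
Hypothesis cper: Zd_periodic c.
Local Notation RR:= (reach c cmax Lc).
(** [r0] bounds the distance to the nearest period, [D0] is a time sufficient to travel it, and [CC]
    adds to [r0] the distance that can be covered during [D0]. *)
Local Notation r0:= (d%:R: R).
Local Notation D0:= (r0*(2/cmin)).
Local Notation CC:= (r0+cmax*D0).

Lemma cm0: 0<=cmax. Proof using cmin0 cl cu. by rewrite ltW// (cmax0 cmin0 cl cu). Qed.
Lemma D00: 0<=D0. Proof using cmin0. by rewrite mulr_ge0// divr_ge0// ltW. Qed.
#[local] Hint Resolve cm0 D00: core.
Lemma CC0: 0<=CC. Proof using cmin0 cl cu. by rewrite addr_ge0// mulr_ge0. Qed.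
#[local] Hint Resolve CC0: core.

Lemma reach_near x k: enorm (x-k)<=r0 -> RR D0 x k.
Proof using -(clip cper).
move=> xk; apply: (reach_travel cmin0 cl cu Lc0) => //; rewrite -(enormBC x); apply: le_trans xk _.
by apply: eq_le_imp; field; rewrite gt_eqF.
Qed.

(** Support function of the set reachable from 0. *)
Definition hs (t: R) (p: V): R:= sup [set dot p y | y in [set y | RR t 0 y]].

Lemma reach0_bound t y p: RR t 0 y -> dot p y<=cmax * t*enorm p.
Proof using -(clip cper).
move=> r; apply: le_trans (dot_le _ _) _; rewrite mulrC ler_wpM2r//.
by have:= reach_bound cmin0 cl cu Lc0 r; rewrite subr0.
Qed.

Lemma hs_has t p: 0<=t -> has_sup [set dot p y | y in [set y | RR t 0 y]].
Proof using -(clip cper).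
move=> t0; split; first by exists (dot p 0), 0 => //=; exact: (reach_stay cmin0 cl cu Lc0).
by exists (cmax * t*enorm p) => _ [y /= r <-]; exact: reach0_bound.
Qed.

Lemma hs_ub t p y: 0<=t -> RR t 0 y -> dot p y<=hs t p.
Proof using -(clip cper). by move=> t0 r; apply: ub_le_sup; [exact: (hs_has p t0).2|exists y]. Qed.

Lemma hs_le t p m: 0<=t -> (forall y, RR t 0 y -> dot p y<=m) -> hs t p<=m.
Proof using -(clip cper).
by move=> t0 h; apply: ge_sup; [exact: (hs_has p t0).1|move=> _ [y /= r <-]; exact: h].
Qed.

Lemma hs_near t p: 0<=t -> exists2 y, RR t 0 y & hs t p-enorm p<=dot p y.
Proof using -(clip cper).
move=> t0; have [p0|p0]:= eqVneq (enorm p) 0.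
 exists 0; first exact: (reach_stay cmin0 cl cu Lc0).
 by rewrite p0 subr0 dot0r; apply: hs_le => // y _; rewrite (enorm_eq0 p0) dot0l.
have pp: 0<enorm p by rewrite lt_def p0 enorm_ge0.
by have [_ [y /= r <-] /ltW h]:= sup_adherent pp (hs_has p t0); exists y.
Qed.

Lemma hs_ge0 t p: 0<=t -> 0<=hs t p.
Proof using -(clip cper). by move=> t0; rewrite -(dot0r p); apply: hs_ub => //; exact: (reach_stay cmin0 cl cu Lc0). Qed.

(** Cut the path at time [t] and translate the second part by the period nearest to the cut, so that
    a detour of time [D0] makes it start at 0; trimming the last [D0] costs [cmax*D0]. *)
Lemma hs_sub s t p: 0<=s -> 0<=t -> hs (t+s) p<=hs t p+hs s p+CC*enorm p.
Proof using All.
move=> s0 t0; apply: hs_le => [|y ry]; first by rewrite addr_ge0.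
have [x rx rxy]:= reach_split cmin0 cl cu Lc0 clip t0 s0 ry.
have [k pk xk]:= period_near cper x.
have r1: RR D0 0 (x-k) by apply: (reach_sym (reach_near _)); rewrite subr0.
have r2: RR (s+D0) 0 (y-k).
 by rewrite addrC; apply: reach_comp r1 _; exact: (reach_period (periodN pk) rxy).
have [z rz rz']:= reach_split cmin0 cl cu Lc0 clip s0 D00 r2.
have b:= reach_bound cmin0 cl cu Lc0 rz'.
have -> : dot p y = dot p x+dot p z+(dot p (k-x)+dot p (y-k-z)) by rewrite !dotBr; ring.
apply: lerD; first by apply: lerD; exact: hs_ub.
rewrite mulrDl; apply: lerD.
 by apply: le_trans (dot_le _ _) _; rewrite mulrC ler_wpM2r// enormBC.
by apply: le_trans (dot_le _ _) _; rewrite mulrC ler_wpM2r.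
Qed.

(** Conversely, concatenate the two paths after translating the second by a period, with a detour of
    time [D0] in between. *)
Lemma hs_super s t p: 0<=s -> 0<=t -> hs t p+hs s p<=hs (t+s) p+CC*enorm p.
Proof using All.
move=> s0 t0; have ts0: 0<=t+s by rewrite addr_ge0.
rewrite -lerBrDr; apply: hs_le => // x rx; rewrite lerBrDr addrC -lerBrDr; apply: hs_le => // y ry.
have [k pk xk]:= period_near cper x.
have r1:= reach_near xk; have:= reach_period pk ry; rewrite add0r => r2.
have r3: RR (t+s+D0) 0 (y+k).
 by rewrite -addrA [s+D0]addrC; apply: reach_comp rx _; exact: reach_comp r1 r2.
have [z rz rz']:= reach_split cmin0 cl cu Lc0 clip ts0 D00 r3.
have b:= reach_bound cmin0 cl cu Lc0 rz'; have h:= hs_ub p ts0 rz.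
have h1: dot p (x-k)<=r0*enorm p.
 by apply: le_trans (dot_le _ _) _; rewrite mulrC ler_wpM2r.
have h2: dot p (y+k-z)<=cmax*D0*enorm p.
 by apply: le_trans (dot_le _ _) _; rewrite mulrC ler_wpM2r.
by rewrite !dotBr dotDr in h1 h2; rewrite mulrDl; lra.
Qed.

(** Fekete's limit of [hs n%:R p/n%:R]; the added [CC*enorm p] makes the sequence truly subadditive,
    so that the infimum is the limit. *)
Definition Hb (p: V): R:= inf [set (hs n.+1%:R p+CC*enorm p)/n.+1%:R | n in [set: nat]].

Lemma hs_mul (n m: nat) p: (0<n)%N -> (0<m)%N ->
 hs (n * m)%:R p+CC*enorm p<=n%:R*(hs m%:R p+CC*enorm p) /\
 n%:R*(hs m%:R p-CC*enorm p)<=hs (n * m)%:R p-CC*enorm p.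
Proof using All.
move=> n0 m0; case: n n0 => // n _; elim: n => [|n [IH1 IH2]]; first by rewrite mul1n !mul1r.
rewrite mulSnr natrD; have h1:= hs_sub p (ler0n R m) (ler0n R (n.+1 * m)).
have h2:= hs_super p (ler0n R m) (ler0n R (n.+1 * m)).
by rewrite -[n.+2%:R]natr1 [(_+1)*(hs _ _+_)]mulrDl [(_+1)*(hs _ _-_)]mulrDl !mul1r; split; lra.
Qed.

(** Subadditivity alone gives convergence without a rate; superadditivity up to a constant makes the
    error bounded uniformly in [n]. *)
Lemma Hb_bounds (n: nat) p: (0<n)%N -> n%:R*Hb p<=hs n%:R p+CC*enorm p /\
 hs n%:R p-CC*enorm p<=n%:R*Hb p.
Proof using All.
case: n => // n _; have n0: 0<n.+1%:R :> R by rewrite ltr0n.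
split.
 rewrite mulrC -ler_pdivlMr//; apply: ge_inf; last by exists n.
 exists 0 => _ [m _ <-]; rewrite divr_ge0// addr_ge0 ?hs_ge0// mulr_ge0//.
rewrite [leRHS]mulrC -ler_pdivrMr//; apply: lb_le_inf; first by exists ((hs 1 p+CC*enorm p)/1), 0%N.
move=> _ [m _ <-]; have m0: 0<m.+1%:R :> R by rewrite ltr0n.
rewrite ler_pdivrMr// mulrAC ler_pdivlMr//.
have [h1 _]:= @hs_mul n.+1 m.+1 p isT isT; have [_ h2]:= @hs_mul m.+1 n.+1 p isT isT.
move: h1 h2; rewrite [(m.+1*n.+1)%N]mulnC.
set X:= hs _ p; set Y:= hs n.+1%:R p; set Z:= hs m.+1%:R p => h1 h2.
have: 0<=CC*enorm p by rewrite mulr_ge0.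
lra.
Qed.

Lemma Hb_sublinear: sublinear Hb cmax.
Proof using All.
have Hle p q (a b: R) e: 0<=a -> 0<=b -> (forall n: nat, (0<n)%N -> hs n%:R e<=a*hs n%:R p+b*hs n%:R q) ->
  Hb e<=a*Hb p+b*Hb q.
 move=> a0 b0 h; apply: (@nat_le_limit _ _ _ (CC*enorm e+a*(CC*enorm p)+b*(CC*enorm q))) => n n0.
 have [h1 _]:= Hb_bounds e n0; have [_ h2]:= Hb_bounds p n0; have [_ h3]:= Hb_bounds q n0.
 have:= h n n0; have:= ler_wpM2l a0 h2; have:= ler_wpM2l b0 h3; lra.
have Hge0 p: 0<=Hb p.
 apply: (@nat_le_limit _ _ _ (CC*enorm p)) => n n0; have [_ h2]:= Hb_bounds p n0.
 by have:= hs_ge0 p (ler0n R n); lra.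
split=> //.
- move=> p q; have:= @Hle p q 1 1 (p+q) ler01 ler01; rewrite !mul1r; apply=> n _; rewrite !mul1r.
 by apply: hs_le => // y ry; rewrite dotDl; apply: lerD; exact: hs_ub.
- have half (a: R) p: 0<=a -> Hb (a *: p)<=a*Hb p.
  move=> a0; have:= @Hle p 0 a 0 (a *: p) a0 (lexx _); rewrite mul0r addr0; apply=> n _.
  by rewrite mul0r addr0; apply: hs_le => // y ry; rewrite dotZl ler_wpM2l//; exact: hs_ub.
 move=> a p a0; apply/eqP; rewrite eq_le half//=.
 have [->|an0]:= eqVneq a 0; first by rewrite mul0r.
 have {an0}a0: 0<a by rewrite lt_def an0.
 have ia: 0<=a^-1 by rewrite invr_ge0 ltW.
 have:= half a^-1 (a *: p) ia; rewrite scalerA mulVf ?gt_eqF// scale1r.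
 by rewrite mulrC ler_pdivlMr// mulrC.
- move=> p; apply: (@nat_le_limit _ _ _ (CC*enorm p)) => n n0; have [h1 _]:= Hb_bounds p n0.
 have: hs n%:R p<=cmax*n%:R*enorm p by apply: hs_le => // y; exact: reach0_bound.
 lra.
Qed.

(** A path from 0 to [y], run backwards and translated by a period near [y], leads from near 0 to
    near [- y]; this rests on the symmetry of steps. *)
Lemma Hb_even p: Hb (- p) = Hb p.
Proof using All.
suff h q: Hb (- q)<=Hb q by apply/eqP; rewrite eq_le h/= -{1}(opprK p) h.
apply: (@nat_le_limit _ _ _ (CC*enorm q+CC*enorm q+CC*enorm q)) => n n0.
have [h1 _]:= Hb_bounds (- q) n0; have [_ h2]:= Hb_bounds q n0; rewrite enormN in h1.
suff: hs n%:R (- q)<=hs n%:R q+CC*enorm q by lra.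
apply: hs_le => // y ry; have [k pk yk]:= period_near cper y.
have n0': 0<=n%:R :> R by [].
have r1:= reach_period (periodN pk) (reach_sym ry); rewrite add0r in r1.
have r2: RR D0 0 (y-k) by apply: (reach_sym (reach_near _)); rewrite subr0.
have r3: RR (n%:R+D0) 0 (- k) by rewrite addrC; exact: reach_comp r2 r1.
have [z rz rz']:= reach_split cmin0 cl cu Lc0 clip n0' D00 r3.
have b:= reach_bound cmin0 cl cu Lc0 rz'; have h:= hs_ub q n0' rz.
have a1: dot (- q) (y-k)<=r0*enorm q.
 by apply: le_trans (dot_le _ _) _; rewrite mulrC enormN ler_wpM2r.
have a2: dot q (- k-z)<=cmax*D0*enorm q.
 by apply: le_trans (dot_le _ _) _; rewrite mulrC ler_wpM2r.
by rewrite !dotBr !dotNl !dotNr in a1 a2 *; rewrite mulrDl; lra.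
Qed.

Lemma Hb_lower p: cmin/2*enorm p<=Hb p.
Proof using All.
apply: (@nat_le_limit _ _ _ (CC*enorm p)) => n n0; have [_ h2]:= Hb_bounds p n0.
have [p0|p0]:= eqVneq (enorm p) 0.
 by rewrite p0 !mulr0 addr0 mulr_ge0// (sl_ge0 Hb_sublinear).
pose y:= (n%:R*(cmin/2)/enorm p) *: p.
have c2: 0<=cmin/2 by rewrite divr_ge0// ltW.
have ny: enorm y = n%:R*(cmin/2).
 by rewrite /y enormZ ger0_norm ?mulfVK// mulr_ge0 ?invr_ge0// mulr_ge0.
have ry: RR n%:R 0 y by apply: (reach_travel cmin0 cl cu Lc0) => //; rewrite subr0 ny.
have:= hs_ub p (ler0n R n) ry; rewrite dotZr -enorm_sqr expr2 mulrA mulfVK//; lra.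
Qed.

Lemma reach_effective t x y p: RR t x y ->
 dot p (y-x)<=t*Hb p+(r0+D0*cmax+cmax+CC)*enorm p.
Proof using All.
move=> rxy; have t0:= reach_ge0 rxy; have [k pk xk]:= period_near cper x.
have r1: RR D0 0 (x-k) by apply: (reach_sym (reach_near _)); rewrite subr0.
have r2: RR (D0+t) 0 (y-k) by apply: reach_comp r1 _; exact: (reach_period (periodN pk) rxy).
have Dt: 0<=D0+t by rewrite addr_ge0.
pose n:= (Num.truncn (D0+t)).+1.
have tn: D0+t<=n%:R by apply: ltW; exact: truncnS_gt.
have nt: n%:R<=D0+t+1.
 by rewrite /n -natr1 lerD2r; have /andP[]:= truncn_itv Dt.
have r3:= reach_mono cmin0 cl cu Lc0 tn r2.
have h:= hs_ub p (ler0n R n) r3; have [_ h2]:= @Hb_bounds n p isT.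
have Hp:= sl_ge0 Hb_sublinear p; have Hc:= sl_le Hb_sublinear p.
have h3: n%:R*Hb p<=(D0+t+1)*Hb p by rewrite ler_wpM2r.
have h4: dot p (k-x)<=r0*enorm p.
 by apply: le_trans (dot_le _ _) _; rewrite mulrC ler_wpM2r// enormBC.
have h5: D0*Hb p<=D0*(cmax*enorm p) by rewrite ler_wpM2l.
by rewrite !dotBr in h4 h *; rewrite !mulrDl in h3 *; lra.
Qed.

(** The Wulff shape of [Hb]: the convex set of effective velocities. *)
Definition WW (w: V): Prop:= forall p, dot p w<=Hb p.

Lemma WW_bound w: WW w -> enorm w<=cmax.
Proof using All.
move=> Ww; have [->//|w0]:= eqVneq (enorm w) 0.
have w1: 0<enorm w by rewrite lt_def w0 enorm_ge0.
have:= le_trans (Ww w) (sl_le Hb_sublinear w); rewrite -enorm_sqr expr2 ler_pM2r//.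
Qed.

(** A cluster point of [y n/n.+1], where [y n] is reachable in time [n.+1] and nearly optimal in
    direction [p]; compactness replaces a separation theorem. *)
Lemma WW_support p: exists2 w, WW w & Hb p<=dot p w.
Proof using All.
have ex n: exists y, RR n.+1%:R 0 y /\ hs n.+1%:R p-enorm p<=dot p y.
 by have [y a b]:= hs_near p (ler0n R n.+1); exists y.
have [y yP]:= choice ex.
pose w n:= n.+1%:R^-1 *: y n.
have n0 n: 0<n.+1%:R :> R by rewrite ltr0n.
have wb n: enorm (w n)<=cmax.
 rewrite /w enormZ ger0_norm ?invr_ge0// mulrC ler_pdivrMr//.
 by have:= reach_bound cmin0 cl cu Lc0 (yP n).1; rewrite subr0.
have cB:= @closed_ball_compact R d cmax.
have Fw: (w @ \oo) [set x: V | enorm x<=cmax] by exists 0%N => // n _; exact: wb.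
have [w0 [_ clw]]:= cB (w @ \oo) _ Fw.
have approx (e: R) N: 0<e -> exists n, (N<=n)%N /\ enorm (w n-w0)<e.
 move=> e0; have [||x [[n /= Nn <-] h]]:= clw [set w n | n in [set n | (N<=n)%N]] [set x | enorm (x-w0)<e].
 - by exists N => // n /= Nn; exists n.
 - by apply/near_enorm; exists e.
 - by exists n.
have lim1 q a: (forall n, a-dot q (w n)<=(CC+1)*enorm q/n.+1%:R) -> a<=dot q w0.
 move=> h; apply/ler_addgt0Pr => e e0.
 pose k:= enorm q+(CC+1)*enorm q+1.
 have k0: 0<k by rewrite ltr_wpDl// addr_ge0// mulr_ge0// addr_ge0.
 pose N:= Num.truncn (k/e).
 (* From the index [N.*2.+1] on, half of [n.+1] is at least [N.+1] and so exceeds [k/e]. *)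
 have [n [Nn wn]]:= approx (e/(2*k)) N.*2.+1 (divr_gt0 e0 (mulr_gt0 (ltr0Sn R 1) k0)).
 have h1: dot q (w n-w0)<=enorm q*(e/(2*k)).
  by apply: le_trans (dot_le _ _) _; rewrite ler_wpM2l// ltW.
 have h2: (CC+1)*enorm q/n.+1%:R<=e/2.
  rewrite ler_pdivrMr//; apply: (@le_trans _ _ k).
   by rewrite /k; have:= enorm_ge0 q; lra.
  have: k/e<N.+1%:R by apply: truncnS_gt.
  rewrite ltr_pdivrMr// => kN; apply: le_trans (ltW kN) _.
  have -> : e/2*n.+1%:R = (n.+1%:R/2)*e by ring.
  rewrite ler_pM2r// ler_pdivlMr// -natrM ler_nat.
  by move: Nn; rewrite -addnn; lia.
 have h3: enorm q*(e/(2*k))<=e/2.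
  have -> : enorm q*(e/(2*k)) = e/2*(enorm q/k) by field; rewrite gt_eqF.
  rewrite ger_pMr ?divr_gt0// ler_pdivrMr// mul1r /k.
  have: 0<=(CC+1)*enorm q by rewrite mulr_ge0// addr_ge0.
  by have:= enorm_ge0 q; lra.
 have h':= h n; rewrite (dotBr (w n)) in h1.
 by have:= lerD (le_trans h' h2) (le_trans h1 h3); rewrite subrKA -splitr lerBlDl.
exists w0.
 move=> q; rewrite -lerN2 -dotNl; apply: lim1 => n.
 have -> : - Hb q-dot (- q) (w n) = dot q (w n)-Hb q by rewrite dotNl; ring.
 rewrite enormN ler_pdivlMr// mulrBl /w dotZr [_^-1*_]mulrC.
 have [_ h]:= @Hb_bounds n.+1 q isT; have h2:= hs_ub q (ler0n R n.+1) (yP n).1.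
 rewrite mulfVK ?gt_eqF//; have:= enorm_ge0 q; lra.
apply: lim1 => n; rewrite ler_pdivlMr// mulrBl /w dotZr [_^-1*_]mulrC mulfVK ?gt_eqF//.
have [h _]:= @Hb_bounds n.+1 p isT; have:= (yP n).2; lra.
Qed.

Definition QW (t: R) (x y: V): Prop:= exists2 w, WW w & y = x+t *: w.

Lemma QW_rf: reach_family QW (fun=> Hb) cmax 1.
Proof using All.
split=> //.
- move=> t x _ t0 [w Ww ->]; rewrite addrC addKr enormZ ger0_norm// mulrC ler_wpM2r//.
 exact: WW_bound.
- move=> s t x _ _ s0 t0 [w Ww ->] [w' Ww' ->].
 have: 0<=s+t by rewrite addr_ge0.
 rewrite le_eqVlt => /orP[/eqP st0|st0].
  have [-> ->]: s = 0 /\ t = 0 by split; lra.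
  by rewrite !scale0r !addr0; exists w => //; rewrite scale0r addr0.
 exists ((s+t)^-1 *: (s *: w+t *: w')).
  move=> p; rewrite dotZr dotDr !dotZr mulrC ler_pdivrMr// mulrDr [Hb p*s]mulrC [Hb p * t]mulrC.
  by apply: lerD; rewrite ler_wpM2l.
 by rewrite scalerA mulfV ?gt_eqF// scale1r addrA.
- move=> s t x z s0 t0 [w Ww ->]; exists (x+s *: w); first by exists w.
 by exists w => //; rewrite scalerDl addrA.
- move=> t x t0; exists x, 0; last by rewrite scaler0 addr0.
 by move=> p; rewrite dot0r (sl_ge0 Hb_sublinear).
- move=> t x x' _ t0 [w Ww ->]; exists (x'+t *: w); first by exists w.
 by rewrite mul1r opprD addrACA subrr addr0.
- move=> x p e e0; exists 1 => // h _ h0 _ [w Ww ->]; rewrite addrC addKr dotZr -mulrN -dotNl.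
 by rewrite ler_wpM2l//; apply: le_trans (Ww _) _; rewrite Hb_even lerDl ltW.
- move=> x p e e0; exists 1 => // h h0 _; have [w Ww hw]:= WW_support (- p).
 exists (x+h *: w); first by exists w.
 rewrite [x+_]addrC addrK dotZr -mulrN -dotNl ler_wpM2l//; apply: le_trans _ hw.
 by rewrite Hb_even; lra.
Qed.

(** The displacement is divided by [t+a] rather than [t]: since [Hb] dominates [cmin/2] times the
    norm, the extra time [a] absorbs the additive error of [reach_effective]. *)
Lemma hom_lower t x y: RR t x y -> exists2 w, WW w &
 enorm (y-x-t *: w)<=cmax*((r0+D0*cmax+cmax+CC)*(2/cmin)).
Proof using All.
move=> r; have t0:= reach_ge0 r; set C2:= r0+_+_+_; set a:= C2*(2/cmin).
have C20: 0<=C2 by rewrite /C2 !addr_ge0// mulr_ge0.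
have a0: 0<=a by rewrite mulr_ge0// divr_ge0// ltW.
have: 0<=t+a by rewrite addr_ge0.
rewrite le_eqVlt => /orP[/eqP ta0|ta].
 exists 0; first by move=> p; rewrite dot0r (sl_ge0 Hb_sublinear).
 have -> : t = 0 by lra.
 rewrite scaler0 subr0; apply: le_trans (reach_bound cmin0 cl cu Lc0 r) _.
 by rewrite ler_wpM2l//; lra.
have Ww: WW ((t+a)^-1 *: (y-x)).
 move=> p; rewrite dotZr mulrC ler_pdivrMr//; apply: le_trans (reach_effective p r) _.
 rewrite -/C2 mulrDr [Hb p * t]mulrC lerD2l.
 have -> : C2*enorm p = a*(cmin/2*enorm p) by rewrite /a; field; rewrite gt_eqF.
 by rewrite mulrC ler_wpM2r// Hb_lower.
exists ((t+a)^-1 *: (y-x)) => //.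
have -> : y-x-t *: ((t+a)^-1 *: (y-x)) = a *: ((t+a)^-1 *: (y-x)).
 rewrite -{1}(scale1r (y-x)) !scalerA -scalerBl; congr (_ *: _); field; rewrite gt_eqF//.
by rewrite enormZ ger0_norm// mulrC ler_wpM2r// WW_bound.
Qed.

(* A greedy strategy in the spirit of Blackwell's approachability: at each stage, run for
   time [T] in the direction that best reduces the current deviation. *)
Lemma hom_greedy (T k: nat) x w: (0<T)%N -> WW w ->
 exists2 y, RR (k%:R*(T%:R+D0)) x y &
  enorm (y-x-(k%:R*T%:R) *: w) <=
   k%:R*(r0+CC+1)+Num.sqrt k%:R*(r0+2*cmax*T%:R).
Proof using All.
move=> T0 Ww; elim: k => [|k [z rz hz]].
 by exists x; rewrite ?mul0r; [exact: reach_nil|rewrite subrr scale0r subr0 enorm0 sqrtr0 mul0r addr0].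
set C1:= r0+CC+1; set b:= r0+2*cmax*T%:R; rewrite -/C1 -/b in hz.
have C10: 0<=C1 by rewrite /C1 addr_ge0// addr_ge0.
have b0: 0<=b by rewrite /b addr_ge0// !mulr_ge0.
set e:= z-x-(k%:R*T%:R) *: w in hz; have e0:= enorm_ge0 e.
have [m pm zm]:= period_near cper z.
(* As [dot (- e) w<=Hb (- e)], the point chosen does at least as well as [w] against the deviation,
   up to constants. *)
have [y ry hy]:= hs_near (- e) (ler0n R T).
exists (y+m).
 rewrite -natr1 mulrDl mul1r; apply: reach_comp rz _; rewrite addrC.
 by apply: reach_comp (reach_near zm) _; have:= reach_period pm ry; rewrite add0r.
set f:= (m-z)+(y-T%:R *: w).
have -> : y+m-x-(k.+1%:R*T%:R) *: w = e+f.
 rewrite /e /f -natr1 mulrDl mul1r scalerDl.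
 by apply/rowP => i; rewrite !mxE; ring.
have f1: enorm f<=b.
 apply: le_trans (enormD _ _) _; rewrite /b; apply: lerD; first by rewrite enormBC.
 apply: le_trans (enormB _ _) _.
 have:= reach_bound cmin0 cl cu Lc0 ry; rewrite subr0 => h.
 have: enorm (T%:R *: w)<=cmax*T%:R by rewrite enormZ ger0_norm// mulrC ler_wpM2r// WW_bound.
 lra.
have f2: dot e f<=enorm e*C1.
 rewrite /f dotDr; have h1: dot e (m-z)<=enorm e*r0.
  by apply: le_trans (dot_le _ _) _; rewrite ler_wpM2l// enormBC.
 have [h2 _]:= Hb_bounds (- e) T0; have h3:= Ww (- e).
 have h4: T%:R*dot (- e) w<=T%:R*Hb (- e) by rewrite ler_wpM2l.
 have -> : dot e (y-T%:R *: w) = T%:R*dot (- e) w-dot (- e) y by rewrite [dot e _]dotBr dotZr !dotNl; ring.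
 by rewrite enormN in hy h2; rewrite /C1; lra.
rewrite -(@ler_pXn2r _ 2)// ?nnegrE//; last by rewrite addr_ge0// mulr_ge0// sqrtr_ge0.
rewrite enorm_sqrD; exact: greedy_alg.
Qed.

Definition homC: R:= cmax*((r0+D0*cmax+cmax+CC)*(2/cmin)) +
 (r0+CC+1+cmax*D0+(r0+2*cmax)+cmax*(1+D0)).

Lemma homC_ge0: 0<=homC.
Proof using cmin0 cl cu.
by rewrite /homC !addr_ge0// !mulr_ge0// ?addr_ge0// ?mulr_ge0// ?invr_ge0// ltW.
Qed.

(** There are about [t/T] stages: the first term is their systematic loss, the second the
    accumulated squares, the last the unfinished stage. *)
Lemma hom_upper (T: nat) t x w: (0<T)%N -> 0<=t -> WW w ->
 exists2 y, RR t x y & enorm (y-x-t *: w) <=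
  homC*(t/T%:R+Num.sqrt (t/T%:R)*T%:R+T%:R).
Proof using All.
move=> T0 t0 Ww; have TR: 0<T%:R :> R by rewrite ltr0n.
have T1: 1<=T%:R :> R by rewrite ler1n.
have TD: 0<T%:R+D0 by rewrite ltr_wpDr.
(* A stage lasts [T%:R+D0], the detour to the nearest period included. *)
pose k:= Num.truncn (t/(T%:R+D0)).
have /andP[k1 k2]: k%:R<=t/(T%:R+D0)<k.+1%:R by apply: truncn_itv; rewrite divr_ge0// ltW.
rewrite ler_pdivlMr// in k1; rewrite ltr_pdivrMr// -natr1 in k2.
have [y ry hy]:= hom_greedy k x T0 Ww.
exists y; first exact: (reach_mono cmin0 cl cu Lc0 k1).
have kT: k%:R<=t/T%:R.
 rewrite ler_pdivlMr//; apply: le_trans _ k1; rewrite ler_wpM2l// lerDl//.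
have sk: Num.sqrt k%:R<=Num.sqrt (t/T%:R) by rewrite ler_sqrt// divr_ge0.
set q:= t/T%:R in kT sk *; set s:= Num.sqrt q in sk *; have s0: 0<=s by exact: sqrtr_ge0.
have -> : y-x-t *: w = (y-x-(k%:R*T%:R) *: w)-(t-k%:R*T%:R) *: w.
 by rewrite scalerBl opprB addrA subrK.
apply: le_trans (enormB _ _) _.
have nw: enorm ((t-k%:R*T%:R) *: w)<=cmax*(T%:R+D0+k%:R*D0).
 rewrite enormZ mulrC; apply: ler_pM => //; first exact: WW_bound.
 have:= mulr_ge0 (ler0n R k) D00; rewrite mulrDr in k1; rewrite mulrDl mulrDr mul1r in k2.
 by move=> ?; rewrite ger0_norm; lra.
apply: le_trans (lerD hy nw) _.
have q0: 0<=q by rewrite divr_ge0.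
have a1: k%:R*(r0+CC+1)<=q*(r0+CC+1) by rewrite ler_wpM2r// !addr_ge0// mulr_ge0.
have a2: Num.sqrt k%:R*(r0+2*cmax*T%:R)<=s*T%:R*(r0+2*cmax).
 rewrite -[s*_*_]mulrA; apply: ler_pM => //; first by rewrite addr_ge0// !mulr_ge0.
 by rewrite [T%:R*_]mulrDr; have: r0*1<=r0*T%:R by [rewrite ler_wpM2l]; lra.
have a3: cmax*(T%:R+D0+k%:R*D0)<=cmax*(1+D0)*T%:R+q*(cmax*D0).
 have e1: D0*1<=D0*T%:R by rewrite ler_wpM2l.
 have e2: k%:R*D0<=q*D0 by rewrite ler_wpM2r.
 have: cmax*(T%:R+D0+k%:R*D0)<=cmax*(T%:R+D0*T%:R+q*D0) by rewrite ler_wpM2l//; lra.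
 by move=> /le_trans; apply; apply: eq_le_imp; ring.
apply: le_trans (lerD (lerD a1 a2) a3) _.
set Y:= q+s*T%:R+T%:R; rewrite /homC.
have sT: 0<=s*T%:R by rewrite mulr_ge0.
have X0: 0<=cmax*((r0+D0*cmax+cmax+CC)*(2/cmin)).
 by rewrite !mulr_ge0// ?addr_ge0// ?mulr_ge0// ?invr_ge0// ltW.
have Y0: 0<=Y by rewrite /Y !addr_ge0.
rewrite [leRHS](mulrDl _ _ Y); apply: (@le_trans _ _ ((r0+CC+1+cmax*D0+(r0+2*cmax)+cmax*(1+D0))*Y)); last first.
 by rewrite lerDr mulr_ge0.
have cD: 0<=cmax*D0 by rewrite mulr_ge0.
have b1: q*(r0+CC+1)<=Y*(r0+CC+1) by rewrite ler_wpM2r ?addr_ge0// /Y; lra.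
have b2: q*(cmax*D0)<=Y*(cmax*D0) by rewrite ler_wpM2r// /Y; lra.
have b3: s*T%:R*(r0+2*cmax)<=Y*(r0+2*cmax) by rewrite ler_wpM2r ?addr_ge0 ?mulr_ge0// /Y; lra.
have b4: cmax*(1+D0)*T%:R<=Y*(cmax*(1+D0)).
 by rewrite mulrC ler_wpM2r ?mulr_ge0 ?addr_ge0// /Y; lra.
by move: b1 b2 b3 b4; set A:= r0+CC+1; set B:= cmax*D0; set E:= r0+2*cmax; set F:= cmax*(1+D0); lra.
Qed.

Definition reachE (eps: R) (t: R) (x y: V): Prop:= RR (t/eps) (eps^-1 *: x) (eps^-1 *: y).

Lemma reachE_rf eps: 0<eps -> reach_family (reachE eps) (fun x p => c (eps^-1 *: x)*enorm p)
 cmax (cmax*(2/cmin)).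
Proof using -cper.
move=> e0; exact: (reach_family_scale e0 (reach_rf cmin0 cl cu Lc0 clip)).
Qed.

(** The two reachable sets approximate each other up to [B] on the microscopic scale, and the
    Lipschitz bound on [v] transfers this to the infima. *)
Lemma hom_step eps (v: V -> R) L (T: nat) t x: 0<eps -> 0<=L -> qlip v ->
 (forall x y, v x-v y<=L*enorm (x-y)) -> (0<T)%N -> 0<=t ->
 `|infQ (reachE eps) v (eps * t) x-infQ QW v (eps * t) x| <=
  eps*L*(homC*(t/T%:R+Num.sqrt (t/T%:R)*T%:R+T%:R)).
Proof using All.
move=> e0 L0 ql vL T0 t0; have en: eps != 0 by rewrite gt_eqF.
set B:= homC*_; have et0: 0<=eps * t by rewrite mulr_ge0// ltW.
have ie: eps * t/eps = t by rewrite mulrC mulKf.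
have rfe:= reachE_rf e0; have rfW:= QW_rf.
have TR: 1<=T%:R :> R by rewrite ler1n.
have BT: homC<=B.
 rewrite /B ler_peMr ?homC_ge0//.
 have: 0<=t/T%:R by rewrite divr_ge0.
 have: 0<=Num.sqrt (t/T%:R)*T%:R by rewrite mulr_ge0// sqrtr_ge0.
 lra.
have sc (y w: V): enorm (y-(x+(eps * t) *: w)) = eps*enorm (eps^-1 *: y-eps^-1 *: x-t *: w).
 have -> : y-(x+(eps * t) *: w) = eps *: (eps^-1 *: y-eps^-1 *: x-t *: w).
  by rewrite !scalerBr !scalerA mulfV// !scale1r opprD addrA.
 by rewrite enormZ gtr0_norm.
rewrite ler_norml; apply/andP; split.
 rewrite lerBrDr; apply: (infQ_ge rfe) => // y; rewrite /reachE ie => r.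
 have [w Ww hw]:= hom_lower r.
 have q: QW (eps * t) x (x+(eps * t) *: w) by exists w.
 have h1:= infQ_le rfW ql et0 q; have:= vL (x+(eps * t) *: w) y; rewrite enormBC sc => h2.
 have h3: enorm (eps^-1 *: y-eps^-1 *: x-t *: w)<=B.
  apply: le_trans hw _; apply: le_trans _ BT; rewrite /homC lerDl.
  by rewrite !addr_ge0// !mulr_ge0// ?addr_ge0// ?mulr_ge0// ?invr_ge0// ltW.
 have: L*(eps*enorm (eps^-1 *: y-eps^-1 *: x-t *: w))<=L*(eps*B).
  by rewrite ler_wpM2l// ler_wpM2l// ltW.
 lra.
rewrite lerBlDr -lerBlDl; apply: (infQ_ge rfW) => // _ [w Ww ->].
have [y r hy]:= hom_upper (eps^-1 *: x) T0 t0 Ww.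
have q: reachE eps (eps * t) x (eps *: y) by rewrite /reachE ie scalerA mulVf// scale1r.
have h1:= infQ_le rfe ql et0 q; have:= vL (eps *: y) (x+(eps * t) *: w); rewrite sc scalerA mulVf// scale1r => h2.
have: L*(eps*enorm (y-eps^-1 *: x-t *: w))<=L*(eps*B).
 by rewrite ler_wpM2l// ler_wpM2l// ltW.
lra.
Qed.

End Effective.

(** * Flows on a time grid and their extension to continuous paths *)

Lemma stair_div (M k j: nat): (j<M)%N ->
 [/\ (((k+(M-j).-1).+1 %/ M) = (k %% M == j)+(k+(M-j).-1) %/ M)%N,
   (k %% M)%N = j -> ((k+(M-j).-1) %/ M = k %/ M)%N &
   (k<=(k+(M-j).-1) %/ M*M+M)%N /\ ((k+(M-j).-1) %/ M*M<=k+M)%N].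
Proof.
move=> jM; have M0: (0<M)%N by lia.
have kE:= divn_eq k M; have kM:= ltn_pmod k M0.
split.
- rewrite divnS//; congr (nat_of_bool _+_)%N; apply/idP/eqP => [/dvdnP[q E]|kj].
  have: (q*M+j = k+M)%N by move: E jM; clear; lia.
  by move/(congr1 (fun n => n %% M)%N); rewrite modnMDl modnDr modn_small.
 by apply/dvdnP; exists (k %/ M).+1; rewrite mulSn; move: kE kj jM; clear; lia.
- move=> kj; have -> : (k+(M-j).-1 = k %/ M*M+M.-1)%N by move: kj jM kE; clear; lia.
 have e0: (M.-1 %/ M = 0)%N by rewrite divn_small// ltn_predL.
 by rewrite divnMDl// e0 addn0.
- have:= divn_eq (k+(M-j).-1) M; have:= ltn_pmod (k+(M-j).-1) M0.
 by move: (_ %/ _)%N (_ %% _)%N => q r; move: jM; clear; lia.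
Qed.

Section GridSolutions.
Variables (R: realType) (d M: nat).
Local Notation V:= 'rV[R]_d.

Lemma UCstrip_glue (u: V -> R -> R) (a b c: R): a<=b -> b<=c ->
 UCstrip u a b -> UCstrip u b c -> UCstrip u a c.
Proof.
move=> ab bc u1 u2 e e0; have e2: 0<e/2 by rewrite divr_gt0.
have [d1 d10 h1]:= u1 _ e2; have [d2 d20 h2]:= u2 _ e2.
exists (Num.min d1 d2); first by rewrite lt_min d10.
have x0 (x: V) (del: R): 0<del -> enorm (x-x)<del by rewrite subrr enorm0.
have key x y s t: a<=s<=b -> b<=t<=c -> enorm (x-y)<Num.min d1 d2 ->
  `|s-t| < Num.min d1 d2 -> `|u x s-u y t| < e.
 move=> /andP[s1 s2] /andP[t1 t2]; rewrite !lt_min => /andP[xy1 xy2] /andP[st1 st2].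
 have sb: `|s-b| < d1 by rewrite distrC ger0_norm ?subr_ge0//; move: st1; rewrite distrC ger0_norm; lra.
 have bt: `|b-t| < d2 by rewrite distrC ger0_norm ?subr_ge0//; move: st2; rewrite distrC ger0_norm; lra.
 have k1:= h1 x x s b; have k2:= h2 x y b t; rewrite -(subrK (u x b) (u x s)) -addrA.
 apply: le_lt_trans (ler_normD _ _) _.
 have:= k1 (introT andP (conj s1 s2)) (introT andP (conj ab (lexx b))) (x0 _ _ d10) sb.
 have:= k2 (introT andP (conj (lexx b) bc)) (introT andP (conj t1 t2)) xy2 bt.
 lra.
have two (X Y E: R): X<E/2 -> 0<E -> X<E by lra.
move=> x y s t /andP[s1 s2] /andP[t1 t2] xy st.
have [sb|sb]:= leP s b; have [tb|tb]:= leP t b.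
- apply: (two _ 0) => //; apply: h1; rewrite ?s1 ?t1//; [move: xy|move: st]; rewrite lt_min => /andP[]//.
- by apply: key; rewrite ?s1 ?sb ?t2 ?(ltW tb).
- by rewrite distrC; apply: key; rewrite ?s2 ?tb ?t1 ?(ltW sb)// 1?distrC// enormBC.
- apply: (two _ 0) => //; apply: h2; rewrite ?s2 ?t2 ?(ltW sb) ?(ltW tb)//; [move: xy|move: st]; rewrite lt_min => /andP[]//.
Qed.

Lemma UCstrip_grid (u: V -> R -> R) (h: R): 0<h ->
 (forall k: nat, UCstrip u (k%:R*h) (k.+1%:R*h)) -> forall T, UCstrip u 0 T.
Proof.
move=> h0 H T.
have A n: UCstrip u 0 (n.+1%:R*h).
 elim: n => [|n IH]; first by have:= H 0%N; rewrite mul0r.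
 apply: UCstrip_glue IH (H n.+1); first by rewrite mulr_ge0// ltW.
 by rewrite ler_wpM2r ?ler_nat// ltW.
apply: (UCstrip_sub (lexx 0) _ (A (Num.truncn (T/h)))).
by rewrite -ler_pdivrMr// ltW// truncnS_gt.
Qed.

Lemma grid_trunc (h t: R) (k: nat): 0<h -> k%:R*h<=t<k.+1%:R*h -> Num.truncn (t/h) = k.
Proof. by move=> h0 kt; apply: truncn_def; rewrite ler_pdivlMr// ltr_pdivrMr. Qed.

Lemma grid_cell (h t: R): 0<h -> 0<=t -> exists k: nat, k%:R*h<=t<k.+1%:R*h.
Proof.
move=> h0 t0; exists (Num.truncn (t/h)); rewrite -ler_pdivlMr// -ltr_pdivrMr//.
by apply: truncn_itv; rewrite divr_ge0// ltW.
Qed.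

Section Grid.
Variables (Q: 'I_M -> R -> V -> V -> Prop) (H: 'I_M -> V -> V -> R) (C C': R).
Hypothesis rf: forall j, reach_family (Q j) (H j) C C'.
Variables (u0: V -> R) (h: R) (J: nat -> 'I_M) (s: nat -> R).
Hypotheses (q0: qlip u0) (h0: 0<h).

Fixpoint gridG (k: nat): V -> R :=
 if k is k'.+1 then sgQ (Q (J k')) (gridG k') (s k') else u0.

Definition gridU (x: V) (t: R): R :=
 let k:= Num.truncn (t/h) in sgQ (Q (J k)) (gridG k) (s k/h*(t-k%:R*h)) x.

Lemma gridG_qlip k: qlip (gridG k).
Proof using rf q0. by elim: k => //= k IH; apply: (sgQ_qlip (rf (J k))). Qed.

(** Holds on the closed cell: at its right end the next cell starts from the same function. *)
Lemma gridU_E k x t: k%:R*h<=t<=k.+1%:R*h ->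
 gridU x t = sgQ (Q (J k)) (gridG k) (s k/h*(t-k%:R*h)) x.
Proof using rf q0 h0.
move=> /andP[k1]; rewrite le_eqVlt => /orP[/eqP ->|k2]; last by rewrite /gridU (grid_trunc (k:= k))// k1.
have kk: k.+1%:R*h<=k.+1%:R*h<k.+2%:R*h by rewrite lexx/= ltr_pM2r// ltr_nat.
rewrite /gridU (grid_trunc _ kk)// subrr mulr0 (sgQ0 (rf _))//; last exact: gridG_qlip.
by rewrite -mulrBl -natrB// subSnn mul1r mulfVK ?gt_eqF.
Qed.

Lemma gridU_grid k x: gridU x (k%:R*h) = gridG k x.
Proof using rf q0 h0.
rewrite (@gridU_E k); last by rewrite lexx ler_wpM2r ?ler_nat// ltW.
by rewrite subrr mulr0 (sgQ0 (rf _))//; exact: gridG_qlip.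
Qed.

Lemma gridU0 x: gridU x 0 = u0 x.
Proof using rf q0 h0. by have:= gridU_grid 0 x; rewrite mul0r. Qed.

Lemma gridU_UC T: UCstrip gridU 0 T.
Proof using rf q0 h0.
apply: (UCstrip_grid h0) => k e e0; have e4: 0<e/4 by rewrite divr_gt0.
have [L L0 hL]:= gridG_qlip k e4; have C0:= rf_C (rf (J k)); have C'0:= rf_C' (rf (J k)).
pose K:= L*C'*(1+C * `|s k/h|)+1.
have LC: 0<=L*C' by rewrite mulr_ge0.
have Cs: 0<=C * `|s k/h| by rewrite mulr_ge0.
have LCC: 0<=L*C'*(C * `|s k/h|) by rewrite mulr_ge0.
have K1: L*C'<=K by rewrite /K; nra.
have K2: L*C'*(C * `|s k/h|)<=K by rewrite /K; nra.
have K0: 0<K by rewrite /K ltr_wpDl// mulr_ge0// addr_ge0.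
exists (e/(4*K)); first by rewrite divr_gt0// mulr_gt0.
have small (X: R): 0<=X -> X<e/(4*K) -> K*X<e/4.
 move=> X0; rewrite !ltr_pdivlMr//; last by rewrite mulr_gt0.
 by move=> X1; have -> : K*X*4 = X*(4*K) by ring.
move=> x y a b aI bI xy ab; rewrite !(@gridU_E k)//.
case/andP: aI => a1 a2; case/andP: bI => b1 b2.
have m1:= sgQ_mod (rf (J k)) (s k/h*(a-k%:R*h)) (gridG_qlip k) L0 hL.
have m2:= @sgQ_time _ _ _ _ _ _ (rf (J k)) _ (s k/h) (a-k%:R*h) (b-k%:R*h) L (e/4)
 (gridG_qlip k) _ _ L0 (ltW e4) hL y.
have {}m2:= m2 (ltac:(lra)) (ltac:(lra)).
rewrite opprB addrA subrK in m2.
have x1:= small _ (enorm_ge0 _) xy; have x2:= small _ (normr_ge0 _) ab.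
have y1: L*C'*enorm (x-y)<=K*enorm (x-y) by rewrite ler_wpM2r.
have y2: L*C'*(C*(`|s k/h| * `|a-b|))<=K * `|a-b|.
 by rewrite (_: L*C'*_ = L*C'*(C * `|s k/h|) * `|a-b|); [rewrite ler_wpM2r|ring].
have n1:= m1 x y; have n2:= m1 y x; rewrite (enormBC y) in n2.
move: m2; rewrite ler_norml => /andP[l1 l2]; rewrite ltr_norml; apply/andP; split; lra.
Qed.

Lemma gridU_visc k: (forall j x p, H j x (- p) = H j x p) ->
 visc_sol (fun x t p => s k/h*H (J k) x p) gridU [set t | k%:R*h<t<k.+1%:R*h].
Proof using rf q0 h0.
by move=> He; apply: (sgQ_visc (rf (J k)) (He (J k)) (gridG_qlip k)) => x t; exact: gridU_E.
Qed.

End Grid.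

Section GridPath.
Variables (h: R) (J: nat -> 'I_M) (s: nat -> R).
Hypothesis h0: 0<h.

Definition gridP (k: nat) (j: 'I_M): R:= \sum_(i<k) (J i == j)%:R*s i.

Definition gridz (j: 'I_M) (t: R): R :=
 let k:= Num.truncn (t/h) in gridP k j+(J k == j)%:R*s k/h*(t-k%:R*h).

Lemma gridPS k j: gridP k.+1 j = gridP k j+(J k == j)%:R*s k.
Proof using. by rewrite /gridP big_ord_recr. Qed.

Lemma gridz_E k j t: k%:R*h<=t<=k.+1%:R*h ->
 gridz j t = gridP k j+(J k == j)%:R*s k/h*(t-k%:R*h).
Proof using h0.
move=> /andP[k1]; rewrite le_eqVlt => /orP[/eqP ->|k2]; last by rewrite /gridz (grid_trunc (k:= k))// k1.
have kk: k.+1%:R*h<=k.+1%:R*h<k.+2%:R*h by rewrite lexx/= ltr_pM2r// ltr_nat.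
have hE: k.+1%:R*h-k%:R*h = h by rewrite -mulrBl -natrB// subSnn mul1r.
rewrite /gridz (grid_trunc h0 kk).
rewrite subrr mulr0 addr0.
rewrite gridPS hE; congr (_+_).
by rewrite mulfVK// gt_eqF.
Qed.

Lemma gridz_grid k j: gridz j (k%:R*h) = gridP k j.
Proof using h0.
rewrite (@gridz_E k); last by rewrite lexx ler_wpM2r ?ler_nat// ltW.
by rewrite subrr mulr0 addr0.
Qed.

Lemma gridz_UC j T: UCstrip (fun _: V => gridz j) 0 T.
Proof using d h0.
apply: (UCstrip_grid h0) => k e e0; pose K:= `|(J k == j)%:R*s k/h| + 1.
have K0: 0<K by rewrite ltr_wpDl.
exists (e/K); first by rewrite divr_gt0.
move=> x y a b aI bI _; rewrite ltr_pdivlMr// => ab; rewrite !(@gridz_E k)//.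
rewrite opprD addrACA subrr add0r -mulrBr opprB addrA subrK normrM.
have:= normr_ge0 (a-b); move: ab; rewrite /K; nra.
Qed.

Lemma gridz_cont T: cont_path gridz T.
Proof using d h0.
move=> j t e tT e0; have [del d0 hd]:= gridz_UC j T e0; exists del => // r rT rt.
by apply: (hd 0 0) => //; rewrite subrr enorm0.
Qed.

Lemma gridz_step_le k j t: k%:R*h<=t<=k.+1%:R*h -> `|gridz j t-gridP k j| <= `|s k|.
Proof using h0.
move=> kt; rewrite (gridz_E _ kt) addrC addKr normrM normf_div normrM.
case/andP: kt => a b; rewrite (gtr0_norm h0) (ger0_norm (_: 0<=t-_)) ?subr_ge0//.
rewrite mulrAC ler_pdivrMr//.
have t1: t-k%:R*h<=h by move: b; rewrite -natr1 mulrDl mul1r; lra.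
apply: ler_pM; rewrite ?subr_ge0 ?mulr_ge0//.
by case: (J k == j); rewrite ?normr1 ?normr0 ?mul1r ?mul0r.
Qed.

End GridPath.

(** Clamping the time to [0, T] extends the path continuously to the line, where [heine] applies. *)
Lemma path_unif z T (e: R): 0<=T -> cont_path z T -> 0<e ->
 exists2 del: R, 0<del & forall (j: 'I_M) s t, 0<=s<=T -> 0<=t<=T -> `|s-t| < del -> `|z j s-z j t| <= e.
Proof using d.
move=> T0 cz e0.
have cl (t: R): 0<=Num.max 0 (Num.min t T)<=T.
 by rewrite le_max lexx/= ge_max T0/= ge_min lexx orbT.
have cl1 (s t: R): `|Num.max 0 (Num.min s T)-Num.max 0 (Num.min t T)| <= `|s-t|.
 by case: (leP s T) => ?; case: (leP t T) => ?; rewrite ?(max_r T0); try (case: (leP 0 s) => ?);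
  try (case: (leP 0 t) => ?); rewrite ler_norml; case: (ger0P (s-t)) => ?; apply/andP; split; lra.
have cid (t: R): 0<=t<=T -> Num.max 0 (Num.min t T) = t.
 by move=> /andP[a b]; rewrite min_l// max_r.
have ex j: exists del: R, 0<del /\ forall s t, 0<=s<=T -> 0<=t<=T -> `|s-t| < del -> `|z j s-z j t| <= e.
 have cf: continuous (fun t: R => z j (Num.max 0 (Num.min t T))).
  move=> t; apply/cvgrPdist_lt => e' e'0; have [r r0 hr]:= cz j _ e' (cl t) e'0.
  apply/nbhs_normP; exists r => // s /= ts; rewrite distrC; apply: hr => //.
  by apply: le_lt_trans (cl1 _ _) _; rewrite distrC.
 have [del d0 hd]:= heine T0 cf e0; exists del; split=> // s t sT tT st.
 by have:= hd s t sT tT st; rewrite !cid.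
have [del hd]:= choice ex.
have [m m0 hm]:= @fin_min R M (fun j r => forall s t, 0<=s<=T -> 0<=t<=T -> `|s-t| < r -> `|z j s-z j t| <= e)
 (fun j => let: conj a b:= hd j in ex_intro2 _ _ (del j) a b)
 (fun j r r' _ rr hr s t sT tT st => hr s t sT tT (lt_le_trans st rr)).
by exists m => // j s t; exact: hm.
Qed.

(** A grid path moves one coordinate at a time, so every interval of length [hh] is cut into [M]
    cells in which the coordinates catch up in turn. *)
Lemma stair z T (e: R): (0<M)%N -> 0<T -> 0<e -> (forall T, cont_path z T) -> (forall j, z j 0 = 0) ->
 exists h J s, 0<h /\ forall j t, 0<=t<=T -> `|gridz h J s j t-z j t| <= e.
Proof using d.
move=> M0 T0 e0 cz z0; have T1: 0<=T+2 by lra.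
have [del d0 hd]:= path_unif T1 (cz _) e0.
pose hh:= Num.min 1 (del/3); have hh0: 0<hh by rewrite lt_min ltr01 divr_gt0.
have hh1: hh<=1 by rewrite ge_min lexx.
have hhd: hh<=del/3 by rewrite ge_min lexx orbT.
have MR: 0<M%:R :> R by rewrite ltr0n.
pose h:= hh/M%:R; have h0: 0<h by rewrite divr_gt0.
have hM: h*M%:R = hh by rewrite mulfVK ?gt_eqF.
pose J (k: nat): 'I_M:= Ordinal (ltn_pmod k M0).
pose s (k: nat):= z (J k) ((k %/ M).+1%:R*hh)-z (J k) ((k %/ M)%:R*hh).
(* The quotient counts the indices below [k] congruent to [j] modulo [M]; thus [tau k j] is the time
   up to which coordinate [j] has been followed after [k] cells. *)
pose tau (k: nat) (j: 'I_M): R:= ((k+(M-j).-1) %/ M)%:R*hh.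
have PE k j: gridP J s k j = z j (tau k j).
 have jM:= ltn_ord j.
 elim: k => [|k IH].
  by rewrite /gridP big_ord0 /tau add0n divn_small ?mul0r ?z0// -ltnS prednK ?subn_gt0// ltnS leq_subr.
 rewrite gridPS IH /tau addSn; have [-> kj _]:= @stair_div M k j jM.
 have -> : (J k == j) = (k %% M == j)%N by [].
 have [kj'|_]:= eqVneq (k %% M)%N (nat_of_ord j); last by rewrite mul0r addr0 add0n.
 have Jk: J k = j by exact: val_inj.
 by rewrite kj// mul1r /s Jk addrC subrK add1n.
exists h, J, s; split => // j t /andP[t0 tT].
have tau_near (k: nat): [/\ 0<=tau k j, k%:R*h<=tau k j+hh & tau k j<=k%:R*h+hh].
 have [_ _]:= @stair_div M k j (ltn_ord j); rewrite /tau -hM; move: (_ %/ _)%N => q.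
 have -> : q%:R*(h*M%:R) = (q*M)%:R*h by rewrite natrM; ring.
 have -> : k%:R*h+h*M%:R = (k+M)%:R*h by rewrite natrD; ring.
 have -> : (q*M)%:R*h+h*M%:R = (q*M+M)%:R*h by rewrite [(_+M)%:R]natrD; ring.
 by have h0':= ltW h0; move=> [? ?]; split; [exact: mulr_ge0|rewrite ler_wpM2r// ler_nat|rewrite ler_wpM2r// ler_nat].
have [k /andP[k1 k2]]:= grid_cell h0 t0.
have kt: k%:R*h<=t<=k.+1%:R*h by rewrite k1 ltW.
have hle: h<=hh.
 by rewrite -hM ler_peMr ?(ltW h0)// ler1n.
have k2': t<k%:R*h+h by rewrite -[X in _+X]mul1r -mulrDl natr1.
have k0: 0<=k%:R*h by rewrite mulr_ge0// ltW.
have near (k': nat): k%:R*h<=k'%:R*h -> k'%:R*h<=k%:R*h+h -> `|z j (tau k' j)-z j t| <= e.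
 move=> a b; have [c0 c1 c2]:= tau_near k'; apply: hd.
 - by apply/andP; split; lra.
 - by rewrite t0; lra.
 - by rewrite ltr_norml; apply/andP; split; lra.
have n1:= near k (lexx _) (ltac:(lra)).
have n2:= near k.+1; rewrite -natr1 mulrDl mul1r in n2; have {}n2:= n2 (ltac:(lra)) (ltac:(lra)).
rewrite (@gridz_E h J s h0 k)//.
have P2:= gridPS J s k j; rewrite !PE in P2 *; set X:= _*s k in P2 *.
pose l:= (t-k%:R*h)/h.
have l01: 0<=l<=1 by rewrite /l divr_ge0 ?subr_ge0// ?(ltW h0)//= ler_pdivrMr// mul1r; lra.
have -> : z j (tau k j)+X/h*(t-k%:R*h)-z j t =
 (1-l)*(z j (tau k j)-z j t)+l*(z j (tau k.+1 j)-z j t) by rewrite P2 /l; ring.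
case/andP: l01; move: l => l la lb; apply: le_trans (ler_normD _ _) _; rewrite !normrM (ger0_norm la) (ger0_norm (_: 0<=1-l)) ?subr_ge0//.
have: (1-l) * `|z j (tau k j)-z j t| <= (1-l)*e by rewrite ler_wpM2l// subr_ge0.
have: l * `|z j (tau k.+1 j)-z j t| <= l*e by rewrite ler_wpM2l.
lra.
Qed.

Section Limits.
Variables (H: 'I_M -> V -> R) (C: R) (Q: 'I_M -> R -> V -> V -> Prop) (C1 C': R).
Hypotheses (C0: 0<=C) (sl: forall j, sublinear (H j) C).
Hypothesis rf: forall j, reach_family (Q j) (fun=> H j) C1 C'.
Hypothesis Heven: forall j p, H j (- p) = H j p.
Variable u0: V -> R.
Hypothesis q0: qlip u0.

Lemma gridU_rsol h J s t: 0<h -> 0<=t -> rsol H (gridU Q u0 h J s) (gridz h J s) t.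
Proof using rf Heven q0.
move=> h0 t0; have [k /andP[k1 k2]]:= grid_cell h0 t0.
exists (k.+1%:R*h-t), (fun j r => gridP J s k j+(J k == j)%:R*s k/h*(r-k%:R*h)),
 (fun j _ => (J k == j)%:R*s k/h); split.
- by rewrite subr_gt0.
- move=> j; split; last by move=> r; exact: cvg_cst.
 move=> r e e0; exists 1 => // r' _; set X:= _*_/h.
 have -> : gridP J s k j+X*(r'-k%:R*h)-(gridP J s k j+X*(r-k%:R*h))-X*(r'-r) = 0 by ring.
 by rewrite normr0 mulr_ge0// ltW.
- by move=> j r /andP[r1 r2]; rewrite (@gridz_E h J s h0 k)// (le_trans k1 r1)/=; lra.
have He j (x p: V): (fun=> H j) x (- p) = (fun=> H j) x p by exact: Heven.
have gv:= @gridU_visc Q _ _ _ rf u0 h J s q0 h0 k He.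
apply: visc_sol_ext gv.
- by move=> r /= /andP[r1 r2]; rewrite (le_lt_trans k1 r1)/=; lra.
- move=> x r p _; rewrite /limH (bigD1 (J k))//= eqxx mul1r mulrC big1 ?addr0// => j jJ.
 by rewrite eq_sym (negbTE jJ) !mul0r mulr0.
- by move=> r _; exists 1.
Qed.

(** The solution operator extended to continuous paths: [v] is close to a genuine solution whose
    driving path is close to [z]. Asking only [rsol] of the approximants admits polygonal and C^1
    paths alike. *)
Definition Lim (z: 'I_M -> R -> R) (v: V -> R -> R): Prop :=
 forall T e: R, 0<T -> 0<e -> exists v' z', [/\ UCstrip v' 0 T /\ (forall x, v' x 0 = u0 x),
  cont_path z' T, (forall t, 0<=t<T -> rsol H v' z' t),
  (forall j t, 0<=t<=T -> `|z' j t-z j t| <= e) &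
  (forall x t, 0<=t<=T -> `|v' x t-v x t| <= e)].

Lemma Lim_exact z v: (forall T, UCstrip v 0 T) -> (forall x, v x 0 = u0 x) ->
 (forall T, cont_path z T) -> (forall t, 0<=t -> rsol H v z t) -> Lim z v.
Proof using.
move=> uc v0 cz rs T e T0 e0; exists v, z; split => //.
- by move=> t /andP[t0 _]; exact: rs.
- by move=> *; rewrite subrr normr0 ltW.
- by move=> *; rewrite subrr normr0 ltW.
Qed.

Lemma gridU_Lim h J s: 0<h -> Lim (gridz h J s) (gridU Q u0 h J s).
Proof using rf Heven q0.
move=> h0; apply: Lim_exact.
- by move=> T; apply: (gridU_UC rf).
- by move=> x; apply: (gridU0 rf).
- by move=> T; apply: gridz_cont.
- by move=> t; apply: gridU_rsol.
Qed.

Lemma Lim_stab z1 z2 v1 v2 (T w L h: R): Lim z1 v1 -> Lim z2 v2 -> 0<T -> 0<=L -> 0<=h ->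
 (forall x y, u0 x-u0 y<=w+L*enorm (x-y)) ->
 (forall j t, 0<=t<=T -> `|z1 j t-z2 j t| <= h) ->
 forall x t, 0<=t<=T -> `|v1 x t-v2 x t| <= w+C*L*M%:R*(2*h).
Proof using C0 sl.
move=> l1 l2 T0 L0 h0 wL zh x t tT; set K:= C*L*M%:R; have K0: 0<=K by rewrite !mulr_ge0.
apply/ler_addgt0Pr => e e0; pose e':= e/(2+4*K).
have D0: 0<2+4*K by lra.
have e'0: 0<e' by rewrite divr_gt0.
have [v1' [z1' [[uc1 i1] c1 r1 hz1 hv1]]]:= l1 T e' T0 e'0.
have [v2' [z2' [[uc2 i2] c2 r2 hz2 hv2]]]:= l2 T e' T0 e'0.
have zz j r: 0<=r<=T -> `|z1' j r-z2' j r| <= h+2*e'.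
 move=> rT; have:= hz1 j r rT; have:= hz2 j r rT; have:= zh j r rT.
 rewrite !ler_norml => /andP[? ?] /andP[? ?] /andP[? ?]; apply/andP; split; lra.
have zz' j r: 0<=r<=T -> `|z2' j r-z1' j r| <= h+2*e' by rewrite distrC; exact: zz.
have h'0: 0<=h+2*e' by rewrite addr_ge0// mulr_ge0// ltW.
have s1:= stability C0 sl (ltW T0) h'0 L0 uc1 uc2 i1 i2 wL c1 c2 r1 r2 zz x tT.
have s2:= stability C0 sl (ltW T0) h'0 L0 uc2 uc1 i2 i1 wL c2 c1 r2 r1 zz' x tT.
have E: e = (2+4*K)*e' by rewrite /e' mulrC mulfVK// gt_eqF.
have:= hv1 x t tT; have:= hv2 x t tT; move: s1 s2; rewrite -/K E !ler_norml.
have -> : K*(2*(h+2*e')) = K*(2*h)+4*K*e' by ring.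
by move=> s1 s2 /andP[? ?] /andP[? ?]; apply/andP; split; lra.
Qed.

Lemma Lim_eq z v1 v2 x t: Lim z v1 -> Lim z v2 -> 0<=t -> v1 x t = v2 x t.
Proof using C0 sl q0.
move=> l1 l2 t0; apply/eqP; rewrite -subr_eq0 -normr_le0; apply/ler_addgt0Pr => e e0; rewrite add0r.
have [L L0 hL]:= q0 e0; have t1: 0<t+1 by rewrite ltr_wpDl.
have:= @Lim_stab z z v1 v2 (t+1) e L 0 l1 l2 t1 L0 (lexx _) hL _ x t _.
by rewrite !mulr0 addr0; apply=> [j r _|]; rewrite ?subrr ?normr0// t0/= lerDl.
Qed.

Lemma Lim_UC z v T: Lim z v -> UCstrip v 0 T.
Proof using.
move=> l e e0; have e4: 0<e/4 by rewrite divr_gt0.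
have T1: 0<Num.max T 0+1 by rewrite ltr_wpDl// le_max lexx orbT.
have [v' [z' [[uc _] _ _ _ hv]]]:= l _ _ T1 e4.
have [del d0 hd]:= uc _ e4; exists del => // x y s t /andP[s0 sT] /andP[t0 tT] xy st.
have TT r: r<=T -> r<=Num.max T 0+1.
 by move=> /le_trans; apply; apply: (@le_trans _ _ (Num.max T 0)); rewrite ?le_max ?lexx// lerDl.
have sI: 0<=s<=Num.max T 0+1 by rewrite s0 TT.
have tI: 0<=t<=Num.max T 0+1 by rewrite t0 TT.
have:= hv x s sI; have:= hv y t tI; have:= hd x y s t sI tI xy st.
rewrite !ler_norml !ltr_norml => /andP[? ?] /andP[? ?] /andP[? ?]; apply/andP; split; lra.
Qed.

(** The approximants at precision 1/(n+1) on [0, n+1] are uniformly Cauchy by [Lim_stab], with a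
    modulus that comes from [u0] alone. *)
Lemma Lim_ex (z: 'I_M -> R -> R): (forall T e: R, 0<T -> 0<e -> exists v' z',
 Lim z' v' /\ forall j t, 0<=t<=T -> `|z' j t-z j t| <= e) -> exists v, Lim z v.
Proof using C0 sl q0.
move=> ap; have ex (n: nat): exists vz: (V -> R -> R)*('I_M -> R -> R), Lim vz.2 vz.1 /\
  forall j t, 0<=t<=n.+1%:R -> `|vz.2 j t-z j t| <= n.+1%:R^-1.
 have n0: 0<n.+1%:R :> R by rewrite ltr0n.
 by have [v' [z' hh]]:= ap n.+1%:R n.+1%:R^-1 n0 (ltac:(by rewrite invr_gt0)); exists (v', z').
have [vz vzP]:= choice ex; pose vn n:= (vz n).1; pose zn n:= (vz n).2.
have cau (T e: R): 0<e -> exists N: nat, T<=N%:R /\ forall n m, (N<=n)%N -> (N<=m)%N -> forall x t, 0<=t<=T ->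
  `|vn n x t-vn m x t| <= e.
 move=> e0; have e2: 0<e/2 by rewrite divr_gt0.
 have [L L0 hL]:= q0 e2; set K:= C*L*M%:R; have K0: 0<=K by rewrite !mulr_ge0.
 pose N:= (Num.truncn (T+8*K/e)).+1; have [_ N1]:= (I, truncnS_gt (T+8*K/e)); rewrite -/N in N1.
 have [T0|T0]:= ltP T 0.
  exists 0%N; split; first exact: ltW. move=> n m _ _ x t /andP[t0 tT]; lra.
 have X0: 0<=8*K/e by rewrite divr_ge0 ?mulr_ge0// ltW.
 have TN: T<=N%:R by lra.
 have NK: 8*K/e<N%:R by lra.
 have N0: 0<N%:R :> R by rewrite ltr0n.
 exists N; split => // n m Nn Nm x t tT.
 have iN (k: nat): (N<=k)%N -> k.+1%:R^-1<=N%:R^-1 :> R.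
  by move=> Nk; rewrite lef_pV2 ?posrE ?ltr0n// ler_nat ltnW.
 have TT: 0<N%:R :> R by [].
 have zz j r: 0<=r<=N%:R -> `|zn n j r-zn m j r| <= 2*N%:R^-1.
  have le (k: nat): (N<=k)%N -> N%:R<=k.+1%:R :> R by move=> Nk; rewrite ler_nat ltnW.
  move=> /andP[r0 rN]; have [_ /(_ j r)a1]:= vzP n; have [_ /(_ j r)a2]:= vzP m.
  move: a1 a2; rewrite r0 !(le_trans rN (le _ _))//= => /(_ isT)a1 /(_ isT)a2.
  move: (le_trans a1 (iN _ Nn)) (le_trans a2 (iN _ Nm)); rewrite /zn; move: N%:R^-1 => q.
  rewrite !ler_norml => /andP[? ?] /andP[? ?]; apply/andP; split; lra.
 have z0: 0<=2*N%:R^-1 :> R by rewrite mulr_ge0.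
 have tN: 0<=t<=N%:R by case/andP: tT => -> /le_trans; apply.
 have:= Lim_stab (vzP n).1 (vzP m).1 TT L0 z0 hL zz x tN; rewrite -/K => /le_trans; apply.
 have: K*(2*(2*N%:R^-1))<=e/2; last by lra.
 have -> : K*(2*(2*N%:R^-1)) = (4*K)/N%:R by ring.
 by rewrite ler_pdivrMr//; move: NK; rewrite ltr_pdivrMr//; lra.
have cv x t: 0<=t -> cvg (vn n x t @[n --> \oo]).
 move=> t0; apply/cauchy_cvgP/cauchyP => e e0; have [N [_ hN]]:= cau t _ (divr_gt0 e0 (ltr0Sn R 1)).
 exists (vn N x t); exists N => // n /= Nn; rewrite /ball/= /ball_.
 by apply: le_lt_trans (hN N n _ _ x t _) _; rewrite ?t0 ?lexx//=; lra.
pose v x t:= lim (vn n x t @[n --> \oo]).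
have vv (T e: R): 0<e -> exists N: nat, T<=N%:R /\ forall n, (N<=n)%N -> forall x t, 0<=t<=T ->
  `|vn n x t-v x t| <= e.
 move=> e0; have [N [TN hN]]:= cau T _ (divr_gt0 e0 (ltr0Sn R 1)); exists N; split => // n Nn x t tT.
 have t0: 0<=t by case/andP: tT.
 have /cvgrPdist_lt/(_ _ (divr_gt0 e0 (ltr0Sn R 1)))[N' _ hN']:= cv x t t0.
 have:= hN' (maxn N N') (leq_maxr _ _); have:= hN n (maxn N N') Nn (leq_maxl _ _) x t tT; rewrite /= -/(v x t).
 rewrite !ler_norml ltr_norml => /andP[? ?] /andP[? ?]; apply/andP; split; lra.
exists v => T e T0 e0; have e2: 0<e/2 by rewrite divr_gt0.
have [N [TN hN]]:= vv T _ e2.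
pose n:= maxn N (Num.truncn (e/2)^-1); have nN: (N<=n)%N by exact: leq_maxl.
have n1: n.+1%:R^-1<=e/2.
 rewrite -[leRHS]invrK lef_pV2 ?posrE ?invr_gt0 ?ltr0n//; apply: ltW; apply: lt_le_trans (truncnS_gt _) _.
 by rewrite ler_nat ltnS leq_maxr.
have [ln hz]:= vzP n; have [v' [z' [uci c r hz' hv']]]:= ln T _ T0 e2.
exists v', z'; split => // [j t tT|x t tT].
 have tn: 0<=t<=n.+1%:R.
  by case/andP: tT => -> tT/=; rewrite (le_trans tT)// (le_trans TN)// ler_nat ltnW.
 have:= le_trans (hz j t tn) n1; have:= hz' j t tT.
 rewrite !ler_norml => /andP[? ?] /andP[? ?]; apply/andP; split; lra.
have:= hN n nN x t tT; have:= hv' x t tT.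
rewrite /vn !ler_norml => /andP[? ?] /andP[? ?]; apply/andP; split; lra.
Qed.

Lemma Lim_exists z: (0<M)%N -> (forall T, cont_path z T) -> (forall j, z j 0 = 0) -> exists v, Lim z v.
Proof using C0 sl rf Heven q0.
move=> M0 cz z0; apply: Lim_ex => T e T0 e0; have [h [J [s [h0 hh]]]]:= stair M0 T0 e0 cz z0.
by exists (gridU Q u0 h J s), (gridz h J s); split => //; exact: gridU_Lim.
Qed.

End Limits.
End GridSolutions.

(** * Limits are stochastic viscosity solutions *)

Lemma UCall_cont (R: realType) (d: nat) (u: 'rV[R]_d -> R -> R) :
 (forall T, UCstrip u 0 T) -> cont_on_half u.
Proof.
move=> uc; apply/subspace_continuousP => -[x t] /= t0; apply/cvgrPdist_lt => e e0.
have [del d0 h]:= uc (t+1) e e0; rewrite near_withinE; apply/near_enorm2.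
exists (Num.min del 1); first by rewrite lt_min d0 ltr01.
move=> y s; rewrite !lt_min /= => /andP[yx _] /andP[st s1] s0; apply: h.
- by apply/andP; split; [exact: t0|rewrite /= lerDl ler01].
- by rewrite /= s0/=; have:= ler_norm (s-t); lra.
- by rewrite enormBC.
- by rewrite distrC.
Qed.

Lemma uc_class_UC (R: realType) (d: nat) (u0: 'rV[R]_d -> R) u: uc_class u0 u -> forall T, UCstrip u 0 T.
Proof.
move=> [_ [_ h]] T; have T1: 0<Num.max T 0+1 by rewrite ltr_wpDl// le_max lexx orbT.
apply: (UCstrip_sub (lexx 0) _ (h _ T1)); apply: (@le_trans _ _ (Num.max T 0)); last by rewrite lerDl.
by rewrite le_max lexx.
Qed.

Lemma has_expZ (R: realType) (f f': R -> R) k: has_exp f f' -> has_exp (fun t => k*f t) (fun t => k*f' t).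
Proof.
move=> h t e e0; have k1: 0 < `|k| + 1 by rewrite ltr_wpDl.
have [r r0 hr]:= h t _ (divr_gt0 e0 k1); exists r => // s st.
have -> : k*f s-k*f t-k*f' t*(s-t) = k*(f s-f t-f' t*(s-t)) by ring.
rewrite normrM; apply: (@le_trans _ _ (`|k| * (e/(`|k| + 1) * `|s-t|))).
 by rewrite ler_wpM2l// hr.
have -> : `|k| * (e/(`|k| + 1) * `|s-t|) = `|k| / (`|k| + 1)*(e * `|s-t|) by ring.
by rewrite ler_piMl ?mulr_ge0 ?(ltW e0)// ler_pdivrMr// mul1r lerDl.
Qed.

Section StochasticSolution.
Variables (R: realType) (d M: nat) (H: 'I_M -> 'rV[R]_d -> R) (C: R).
Hypotheses (C0: 0<=C) (sl: forall j, sublinear (H j) C).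
Local Notation V:= 'rV[R]_d.

(** Homogeneity of degree 1 recovers [H j p] from its value on the sphere; at [p = 0] both sides
    vanish. *)
Lemma limit_HE kap (z: 'I_M -> R -> R) x t p :
 limit_H (fun e j => kap*H j e) z x t p = limH H (fun j t => kap*derive1 (z j) t) x t p.
Proof using sl.
rewrite /limit_H /limH; apply: eq_bigr => j _; have [p0|p0]:= eqVneq (enorm p) 0.
 rewrite p0 mulr0 mul0r; have:= sl_le (sl j) p; rewrite p0 mulr0 => h.
 have -> : H j p = 0 by apply/eqP; rewrite eq_le h (sl_ge0 (sl j)).
 by rewrite mul0r.
have -> : H j p = enorm p*H j ((enorm p)^-1 *: p).
 by rewrite -(sl_scale (sl j))// scalerA mulfV// scale1r.
by ring.
Qed.

Lemma sublinear_sphere_cont kap j: {within [set e: V | enorm e = 1], continuous (fun e => kap*H j e)}.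
Proof using C0 sl.
apply: continuous_subspaceT => x; apply/cont_enormP => e e0.
have K0: 0 < `|kap| * C+1 by rewrite ltr_wpDl// mulr_ge0.
exists (e/(`|kap| * C+1)); first by rewrite divr_gt0.
move=> y; rewrite ltr_pdivlMr// -mulrBr normrM => yx.
have h:= ler_wpM2l (normr_ge0 kap) (sl_lip sl j y x).
by have:= enorm_ge0 (y-x); nra.
Qed.

Lemma Lim_stoch kap u0 z v: qlip u0 -> Lim H u0 (fun j t => kap*z j t) v ->
 stoch_visc_sol (fun e j => kap*H j e) u0 z v.
Proof using C0 sl.
move=> q0 lv zn vn c1 cv hv.
have ln n: Lim H u0 (fun j t => kap*zn n j t) (vn n).
 have [uc vs]:= hv n; have C1z: C1p (fun j t => kap*zn n j t) (fun j t => kap*derive1 (zn n j) t).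
  move=> j; have [dz cz]:= c1 n j; split; first exact/has_expZ/derivable_exp.
  by move=> t; apply: cvgMr; exact: cz.
 apply: Lim_exact.
 - exact: uc_class_UC uc.
 - exact: uc.2.1.
 - move=> T j t e _ e0; have [he _]:= C1z j; have hec:= has_exp_cont he.
  have /cvgrPdist_lt/(_ _ e0)/nbhs_normP[r /= r0 rP]:= hec t; exists r => // s _ st.
  by rewrite distrC; apply: rP; rewrite /= distrC.
 - move=> t t0; exists 1, (fun j t => kap*zn n j t), (fun j t => kap*derive1 (zn n j) t).
  split => //; apply: visc_sol_ext vs.
  + by move=> s /= /andP[ts _]; exact: le_lt_trans ts.
  + by move=> x s p _; exact: limit_HE.
  + by move=> s _; exists 1.
move=> r e r0 e0; have e2: 0<e/4 by rewrite divr_gt0.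
have [L L0 hL]:= q0 _ e2; set K:= C*L*M%:R; have K0: 0<=K by rewrite !mulr_ge0.
pose h:= e/(8*(K+1)); have h0: 0<h by rewrite divr_gt0// mulr_gt0// ltr_wpDl.
have k1: 0 < `|kap| + 1 by rewrite ltr_wpDl.
have [N hN]:= cv r _ r0 (divr_gt0 h0 k1).
exists N => n Nn x t _ tr.
have:= @Lim_stab _ _ _ _ _ C0 sl _ _ _ _ _ r (e/4) L h (ln n) lv r0 L0 (ltW h0) hL _ x t tr; rewrite -/K.
move=> /(_ _)/le_lt_trans; apply.
 move=> j s sr; rewrite -mulrBr normrM; have:= hN n Nn j s sr; rewrite ltr_pdivlMr// => q.
 by have:= normr_ge0 (zn n j s-z j s); nra.
have -> : K*(2*h) = e/4*(K/(K+1)) by rewrite /h; field; rewrite gt_eqF// ltr_wpDl.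
have: K/(K+1)<=1 by rewrite ler_pdivrMr ?ltr_wpDl// mul1r lerDl.
by move: (K/(K+1)) => q q1; nra.
Qed.
End StochasticSolution.

(** * Dependence of solutions on the speeds *)

Section SpeedContinuity.
Variables (R: realType) (d: nat).
Local Notation V:= 'rV[R]_d.

(** Within each open cell the speed does not depend on time; uniform continuity alone carries the
    solution across the grid times. *)
Definition cell_sol (h: R) (c: nat -> V -> R) (u0: V -> R) (u: V -> R -> R): Prop :=
 [/\ forall T, UCstrip u 0 T, forall x, u x 0 = u0 x &
   forall k: nat, visc_sol (fun x t p => c k x*enorm p) u [set t | k%:R*h<t<k.+1%:R*h]].

Lemma cell_sol_step (h: R) (c1 c2: V -> R) u1 u2 (k: nat) (La A eta w L: R) :
 0<h -> (forall T, UCstrip u1 0 T) -> (forall T, UCstrip u2 0 T) ->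
 visc_sol (fun x t p => c1 x*enorm p) u1 [set t | k%:R*h<t<k.+1%:R*h] ->
 visc_sol (fun x t p => c2 x*enorm p) u2 [set t | k%:R*h<t<k.+1%:R*h] ->
 0<=La -> 0<=A -> 0<=eta -> 0<=L ->
 (forall x y, `|c1 x-c1 y| <= La*enorm (x-y)) -> (forall x, `|c1 x| <= A) ->
 (forall x, `|c1 x-c2 x| <= eta) ->
 (forall x y, u1 x (k%:R*h)-u2 y (k%:R*h)<=w+L*enorm (x-y) /\
       u2 x (k%:R*h)-u1 y (k%:R*h)<=w+L*enorm (x-y)) ->
 let L':= L*expR (La*h) in
 forall x y t, k%:R*h<=t<=k.+1%:R*h ->
 u1 x t-u2 y t<=w+eta*L'*h+L'*enorm (x-y) /\
 u2 x t-u1 y t<=w+eta*L'*h+L'*enorm (x-y).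
Proof.
move=> h0 uc1 uc2 vs1 vs2 La0 A0 eta0 L0 lip bd cc init L' x y t tI.
have kh: k.+1%:R*h-k%:R*h = h by rewrite -mulrBl -natrB// subSnn mul1r.
have k1: k%:R*h<k.+1%:R*h by rewrite ltr_pM2r// ltr_nat.
have kh0: 0<=k%:R*h by rewrite mulr_ge0// ltW.
have s1 (T: R): UCstrip u1 (k%:R*h) T by exact: (UCstrip_sub kh0 (lexx T) (uc1 T)).
have s2 (T: R): UCstrip u2 (k%:R*h) T by exact: (UCstrip_sub kh0 (lexx T) (uc2 T)).
have sN (u: V -> R -> R) (T: R): UCstrip u (k%:R*h) T -> UCstrip (fun x t => - u x t) (k%:R*h) T.
 move=> uc e /uc[del d0 hd]; exists del => // a b s r *.
 by rewrite -opprD normrN; apply: hd.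
have vN (c: V -> R) (u: V -> R -> R): visc_sol (fun x t p => c x*enorm p) u [set t | k%:R*h<t<k.+1%:R*h] ->
  visc_sol (fun x t p => - c x*enorm p) (fun x t => - u x t) [set t | k%:R*h<t<k.+1%:R*h].
 move=> /visc_solN; apply: visc_sol_ext => //; first by move=> a r p _; rewrite enormN mulNr.
 by move=> r _; exists 1.
split.
 have:= @speed_comparison _ _ c1 c2 u1 u2 _ _ La A eta w L k1 (s1 _) (s2 _) (visc_sol_sub vs1)
  (visc_sol_super vs2) La0 A0 eta0 L0 lip bd cc (fun x y => (init x y).1) x y t tI.
 by rewrite kh.
have a1 a b: `|- c1 a - - c1 b| <= La*enorm (a-b) by rewrite -opprD normrN.
have a2 a: `|- c1 a| <= A by rewrite normrN.
have a3 a: `|- c1 a - - c2 a| <= eta by rewrite -opprD normrN.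
have a4 a b: - u1 a (k%:R*h) - - u2 b (k%:R*h)<=w+L*enorm (a-b).
 by rewrite opprK addrC enormBC; have [_]:= init b a.
have:= speed_comparison k1 (sN _ (k.+1%:R*h) (s1 (k.+1%:R*h))) (sN _ (k.+1%:R*h) (s2 (k.+1%:R*h))) (visc_sol_sub (vN _ _ vs1))
  (visc_sol_super (vN _ _ vs2)) La0 A0 eta0 L0 a1 a2 a3 a4 y x tI.
by rewrite kh opprK addrC enormBC.
Qed.

(** The induction over cells also carries a bound with some slope [L], as initial data for the next
    cell. Since [del] depends on the Lipschitz constants of the speeds, this serves for fixed [eps]:
    it yields uniqueness, and continuity in the letters. *)
Lemma speed_cont (h: R) (c: nat -> V -> R) (La A: nat -> R) u0 u1: 0<h -> qlip u0 ->
 (forall k, [/\ 0<=La k, 0<=A k, (forall x y, `|c k x-c k y| <= La k*enorm (x-y)) &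
  forall x, `|c k x| <= A k]) -> cell_sol h c u0 u1 ->
 forall (K: nat) (e: R), 0<e -> exists2 del: R, 0<del &
 forall w c2 u02 u2, 0<=w -> cell_sol h c2 u02 u2 -> (forall x, `|u0 x-u02 x| <= w) ->
  (forall k x, (k<K)%N -> `|c k x-c2 k x| <= del) ->
  forall x t, 0<=t<=K%:R*h -> `|u1 x t-u2 x t| <= w+e.
Proof.
move=> h0 q0 hc [uc1 i1 vs1].
suff main (K: nat) (e: R): 0<e -> exists2 del: R, 0<del & exists2 L: R, 0<=L &
 forall w c2 u02 u2, 0<=w -> cell_sol h c2 u02 u2 -> (forall x, `|u0 x-u02 x| <= w) ->
  (forall k x, (k<K)%N -> `|c k x-c2 k x| <= del) ->
  (forall x t, 0<=t<=K%:R*h -> `|u1 x t-u2 x t| <= w+e) /\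
  (forall x y, u1 x (K%:R*h)-u2 y (K%:R*h)<=w+e+L*enorm (x-y) /\
       u2 x (K%:R*h)-u1 y (K%:R*h)<=w+e+L*enorm (x-y)).
 move=> K e e0; have [del d0 [L _ hh]]:= main K e e0; exists del => // w c2 u02 u2 w0 cs uu cc.
 by have []:= hh w c2 u02 u2 w0 cs uu cc.
elim: K e => [|K IH] e e0.
 have [L L0 hL]:= q0 e e0; exists 1 => //; exists L => // w c2 u02 u2 w0 [_ i2 _] uu _.
 rewrite mul0r; split=> [x t|x y].
  rewrite -eq_le => /eqP <-; rewrite i1 i2; apply: le_trans (uu x) _; rewrite lerDl ltW//.
 rewrite !i1 !i2; have:= hL x y; have:= uu x; have:= uu y.
 by rewrite !ler_norml => /andP[? ?] /andP[? ?] ?; split; lra.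
have e2: 0<e/2 by rewrite divr_gt0.
have [del d0 [L L0 hh]]:= IH _ e2; have [La0 A0 lip bd]:= hc K.
pose L':= L*expR (La K*h); have L'0: 0<=L' by rewrite mulr_ge0// expR_ge0.
have Lh: 0<L'*h+1 by rewrite ltr_wpDl// mulr_ge0// ltW.
pose del':= Num.min del (e/(2*(L'*h+1))).
have d'0: 0<del' by rewrite lt_min d0 divr_gt0// mulr_gt0.
have dd: del'<=del by rewrite ge_min lexx.
exists del' => //; exists L' => // w c2 u02 u2 w0 cs uu cc.
have cc1 k x: (k<K)%N -> `|c k x-c2 k x| <= del.
 by move=> kK; apply: (le_trans (cc k x (leqW kK))).
have [h1 h2]:= hh w c2 u02 u2 w0 cs uu cc1; have [uc2 i2 vs2]:= cs.
have small: del'*L'*h<=e/2.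
 have: del'<=e/(2*(L'*h+1)) by rewrite ge_min lexx orbT.
 rewrite ler_pdivlMr ?mulr_gt0// => a.
 have:= ltW d'0; have: 0<=L'*h by rewrite mulr_ge0// ltW.
 by move: a; rewrite -mulrA; move: (L'*h) => X; nra.
have st:= cell_sol_step h0 uc1 uc2 (vs1 K) (vs2 K) La0 A0 (ltW d'0) L0 lip bd (fun x => cc K x (ltnSn K)) h2.
split.
 move=> x t /andP[t0 tK]; have [tk|tk]:= leP t (K%:R*h).
  by apply: le_trans (h1 x t _) _; rewrite ?t0//; lra.
 have tI: K%:R*h<=t<=K.+1%:R*h by rewrite (ltW tk).
 have [a b]:= st x x t tI; rewrite subrr enorm0 mulr0 addr0 -/L' in a b.
 by rewrite ler_norml; apply/andP; split; lra.
move=> x y; have tI: K%:R*h<=K.+1%:R*h<=K.+1%:R*h by rewrite lexx ler_wpM2r ?ler_nat// ltW.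
by have [a b]:= st x y _ tI; rewrite -/L' in a b; split; lra.
Qed.

Lemma inf_conv (u0: V -> R) (w L: R): 0<=L -> (forall x y, u0 x-u0 y<=w+L*enorm (x-y)) ->
 exists v: V -> R, (forall x y, v x-v y<=L*enorm (x-y)) /\ forall x, `|u0 x-v x| <= w.
Proof.
move=> L0 h; pose S x:= [set u0 y+L*enorm (x-y) | y in [set: V]].
have lb x y: u0 x-w<=u0 y+L*enorm (x-y) by have:= h x y; lra.
have hi x: has_inf (S x).
 by split; [exists (u0 x+L*enorm (x-x)), x|exists (u0 x-w) => _ [y _ <-]].
have le x y: inf (S x)<=u0 y+L*enorm (x-y) by apply: ge_inf; [exact: (hi x).2|exists y].
exists (fun x => inf (S x)); split=> [x y|x].
 rewrite lerBlDr -lerBlDl; apply: lb_le_inf; first exact: (hi y).1.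
 move=> _ [z _ <-]; have:= le x z.
 by have:= ler_wpM2l L0 (enorm_trian y x z); rewrite mulrDr; lra.
have:= le x x; rewrite subrr enorm0 mulr0 addr0.
have: u0 x-w<=inf (S x) by apply: lb_le_inf; [exact: (hi x).1|move=> _ [y _ <-]].
by move=> a b; have:= h x x; rewrite !subrr enorm0 mulr0 addr0 => w0; rewrite ler_norml; apply/andP; split; lra.
Qed.

Lemma lip_qlip (v: V -> R) (L: R): 0<=L -> (forall x y, v x-v y<=L*enorm (x-y)) -> qlip v.
Proof. by move=> L0 h e e0; exists L => // x y; have:= h x y; lra. Qed.

End SpeedContinuity.

(** * Summation of the homogenisation errors *)

Section HomogenizedApproximation.
Variables (R: realType) (d M: nat) (c: 'I_M -> 'rV[R]_d -> R) (cmin cmax Lc: R).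
Local Notation V:= 'rV[R]_d.
Hypotheses (cmin0: 0<cmin) (cl: forall j x, cmin<=c j x) (cu: forall j x, c j x<=cmax).
Hypotheses (Lc0: 0<=Lc) (clip: forall j x y, `|c j x-c j y| <= Lc*enorm (x-y)).
Hypothesis cper: forall j, Zd_periodic (c j).

Definition HB (j: 'I_M): V -> R:= Hb (c j) cmin cmax Lc.
Definition QB (j: 'I_M):= QW (c j) cmin cmax Lc.
Definition QE (eps: R) (j: 'I_M):= reachE (c j) cmax Lc eps.

Lemma HB_sl j: sublinear (HB j) cmax.
Proof using All. exact: (Hb_sublinear cmin0 (cl j) (cu j) Lc0 (clip j) (cper j)). Qed.
Lemma HB_even j p: HB j (- p) = HB j p.
Proof using All. exact: (Hb_even cmin0 (cl j) (cu j) Lc0 (clip j) (cper j)). Qed.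
Lemma QB_rf j: reach_family (QB j) (fun=> HB j) cmax 1.
Proof using All. exact: (QW_rf cmin0 (cl j) (cu j) Lc0 (clip j) (cper j)). Qed.
Lemma QE_rf eps j: 0<eps -> reach_family (QE eps j) (fun x p => c j (eps^-1 *: x)*enorm p) cmax (cmax*(2/cmin)).
Proof using -cper. exact: (reachE_rf cmin0 (cl j) (cu j) Lc0 (clip j)). Qed.

Definition homE (eps L t: R) (T: nat): R :=
 eps*L*(homC d cmin cmax*(t/T%:R+Num.sqrt (t/T%:R)*T%:R+T%:R)).

Lemma hom_sgQ eps (v: V -> R) (L: R) (T: nat) t rho j x: 0<eps -> 0<=L ->
 (forall x y, v x-v y<=L*enorm (x-y)) -> (0<T)%N -> `|rho| <= eps * t ->
 `|sgQ (QE eps j) v rho x-sgQ (QB j) v rho x| <= homE eps L t T.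
Proof using All.
move=> e0 L0 vL T0 rt; have en: eps != 0 by rewrite gt_eqF.
have c0:= cmax0 cmin0 (cl j) (cu j).
have hC: 0<=homC d cmin cmax by exact: (homC_ge0 cmin0 (cl j) (cu j)).
have key v' r: (forall x y, v' x-v' y<=L*enorm (x-y)) -> 0<=r -> r<=eps * t ->
  `|infQ (QE eps j) v' r x-infQ (QB j) v' r x| <= homE eps L t T.
 move=> v'L r0 rr; have t'0: 0<=r/eps by rewrite divr_ge0// ltW.
 have:= hom_step cmin0 (cl j) (cu j) Lc0 (clip j) (cper j) x e0 L0 (lip_qlip L0 v'L) v'L T0 t'0.
 have -> : eps*(r/eps) = r by rewrite mulrC mulfVK.
 move=> /le_trans; apply; rewrite /homE ler_wpM2l ?mulr_ge0 ?(ltW e0)// ler_wpM2l// lerD2r.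
 have tt: r/eps/T%:R<=t/T%:R by rewrite ler_wpM2r ?invr_ge0// ler_pdivrMr// mulrC.
 apply: lerD => //; rewrite ler_wpM2r// ler_sqrt//; apply: le_trans tt; exact: divr_ge0.
rewrite /sgQ; case: (leP 0 rho) => r0; first by apply: key => //; move: rt; rewrite ger0_norm.
rewrite -opprD normrN; apply: key.
- by move=> a b; rewrite opprK addrC enormBC; exact: vL.
- by lra.
- by move: rt; rewrite ltr0_norm.
Qed.

Lemma gridG_contr Q H C C' (v v': V -> R) (J: nat -> 'I_M) s w k x :
 (forall j, reach_family (Q j) (H j) C C') -> qlip v -> qlip v' -> (forall x, `|v x-v' x| <= w) ->
 `|gridG Q v J s k x-gridG Q v' J s k x| <= w.
Proof using.
move=> rf q q' vw; elim: k x => //= k IH x.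
by apply: (sgQ_contr (rf (J k))) => //; exact: (gridG_qlip rf).
Qed.

Lemma gridU_contr Q H C C' (v v': V -> R) h (J: nat -> 'I_M) s w x t :
 (forall j, reach_family (Q j) (H j) C C') -> qlip v -> qlip v' -> (forall x, `|v x-v' x| <= w) ->
 `|gridU Q v h J s x t-gridU Q v' h J s x t| <= w.
Proof using.
move=> rf q q' vw; apply: (sgQ_contr (rf _)); [exact: (gridG_qlip rf)|exact: (gridG_qlip rf)|].
by move=> y; exact: (gridG_contr _ _ _ _ rf).
Qed.

(** The constant 1 in [QB_rf], due to translation invariance, prevents [L] from being multiplied at
    each of the many steps. *)
Lemma gridG_lip (v: V -> R) (L: R) (J: nat -> 'I_M) s k: 0<=L -> (forall x y, v x-v y<=L*enorm (x-y)) ->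
 forall x y, gridG QB v J s k x-gridG QB v J s k y<=L*enorm (x-y).
Proof using All.
move=> L0 vL; elim: k => //= k IH x y.
have IH' a b: gridG QB v J s k a-gridG QB v J s k b<=0+L*enorm (a-b) by rewrite add0r.
by have:= sgQ_mod (QB_rf (J k)) (s k) (lip_qlip L0 IH) L0 IH' x y; rewrite mulr1 add0r.
Qed.

(** At each step the two flows are compared on the homogenised data, which remain [L]-Lipschitz, and
    the true flow, a contraction, transports the earlier errors. *)
Lemma hom_grid eps (v: V -> R) (L: R) (T: nat) t h (J: nat -> 'I_M) s (n: nat): 0<eps -> 0<=L -> 0<h ->
 (forall x y, v x-v y<=L*enorm (x-y)) -> (0<T)%N -> (forall k, `|s k| <= eps * t) ->
 forall x r, 0<=r<=n%:R*h -> `|gridU (QE eps) v h J s x r-gridU QB v h J s x r| <= n.+1%:R*homE eps L t T.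
Proof using All.
move=> e0 L0 h0 vL T0 st; set E:= homE _ _ _ _.
have rfE j:= QE_rf j e0; have ql:= lip_qlip L0 vL.
have E0: 0<=E by apply: le_trans (hom_sgQ (J 0%N) 0 e0 L0 vL T0 (st 0%N)).
have step k rho x: (forall y, `|gridG (QE eps) v J s k y-gridG QB v J s k y| <= k%:R*E) -> `|rho| <= eps * t ->
  `|sgQ (QE eps (J k)) (gridG (QE eps) v J s k) rho x-sgQ (QB (J k)) (gridG QB v J s k) rho x| <= k.+1%:R*E.
 move=> IH rt; have q1:= gridG_qlip rfE J s ql k; have q2:= gridG_qlip QB_rf J s ql k.
 have:= sgQ_contr (rfE (J k)) rho x q1 q2 IH.
 have:= hom_sgQ (J k) x e0 L0 (gridG_lip J s k L0 vL) T0 rt; rewrite -/E => a b.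
 rewrite -natr1 mulrDl mul1r; apply: le_trans _ (lerD b a).
 by rewrite -[X in `|X|](subrKA (sgQ (QE eps (J k)) (gridG QB v J s k) rho x)); exact: ler_normD.
have G k x: `|gridG (QE eps) v J s k x-gridG QB v J s k x| <= k%:R*E.
 by elim: k x => [x|k IH x]; [rewrite /= subrr normr0 mul0r|exact: step].
move=> x r /andP[r0 rn]; have [k kr]:= grid_cell h0 r0; have /andP[k1 k2]:= kr.
rewrite /gridU (grid_trunc h0 kr); apply: (@le_trans _ _ (k.+1%:R*E)).
 apply: step => //; apply: le_trans _ (st k); rewrite normrM normf_div (gtr0_norm h0).
 rewrite ger0_norm ?subr_ge0// mulrAC ler_pdivrMr// ler_wpM2l//.
 by move: k2; rewrite -natr1 mulrDl mul1r; lra.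
rewrite ler_wpM2r// ler_nat ltnS -(ler_nat R).
by have:= le_trans k1 rn; rewrite ler_pM2r.
Qed.

Lemma homE_small (gamma L Tm e: R): 0<gamma<4^-1 -> 0<=L -> 0<=Tm -> 0<e ->
 exists2 eps0: R, 0<eps0 & forall eps, 0<eps -> eps<eps0 -> exists n T: nat,
  [/\ (0<T)%N, Tm<=n%:R*eps `^ (2 * gamma) & n.+1%:R*homE eps L (eps `^ (gamma-1)) T<=e].
Proof using.
move=> /andP[g0 g1] L0 Tm0 e0.
pose K:= (Tm+2)*(5*L * `|homC d cmin cmax|)+1.
have K0: 0<K by rewrite /K ltr_wpDl// mulr_ge0 ?mulr_ge0// addr_ge0.
pose a:= (1-4 * gamma)/3; have a0: 0<a by rewrite /a divr_gt0//; lra.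
pose eps0:= Num.min 1 ((e/K) `^ a^-1).
have q0: 0<(e/K) `^ a^-1 by rewrite powR_gt0// divr_gt0.
exists eps0; first by rewrite lt_min ltr01.
move=> eps ep; rewrite lt_min => /andP[ep1 ep2].
have pp r:= powR_gt0 r ep.
pose h:= eps `^ (2 * gamma); have h0: 0<h by exact: pp.
have le1 r: 0<=r -> eps `^ r<=1.
 by move=> r0; rewrite -(powRr0 eps) ger_powR// ep ltW.
have h1: h<=1 by apply: le1; lra.
pose n:= (Num.truncn (Tm/h)).+1; have n1: Tm/h<n%:R by exact: truncnS_gt.
have n2: n%:R<=Tm/h+1.
 by rewrite /n -natr1 lerD2r; have /andP[]:= truncn_itv (divr_ge0 Tm0 (ltW h0)).
(* [r] is the cube root of the duration eps^(gamma-1); taking [T] next to [r] makes each of the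
   three terms of [homE] of order at most [r^+2]. *)
pose r:= eps `^ ((gamma-1)/3); have r0: 0<r by exact: pp.
have rE: r^+3 = eps `^ (gamma-1).
 by rewrite -powR_mulrn ?(ltW r0)// -powRrM; congr powR; field.
have r1: 1<=r.
 have -> : r = (eps `^ ((1-gamma)/3))^-1.
  by rewrite -powRN; congr powR; rewrite -mulNr opprB.
 by rewrite invf_ge1 ?pp// le1//; lra.
pose T:= (Num.truncn r).+1; have T1: r<T%:R by exact: truncnS_gt.
have T2: T%:R<=r+1.
 by rewrite /T -natr1 lerD2r; have /andP[]:= truncn_itv (ltW r0).
have T0: 0<T%:R :> R by rewrite ltr0n.
exists n, T; split => //; first by rewrite -ler_pdivrMr// ltW.
rewrite /homE -rE.
have q1: r^+3/T%:R<=r^+2.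
 by rewrite ler_pdivrMr// exprSr ler_wpM2l ?sqr_ge0// ltW.
have q2: Num.sqrt (r^+3/T%:R)<=r.
 apply: (@le_trans _ _ (Num.sqrt (r^+2))); first by rewrite ler_sqrt ?sqr_ge0.
 by rewrite sqrtr_sqr ger0_norm// ltW.
have q3: r^+3/T%:R+Num.sqrt (r^+3/T%:R)*T%:R+T%:R<=5*r^+2.
 have: Num.sqrt (r^+3/T%:R)*T%:R<=r*(r+1) by apply: ler_pM => //; rewrite ?sqrtr_ge0// ltW.
 by move: q1; rewrite expr2; nra.
have nh: n.+1%:R<=(Tm+2)/h.
 rewrite -natr1; apply: (@le_trans _ _ (Tm/h+2)); first by lra.
 by rewrite mulrDl lerD2l ler_peMr// invf_ge1.
have q4: 0<=r^+3/T%:R+Num.sqrt (r^+3/T%:R)*T%:R+T%:R.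
 by rewrite !addr_ge0// ?mulr_ge0 ?sqrtr_ge0// ?exprn_ge0 ?invr_ge0// ltW.
have main: eps*r^+2/h = eps `^ a.
 rewrite -{1}(powRr1 (ltW ep)) -powR_mulrn ?(ltW r0)// -powRrM -powRN -!powRD ?(gt_eqF ep) ?implybT//.
 by congr powR; rewrite /a; field.
have ea: eps `^ a<=e/K.
 have -> : e/K = ((e/K) `^ a^-1) `^ a by rewrite -powRrM mulVf ?gt_eqF// powRr1// divr_ge0 ?ltW.
 by rewrite ge0_ler_powR// ?nnegrE ltW.
set X:= _+_+_ in q3 q4 *; set hc:= homC _ _ _.
apply: (@le_trans _ _ ((Tm+2)/h*(eps*L*(`|hc| * (5*r^+2))))).
 apply: (@le_trans _ _ (n.+1%:R*(eps*L*(`|hc| * (5*r^+2))))).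
  rewrite ler_wpM2l// ler_wpM2l ?mulr_ge0 ?(ltW ep)//.
  apply: (@le_trans _ _ (`|hc| * X)); first by rewrite ler_wpM2r// ler_norm.
  by rewrite ler_wpM2l.
 by rewrite ler_wpM2r// !mulr_ge0 ?sqr_ge0 ?(ltW ep) ?(ltW r0).
have -> : (Tm+2)/h*(eps*L*(`|hc| * (5*r^+2))) = (K-1)*(eps*r^+2/h).
 by rewrite /K addrK; ring.
rewrite main; apply: (@le_trans _ _ (K*(e/K))); last by rewrite mulrC mulfVK ?gt_eqF.
apply: ler_pM => //; first by rewrite /K addrK mulr_ge0 ?mulr_ge0// addr_ge0.
 exact: ltW (pp a).
by rewrite lerBlDr lerDl.
Qed.

(** The chain runs from [u] to the true flow of a Lipschitz [v0], to the homogenised flow of [v0],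
    to that of [u0]. The first link rests on the uniqueness of the oscillating problem, the last on
    that of [Lim]. *)
Lemma hom_approx (gamma Tm e: R) u0: 0<gamma<4^-1 -> qlip u0 -> 0<=Tm -> 0<e ->
 exists2 eps0: R, 0<eps0 & forall (eps: R) (J: nat -> 'I_M) (sg: nat -> R) u v, 0<eps -> eps<eps0 ->
 (forall k, `|sg k| <= 1) ->
 cell_sol (eps `^ (2 * gamma)) (fun k x => (eps `^ gamma)^-1*(sg k*c (J k) (eps^-1 *: x))) u0 u ->
 Lim HB u0 (gridz (eps `^ (2 * gamma)) J (fun k => sg k*eps `^ gamma)) v ->
 forall x t, 0<=t<=Tm -> `|u x t-v x t| <= e.
Proof using All.
move=> gI q0 Tm0 e0; have e8: 0<e/8 by rewrite divr_gt0.
have [L L0 hL]:= q0 _ e8; have [v0 [v0L uv0]]:= inf_conv L0 hL.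
have qv0:= lip_qlip L0 v0L.
have [eps0 p0 small]:= homE_small gI L0 Tm0 e8; exists eps0 => // eps J sg u v ep ee sg1 cs lv x t tI.
have [n [T [T0 nT nE]]]:= small _ ep ee.
set h:= eps `^ (2 * gamma) in cs lv nT; set s:= (fun k: nat => sg k*eps `^ gamma) in lv.
have h0: 0<h by exact: powR_gt0.
have g0: 0<eps `^ gamma by exact: powR_gt0.
have sh k: s k/h = (eps `^ gamma)^-1*sg k.
 have -> : h = eps `^ gamma*eps `^ gamma by rewrite /h mulr_natl mulr2n powRD// (gt_eqF ep) implybT.
 by rewrite /s; field; rewrite gt_eqF.
have rfE j:= QE_rf j ep.
have vE: forall x' t', 0<=t' -> v x' t' = gridU QB u0 h J s x' t'.
 move=> x' t' t'0; case/andP: gI => ? ?.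
 have cm:= ltW (cmax0 cmin0 (cl (J 0%N)) (cu (J 0%N))).
 exact: (Lim_eq cm HB_sl q0 x' lv (gridU_Lim QB_rf HB_even q0 J s h0) t'0).
have tn: 0<=t<=n%:R*h by case/andP: tI => -> /le_trans; exact.
have a1: `|gridU (QE eps) v0 h J s x t-gridU QB v0 h J s x t| <= e/8.
 apply: le_trans _ nE; apply: (@hom_grid eps v0 L T _ h J s n ep L0 h0 v0L T0) => // k.
 rewrite /s normrM (gtr0_norm g0) -{2}(powRr1 (ltW ep)) -powRD ?(gt_eqF ep) ?implybT//.
 by rewrite addrC subrK ler_piMl// ltW.
have a2: `|gridU QB v0 h J s x t-v x t| <= e/8.
 rewrite vE; last by case/andP: tI.
 by apply: (gridU_contr _ _ _ _ _ QB_rf) => // y; rewrite distrC.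
pose La (k: nat):= (eps `^ gamma)^-1 * `|sg k| * Lc*eps^-1.
pose A (k: nat):= (eps `^ gamma)^-1 * `|sg k| * cmax.
have ig: 0<=(eps `^ gamma)^-1 by rewrite invr_ge0 ltW.
have hc k: [/\ 0<=La k, 0<=A k, (forall x y, `|(eps `^ gamma)^-1*(sg k*c (J k) (eps^-1 *: x)) -
  (eps `^ gamma)^-1*(sg k*c (J k) (eps^-1 *: y))| <= La k*enorm (x-y)) &
  forall x, `|(eps `^ gamma)^-1*(sg k*c (J k) (eps^-1 *: x))| <= A k].
 have cm:= ltW (cmax0 cmin0 (cl (J k)) (cu (J k))).
 split.
 - by rewrite /La !mulr_ge0// invr_ge0 ltW.
 - by rewrite /A !mulr_ge0.
 - move=> y y'; rewrite -!mulrBr !normrM (ger0_norm ig) /La -!mulrA ler_wpM2l// ler_wpM2l//.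
  apply: le_trans (clip _ _ _) _; rewrite -scalerBr enormZ ger0_norm ?invr_ge0// ltW//.
 - move=> y; rewrite !normrM (ger0_norm ig) /A -mulrA ler_wpM2l// ler_wpM2l//.
  by rewrite ger0_norm ?cu// (le_trans (ltW cmin0)).
(* Used with equal speeds, hence as a uniqueness statement up to the change of initial data. *)
have [del d0 hd]:= speed_cont h0 q0 hc cs n e8.
have csE: cell_sol h (fun k x => (eps `^ gamma)^-1*(sg k*c (J k) (eps^-1 *: x))) v0 (gridU (QE eps) v0 h J s).
 split.
 - exact: (gridU_UC rfE).
 - exact: (gridU0 rfE).
 - move=> k; apply: visc_sol_ext (gridU_visc rfE J s qv0 h0 (k:= k) _).
  + by [].
  + by move=> x' t' p _; rewrite sh; ring.
  + by move=> t' _; exists 1.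
  + by move=> j x' p; rewrite enormN.
have a3:= hd (e/8) _ v0 _ (ltW e8) csE uv0 _ x t tn.
have {}a3: `|u x t-gridU (QE eps) v0 h J s x t| <= e/8+e/8.
 by apply: a3 => k y _; rewrite subrr normr0 ltW.
move: a1 a2 a3; rewrite !ler_norml => /andP[? ?] /andP[? ?] /andP[? ?]; apply/andP; split; lra.
Qed.

End HomogenizedApproximation.


(** * Expectations of bounded measurable functions *)

Local Notation mfunT:= (measurable_fun setT).

Lemma cvg_half (R: realType): (2^-1: R)^+n @[n --> \oo] --> 0.
Proof. by apply: cvg_expr; rewrite ger0_norm ?invr_ge0//; lra. Qed.

Section Expectation.
Variables (R: realType) (dO: measure_display) (Om: measurableType dO) (P: probability Om R).
Implicit Types f g: Om -> R.

Definition bm f: Prop:= mfunT f /\ exists K: R, forall w, `|f w| <= K.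
Definition Ex f: R:= \int[P]_w f w.

Lemma PT: (P: {measure set Om -> \bar R}) setT = 1%E. Proof. exact: probability_setT. Qed.

Lemma bm_meas f: bm f -> mfunT f. Proof. by case. Qed.

Lemma bm_int f: bm f -> P.-integrable setT (EFin \o f).
Proof.
move=> [mf [K hK]]; apply: measurable_bounded_integrable => //; first by rewrite PT ltry.
exists K; split; first exact: num_real.
by move=> r Kr w _; apply: le_trans (hK w) _; exact: ltW.
Qed.

Lemma bm_cst (c: R): bm (fun=> c).
Proof. by split; [exact: measurable_cst|exists `|c|]. Qed.
Lemma bmD f g: bm f -> bm g -> bm (fun w => f w+g w).
Proof.
move=> [mf [K hK]] [mg [L hL]]; split; first exact: measurable_funD.
by exists (K+L) => w; apply: le_trans (ler_normD _ _) _; exact: lerD.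
Qed.
Lemma bmM f g: bm f -> bm g -> bm (fun w => f w * g w).
Proof.
move=> [mf [K hK]] [mg [L hL]]; split; first exact: measurable_funM.
by exists (K*L) => w; rewrite normrM; apply: ler_pM.
Qed.
Lemma bmZ (c: R) f: bm f -> bm (fun w => c*f w).
Proof. by apply: bmM; exact: bm_cst. Qed.
Lemma bmN f: bm f -> bm (fun w => - f w).
Proof. by move=> /(bmZ (-1)); rewrite (_: (fun w => _) = fun w => - f w)//; apply/funext => w; rewrite mulN1r. Qed.
Lemma bmB f g: bm f -> bm g -> bm (fun w => f w-g w).
Proof. by move=> bf /bmN; exact: bmD. Qed.
Lemma bm_norm f: bm f -> bm (fun w => `|f w|).
Proof.
move=> [mf [K hK]]; split; first exact: measurableT_comp.
by exists K => w; rewrite normr_id.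
Qed.
Lemma bm_sum (I: Type) (r: seq I) (p: pred I) (F: I -> Om -> R) :
 (forall i, bm (F i)) -> bm (fun w => \sum_(i <- r | p i) F i w).
Proof.
move=> h; elim: r => [|i r IH].
 by under eq_fun do rewrite big_nil; exact: bm_cst.
under eq_fun do rewrite big_cons; case: (p i) => //; exact: bmD.
Qed.
Lemma bm_prod (I: Type) (r: seq I) (p: pred I) (F: I -> Om -> R) :
 (forall i, bm (F i)) -> bm (fun w => \prod_(i <- r | p i) F i w).
Proof.
move=> h; elim: r => [|i r IH].
 by under eq_fun do rewrite big_nil; exact: bm_cst.
under eq_fun do rewrite big_cons; case: (p i) => //; exact: bmM.
Qed.
Lemma bm_comp (h: R -> R) f (K: R): mfunT h -> (forall x, `|h x| <= K) ->
 mfunT f -> bm (fun w => h (f w)).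
Proof. by move=> mh hK mf; split; [exact: measurableT_comp|exists K]. Qed.
Lemma bm_indic (A: set Om): measurable A -> bm (\1_A).
Proof. by move=> mA; split => //; exists 1 => w; rewrite indicE; case: (_ \in _); rewrite ?normr1 ?normr0. Qed.

Lemma Ex_cst (c: R): Ex (fun=> c) = c.
Proof. by rewrite /Ex Rintegral_cst// PT mulr1. Qed.
Lemma ExD f g: bm f -> bm g -> Ex (fun w => f w+g w) = Ex f+Ex g.
Proof. by move=> bf bg; rewrite /Ex RintegralD//; exact: bm_int. Qed.
Lemma ExB f g: bm f -> bm g -> Ex (fun w => f w-g w) = Ex f-Ex g.
Proof. by move=> bf bg; rewrite /Ex RintegralB//; exact: bm_int. Qed.
Lemma ExZ (c: R) f: bm f -> Ex (fun w => c*f w) = c*Ex f.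
Proof. by move=> bf; rewrite /Ex RintegralZl//; exact: bm_int. Qed.
Lemma Ex_sum (I: Type) (r: seq I) (p: pred I) (F: I -> Om -> R): (forall i, bm (F i)) ->
 Ex (fun w => \sum_(i <- r | p i) F i w) = \sum_(i <- r | p i) Ex (F i).
Proof.
move=> h; elim: r => [|i r IH].
 by under eq_fun do rewrite big_nil; rewrite big_nil Ex_cst.
rewrite big_cons -IH; under eq_fun do rewrite big_cons; case: (p i) => //.
by rewrite ExD//; exact: bm_sum.
Qed.
Lemma le_Ex f g: bm f -> bm g -> (forall w, f w<=g w) -> Ex f<=Ex g.
Proof. by move=> bf bg h; apply: le_Rintegral => //; exact: bm_int. Qed.
Lemma Ex_norm_le f (K: R): bm f -> (forall w, `|f w| <= K) -> `|Ex f| <= K.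
Proof.
move=> bf h; rewrite ler_norml; apply/andP; split.
 by rewrite -(Ex_cst (- K)); apply: le_Ex => // [|w]; [exact: bm_cst|have:= h w; rewrite ler_norml => /andP[]].
by rewrite -(Ex_cst K); apply: le_Ex => // [|w]; [exact: bm_cst|have:= h w; rewrite ler_norml => /andP[]].
Qed.
Lemma Ex_diff_le f g h: bm f -> bm g -> bm h -> (forall w, `|f w-g w| <= h w) -> `|Ex f-Ex g| <= Ex h.
Proof.
move=> bf bg bh fgh; rewrite -ExB// ler_norml; apply/andP; split.
 rewrite -[- Ex h]mulN1r -ExZ//; apply: le_Ex; [exact: bmZ|exact: bmB|].
 by move=> w; have:= fgh w; rewrite ler_norml mulN1r => /andP[].
by apply: le_Ex => //; [exact: bmB|move=> w; have:= fgh w; rewrite ler_norml => /andP[]].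
Qed.
Lemma Ex_E f: bm f -> (\int[P]_w (f w)%:E = (Ex f)%:E)%E.
Proof. by move=> bf; rewrite /Ex /Rintegral fineK//; apply: integrable_fin_num => //; exact: bm_int. Qed.
Lemma Ex_indic (A: set Om): measurable A -> P A = (Ex \1_A)%:E.
Proof. by move=> mA; rewrite -Ex_E ?integral_indic ?setIT//; exact: bm_indic. Qed.
Lemma Ex_ae f g: bm f -> bm g -> {ae P, forall w, f w = g w} -> Ex f = Ex g.
Proof.
move=> bf bg h; apply: EFin_inj; rewrite -!Ex_E//; apply: ae_eq_integral => //.
- exact/measurable_EFinP/bm_meas.
- exact/measurable_EFinP/bm_meas.
- by apply: filterS h => w E _; rewrite E.
Qed.
Lemma Ex_dct (F: nat -> Om -> R) f (K: R): (forall n, mfunT (F n)) -> mfunT f ->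
 (forall n w, `|F n w| <= K) -> {ae P, forall w, F n w @[n --> \oo] --> f w} ->
 Ex (F n) @[n --> \oo] --> Ex f.
Proof.
move=> mF mf FK cv.
have iK: P.-integrable setT (fun=> K%:E) by exact: (bm_int (bm_cst K)).
have bF n: bm (F n) by split => //; exists K.
have bf: P.-integrable setT (EFin \o f) /\ (\int[P]_w (F n w)%:E)%E @[n --> \oo] --> (\int[P]_w (f w)%:E)%E.
 have mE g: mfunT g -> mfunT (fun w => (g w)%:E) by move=> mg; apply/measurable_EFinP.
 have []:= @dominated_convergence _ _ _ P setT measurableT (fun n w => (F n w)%:E) (fun w => (f w)%:E) (fun=> K%:E).
 - by move=> n; exact: mE.
 - exact: mE.
 - apply: filterS cv => w hw _; apply: cvg_EFin hw; exact: nearW.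
 - exact: iK.
 - by apply: aeW => w n _; rewrite /= lee_fin.
 - by [].
have [intf h]:= bf; rewrite /Ex /Rintegral; apply: fine_cvg.
by rewrite fineK//; exact: integrable_fin_num.
Qed.

Lemma measurable_ltset f g: mfunT f -> mfunT g -> measurable [set w | f w<g w].
Proof.
move=> mf mg; have:= measurable_fun_ltr mf mg measurableT (_: measurable [set true]).
by rewrite setTI; apply.
Qed.

Lemma measurable_leset f g: mfunT f -> mfunT g -> measurable [set w | f w<=g w].
Proof.
move=> mf mg; have:= measurable_fun_ler mf mg measurableT (_: measurable [set true]).
by rewrite setTI; apply.
Qed.

Lemma bm_leind f (a: R): mfunT f -> bm (fun w => (f w<=a)%R%:R: R).
Proof.
move=> mf; rewrite (_: (fun w => _) = \1_[set w | f w<=a]); first by apply: bm_indic; exact: measurable_leset.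
apply/funext => w; rewrite indicE; case: (leP (f w) a) => h; first by rewrite mem_set.
by rewrite memNset//=; apply/negP; rewrite -ltNge.
Qed.

Lemma bm_geind f (a: R): mfunT f -> bm (fun w => (a <= `|f w|)%R%:R: R).
Proof.
move=> mf; rewrite (_: (fun w => _) = fun w => (- `|f w| <= - a)%R%:R: R); last by apply/funext => w; rewrite lerN2.
by apply: bm_leind; apply: measurableT_comp => //; apply: measurableT_comp.
Qed.

(** The preimage of an open ray is a union of boxes with rational centres and sizes in finitely many
    of the [X i], and there are countably many such boxes. *)
Lemma measurable_countable (I: countType) (X: I -> Om -> R) (Phi: Om -> R) :
 (forall i, mfunT (X i)) ->
 (forall w (e: R), 0<e -> exists (s: seq I) (del: R), 0<del /\
  forall w', (forall i, i \in s -> `|X i w'-X i w| < del) -> `|Phi w'-Phi w| < e) ->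
 mfunT Phi.
Proof.
move=> mX loc _; apply: (measurability _ (RGenOInfty.measurableE R)) => //.
move=> _ [_ [a ->] <-]; rewrite setTI.
pose box (k: seq (I*rat)*rat):= [set w | all (fun iq => `|X iq.1 w-ratr iq.2| < ratr k.2) k.1].
have mbox k: measurable (box k).
 rewrite /box; case: k => s q /=; elim: s => [|[i r] s IH] /=.
  by rewrite (_: [set _ | _] = setT)//; apply/seteqP; split.
 rewrite (_: [set _ | _] = [set w | `|X i w-ratr r| < ratr q] `&` [set w | all (fun iq => `|X iq.1 w-ratr iq.2| < ratr q) s]).
  apply: measurableI => //; apply: measurable_ltset => //.
  by apply: measurableT_comp => //; exact: measurable_funB.
 by apply/seteqP; split=> w /= => [/andP[]//|[-> ->]].
rewrite (_: Phi @^-1` _ = \bigcup_(k in [set k | box k `<=` Phi @^-1` `]a, +oo[]) box k); last first.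
 apply/seteqP; split=> [w /=|w [k hk]]; last exact: hk.
 rewrite in_itv/= andbT => aw; have [s [del [d0 hd]]]:= loc w (Phi w-a) (ltac:(by rewrite subr_gt0)).
 have [q]:= rat_in_itvoo (divr_gt0 d0 (ltr0Sn R 1)); rewrite in_itv/= => /andP[q1 q2].
 have ex i: exists r: rat, `|X i w-ratr r| < ratr q.
  have [r]:= @rat_in_itvoo R (X i w-ratr q) (X i w+ratr q) (ltac:(lra)).
  by rewrite in_itv/= => /andP[? ?]; exists r; rewrite ltr_norml; apply/andP; split; lra.
 have [r hr]:= choice ex.
 exists ([seq (i, r i) | i <- s], q); last first.
  by rewrite /box/= all_map; apply/allP => i _ /=; exact: hr.
 move=> w' /= /allP hw'; rewrite in_itv/= andbT.
 have: `|Phi w'-Phi w| < Phi w-a.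
  apply: hd => i si; have:= hw' (i, r i) (map_f (fun i => (i, r i)) si); have:= hr i; rewrite /=.
  by rewrite !ltr_norml => /andP[? ?] /andP[? ?]; apply/andP; split; lra.
 by rewrite ltr_norml => /andP[? ?]; lra.
rewrite bigcup_mkcond; apply: countable_bigcupT_measurable => // k.
by case: ifP.
Qed.

End Expectation.

(** * Independence of the letters *)

Section Letters.
Variables (R: realType) (m: nat) (dO: measure_display) (Om: measurableType dO) (P: probability Om R).
Variable xi: nat -> 'I_m -> Om -> R.
Hypothesis mxi: forall k i, mfunT (xi k i).
Hypothesis Pxi: forall (n: nat) (y: nat -> 'I_m -> R), (forall k i, y k i = 1 \/ y k i = -1) ->
  P [set w | forall k i, (k<=n)%N -> xi k i w = y k i] = ((2^-1)^+(m*n.+1))%:E.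

Definition letter: finType:= {ffun 'I_m -> bool}.
Definition sgb (b: bool): R:= if b then 1 else -1.
Definition lett (k: nat) (w: Om): letter:= [ffun i => xi k i w == 1].
Definition avg (g: letter -> R): R:= (2^-1)^+m*\sum_l g l.
Definition goodxi (w: Om): Prop:= forall k i, xi k i w = sgb (lett k w i).

Lemma sgb_norm b: `|sgb b| = 1. Proof. by case: b; rewrite /= ?normrN normr1. Qed.

Lemma card_letter: (#|{: letter}|)%:R = 2^+m :> R.
Proof. by rewrite card_ffun card_bool card_ord natrX. Qed.

Definition cyl n (f: {ffun 'I_n.+1 -> letter}): set Om :=
 [set w | forall k i, (k<=n)%N -> xi k i w = sgb (f (inord k) i)].

Lemma measurable_cyl n f: measurable (@cyl n f).
Proof using mxi.
rewrite (_: cyl f = [set w | \sum_(k<n.+1) \sum_i (xi k i w-sgb (f k i))^+2<=0]).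
 apply: measurable_leset => //; apply: measurable_sum => k; apply: measurable_sum => i.
 by under eq_fun do rewrite expr2; apply: measurable_funM; exact: measurable_funB.
have ge0 (k: 'I_n.+1) w: 0<=\sum_i (xi k i w-sgb (f k i))^+2 by apply: sumr_ge0 => i _; exact: sqr_ge0.
apply/seteqP; split=> w /= h.
 by rewrite big1// => k _; rewrite big1// => i _; rewrite h -1?ltnS// inord_val subrr expr0n.
move=> k i; rewrite -ltnS => kn; have: \sum_(k<n.+1) \sum_i (xi k i w-sgb (f k i))^+2 = 0.
 by apply/eqP; rewrite eq_le h sumr_ge0// => k' _; exact: ge0.
move=> /eqP; rewrite psumr_eq0 => [|k' _]; last exact: ge0.
move=> /allP/(_ (Ordinal kn) (mem_index_enum _))/=.
rewrite psumr_eq0 => [|i' _]; last exact: sqr_ge0.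
move=> /allP/(_ i (mem_index_enum _))/=; rewrite sqrf_eq0 subr_eq0 => /eqP ->.
by congr (sgb (f _ _)); apply: val_inj; rewrite /= inordK.
Qed.

Lemma P_cyl n f: Ex P (\1_(@cyl n f)) = (2^-1)^+(m*n.+1).
Proof using mxi Pxi.
apply: EFin_inj; rewrite -Ex_indic; last exact: measurable_cyl.
by apply: Pxi => k i; case: (f _ _); [left|right].
Qed.

Lemma cyl_lett n f w: @cyl n f w -> f = [ffun k => lett (val k) w].
Proof using.
move=> h; apply/ffunP => k; rewrite ffunE; apply/ffunP => i; rewrite ffunE.
rewrite h -1?ltnS ?ltn_ord// inord_val; case: (f k i); first by rewrite /= eqxx.
by apply/esym/negbTE/eqP => e; move: e; rewrite /= ; lra.
Qed.

Lemma cyl_sum n w (G: {ffun 'I_n.+1 -> letter} -> R) :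
 \sum_f G f*\1_(cyl f) w = G [ffun k => lett (val k) w]*\1_(cyl [ffun k: 'I_n.+1 => lett (val k) w]) w.
Proof using.
rewrite (bigD1 [ffun k => lett (val k) w])//= big1 ?addr0// => f fl.
rewrite indicE memNset ?mulr0// => cf; move: fl; rewrite {1}(cyl_lett cf) eqxx//.
Qed.

(** The cylinders of a given length are disjoint and their probabilities add up to 1, so almost
    every point lies in one of them. *)
Lemma good_ae: {ae P, forall w, goodxi w}.
Proof using mxi Pxi.
suff h n: {ae P, forall w, cyl [ffun k: 'I_n.+1 => lett (val k) w] w}.
 have:= ae_foralln h; apply: filterS => w hw k i; rewrite (hw k k i)//.
 by rewrite ffunE /= inordK.
pose F (w: Om): R:= 1-\sum_(f: {ffun 'I_n.+1 -> letter}) 1*\1_(cyl f) w.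
have bi0 f: bm (\1_(@cyl n f): Om -> R) by apply/bm_indic/measurable_cyl.
have bi f: bm (R:= R) (fun w => 1*\1_(@cyl n f) w) by apply/bmZ/bm_indic/measurable_cyl.
have bF: bm F by apply: bmB; [exact: bm_cst|exact: bm_sum].
have F0 w: 0<=F w.
 by rewrite /F cyl_sum mul1r indicE; case: (_ \in _); rewrite ?subrr ?subr0.
have EF: Ex P F = 0.
 rewrite /F ExB ?Ex_cst ?Ex_sum//; [|exact: bm_cst|exact: bm_sum].
 under eq_bigr => f _ do rewrite (ExZ P 1 (bi0 f)) P_cyl mul1r.
 rewrite sumr_const card_ffun card_ord -[X in X *+ _]mulr1 -mulrnAr.
 rewrite natrX card_letter -exprM -exprMn mulVf// expr1n subrr//.
have: ae_eq P setT (fun w => (F w)%:E) (cst 0%E).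
 apply/ae_eq_integral_abs => //; first exact/measurable_EFinP/bm_meas.
 under eq_integral do rewrite /= ger0_norm//.
 by rewrite (Ex_E P bF) EF.
apply: filterS => w /(_ I) h; move: (EFin_inj h); rewrite /F cyl_sum mul1r indicE.
case: (boolP (w \in _)) => [|_]; first by rewrite inE.
by rewrite subr0 => /eqP; rewrite oner_eq0.
Qed.

Lemma bm_letter k (g: letter -> R): bm (fun w => g (lett k w)).
Proof using mxi.
rewrite (_: (fun w => _) = fun w => \sum_l g l*\prod_i (if l i then \1_[set w | xi k i w = 1] w else 1-\1_[set w | xi k i w = 1] w)).
 have mi i: measurable [set w | xi k i w = 1].
  rewrite (_: [set _ | _] = [set w | xi k i w<=1] `&` [set w | 1<=xi k i w]).
   by apply: measurableI; apply: measurable_leset.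
  by apply/seteqP; split=> w /= => [->|[a b]]; [rewrite lexx|apply/eqP; rewrite eq_le a b].
 apply: bm_sum => l; apply: bmZ; apply: bm_prod => i; case: (l i); first exact: bm_indic.
 by apply: bmB; [exact: bm_cst|exact: bm_indic].
apply/funext => w; rewrite (bigD1 (lett k w))//= [X in _ = _+X]big1 => [|l lw].
 rewrite addr0 big1 ?mulr1// => i _; rewrite ffunE indicE; case: eqP => e.
  by rewrite mem_set.
 by rewrite memNset// subr0.
have [i li]: exists i, l i != lett k w i.
 by apply/existsP; rewrite -negb_forall; apply: contra lw => /forallP h; apply/eqP/ffunP => i; apply/eqP.
rewrite [X in g l*X](bigD1 i)//= [X in g l*(X*_)](_: _ = 0) ?mul0r ?mulr0//.
move: li; rewrite ffunE indicE; case: (l i); case: (xi k i w =P 1) => e //= _.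
 by rewrite memNset.
by rewrite mem_set// subrr.
Qed.

Lemma Ex_letters (n: nat) (g: nat -> letter -> R) :
 Ex P (fun w => \prod_(k<n) g k (lett k w)) = \prod_(k<n) avg (g k).
Proof using mxi Pxi.
case: n => [|n]; first by under eq_fun do rewrite big_ord0; rewrite big_ord0 Ex_cst.
have bi0 f: bm (\1_(@cyl n f): Om -> R) by apply/bm_indic/measurable_cyl.
have bi (f: {ffun 'I_n.+1 -> letter}): bm (fun w => (\prod_k g (val k) (f k))*\1_(@cyl n f) w) by apply/bmZ/bm_indic/measurable_cyl.
rewrite (@Ex_ae _ _ _ P _ (fun w => \sum_(f: {ffun 'I_n.+1 -> letter}) (\prod_k g (val k) (f k))*\1_(cyl f) w)).
- rewrite Ex_sum//; under eq_bigr => f _ do rewrite (ExZ P _ (bi0 f)) P_cyl.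
 rewrite -mulr_suml mulrC exprM -(bigA_distr_bigA (fun k: 'I_n.+1 => g (val k))) /avg.
 by rewrite big_split/= prodr_const card_ord.
- by apply: bm_prod => k; exact: bm_letter.
- exact: bm_sum.
- apply: filterS good_ae => w gw; rewrite cyl_sum.
 rewrite indicE mem_set ?mulr1; last by move=> k i kn; rewrite ffunE /= inordK// gw.
 by apply: eq_bigr => k _; rewrite ffunE.
Qed.

Lemma avg_cst (c: R): avg (fun=> c) = c.
Proof using.
by rewrite /avg sumr_const -[c *+ _]mulr_natl card_letter mulrA -exprMn mulVf// expr1n mul1r.
Qed.

Lemma Ex_letters_inj (I: finType) (io: I -> nat) (h: I -> letter -> R): injective io ->
 Ex P (fun w => \prod_i h i (lett (io i) w)) = \prod_i avg (h i).
Proof using mxi Pxi.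
move=> ioI; pose B:= (\max_i io i).+1.
have lt i: (io i<B)%N by rewrite ltnS leq_bigmax.
pose p i: 'I_B:= Ordinal (lt i).
have part (F: I -> R): \prod_i F i = \prod_(j<B) \prod_(i | p i == j) F i.
 by rewrite (partition_big p predT).
under eq_fun => w do rewrite part.
rewrite (_: (fun w => _) = fun w => \prod_(j<B) \prod_(i | io i == j) h i (lett j w)).
 rewrite (Ex_letters B (fun j l => \prod_(i | io i == j) h i l)) part; apply: eq_bigr => j _.
 have [/existsP[i /eqP ij]|no]:= boolP [exists i, io i == j].
  have E i': (io i' == j) = (i' == i) by rewrite -ij (inj_eq ioI).
  rewrite (eq_bigl (fun i' => i' == i)) => [|i']; last by rewrite -E.
  rewrite big_pred1_eq; congr avg; apply/funext => l; rewrite (eq_bigl (fun i' => i' == i)) ?big_pred1_eq//.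
 rewrite big_pred0 => [|i]; last first.
  by apply/negbTE; apply: contra no => pi; apply/existsP; exists i; exact: pi.
 rewrite -[RHS](avg_cst 1); congr avg; apply/funext => l; rewrite big_pred0// => i.
 by apply/negbTE; apply: contra no => pi; apply/existsP; exists i.
apply/funext => w; apply: eq_bigr => j _; apply: eq_big => // i /eqP <-.
by [].
Qed.

End Letters.

(** * Laws determined by rays, and quantile functions *)

Section LawExtension.
Variables (R: realType) (dO: measure_display) (Om: measurableType dO) (P: probability Om R).
Variable mu: probability (measurableTypeR R) R.

Lemma bm_indic_comp (T: measurableType dO) (X: T -> R) (A: set R): measurable A ->
 mfunT X -> bm (fun w => \1_A (X w): R).
Proof. by move=> mA mX; apply: (@bm_comp _ _ _ (\1_A) X 1) => // x; rewrite indicE; case: (_ \in _); rewrite ?normr1 ?normr0. Qed.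

Lemma indic_bigcup_cvg (T: Type) (F: nat -> set T) (x: T): trivIset setT F ->
 (\sum_(k<n) \1_(F k) x: R) @[n --> \oo] --> (\1_(\bigcup_k F k) x: R).
Proof.
move=> tF; have [[k _ Fk]|no]:= pselect ((\bigcup_k F k) x).
 rewrite [X in _ --> X](_: _ = 1); last by rewrite indicE mem_set//; exists k.
 apply: cvg_near_cst; exists k.+1 => // n /= kn.
 rewrite (bigD1 (Ordinal kn))//= big1 ?addr0 => [|i ik]; first by rewrite indicE mem_set.
 rewrite indicE memNset// => Fi; move: ik; rewrite -val_eqE/= => /eqP; apply.
 by apply: (tF i k I I); exists x.
rewrite [X in _ --> X](_: _ = 0); last by rewrite indicE memNset.
apply: cvg_near_cst; apply: nearW => n; rewrite big1// => i _; rewrite indicE memNset// => Fi.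
by apply: no; exists (val i).
Qed.

Lemma indic_sum_norm (T: Type) (F: nat -> set T) (x: T) n: trivIset setT F ->
 `|\sum_(k<n) \1_(F k) x: R| <= 1.
Proof.
move=> tF; have [[k Fk]|no]:= pselect (exists k: 'I_n, F k x).
 rewrite (bigD1 k)//= big1 ?addr0 => [|i ik]; first by rewrite indicE mem_set// normr1.
 rewrite indicE memNset// => Fi; move: ik; rewrite -val_eqE/= => /eqP; apply.
 by apply: (tF i k I I); exists x.
rewrite big1 ?normr0// => i _; rewrite indicE memNset// => Fi; apply: no; by exists i.
Qed.

Lemma law_ext (X: Om -> R) (W: Om -> R) (c: R): mfunT X -> bm W -> Ex P W = c ->
 (forall x, Ex P (fun w => \1_(`]x, +oo[%classic) (X w)*W w) = c*Ex mu (\1_(`]x, +oo[%classic))) ->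
 forall A: set R, measurable A -> Ex P (fun w => \1_A (X w)*W w) = c*Ex mu (\1_A).
Proof.
move=> mX bW EW ray A; rewrite [measurable](RGenOInfty.measurableE R).
have bI (B: set R): measurable B -> bm (fun w => \1_B (X w)*W w).
 by move=> mB; apply: bmM => //; apply: bm_indic_comp.
have bJ (B: set (measurableTypeR R)): measurable B -> bm (\1_B: measurableTypeR R -> R) by exact: bm_indic.
move: A; apply: (@dynkin_induction _ (measurableTypeR R) (@RGenOInfty.G R)
 (fun A => Ex P (fun w => \1_A (X w)*W w) = c*Ex mu (\1_A))).
- exact: RGenOInfty.measurableE.
- move=> _ _ [a ->] [b ->]; exists (Num.max a b); apply/seteqP; split=> x /=; rewrite !in_itv/= !andbT gt_max.
  by move=> [-> ->].
 by move=> /andP[].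
- rewrite indicT Ex_cst mulr1 -EW; congr Ex; apply/funext => w; rewrite mul1r//.
- by move=> _ [x ->]; exact: ray.
- move=> B mB hB; have E1 (x: R): \1_(~` B) x = 1-\1_B x :> R by rewrite !indicE in_setC; case: (_ \in _); rewrite ?subrr ?subr0.
 rewrite (_: (fun w => _) = fun w => W w-\1_B (X w)*W w); last first.
  by apply/funext => w; rewrite E1 mulrBl mul1r.
 rewrite ExB//; last exact: bI.
 rewrite (_: \1_(~` B) = fun x => 1-\1_B x); last by apply/funext => x; exact: E1.
 by rewrite ExB ?Ex_cst ?hB ?mulrBr ?mulr1 ?EW//; [exact: bm_cst|exact: bJ].
- move=> F mF tF hF.
 have c1: Ex P (fun w => (\sum_(k<n) \1_(F k) (X w))*W w) @[n --> \oo] --> Ex P (fun w => \1_(\bigcup_k F k) (X w)*W w).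
  have [mW [K hK]]:= bW.
  apply: (@Ex_dct _ _ _ P _ _ K).
  + move=> n; apply: bm_meas; apply: bmM => //; apply: bm_sum => k; apply: bm_indic_comp => //; exact: mF.
  + by apply: bm_meas; apply: bI; apply: bigcup_measurable => k _; exact: mF.
  + move=> n w; rewrite normrM -[leRHS]mul1r; apply: ler_pM => //.
   exact: indic_sum_norm.
  + apply: aeW => w; apply: cvgMl; exact: indic_bigcup_cvg.
 have c2: Ex mu (fun x => \sum_(k<n) \1_(F k) x) @[n --> \oo] --> Ex mu (\1_(\bigcup_k F k)).
  apply: (@Ex_dct _ _ _ mu _ _ 1).
  + by move=> n; apply: bm_meas; apply: bm_sum => k; exact: bJ.
  + by apply: bm_meas; apply: bJ; apply: bigcup_measurable => k _; exact: mF.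
  + by move=> n x; exact: indic_sum_norm.
  + by apply: aeW => w; exact: indic_bigcup_cvg.
 apply: (cvg_unique _ c1) => //.
 rewrite (_: (fun n => Ex P _) = fun n => c*Ex mu (fun x => \sum_(k<n) \1_(F k) x)); first exact: cvgMr.
 apply/funext => n; under eq_fun do rewrite mulr_suml.
 rewrite Ex_sum => [|k]; last by apply: bI; exact: mF.
 rewrite Ex_sum => [|k]; last by apply: bJ; exact: mF.
 by rewrite mulr_sumr; apply: eq_bigr => k _; exact: hF.
Qed.

Definition cdfm (x: R): R:= Ex mu (\1_(`]-oo, x]%classic)).
Local Notation Phi:= cdfm.

Lemma bm_ray x: bm (\1_(`]-oo, x]%classic): measurableTypeR R -> R).
Proof. by apply: bm_indic; exact: measurable_itv. Qed.

Lemma indic_ray (x y: R): \1_(`]-oo, x]%classic) y = (y<=x)%R%:R :> R.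
Proof. rewrite indicE; have -> // : (y \in `]-oo, x]%classic) = (y<=x)%R by apply/idP/idP; rewrite inE /= in_itv. Qed.

Lemma cdfm_mono x y: x<=y -> Phi x<=Phi y.
Proof.
move=> xy; apply: le_Ex; [exact: bm_ray|exact: bm_ray|move=> w; rewrite !indic_ray ler_nat].
by case: (leP w x) => // wx; rewrite (le_trans wx xy).
Qed.

Lemma cdfm01 x: 0<=Phi x<=1.
Proof.
apply/andP; split.
 rewrite -(Ex_cst mu 0); apply: le_Ex; [exact: bm_cst|exact: bm_ray|move=> w; rewrite indic_ray ler0n//].
by rewrite -(Ex_cst mu 1); apply: le_Ex; [exact: bm_ray|exact: bm_cst|move=> w; rewrite indic_ray lern1 leq_b1].
Qed.

Lemma cdfm_cvg (u: nat -> R) (f: measurableTypeR R -> R): mfunT f ->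
 (forall y, \forall n \near \oo, (y<=u n)%R%:R = f y) -> Phi (u n) @[n --> \oo] --> Ex mu f.
Proof.
move=> mf h; apply: (@Ex_dct _ _ _ mu _ _ 1) => //.
- by move=> n w; rewrite indic_ray; case: (w<=u n)%R; rewrite /= ?normr1 ?normr0.
- apply: aeW => y; apply: cvg_near_cst; apply: filterS (h y) => n; by rewrite indic_ray.
Qed.

Lemma cdfm_right x (e: R): 0<e -> exists2 y, x<y & Phi y<Phi x+e.
Proof.
move=> e0; have c: Phi (x+n.+1%:R^-1) @[n --> \oo] --> Phi x.
 apply: cdfm_cvg; first exact/bm_meas/bm_ray.
 move=> y; rewrite indic_ray; have [yx|xy]:= leP y x.
  by apply: nearW => n; rewrite (le_trans yx)// lerDl.
 have d0: 0<y-x by rewrite subr_gt0.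
 near=> n; rewrite leNgt -ltrBrDl; suff -> : n.+1%:R^-1<y-x by [].
 by near: n; exact: near_infty_natSinv_lt (PosNum d0).
have /cvgrPdist_lt/(_ _ e0)[N _ hN]:= c; exists (x+N.+1%:R^-1); first by rewrite ltrDl invr_gt0.
by have:= hN N (leqnn N); rewrite /= ltr_norml => /andP[? ?]; lra.
Unshelve. all: by end_near. Qed.

Lemma cdfm_big (e: R): 0<e -> exists y, 1-e<Phi y.
Proof.
move=> e0; have c: Phi n%:R @[n --> \oo] --> Ex mu (fun=> 1).
 apply: cdfm_cvg => // y; near=> n.
 suff -> : y<=n%:R by [].
 by near: n; exact: nbhs_infty_ger.
rewrite Ex_cst in c; have /cvgrPdist_lt/(_ _ e0)[N _ hN]:= c; exists N%:R.
by have:= hN N (leqnn N); rewrite /= ltr_norml => /andP[? ?]; lra.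
Unshelve. all: by end_near. Qed.

Lemma cdfm_small (e: R): 0<e -> exists y, Phi y<e.
Proof.
move=> e0; have c: Phi (- n%:R) @[n --> \oo] --> Ex mu (fun=> 0).
 apply: cdfm_cvg => // y; near=> n; rewrite leNgt ltrNl.
 suff -> : - y<n%:R by [].
 by near: n; exact: nbhs_infty_gtr.
rewrite Ex_cst in c; have /cvgrPdist_lt/(_ _ e0)[N _ hN]:= c; exists (- N%:R).
by have:= hN N (leqnn N); rewrite /= ltr_norml => /andP[? ?]; lra.
Unshelve. all: by end_near. Qed.

(** Generalised inverse of the distribution function, with default 0 outside ]0, 1[, where the set
    may be empty or unbounded. *)
Definition quant (p: R): R:= if 0<p<1 then sup [set x | Phi x<p] else 0.

Lemma quant_has p: 0<p<1 -> has_sup [set x | Phi x<p].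
Proof.
move=> /andP[p0 p1]; have [y hy]:= cdfm_small p0; split; first by exists y.
have [z hz]:= @cdfm_big (1-p) (ltac:(lra)); exists z => x /= xp; rewrite leNgt; apply/negP => zx.
by have:= cdfm_mono (ltW zx); lra.
Qed.

Lemma quant_le p x: 0<p<1 -> (quant p<=x) = (p<=Phi x).
Proof.
move=> pI; rewrite /quant pI; apply/idP/idP => [h|h].
 rewrite leNgt; apply/negP => xp; have [y xy hy]:= @cdfm_right x (p-Phi x) (ltac:(by rewrite subr_gt0)).
 have: y<=sup [set x | Phi x<p] by apply: ub_le_sup; [exact: (quant_has pI).2|rewrite /=; lra].
 by lra.
apply: ge_sup; first exact: (quant_has pI).1.
by move=> y /= yp; rewrite leNgt; apply/negP => xy; have:= cdfm_mono (ltW xy); lra.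
Qed.

Lemma quant_mono p p': 0<p -> p<=p' -> p'<1 -> quant p<=quant p'.
Proof.
move=> p0 pp p1; have pI: 0<p<1 by rewrite p0 (le_lt_trans pp).
have pI': 0<p'<1 by rewrite p1 (lt_le_trans p0).
by rewrite quant_le// (le_trans pp)// -quant_le.
Qed.

(** Left continuity is the only continuity that quantiles have in general; it suffices because
    binary truncations approach a number from below. *)
Lemma quant_left (u: nat -> R) (p: R): 0<p<1 -> (forall n, u n<=p) -> u n @[n --> \oo] --> p ->
 quant (u n) @[n --> \oo] --> quant p.
Proof.
move=> pI up cu; apply/cvgrPdist_lt => e e0; have /andP[p0 p1]:= pI.
have [y /= yp hy]:= sup_adherent e0 (quant_has pI).
have d0: 0<p-Num.max (Phi y) 0 by rewrite subr_gt0 gt_max yp p0.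
have /cvgrPdist_lt/(_ _ d0) cn:= cu; apply: filterS cn => n cn.
have un: Num.max (Phi y) 0<u n by move: cn; rewrite ltr_norml => /andP[? ?]; lra.
move: un; rewrite gt_max => /andP[u1 u2].
have uI: 0<u n<1 by rewrite u2 (le_lt_trans (up n)).
have h1:= quant_mono u2 (up n) p1.
have h2: y<=quant (u n).
 by rewrite /quant uI; apply: ub_le_sup; [exact: (quant_has uI).2|].
have hq: quant p = sup [set x | Phi x<p] by rewrite /quant pI.
by rewrite ltr_norml; apply/andP; split; lra.
Qed.

Lemma measurable_quant (X: Om -> R): mfunT X -> mfunT (fun w => quant (X w)).
Proof.
move=> mX _; apply: (measurability _ (RGenOInfty.measurableE R)) => //.
move=> _ [_ [a ->] <-]; rewrite setTI.
rewrite (_: _ @^-1` _ = ([set w | 0<X w] `&` [set w | X w<1] `&` [set w | Phi a<X w]) `|`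
 ((if 0 > a then setT else set0) `&` ~` ([set w | 0<X w] `&` [set w | X w<1]))).
 have m01: measurable ([set w | 0<X w] `&` [set w | X w<1]) by apply: measurableI; exact: measurable_ltset.
 apply: measurableU; apply: measurableI => //; first exact: measurable_ltset.
  by case: ifP.
 exact: measurableC.
apply/seteqP; split=> w /=; rewrite in_itv/= andbT.
 case: (boolP (0<X w<1)) => [XI|XI].
  by rewrite ltNge quant_le// -ltNge => h; left; have /andP[]:= XI.
 rewrite /quant (negbTE XI) => a0; right; rewrite a0; split => // -[x1 x2].
 by move: XI; rewrite x1 x2.
move=> [[[x1 x2] h]|[h no]]; first by rewrite ltNge quant_le ?x1// -ltNge.
have XI: (0<X w<1) = false by apply/negP => /andP[x1 x2]; exact: no.
by rewrite /quant XI; move: h; case: ifP.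
Qed.

End LawExtension.

(** * Independent variables of given laws from coin tosses *)

Lemma ae_of_Ex0 (R: realType) (dO: measure_display) (Om: measurableType dO) (P: probability Om R) (f: Om -> R) :
 bm f -> (forall w, 0<=f w) -> Ex P f = 0 -> {ae P, forall w, f w = 0}.
Proof.
move=> bf f0 Ef; have: ae_eq P setT (fun w => (f w)%:E) (cst 0%E).
 apply/ae_eq_integral_abs => //; first exact/measurable_EFinP/bm_meas.
 under eq_integral do rewrite /= ger0_norm//.
 by rewrite (Ex_E P bf) Ef.
by apply: filterS => w /(_ I) h; exact: (EFin_inj h).
Qed.

Section IndependentSequence.
Variables (R: realType) (dO: measure_display) (Om: measurableType dO) (P: probability Om R).
Variable mu: nat -> probability (measurableTypeR R) R.
Variable b: nat -> Om -> bool.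
Hypothesis bmb: forall k (h: bool -> R), bm (fun w => h (b k w)).
Hypothesis indb: forall (I: finType) (io: I -> nat) (h: I -> bool -> R), injective io ->
 Ex P (fun w => \prod_i h i (b (io i) w)) = \prod_i ((h i true+h i false)/2).

(** [pickle] splits the single sequence of coins into countably many sequences, one for each [n]. *)
Definition bb (n k: nat) (w: Om): bool:= b (pickle (n, k)) w.
Fixpoint NN (n K: nat) (w: Om): nat:= if K is K'.+1 then ((NN n K' w).*2+bb n K' w)%N else 0%N.
(** The [k]-th of the [K] binary digits of [i], most significant first, which is the order in which
    [NN] reads the coins. *)
Definition dig (K k i: nat): bool:= odd (i %/ 2 ^ (K-k.+1)).

Lemma NN_lt n K w: (NN n K w<2 ^ K)%N.
Proof using. by elim: K => //= K IH; rewrite expnS; case: (bb _ _ _); lia. Qed.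

Lemma NN_dig n K w i: (i<2 ^ K)%N -> (NN n K w == i)%:R = \prod_(k<K) (bb n k w == dig K k i)%:R :> R.
Proof using.
elim: K i => [|K IH] i iK; first by rewrite big_ord0; move: iK; rewrite expn0; case: i.
rewrite big_ord_recr/= /dig subnn expn0 divn1.
have -> : \prod_(k<K) (bb n k w == odd (i %/ 2 ^ (K.+1-k.+1)))%:R = (NN n K w == i./2)%:R :> R.
 rewrite IH; last by move: iK; rewrite expnS; lia.
 apply: eq_bigr => k _; rewrite /dig; congr ((_ == odd _)%:R).
 have -> : (K.+1-k.+1 = (K-k.+1).+1)%N by have:= ltn_ord k; lia.
 by rewrite expnS divnMA divn2.
rewrite -natrM mulnb; congr (_%:R: R); congr nat_of_bool.
by case: (bb _ _ _); rewrite /=; case: (odd i) (odd_double_half i) => /= E; apply/idP/idP; lia.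
Qed.

Lemma NN_expand n K w (g: nat -> R) :
 g (NN n K w) = \sum_(i<2 ^ K) g i*\prod_(k<K) (bb n k w == dig K k i)%:R.
Proof using.
under eq_bigr => i _ do rewrite -NN_dig//.
rewrite (bigD1 (Ordinal (NN_lt n K w)))//= eqxx mulr1 big1 ?addr0// => i ne.
by rewrite (_: (_ == _) = false) ?mulr0//; apply/negP => /eqP E; case/eqP: ne; apply: val_inj.
Qed.

Lemma bm_NN n K (g: nat -> R): bm (fun w => g (NN n K w)).
Proof using bmb.
under eq_fun do rewrite NN_expand; apply: bm_sum => i; apply: bmZ; apply: bm_prod => k.
exact: (bmb _ (fun c => (c == dig K k i)%:R)).
Qed.

Definition avgK (K: nat) (g: nat -> R): R:= (2^-1)^+K*\sum_(i<2 ^ K) g i.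

Lemma Ex_blocks (I: finType) (nu: I -> nat) K (g: I -> nat -> R): injective nu ->
 Ex P (fun w => \prod_i g i (NN (nu i) K w)) = \prod_i avgK K (g i).
Proof using bmb indb.
move=> nuI.
have E w: \prod_i g i (NN (nu i) K w) = \sum_(F: {ffun I -> 'I_(2 ^ K)}) (\prod_i g i (F i)) *
  \prod_(p: I * 'I_K) (bb (nu p.1) p.2 w == dig K p.2 (F p.1))%:R.
 under eq_bigr => i _ do rewrite NN_expand.
 rewrite bigA_distr_bigA; apply: eq_bigr => F _; rewrite big_split/=; congr (_*_).
 by rewrite pair_bigA.
under eq_fun do rewrite E.
have bp (F: {ffun I -> 'I_(2 ^ K)}): bm (fun w => \prod_(p: I * 'I_K) (bb (nu p.1) p.2 w == dig K p.2 (F p.1))%:R: R).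
 by apply: bm_prod => p; exact: (bmb _ (fun c => (c == dig K p.2 (F p.1))%:R)).
rewrite Ex_sum => [|F]; last exact: bmZ.
have EF (F: {ffun I -> 'I_(2 ^ K)}) :
  Ex P (fun w => \prod_(p: I * 'I_K) (bb (nu p.1) p.2 w == dig K p.2 (F p.1))%:R) = \prod_(i: I) (2^-1)^+K :> R.
 rewrite (@indb _ (fun p: I * 'I_K => pickle (nu p.1, val p.2)) (fun p c => (c == dig K p.2 (F p.1))%:R)); last first.
  by move=> [i k] [i' k'] /(pcan_inj (@pickleK _))[] /nuI -> kk; congr pair; exact: val_inj.
 rewrite (eq_bigr (fun=> 2^-1)) => [|p _]; last by case: (dig _ _ _) => /=; rewrite ?add0r ?addr0 mul1r.
 by rewrite !prodr_const -exprM card_prod card_ord mulnC.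
rewrite (eq_bigr (fun F: {ffun I -> 'I_(2 ^ K)} => (\prod_i g i (F i))*\prod_(i: I) (2^-1)^+K)) => [|F _]; last by rewrite (ExZ P _ (bp F)) EF.
under [RHS]eq_bigr => i _ do rewrite /avgK mulr_sumr.
rewrite bigA_distr_bigA; apply: eq_bigr => F _; rewrite big_split/= mulrC//.
Qed.

Lemma Ex_block n K (g: nat -> R): Ex P (fun w => g (NN n K w)) = avgK K g.
Proof using bmb indb.
have:= @Ex_blocks 'I_1 (fun=> n) K (fun=> g); rewrite big_ord1 => <-.
 by congr Ex; apply/funext => w; rewrite big_ord1.
by move=> i j _; rewrite !ord1.
Qed.

Definition UK n K w: R:= (NN n K w)%:R/2^+K.
Definition UU n w: R:= sup [set UK n K w | K in [set: nat]].

Let p2 K: 0<2^+K :> R. Proof. by rewrite exprn_gt0. Qed.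

Lemma UK_step n K w: UK n K w<=UK n K.+1 w /\ UK n K.+1 w+(2^+K.+1)^-1<=UK n K w+(2^+K)^-1.
Proof using.
have E: UK n K.+1 w = UK n K w+(bb n K w)%:R*(2^+K.+1)^-1.
 by rewrite /UK /= natrD -muln2 natrM exprS; field; rewrite gt_eqF.
have E2: (2^+K)^-1 = 2*(2^+K.+1)^-1 :> R by rewrite exprS; field; rewrite gt_eqF.
have: 0<(2^+K.+1)^-1 :> R by rewrite invr_gt0.
by rewrite E E2; case: (bb n K w) => /=; move: (2^+K.+1)^-1 (UK n K w) => q u; split; lra.
Qed.

Lemma UK_mono n K K' w: (K<=K')%N -> UK n K w<=UK n K' w /\ UK n K' w+(2^+K')^-1<=UK n K w+(2^+K)^-1.
Proof using.
elim: K' => [|K' IH]; first by rewrite leqn0 => /eqP ->.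
rewrite leq_eqVlt => /orP[/eqP ->//|]; rewrite ltnS => /IH[a c].
by have [a' c']:= UK_step n K' w; split; [exact: le_trans a a'|exact: le_trans c' c].
Qed.

Lemma UK_bound n K K' w: UK n K' w<=UK n K w+(2^+K)^-1.
Proof using.
have i0 j: 0<(2^+j)^-1 :> R by rewrite invr_gt0.
have [KK|KK]:= leqP K K'.
 by have [_]:= UK_mono n w KK; have:= i0 K'; lra.
by have [+ _]:= UK_mono n w (ltnW KK); have:= i0 K; lra.
Qed.

Lemma UU_bounds n K w: UK n K w<=UU n w<=UK n K w+(2^+K)^-1.
Proof using.
have hs: has_sup [set UK n K w | K in [set: nat]].
 by split; [exists (UK n 0 w), 0%N|exists (UK n 0 w+(2^+0)^-1) => _ [j _ <-]; exact: UK_bound].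
apply/andP; split; first by apply: ub_le_sup; [exact: hs.2|exists K].
by apply: ge_sup; [exact: hs.1|move=> _ [j _ <-]; exact: UK_bound].
Qed.

Lemma UK_cvg n w: UK n K w @[K --> \oo] --> UU n w.
Proof using.
apply/cvgrPdist_lt => e e0.
have /cvgrPdist_lt/(_ _ e0) h:= @cvg_half R.
apply: filterS h => K; rewrite sub0r normrN ger0_norm ?exprn_ge0 ?invr_ge0// exprVn => h.
by have /andP[a c]:= UU_bounds n K w; rewrite ltr_norml; apply/andP; split; lra.
Qed.

Lemma measurable_UU n: mfunT (UU n).
Proof using bmb.
apply: (@measurable_fun_cvg _ _ _ _ (fun K => UK n K)) => [K|w _]; last exact: UK_cvg.
exact: (bm_meas (bm_NN n K (fun i => i%:R/2^+K))).
Qed.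

Lemma count_le (x: R) n: 0<=x -> let S:= \sum_(i<n) (i%:R<=x)%R%:R in
 [/\ S<=n%:R, S<=x+1 & Num.min n%:R x<=S].
Proof using.
move=> x0 S; rewrite /S; elim: n {S} => [|n [IH1 IH2 IH3]].
 by rewrite big_ord0 ge_min lexx; split => //; rewrite addr_ge0.
rewrite big_ord_recr/= -natr1; set s:= \sum_(i<n) _ in IH1 IH2 IH3 *.
move: IH3; rewrite !ge_min; case: (leP n%:R x) => nx /=.
 rewrite orbF_ || idtac; move=> h; split; [lra|lra|].
 by apply/orP; left; move: h => /orP[]; lra.
by move=> /orP[h|h]; split; try lra; apply/orP; right; lra.
Qed.

Lemma Ex_UK n K a: 0<=a<=1 -> a<=Ex P (fun w => (UK n K w<=a)%R%:R)<=a+(2^+K)^-1.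
Proof using bmb indb.
move=> /andP[a0 a1]; rewrite (Ex_block n K (fun i => (i%:R/2^+K<=a)%R%:R)) /avgK exprVn.
have -> : \sum_(i<2 ^ K) (i%:R/2^+K<=a)%R%:R = \sum_(i<2 ^ K) (i%:R<=a*2^+K)%R%:R :> R.
 by apply: eq_bigr => i _; rewrite ler_pdivrMr.
have x0: 0<=a*2^+K by rewrite mulr_ge0// ltW.
have [_]:= @count_le _ (2 ^ K)%N x0; set S:= \sum_(i<_) _ => h1.
have -> : Num.min (2 ^ K)%:R (a*2^+K) = a*2^+K.
 by apply: min_r; rewrite natrX ler_piMl// ltW.
move=> h2; rewrite mulrC ler_pdivlMr// h2/= ler_pdivrMr// mulrDl mulVf ?gt_eqF//.
Qed.

(** The truncation to [K] digits is uniform on the multiples of 2^-K, and [UU] exceeds it by at most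
    2^-K. *)
Lemma UU_law n a: 0<=a<=1 -> Ex P (fun w => (UU n w<=a)%R%:R) = a.
Proof using bmb indb.
move=> aI; have /andP[a0 a1]:= aI; have mU:= measurable_UU n.
have bU K c: bm (fun w => (UK n K w<=c)%R%:R: R).
 by apply: bm_leind; exact: (bm_meas (bm_NN n K (fun i => i%:R/2^+K))).
have key K: `|Ex P (fun w => (UU n w<=a)%R%:R)-a| <= (2^-1)^+K.
 rewrite exprVn ler_norml; apply/andP; split; last first.
  have /andP[_ h]:= Ex_UK n K aI; rewrite lerBlDr addrC; apply: le_trans h.
  apply: le_Ex => // [|w]; first exact: bm_leind.
  rewrite ler_nat; case: (leP (UU n w) a) => // h; suff -> : UK n K w<=a by [].
  by have /andP[q _]:= UU_bounds n K w; exact: le_trans q h.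
 rewrite lerBrDr; have [ha|ha]:= ltP a (2^+K)^-1.
  apply: (@le_trans _ _ 0); first by lra.
  by rewrite -(Ex_cst P 0); apply: le_Ex => //; [exact: bm_cst|exact: bm_leind].
 have aI': 0<=a-(2^+K)^-1<=1.
  by rewrite subr_ge0 ha/=; have:= p2 K; rewrite -invr_gt0; move: (2^+K)^-1 => q; lra.
 have /andP[h _]:= Ex_UK n K aI'; rewrite addrC; apply: le_trans h _.
 apply: le_Ex => // [|w]; first exact: bm_leind.
 rewrite ler_nat; case: (leP (UK n K w) _) => // h; suff -> : UU n w<=a by [].
 by have /andP[_ q]:= UU_bounds n K w; lra.
apply/eqP; rewrite -subr_eq0 -normr_le0; apply/ler_addgt0Pr => e e0; rewrite add0r.
have /cvgrPdist_lt/(_ _ e0)[K _ hK]:= @cvg_half R.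
apply: le_trans (key K) _; have:= hK K (leqnn K); rewrite /= sub0r normrN ger0_norm ?exprn_ge0 ?invr_ge0//.
exact: ltW.
Qed.

Lemma UU_ae n: {ae P, forall w, 0<UU n w<1}.
Proof using bmb indb.
have mU:= measurable_UU n.
have h0: {ae P, forall w, (UU n w<=0)%R%:R = 0 :> R}.
 by apply: ae_of_Ex0 => //; [exact: bm_leind|rewrite UU_law// lexx ler01].
have h1: {ae P, forall w, (- UU n w <= -1)%R%:R = 0 :> R}.
 have mN: mfunT (fun w => - UU n w) by exact: measurableT_comp.
 apply: ae_of_Ex0 => //; first exact: bm_leind.
 apply/eqP; rewrite eq_le; apply/andP; split; last first.
  by rewrite -(Ex_cst P 0); apply: le_Ex => //; [exact: bm_cst|exact: bm_leind].
 apply/ler_addgt0Pr => e e0; rewrite add0r; have [e1|e1]:= leP 1 e.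
  apply: le_trans e1; apply: (@le_trans _ _ (Ex P (fun=> 1))); last by rewrite Ex_cst.
  by apply: le_Ex; [exact: bm_leind|exact: bm_cst|move=> w; rewrite lern1 leq_b1].
 have eI: 0<=1-e<=1 by apply/andP; split; lra.
 have E:= UU_law n eI; have -> : e = 1-Ex P (fun w => (UU n w<=1-e)%R%:R) by rewrite E; lra.
 rewrite -[X in _<=X-_](Ex_cst P 1) -ExB//; [|exact: bm_cst|exact: bm_leind].
 apply: le_Ex; [exact: bm_leind|apply: bmB; [exact: bm_cst|exact: bm_leind]|move=> w].
 rewrite lerN2; case: (leP 1 (UU n w)) => hw; case: (leP (UU n w) (1-e)) => hw' /=; lra.
apply: filterS2 h0 h1 => w a c; apply/andP; split.
 by rewrite ltNge; apply/negP => u; move: a; rewrite u => /eqP; rewrite oner_eq0.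
by rewrite ltNge; apply/negP => u; move: c; rewrite lerN2 u => /eqP; rewrite oner_eq0.
Qed.

Definition ZZ n w: R:= quant (mu n) (UU n w).

Lemma measurable_ZZ n: mfunT (ZZ n).
Proof using bmb. by apply: measurable_quant; exact: measurable_UU. Qed.

Lemma ZZ_law n (A: set R): measurable A -> Ex P (fun w => \1_A (ZZ n w)) = Ex (mu n) (\1_A).
Proof using bmb indb.
move=> mA; have mZ:= measurable_ZZ n.
have:= @law_ext _ _ _ P (mu n) (ZZ n) (fun=> 1) 1 mZ (bm_cst _ 1) (Ex_cst P 1) _ A mA.
under eq_fun do rewrite mulr1; rewrite mul1r; apply => x.
have E (y: R): \1_(`]x, +oo[%classic) y = 1-(y<=x)%R%:R :> R.
 rewrite indicE; case: (leP y x) => yx /=; first by rewrite memNset ?subrr//= in_itv/= andbT; apply/negP; rewrite -leNgt.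
 by rewrite mem_set ?subr0//= in_itv/= yx.
under eq_fun do rewrite mulr1 E; rewrite ExB; [|exact: bm_cst|exact: bm_leind].
rewrite mul1r Ex_cst (_: \1_ _ = fun y => 1-\1_(`]-oo, x]%classic) y); last first.
 by apply/funext => y; rewrite E indic_ray.
rewrite ExB; [|exact: bm_cst|exact: bm_ray].
rewrite Ex_cst; congr (_-_); rewrite -/(cdfm (mu n) x) -(UU_law n (cdfm01 (mu n) x)).
apply: Ex_ae; [exact: bm_leind|apply: bm_leind; exact: measurable_UU|].
by apply: filterS (UU_ae n) => w wI; rewrite /ZZ quant_le.
Qed.

Lemma Ex_ZZ n (g: R -> R) (K: R): mfunT g -> (forall x, `|g x| <= K) ->
 Ex P (fun w => g (ZZ n w)) = Ex (mu n) g.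
Proof using bmb indb.
move=> mg gK; have mZ:= measurable_ZZ n.
have bg: bm (fun w => g (ZZ n w)) by exact: (bm_comp mg gK mZ).
have bg': bm (g: measurableTypeR R -> R) by split => //; exists K.
apply: EFin_inj; rewrite -!Ex_E//.
have mgE: mfunT (fun x: R => (g x)%:E) by exact/measurable_EFinP.
have mZ': @measurable_fun _ _ Om (measurableTypeR R) setT (ZZ n):= mZ.
have mgE': @measurable_fun _ _ (measurableTypeR R) _ setT (fun x: R => (g x)%:E):= mgE.
pose Z': Om -> measurableTypeR R:= ZZ n.
pose X: {RV P >-> measurableTypeR R} := HB.pack Z' (isMeasurableFun.Build _ _ Om (measurableTypeR R) Z' mZ').
have <- := @integral_distribution _ _ _ _ _ P X (fun x => (g x)%:E) mgE' (bm_int P bg).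
apply: eq_measure_integral => A mA _.
have mp: measurable (ZZ n @^-1` A) by rewrite -[X in measurable X]setTI; exact: mZ.
have -> : (mu n: {measure set _ -> \bar R}) A = (Ex (mu n) \1_A)%:E by exact: Ex_indic.
change (P (ZZ n @^-1` A) = (Ex (mu n) \1_A)%:E); rewrite (Ex_indic P mp); congr EFin.
by rewrite -(ZZ_law n mA); congr Ex; apply/funext => w; rewrite !indicE.
Qed.

(** Independence is exact for the truncations to [K] digits and passes to the limit by dominated
    convergence, [g] being continuous and [quant] left continuous. *)
Lemma ZZ_indep (I: finType) (nu: I -> nat) (g: I -> R -> R): injective nu ->
 (forall i, continuous (g i)) -> (forall i x, `|g i x| <= 1) ->
 Ex P (fun w => \prod_i g i (ZZ (nu i) w)) = \prod_i Ex (mu (nu i)) (g i).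
Proof using bmb indb.
move=> nuI cg g1.
have mgi i:= continuous_measurable_fun (cg i).
have bZ K i: bm (fun w => g i (quant (mu (nu i)) (UK (nu i) K w))) by exact: (bm_NN (nu i) K (fun j => g i (quant (mu (nu i)) (j%:R/2^+K)))).
have bZ' i: bm (fun w => g i (ZZ (nu i) w)) by apply: (bm_comp (mgi i) (g1 i)); exact: measurable_ZZ.
have cv i: {ae P, forall w, g i (quant (mu (nu i)) (UK (nu i) K w)) @[K --> \oo] --> g i (ZZ (nu i) w)}.
 apply: filterS (UU_ae (nu i)) => w wI; apply: continuous_cvg; first exact: cg.
 apply: quant_left => //; last exact: UK_cvg.
 by move=> K; have /andP[]:= UU_bounds (nu i) K w.
have c1: Ex P (fun w => \prod_i g i (quant (mu (nu i)) (UK (nu i) K w))) @[K --> \oo] --> Ex P (fun w => \prod_i g i (ZZ (nu i) w)).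
 apply: (@Ex_dct _ _ _ P _ _ 1).
 - by move=> K; apply: bm_meas; apply: bm_prod.
 - by apply: bm_meas; apply: bm_prod.
 - by move=> K w; rewrite normr_prod; apply: prodr_ile1 => i; rewrite normr_ge0 g1.
 - have fin (s: seq I): {ae P, forall w, forall i, i \in s -> g i (quant (mu (nu i)) (UK (nu i) K w)) @[K --> \oo] --> g i (ZZ (nu i) w)}.
   elim: s => [|i s IH]; first by apply: aeW.
   apply: filterS2 (cv i) IH => w a c j; rewrite inE => /orP[/eqP ->//|]; exact: c.
  apply: filterS (fin (index_enum I)) => w hw; apply: cvg_big => [|i _]; first exact: mul_continuous.
  by apply: hw; exact: mem_index_enum.
have c2: \prod_i Ex P (fun w => g i (quant (mu (nu i)) (UK (nu i) K w))) @[K --> \oo] --> \prod_i Ex P (fun w => g i (ZZ (nu i) w)).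
 apply: cvg_big => [|i _]; first exact: mul_continuous.
 apply: (@Ex_dct _ _ _ P _ _ 1) => //.
 - by move=> K; apply: bm_meas.
 - exact: bm_meas.
rewrite (eq_bigr (fun i => Ex P (fun w => g i (ZZ (nu i) w)))) => [|i _]; last by rewrite (Ex_ZZ _ (mgi i) (g1 i)).
apply: (cvg_unique _ c1) => //; rewrite (_: (fun K => Ex P _) = fun K => \prod_i Ex P (fun w => g i (quant (mu (nu i)) (UK (nu i) K w))))//.
apply/funext => K; rewrite (Ex_blocks K (fun i j => g i (quant (mu (nu i)) (j%:R/2^+K))) nuI).
by apply: eq_bigr => i _; rewrite (Ex_block (nu i) K (fun j => g i (quant (mu (nu i)) (j%:R/2^+K)))).
Qed.

End IndependentSequence.

(** * Taylor bounds for sine, cosine and exponential *)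

Section TrigInequalities.
Variable R: realType.
Implicit Types x y: R.

(** Applied repeatedly, it yields the Taylor bounds of sine and cosine, each from the previous
    one. *)
Lemma ge0_of_derive (f f': R -> R): (forall x, is_derive x 1 f (f' x)) -> f 0 = 0 ->
 (forall x, 0<=x -> 0<=f' x) -> forall x, 0<=x -> 0<=f x.
Proof.
move=> df f0 f'0 x x0.
have cf: {within `[0, x], continuous f}.
 by apply: derivable_within_continuous => y _; have []:= df y.
have [c /[!in_itv]/= /andP[c0 _] E]:= MVT_segment x0 (fun y _ => df y) cf.
by move: E; rewrite f0 !subr0 => ->; rewrite mulr_ge0// f'0.
Qed.

Lemma sin_le x: 0<=x -> sin x<=x.
Proof.
move=> x0; rewrite -subr_ge0; apply: (@ge0_of_derive (fun x => x-sin x) (fun x => 1-cos x)) => //.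
- by rewrite sin0 subrr.
Qed.

Lemma cos_ge2 x: 1-x^+2/2<=cos x.
Proof.
wlog x0: x/0<=x.
 by move=> h; have [/h//|x0]:= leP 0 x; have:= h (- x); rewrite cosN sqrrN; apply; lra.
rewrite -subr_ge0; apply: (@ge0_of_derive (fun x => cos x-(1-x^+2/2)) (fun x => x-sin x)) => //.
- by move=> y; apply: is_derive_eq; rewrite /GRing.scale/=; field.
- by rewrite cos0 expr0n mul0r subr0 subrr.
- by move=> y y0; rewrite subr_ge0 sin_le.
Qed.

Lemma sin_ge3 x: 0<=x -> x-x^+3/6<=sin x.
Proof.
move=> x0; rewrite -subr_ge0; apply: (@ge0_of_derive (fun x => sin x-(x-x^+3/6)) (fun x => cos x-(1-x^+2/2))) => //.
- by move=> y; apply: is_derive_eq; rewrite /GRing.scale/=; field.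
- by rewrite sin0 expr0n mul0r !subr0.
- by move=> y y0; rewrite subr_ge0 cos_ge2.
Qed.

Lemma cos_le4 x: cos x<=1-x^+2/2+x^+4/24.
Proof.
wlog x0: x/0<=x.
 move=> h; have [/h//|x0]:= leP 0 x; have:= h (- x); rewrite cosN sqrrN.
 by have -> : (- x)^+4 = x^+4 by [ring]; apply; lra.
rewrite -subr_ge0; apply: (@ge0_of_derive (fun x => 1-x^+2/2+x^+4/24-cos x) (fun x => sin x-(x-x^+3/6))) => //.
- by move=> y; apply: is_derive_eq; rewrite /GRing.scale/=; field.
- by rewrite cos0 !expr0n !mul0r subr0 addr0 subrr.
- by move=> y y0; rewrite subr_ge0 sin_ge3.
Qed.

Lemma sin_sub_le x: `|x-sin x| <= x^+2.
Proof.
wlog x0: x/0<=x.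
 move=> h; have [/h//|x0]:= leP 0 x; have:= h (- x); rewrite sinN sqrrN -opprD normrN.
 by apply; lra.
rewrite ger0_norm ?subr_ge0 ?sin_le//; have [x6|x6]:= leP x 6.
 have:= sin_ge3 x0; rewrite !exprS expr0 => h.
 by have: 0<=x*x*(6-x) by [rewrite !mulr_ge0// subr_ge0]; lra.
by have:= sin_geN1 x; rewrite expr2; nra.
Qed.

Lemma norm_sin_le x: `|sin x| <= `|x|.
Proof.
wlog x0: x/0<=x.
 by move=> h; have [/h//|x0]:= leP 0 x; have:= h (- x); rewrite sinN !normrN; apply; lra.
rewrite (ger0_norm x0) ler_norml sin_le// andbT; have [x1|x1]:= leP x 1.
 have:= sin_ge3 x0; rewrite !exprS expr0 => h.
 by have: 0<=x*(6-x*x) by [rewrite mulr_ge0// subr_ge0; nra]; lra.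
by have:= sin_geN1 x; lra.
Qed.

(** The constant 2 in place of the optimal 1/2 still gives sub-Gaussian moments. For small [x] use
    expR y <= 1/(1-y), for large [x] use |x| <= 2 x^2. *)
Lemma cosh_le x: (expR x+expR (- x))/2<=expR (2*x^+2).
Proof.
have [x2|x2]:= leP (x^+2) (2^-1).
 have e1 y: y<1 -> expR y<=(1-y)^-1.
  move=> y1; have h:= expR_ge1Dx (- y); have p:= expR_gt0 (- y).
  by rewrite -[y]opprK expRN lef_pV2 ?posrE ?opprK// subr_gt0.
 have x1: -1<x<1 by apply/andP; split; nra.
 have /andP[xa xb]:= x1; have a:= e1 x xb; have b:= e1 (- x) (ltac:(lra)).
 have c:= expR_ge1Dx (2*x^+2).
 apply: le_trans c; apply: (@le_trans _ _ (((1-x)^-1+(1 - - x)^-1)/2)); first by lra.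
 have -> : ((1-x)^-1+(1 - - x)^-1)/2 = (1-x^+2)^-1.
  have -> : 1-x^+2 = (1-x)*(1+x) by ring.
  by rewrite opprK; field; rewrite !gt_eqF; lra.
 have d0: 0<1-x^+2 by lra.
 by rewrite -div1r ler_pdivrMr//; have:= sqr_ge0 x; move: x2 d0; move: (x^+2) => q; nra.
have n2: x^+2 = `|x| ^+ 2 by rewrite real_normK// num_real.
have n0:= normr_ge0 x.
have h: `|x| <= 2*x^+2 by move: x2; rewrite n2; move: n0; move: `|x| => q; nra.
have a: expR x<=expR (2*x^+2) by rewrite ler_expR; apply: le_trans h; exact: ler_norm.
have b: expR (- x)<=expR (2*x^+2) by rewrite ler_expR; apply: le_trans h; rewrite -normrN; exact: ler_norm.
lra.
Qed.

(** Turns exponential tails into fourth powers, which can be summed as geometric series. *)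
Lemma expR_ge4 x: 0<=x -> x^+4/256<=expR x.
Proof.
move=> x0; have -> : expR x = expR (x/4)^+4 by rewrite -expRM_natl; congr expR; lra.
have -> : x^+4/256 = (x/4)^+4 by field.
rewrite lerXn2r ?nnegrE ?expR_ge0 ?divr_ge0//.
by have:= expR_ge1Dx (x/4); lra.
Qed.

End TrigInequalities.

(** * Characteristic function and tails of the normal law *)

Section NormalLaw.
Variables (R: realType) (s: R).
Hypothesis s0: s != 0.
Local Notation la:= (@lebesgue_measure R).
Local Notation phi:= (normal_pdf 0 s).

Lemma integral_normal_prob (f: R -> \bar R): mfunT f ->
 (normal_prob 0 s).-integrable setT f ->
 (\int[normal_prob 0 s]_x f x = \int[la]_x (f x*(phi x)%:E))%E.
Proof.
move=> mf intf; rewrite -(Radon_Nikodym_change_of_variables (normal_prob_dominates 0 s))//=.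
apply: ae_eq_integral => //.
- apply: emeasurable_funM => //; apply: (measurable_int la).
 by apply: Radon_Nikodym_integrable; exact: normal_prob_dominates.
- by apply: emeasurable_funM => //=; apply/measurable_EFinP; exact: measurable_normal_pdf.
- apply: ae_eqe_mul2l => /=; rewrite Radon_NikodymE//=; first exact: normal_prob_dominates.
 move=> ?; case: cid => /= h [h1 h2 h3]; apply: integral_ae_eq => //=.
 + by apply/measurable_EFinP; exact: measurable_normal_pdf.
 + by move=> E _ mE; rewrite -h3.
Qed.

Definition In (f: R -> R): R:= \int[la]_x (f x * phi x).

(** Completing the square. *)
Lemma phi_exp (a x: R): expR (a*x) * phi x = expR (a^+2*s^+2/2)*normal_pdf (a*s^+2) s x.
Proof.
have s2: s^+2 *+ 2 != 0 by rewrite mulrn_eq0/= sqrf_eq0.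
rewrite !normal_pdfE// /normal_fun mulrCA [RHS]mulrCA -!expRD; congr (_*expR _).
by rewrite -mulr_natl; field.
Qed.

Lemma In_exp (a: R): la.-integrable setT (fun x => (expR (a*x) * phi x)%:E) /\
 \int[la]_x (expR (a*x) * phi x) = expR (a^+2*s^+2/2).
Proof.
have i:= integrable_normal_pdf (a*s^+2) s.
under eq_fun do rewrite phi_exp EFinM; split; first exact: integrableZl.
under eq_Rintegral do rewrite phi_exp.
by rewrite RintegralZl// /Rintegral integral_normal_pdf mulr1.
Qed.

Lemma In_int (f: R -> R) (K: R): mfunT f ->
 (forall x, `|f x| <= K*(expR x+expR (- x))) -> la.-integrable setT (fun x => (f x * phi x)%:E).
Proof.
move=> mf fK; have [i1 _]:= In_exp 1; have [i2 _]:= In_exp (-1).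
have mphi: mfunT phi by exact: measurable_normal_pdf.
apply: (@le_integrable _ _ _ la setT measurableT _ (fun x => (K*(expR x+expR (- x)) * phi x)%:E)) => //.
- by apply/measurable_EFinP; exact: measurable_funM.
- move=> x _; rewrite lee_fin [leLHS]normrM [leRHS]normrM ler_wpM2r//; apply: le_trans (fK x) _; exact: ler_norm.
- have E x: (K*(expR x+expR (- x)) * phi x)%:E = (K%:E*((expR (1*x) * phi x)%:E+(expR (-1*x) * phi x)%:E))%E.
  by rewrite -EFinD -EFinM mul1r mulN1r; congr EFin; ring.
 by rewrite (funext E); apply: integrableZl => //; exact: integrableD.
Qed.

Lemma bound_exp (x: R): 1<=expR x+expR (- x) /\ `|x| <= expR x+expR (- x).
Proof.
have a:= expR_ge1Dx x; have b:= expR_ge1Dx (- x); have p:= expR_gt0 x; have q:= expR_gt0 (- x).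
by split; [lra|rewrite ler_norml; apply/andP; split; lra].
Qed.

Lemma In_int1 (f: R -> R): mfunT f -> (forall x, `|f x| <= 1) ->
 la.-integrable setT (fun x => (f x * phi x)%:E).
Proof.
move=> mf f1; apply: (@In_int f 1) => // x; rewrite mul1r; apply: le_trans (f1 x) _.
by case: (bound_exp x).
Qed.

Lemma Ex_normal (f: R -> R): mfunT f -> (forall x, `|f x| <= 1) ->
 Ex (normal_prob 0 s) f = In f.
Proof.
move=> mf f1; have bf: bm (f: measurableTypeR R -> R) by split => //; exists 1.
rewrite /Ex /In /Rintegral (integral_normal_prob _ (bm_int _ bf)) //; exact/measurable_EFinP.
Qed.

(** The phase [al] handles the cosine and the sine in one computation. *)
Definition ncf (al t: R): R:= In (fun x => cos (t*x+al)).

Lemma measurable_sc (al t: R): mfunT (fun x => cos (t*x+al)) /\ mfunT (fun x => sin (t*x+al)).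
Proof.
have ct: continuous (fun x: R => t*x+al) by move=> x; apply: cvgD; [apply: cvgMr; exact: cvg_id|exact: cvg_cst].
split; apply: continuous_measurable_fun => x.
 by apply: (@continuous_comp _ _ _ (fun x => t*x+al) cos); [exact: ct|exact: continuous_cos].
by apply: (@continuous_comp _ _ _ (fun x => t*x+al) sin); [exact: ct|exact: continuous_sin].
Qed.

Lemma In_xsin (al t: R): la.-integrable setT (fun x => (x*sin (t*x+al) * phi x)%:E).
Proof.
apply: (@In_int _ 1) => [|x].
 by apply: measurable_funM => //; exact: (measurable_sc al t).2.
rewrite mul1r normrM; have [_]:= bound_exp x; apply: le_trans.
by rewrite ler_piMr// sin_max.
Qed.

Lemma ncf_derive (al t: R): is_derive t (1: R) (ncf al) (- In (fun x => x*sin (t*x+al))).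
Proof.
have mc t':= (measurable_sc al t').1.
pose f (t x: R):= cos (t*x+al) * phi x.
have df (t' x: R): is_derive t' (1: R) (f^~ x) (- (x*sin (t'*x+al)) * phi x).
 by apply: is_derive_eq; rewrite /GRing.scale/=; ring.
have Ia: `](t-1), (t+1)[%classic t by rewrite /= in_itv/=; apply/andP; split; lra.
have intf (t': R): `](t-1), (t+1)[%classic t' -> la.-integrable setT (EFin \o f t').
 by move=> _; apply: In_int1 => // x; exact: cos_max.
have derf (t' x: R): `](t-1), (t+1)[%classic t' -> setT x -> derivable (f^~ x) t' 1.
 by move=> _ _; have []:= df t' x.
have G0 (x: R): 0 <= `|x| * phi x by rewrite mulr_ge0// normal_pdf_ge0.
have intG: la.-integrable setT (EFin \o (fun x: R => `|x| * phi x)).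
 apply: (@In_int _ 1) => // x; rewrite normr_id mul1r; by case: (bound_exp x).
have Gub (t' x: R): `](t-1), (t+1)[%classic t' -> setT x -> `|partial1of2 f t' x| <= `|x| * phi x.
 move=> _ _; rewrite partial1of2E (@derive_val _ _ _ _ _ _ _ (df t' x)) normrM normrN normrM.
 rewrite (ger0_norm (normal_pdf_ge0 _ _ _)) ler_wpM2r ?normal_pdf_ge0// ler_piMr//.
 exact: sin_max.
have D:= derivable_under_integral measurableT Ia intf derf G0 intG Gub.
have V:= differentiation_under_integral measurableT Ia intf derf G0 intG Gub.
have E: (fun x': R => \int[la]_(y in [set: R]) f x' y) = ncf al by [].
rewrite E in D V; apply: (@DeriveDef _ _ _ _ _ _ _ D); rewrite -derive1E V.
rewrite /In -[RHS]mulN1r -RintegralZl//; last exact: In_xsin.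
apply: eq_Rintegral => x _; rewrite -[LHS]/(partial1of2 f t x) partial1of2E (@derive_val _ _ _ _ _ _ _ (df t x)).
by ring.
Qed.

Lemma phiN x: phi (- x) = phi x.
Proof. by rewrite !normal_pdfE// /normal_fun !subr0 sqrrN. Qed.

Lemma phi_small (n: nat): phi n%:R<=expR (s^+2/2)*normal_peak s/n.+1%:R.
Proof.
have h: expR (1*n%:R) * phi n%:R<=expR (s^+2/2)*normal_peak s.
 by rewrite phi_exp expr1n mul1r ler_wpM2l ?expR_ge0// normal_pdf_ub.
rewrite ler_pdivlMr ?ltr0n//; apply: le_trans h; rewrite mulrC ler_wpM2r ?normal_pdf_ge0// mul1r.
by have:= expR_ge1Dx (n%:R: R); rewrite -natr1 addrC.
Qed.

(** Gaussian integration by parts on [-n-1, n+1]; the boundary terms vanish in the limit by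
    [phi_small]. *)
Lemma In_parts (al t: R): In (fun x => x*sin (t*x+al)) = s^+2 * t*ncf al t.
Proof.
have [mc ms]:= measurable_sc al t.
pose h (x: R):= x*sin (t*x+al) * phi x-s^+2 * t*(cos (t*x+al) * phi x).
pose F (x: R):= - (s^+2)*(sin (t*x+al) * phi x).
have i1:= In_xsin al t.
have i2: la.-integrable setT (fun x => (cos (t*x+al) * phi x)%:E).
 by apply: In_int1 => // x; exact: cos_max.
have i2': la.-integrable setT (fun x => (s^+2 * t*(cos (t*x+al) * phi x))%:E).
 by under eq_fun do rewrite EFinM; exact: integrableZl.
have hE: In (fun x => x*sin (t*x+al))-s^+2 * t*ncf al t = \int[la]_x h x.
 by rewrite /h RintegralB// RintegralZl.
have ih: la.-integrable setT (fun x => (h x)%:E) by rewrite /h; under eq_fun do rewrite EFinB; exact: integrableB.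
have s2: s^+2 *+ 2 != 0 by rewrite mulrn_eq0/= sqrf_eq0.
have dphi (x: R): is_derive x (1: R) phi (- (x/s^+2) * phi x).
 rewrite normal_pdfE// /normal_fun; apply: is_derive_eq; rewrite /GRing.scale/= !subr0 -[s^+2 *+ 2]mulr_natl.
 by move: (expR _) (normal_peak s) => E p; field.
have dF (x: R): is_derive x (1: R) F (h x).
 have:= dphi x => d1; rewrite /F /h; apply: is_derive_eq; rewrite /GRing.scale/=.
 by move: (phi x) (sin _) (cos _) => p a b; field.
have dfF (x: R): derivable F x 1 by have []:= dF x.
have cF: continuous F by move=> x; apply: differentiable_continuous; exact/derivable1_diffP.
have ch: continuous h.
 have cl: continuous (fun x: R => t*x+al) by move=> x; apply: cvgD; [apply: cvgMr; exact: cvg_id|exact: cvg_cst].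
 have cs: continuous (fun x => sin (t*x+al)).
  by move=> x; apply: (@continuous_comp _ _ _ (fun x => t*x+al) sin); [exact: cl|exact: continuous_sin].
 have cc: continuous (fun x => cos (t*x+al)).
  by move=> x; apply: (@continuous_comp _ _ _ (fun x => t*x+al) cos); [exact: cl|exact: continuous_cos].
 have cp:= @continuous_normal_pdf R 0 s s0.
 move=> x; apply: cvgB; last by apply: cvgMr; apply: cvgM; [exact: cc|exact: cp].
 by apply: cvgM; [apply: cvgM; [exact: cvg_id|exact: cs]|exact: cp].
have ftc (n: nat): (\int[la]_(x in `[(- n.+1%:R)%R, n.+1%:R]) (h x)%:E = (F n.+1%:R-F (- n.+1%:R))%:E)%E.
 have n0: 0<n.+1%:R :> R by rewrite ltr0n.
 rewrite (@continuous_FTC2 _ h F).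
 - by [].
 - by lra.
 - exact: continuous_subspaceT.
 - split; first by move=> x _; exact: dfF.
   by apply: cvg_at_right_filter; exact: cF.
  by apply: cvg_at_left_filter; exact: cF.
 - by move=> x _; rewrite derive1E (@derive_val _ _ _ _ _ _ _ (dF x)).
have c1: (\int[la]_(x in `[(- n.+1%:R)%R, n.+1%:R]) (h x)%:E)%E @[n --> \oo] --> (\int[la]_x (h x)%:E)%E.
 rewrite (_: (fun n => _) = fun n: nat => (\int[la]_x (((EFin \o h) \_ `[(- n.+1%:R)%R, n.+1%:R]) x))%E); last first.
  by apply/funext => n; rewrite -integral_mkcond.
 have mh: mfunT (EFin \o h) by case/integrableP: ih.
 have [] // := @dominated_convergence _ _ _ la setT measurableT
  (fun n: nat => (EFin \o h) \_ `[(- n.+1%:R)%R, n.+1%:R]) (EFin \o h) (fun x => `|(h x)%:E|%E).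
 - move=> n; apply/(measurable_restrictT _ _).1; [exact: measurable_itv|exact: measurable_funTS].
 - apply: aeW => x _; apply: cvg_near_cst; exists (Num.truncn `|x|) => // n /= xn.
  have xn': `|x| <= n.+1%:R.
   by apply: ltW; apply: lt_le_trans (truncnS_gt _) _; rewrite ler_nat ltnS.
  by rewrite patchE mem_set//= in_itv/= -ler_norml.
 - exact: integrable_abse.
 - by apply: aeW => x n _; rewrite patchE; case: ifP => //; rewrite abse0.
have c2: (F n.+1%:R-F (- n.+1%:R))%:E @[n --> \oo] --> 0%E.
 apply: cvg_EFin; first exact: nearW.
 set C:= expR (s^+2/2)*normal_peak s.
 have C0: 0<=C by rewrite mulr_ge0 ?expR_ge0 ?normal_peak_ge0.
 have bF (n: nat) (sg: R): (sg = 1 \/ sg = -1) -> `|F (sg*n.+1%:R)| <= s^+2*C*n.+1%:R^-1.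
  move=> hs; rewrite /F normrM normrN (ger0_norm (sqr_ge0 s)) -mulrA ler_wpM2l ?sqr_ge0//.
  have -> : phi (sg*n.+1%:R) = phi n.+1%:R by case: hs => ->; rewrite ?mul1r// mulN1r phiN.
  rewrite normrM (ger0_norm (normal_pdf_ge0 _ _ _)); apply: (@le_trans _ _ (phi n.+1%:R)).
   by rewrite ler_piMl ?normal_pdf_ge0// sin_max.
  apply: le_trans (phi_small _) _; rewrite ler_wpM2l// lef_pV2 ?posrE ?ltr0n// ler_nat//.
 apply/cvgrPdist_lt => e e0.
 have K0: 0<2*(s^+2*C)+1 by rewrite ltr_wpDl// mulr_ge0// mulr_ge0// sqr_ge0.
 have:= near_infty_natSinv_lt (PosNum (divr_gt0 e0 K0)); apply: filterS => n /=.
 rewrite ltr_pdivlMr// => hn; rewrite sub0r normrN; apply: le_lt_trans (ler_normB _ _) _.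
 have:= bF n 1 (or_introl erefl); have:= bF n (-1) (or_intror erefl); rewrite mul1r mulN1r => a b.
 have: 0<n.+1%:R^-1 :> R by rewrite invr_gt0.
 by move: a b hn; move: (n.+1%:R^-1) (s^+2*C) => q k; lra.
have Z: (\int[la]_x (h x)%:E = 0)%E.
 apply: (cvg_unique _ c1) => //; rewrite (_: (fun n => _) = fun n: nat => (F n.+1%:R-F (- n.+1%:R))%:E)//.
 by apply/funext => n; exact: ftc.
by apply/eqP; rewrite -subr_eq0 hE /Rintegral Z.
Qed.

(** By [ncf_derive] and [In_parts], f = [ncf al] satisfies f' = - s^2 t f, so its product with exp
    (s^2 t^2/2) is constant. *)
Lemma ncfE (al t: R): ncf al t = cos al*expR (- (s^+2 * t^+2/2)).
Proof.
pose g t:= ncf al t*expR (s^+2 * t^+2/2).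
have dg (u: R): is_derive u (1: R) g 0.
 have:= ncf_derive al u; rewrite In_parts => d1.
 by apply: is_derive_eq; rewrite /GRing.scale/=; field.
have: g t = g 0 by apply: is_derive_0_is_cst.
rewrite /g expr0n/= mulr0 mul0r expR0 mulr1 => h.
have n0: ncf al 0 = cos al.
 rewrite /ncf /In; under eq_Rintegral do rewrite mul0r add0r.
 by rewrite RintegralZl ?/Rintegral ?integral_normal_pdf ?mulr1//; exact: integrable_normal_pdf.
by rewrite expRN -[LHS](mulfK (lt0r_neq0 (expR_gt0 (s^+2 * t^+2/2)))) h n0.
Qed.

Lemma Ex_normal_cos (t: R): Ex (normal_prob 0 s) (fun x => cos (t*x)) = expR (- (s^+2 * t^+2/2)).
Proof.
have:= ncfE 0 t; rewrite cos0 mul1r => <-; rewrite /ncf -Ex_normal.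
- by congr Ex; apply/funext => x; rewrite addr0.
- exact: (measurable_sc 0 t).1.
- by move=> x; exact: cos_max.
Qed.

Lemma Ex_normal_sin (t: R): Ex (normal_prob 0 s) (fun x => sin (t*x)) = 0.
Proof.
have E:= ncfE (- (pi/2)) t; rewrite cosN cos_pihalf mul0r in E; rewrite -[RHS]E /ncf -Ex_normal.
- by congr Ex; apply/funext => x; rewrite cosD cosN sinN cos_pihalf sin_pihalf; ring.
- exact: (measurable_sc _ t).1.
- by move=> x; exact: cos_max.
Qed.

(** Chernoff's bound with parameter 1, on both sides at once. *)
Lemma Ex_normal_tail (a: R): Ex (normal_prob 0 s) (fun x => (a <= `|x|)%R%:R)<=2*expR (s^+2/2)*expR (- a).
Proof.
have ml: mfunT (fun x: R => (a <= `|x|)%R%:R: R) by exact: (bm_meas (bm_geind a (f:= id) (@measurable_id _ R setT))).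
have b1 (x: R): `|(a <= `|x|)%R%:R: R| <= 1 by case: (a <= `|x|)%R; rewrite /= ?normr1 ?normr0.
rewrite Ex_normal// /In; have [i1 e1]:= In_exp 1; have [i2 e2]:= In_exp (-1).
have -> : 2*expR (s^+2/2)*expR (- a) = \int[la]_x (expR (- a)*(expR (1*x) * phi x+expR (-1*x) * phi x)).
 rewrite RintegralZl ?RintegralD ?e1 ?e2//; last first.
  by rewrite /comp; under eq_fun do rewrite EFinD; exact: integrableD.
 by rewrite sqrrN expr1n mul1r; ring.
apply: le_Rintegral => //; first exact: In_int1.
 rewrite /comp; under eq_fun do rewrite EFinM EFinD.
 by apply: integrableZl => //; exact: integrableD.
move=> x _; rewrite -mulrDl mulrA ler_wpM2r ?normal_pdf_ge0// mul1r mulN1r mulrDr -!expRD.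
have p:= expR_gt0 (- a+x); have q:= expR_gt0 (- a-x).
case: (leP a `|x|) => h /=; last by lra.
have [x0|x0]:= ger0P x.
 have: 1<=expR (- a+x) by rewrite -expR0 ler_expR; move: h; rewrite ger0_norm//; lra.
 lra.
have: 1<=expR (- a-x) by rewrite -expR0 ler_expR; move: h; rewrite ltr0_norm//; lra.
lra.
Qed.

End NormalLaw.

(** * Characteristic functions of sums, in real form *)

Section CharacteristicFunctions.
Variables (R: realType) (dO: measure_display) (Om: measurableType dO) (P: probability Om R).

Lemma measurable_cos (f: Om -> R): mfunT f -> mfunT (fun w => cos (f w)).
Proof. by apply: measurableT_comp; apply: continuous_measurable_fun; exact: continuous_cos. Qed.
Lemma measurable_sin (f: Om -> R): mfunT f -> mfunT (fun w => sin (f w)).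
Proof. by apply: measurableT_comp; apply: continuous_measurable_fun; exact: continuous_sin. Qed.
Lemma bm_cos (f: Om -> R): mfunT f -> bm (fun w => cos (f w)).
Proof. by move=> mf; split; [exact: measurable_cos|exists 1 => w; exact: cos_max]. Qed.
Lemma bm_sin (f: Om -> R): mfunT f -> bm (fun w => sin (f w)).
Proof. by move=> mf; split; [exact: measurable_sin|exists 1 => w; exact: sin_max]. Qed.
Lemma measurable_sumr (I: Type) (r: seq I) (F: I -> Om -> R): (forall i, mfunT (F i)) ->
 mfunT (fun w => \sum_(i <- r) F i w).
Proof. by move=> mF; apply: measurable_sum. Qed.

Definition trg (b: bool): R -> R:= if b then cos else sin.

Lemma bm_trg b (f: Om -> R): mfunT f -> bm (fun w => trg b (f w)).
Proof. by case: b; [exact: bm_cos|exact: bm_sin]. Qed.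

(** The addition formulas mix cosines and sines, so the induction carries a further product of
    arbitrary [trg] factors over [r2]; the vanishing sines kill the cross terms. *)
Lemma cf_sum (A: nat -> Om -> R): (forall k, mfunT (A k)) ->
 (forall (r: seq nat) (g: nat -> bool), uniq r ->
  Ex P (fun w => \prod_(k <- r) trg (g k) (A k w)) = \prod_(k <- r) Ex P (fun w => trg (g k) (A k w))) ->
 (forall k, Ex P (fun w => sin (A k w)) = 0) -> forall r, uniq r ->
 Ex P (fun w => cos (\sum_(k <- r) A k w)) = \prod_(k <- r) Ex P (fun w => cos (A k w)) /\
 Ex P (fun w => sin (\sum_(k <- r) A k w)) = 0.
Proof.
move=> mA ind s0.
suff main r1: forall r2 (g: nat -> bool), uniq (r1 ++ r2) ->
 Ex P (fun w => cos (\sum_(k <- r1) A k w)*\prod_(k <- r2) trg (g k) (A k w)) =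
  (\prod_(k <- r1) Ex P (fun w => cos (A k w)))*\prod_(k <- r2) Ex P (fun w => trg (g k) (A k w)) /\
 Ex P (fun w => sin (\sum_(k <- r1) A k w)*\prod_(k <- r2) trg (g k) (A k w)) = 0.
 move=> r ur; have []:= main r [::] (fun=> true); first by rewrite cats0.
 have E (h: R -> R): (fun w => h (\sum_(k <- r) A k w)*\prod_(k <- [::]) trg true (A k w)) =
   fun w => h (\sum_(k <- r) A k w) by apply/funext => w; rewrite big_nil mulr1.
 by rewrite (E cos) (E sin) big_nil mulr1.
elim: r1 => [|i r1 IH] r2 g u.
 split; first by under eq_fun do rewrite big_nil cos0 mul1r; rewrite big_nil mul1r; exact: ind.
 by under eq_fun do rewrite big_nil sin0 mul0r; rewrite Ex_cst.
have ur: uniq (r1 ++ i :: r2) by rewrite -cat1s uniq_catCA /=.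
have ir2: i \notin r2.
 by move: u; rewrite /= mem_cat negb_or => /andP[/andP[]].
pose gi b:= fun j => if j == i then b else g j.
have gE b (F: nat -> bool -> R): \prod_(k <- r2) F k (gi b k) = \prod_(k <- r2) F k (g k).
 rewrite big_seq [RHS]big_seq; apply: eq_bigr => k kr; rewrite /gi; case: eqP => // ki.
 by rewrite ki (negbTE ir2) in kr.
have [c1 c2]:= IH (i :: r2) (gi true) ur; have [d1 d2]:= IH (i :: r2) (gi false) ur.
pose G w:= \prod_(k <- r2) trg (g k) (A k w).
have E b w: \prod_(k <- i :: r2) trg (gi b k) (A k w) = trg b (A i w)*G w.
 by rewrite big_cons {1}/gi eqxx /G (gE b (fun k c => trg c (A k w))).
have E' b: \prod_(k <- i :: r2) Ex P (fun w => trg (gi b k) (A k w)) =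
 Ex P (fun w => trg b (A i w))*\prod_(k <- r2) Ex P (fun w => trg (g k) (A k w)).
 by rewrite big_cons {1}/gi eqxx (gE b (fun k c => Ex P (fun w => trg c (A k w)))).
have bS b: bm (fun w => trg b (\sum_(k <- r1) A k w)) by apply: bm_trg; exact: measurable_sumr.
have bG: bm G by apply: bm_prod => k; exact: bm_trg.
have bb b b': bm (fun w => trg b (\sum_(k <- r1) A k w)*(trg b' (A i w)*G w)).
 by apply: bmM => //; apply: bmM => //; exact: bm_trg.
have E2 (h: R -> R) b: (fun w => h (\sum_(k <- r1) A k w)*\prod_(k <- i :: r2) trg (gi b k) (A k w)) =
  fun w => h (\sum_(k <- r1) A k w)*(trg b (A i w)*G w) by apply/funext => w; rewrite E.
rewrite E' in c1; rewrite E' in d1; rewrite E2 in c1; rewrite E2 in c2; rewrite E2 in d1; rewrite E2 in d2.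
split.
 rewrite (_: (fun w => _) = fun w => cos (\sum_(k <- r1) A k w)*(trg true (A i w)*G w) -
   sin (\sum_(k <- r1) A k w)*(trg false (A i w)*G w)).
  by rewrite (ExB P (bb true true) (bb false false)) c1 d2 subr0 big_cons; ring.
 by apply/funext => w; rewrite big_cons cosD /G /=; ring.
rewrite (_: (fun w => _) = fun w => cos (\sum_(k <- r1) A k w)*(trg false (A i w)*G w) +
  sin (\sum_(k <- r1) A k w)*(trg true (A i w)*G w)).
 by rewrite (ExD P (bb true false) (bb false true)) c2 d1 /= s0 mul0r mulr0 addr0.
by apply/funext => w; rewrite big_cons sinD /G /=; ring.
Qed.

End CharacteristicFunctions.

(** * Levy's continuity theorem by Bernstein polynomials *)

Section LevyContinuity.
Variables (R: realType) (dO: measure_display) (Om: measurableType dO) (P: probability Om R) (I: finType).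

(* The Bernstein operator, written as the average over independent coin tosses, one for each
   entry [i] of the list, with success probability [y i]. *)
Fixpoint BT (s: seq I) (F: (I -> nat) -> R) (y: I -> R): R :=
 if s is i :: s' then (1-y i)*BT s' F y+y i*BT s' (fun c => F (fun j => ((j == i)+c j)%N)) y
 else F (fun=> 0%N).

Lemma BT_le s F G y: (forall i, 0<=y i<=1) -> (forall c, F c<=G c) -> BT s F y<=BT s G y.
Proof.
move=> y01; elim: s F G => [|i s IH] F G FG /=; first exact: FG.
have /andP[a b]:= y01 i; apply: lerD; rewrite ler_wpM2l ?subr_ge0//; apply: IH => // c; exact: FG.
Qed.

Lemma BT_lin s F G y (a b: R): BT s (fun c => a*F c+b*G c) y = a*BT s F y+b*BT s G y.
Proof. by elim: s F G => //= i s IH F G; rewrite !IH; ring. Qed.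

Lemma BT_cst s y (a: R): BT s (fun=> a) y = a.
Proof. by elim: s => //= i s ->; ring. Qed.

Lemma BT_sum s (J: Type) (r: seq J) (F: J -> (I -> nat) -> R) y :
 BT s (fun c => \sum_(j <- r) F j c) y = \sum_(j <- r) BT s (F j) y.
Proof.
elim: r => [|j r IH].
 rewrite big_nil (_: (fun c => _) = fun=> 0) ?BT_cst//; by apply/funext => c; rewrite big_nil.
rewrite big_cons -IH (_: (fun c => _) = fun c => 1*F j c+1*\sum_(j <- r) F j c) ?BT_lin ?mul1r//.
by apply/funext => c; rewrite big_cons !mul1r.
Qed.

(** Bias and variance of a binomial variable; the shift [a] is what the induction on the list
    needs. *)
Lemma BT_var s i y (a: R): BT s (fun c => ((c i)%:R+a)^+2) y =
 ((count_mem i s)%:R*y i+a)^+2+(count_mem i s)%:R*(y i*(1-y i)).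
Proof.
elim: s a => [|j s IH] a /=; first by rewrite !mul0r addr0.
have [->|ij]:= eqVneq j i.
 have -> : BT s (fun c => ((true+c i)%:R+a)^+2) y = BT s (fun c => ((c i)%:R+(a+1))^+2) y.
  by congr (BT s _ y); apply/funext => c; rewrite natrD /=; congr (_^+2); ring.
 by rewrite !IH natrD /=; ring.
by change (BT s (fun c => ((false+c i)%:R+a)^+2) y) with (BT s (fun c => ((c i)%:R+a)^+2) y); rewrite !IH !add0n; ring.
Qed.

Lemma BT_abs s i y (q: nat): (forall i, 0<=y i<=1) -> (0<q)%N -> count_mem i s = (q*q)%N ->
 BT s (fun c => `|(c i)%:R-(q*q)%:R*y i|) y<=q%:R.
Proof.
move=> y01 q0 cq; have qp: 0<q%:R :> R by rewrite ltr0n.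
have V:= BT_var s i y (- ((q*q)%:R*y i)); rewrite cq subrr expr0n add0r in V.
(* AM-GM: [2 |t| <= q + t^2 / q] *)
apply: (@le_trans _ _ (BT s (fun c => (2^-1)*(fun=> q%:R) c+(2*q%:R)^-1*((c i)%:R-(q*q)%:R*y i)^+2) y)).
 apply: BT_le => // c; set t:= _-_; have h:= sqr_ge0 (`|t| - q%:R).
 have -> : 2^-1*q%:R+(2*q%:R)^-1 * t^+2 = (q%:R^+2 + `|t| ^+ 2)/(2*q%:R).
  by rewrite real_normK ?num_real//; field; rewrite gt_eqF.
 by rewrite ler_pdivlMr ?mulr_gt0//; move: h; rewrite sqrrB -mulr_natl; lra.
rewrite (BT_lin s (fun=> q%:R) (fun c => ((c i)%:R-(q*q)%:R*y i)^+2)) BT_cst V natrM.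
have -> : (2*q%:R)^-1*(q%:R*q%:R*(y i*(1-y i))) = q%:R/2*(y i*(1-y i)).
 by field; rewrite gt_eqF.
by have /andP[a b]:= y01 i; have: y i*(1-y i)<=1 by [nra]; move: (y i*_) => v; nra.
Qed.

Section Convergence.
Variables (X: nat -> I -> Om -> R) (Y: I -> Om -> R).
Hypothesis mX: forall n i, mfunT (X n i).
Hypothesis mY: forall i, mfunT (Y i).
Hypothesis cfc: forall th: I -> R, Ex P (fun w => cos (\sum_i th i*X n i w)) @[n --> \oo] --> Ex P (fun w => cos (\sum_i th i*Y i w)).
Hypothesis cfs: forall th: I -> R, Ex P (fun w => sin (\sum_i th i*X n i w)) @[n --> \oo] --> Ex P (fun w => sin (\sum_i th i*Y i w)).

(** Maps the line periodically into [0, 1], so that a polynomial in these quantities is a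
    trigonometric polynomial in [x]. *)
Definition ysin (p: R) (x: I -> R) (i: I): R:= 2^-1+2^-1*sin (p*x i).

Lemma ysin01 p x i: 0<=ysin p x i<=1.
Proof using. by have:= sin_geN1 (p*x i); have:= sin_le1 (p*x i); rewrite /ysin => a b; apply/andP; split; lra. Qed.

Lemma bm_ysin p (Z: I -> Om -> R) i: mfunT (Z i) -> bm (fun w => ysin p (Z^~ w) i).
Proof using.
move=> mZ; apply: bmD; first exact: bm_cst.
by apply: bmZ; apply: bm_sin; apply: measurable_funM.
Qed.

Lemma bm_BT s F p (Z: I -> Om -> R): (forall i, mfunT (Z i)) -> bm (fun w => BT s F (ysin p (Z^~ w))).
Proof using.
move=> mZ; elim: s F => [|i s IH] F /=; first exact: bm_cst.
apply: bmD; apply: bmM => //; last exact: bm_ysin.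
by apply: bmB; [exact: bm_cst|exact: bm_ysin].
Qed.

Lemma mlin (Z: I -> Om -> R) (th: I -> R) (al: R): (forall i, mfunT (Z i)) ->
 mfunT (fun w => \sum_i th i*Z i w+al).
Proof using.
move=> mZ; apply: measurable_funD => //; apply: measurable_sumr => i; exact: measurable_funM.
Qed.

(** One Bernstein factor times a cosine is a combination of cosines with shifted frequencies, a sine
    being a cosine with phase [- pi/2]. *)
Lemma BT_cos_step p (Z: I -> Om -> R) i s F th al w :
 BT (i :: s) F (ysin p (Z^~ w))*cos (\sum_j th j*Z j w+al) =
 2^-1*(BT s F (ysin p (Z^~ w))*cos (\sum_j th j*Z j w+al) +
     BT s (fun c => F (fun j => ((j == i)+c j)%N)) (ysin p (Z^~ w))*cos (\sum_j th j*Z j w+al)) +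
 4^-1*((BT s (fun c => F (fun j => ((j == i)+c j)%N)) (ysin p (Z^~ w))*cos (\sum_j (th j+(j == i)%:R * p)*Z j w+(al-pi/2)) -
     BT s (fun c => F (fun j => ((j == i)+c j)%N)) (ysin p (Z^~ w))*cos (\sum_j (th j-(j == i)%:R * p)*Z j w+(al-pi/2))) -
     (BT s F (ysin p (Z^~ w))*cos (\sum_j (th j+(j == i)%:R * p)*Z j w+(al-pi/2)) -
     BT s F (ysin p (Z^~ w))*cos (\sum_j (th j-(j == i)%:R * p)*Z j w+(al-pi/2)))).
Proof using.
have S (sg: R): \sum_j (th j+sg*((j == i)%:R * p))*Z j w = \sum_j th j*Z j w+sg*(p*Z i w).
 under eq_bigr do rewrite mulrDl; rewrite big_split/=; congr (_+_).
 rewrite (bigD1 i)//= eqxx mul1r big1 ?addr0 ?mulrA// => j /negbTE ->.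
 by rewrite mul0r mulr0 mul0r.
have S1: \sum_j (th j+(j == i)%:R * p)*Z j w = \sum_j th j*Z j w+p*Z i w.
 by rewrite -[p*Z i w]mul1r -S; apply: eq_bigr => j _; rewrite mul1r.
have S2: \sum_j (th j-(j == i)%:R * p)*Z j w = \sum_j th j*Z j w-p*Z i w.
 by rewrite -mulN1r -S; apply: eq_bigr => j _; rewrite mulN1r.
rewrite S1 S2 /= /ysin; set v:= \sum_j _; set u:= p*Z i w.
have q (z: R): cos (z+(al-pi/2)) = sin (z+al).
 by rewrite addrA cosD cosN sinN cos_pihalf sin_pihalf; ring.
rewrite !q; have -> : v+u+al = v+al+u by ring.
have -> : v-u+al = v+al-u by ring.
rewrite sinD sinB; move: (BT _ _ _) (BT s _ _) (cos _) (cos u) (sin _) (sin u) => a b c e f g.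
by field.
Qed.

(** By [BT_cos_step] these expectations are finite combinations of characteristic functions, whose
    convergence is assumed. *)
Lemma BT_conv p s: forall F th al,
 Ex P (fun w => BT s F (ysin p ((X n)^~ w))*cos (\sum_j th j*X n j w+al)) @[n --> \oo] -->
 Ex P (fun w => BT s F (ysin p (Y^~ w))*cos (\sum_j th j*Y j w+al)).
Proof using mX mY cfc cfs.
elim: s => [|i s IH] F th al /=.
 have E (Z: I -> Om -> R): (forall i, mfunT (Z i)) ->
   Ex P (fun w => F (fun=> 0%N)*cos (\sum_j th j*Z j w+al)) =
   F (fun=> 0%N)*(cos al*Ex P (fun w => cos (\sum_j th j*Z j w))-sin al*Ex P (fun w => sin (\sum_j th j*Z j w))).
  move=> mZ; have m0: mfunT (fun w => \sum_j th j*Z j w).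
   by apply: measurable_sumr => j; exact: measurable_funM.
  have bc:= bm_cos m0; have bs:= bm_sin m0.
  rewrite ExZ; last by apply: bm_cos; exact: mlin.
  congr (_*_); rewrite -(ExZ P _ bc) -(ExZ P _ bs) -ExB; [|exact: bmZ|exact: bmZ].
  by congr Ex; apply/funext => w; rewrite cosD; ring.
 under eq_cvg => n do rewrite (E _ (mX n)); rewrite (E _ mY).
 by apply: cvgMr; apply: cvgB; apply: cvgMr; [exact: cfc|exact: cfs].
have bb (Z: I -> Om -> R) G th' al': (forall i, mfunT (Z i)) ->
  bm (fun w => BT s G (ysin p (Z^~ w))*cos (\sum_j th' j*Z j w+al')).
 by move=> mZ; apply: bmM; [exact: bm_BT|apply: bm_cos; exact: mlin].
pose F' c:= F (fun j => ((j == i)+c j)%N).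
have E (Z: I -> Om -> R): (forall i, mfunT (Z i)) ->
 Ex P (fun w => BT (i :: s) F (ysin p (Z^~ w))*cos (\sum_j th j*Z j w+al)) =
 2^-1*(Ex P (fun w => BT s F (ysin p (Z^~ w))*cos (\sum_j th j*Z j w+al)) +
     Ex P (fun w => BT s F' (ysin p (Z^~ w))*cos (\sum_j th j*Z j w+al))) +
 4^-1*((Ex P (fun w => BT s F' (ysin p (Z^~ w))*cos (\sum_j (th j+(j == i)%:R * p)*Z j w+(al-pi/2))) -
     Ex P (fun w => BT s F' (ysin p (Z^~ w))*cos (\sum_j (th j-(j == i)%:R * p)*Z j w+(al-pi/2)))) -
     (Ex P (fun w => BT s F (ysin p (Z^~ w))*cos (\sum_j (th j+(j == i)%:R * p)*Z j w+(al-pi/2))) -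
     Ex P (fun w => BT s F (ysin p (Z^~ w))*cos (\sum_j (th j-(j == i)%:R * p)*Z j w+(al-pi/2))))).
 move=> mZ; under eq_fun do rewrite BT_cos_step.
 by rewrite -!ExB -?ExD -?ExZ -?ExD//; repeat (first [exact: bb|apply: bmZ|apply: bmB|apply: bmD]).
have EX:= funext (fun n => E _ (mX n)); rewrite /= in EX E; rewrite EX (E _ mY).
apply: cvgD; apply: cvgMr; first by apply: cvgD; exact: IH.
by apply: cvgB; apply: cvgB; exact: IH.
Qed.

Variables (f: (I -> R) -> R) (K: R).
Hypothesis fK: forall x, `|f x| <= K.
Hypothesis f_mod: forall e: R, 0<e -> exists2 L: R, 0<=L & forall x y, `|f x-f y| <= e+L*\sum_i `|x i-y i|.

Lemma count_blocks N i: count_mem i (flatten [seq nseq N j | j <- enum I]) = N.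
Proof using.
rewrite count_flatten sumnE -map_comp big_map big_enum /= (bigD1 i)//= count_nseq /= eqxx mul1n big1 ?addn0// => j /negbTE ji.
by rewrite count_nseq /= ji.
Qed.

(** The sampled point is close to [Pp*sin (x i/Pp)] by the variance bound, and this is close to
    [x i] when |x i| < A and [Pp] is large; otherwise [f] is merely bounded by [K]. *)
Lemma BT_approx (e L A Pp: R) (q: nat) x: 0<=L -> 0<Pp -> (0<q)%N ->
 (forall x y, `|f x-f y| <= e+L*\sum_i `|x i-y i|) -> 0<=e -> 0<=A ->
 `|f x-BT (flatten [seq nseq (q*q) j | j <- enum I])
   (fun c => f (fun i => Pp*(2*(c i)%:R/(q*q)%:R-1))) (ysin Pp^-1 x)| <=
 e+L*(#|I|%:R*(A^+2/Pp+2*Pp/q%:R))+2*K*\sum_i (A <= `|x i|)%R%:R.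
Proof using fK.
move=> L0 P0 q0 fm e0 A0; set s:= flatten _; set F:= fun c => _; set y:= ysin _ _.
have q0': 0<q%:R :> R by rewrite ltr0n.
have y01 i: 0<=y i<=1 by exact: ysin01.
have K0: 0<=K by apply: le_trans (fK x).
have dB (G: (I -> nat) -> R): (forall c, `|f x-F c| <= G c) -> `|f x-BT s F y| <= BT s G y.
 move=> FG; have l1: BT s (fun k => 1*f x+(-1)*F k) y<=BT s G y.
  by apply: BT_le => // c; have:= FG c; rewrite ler_norml => /andP[? ?]; lra.
 have l2: BT s (fun k => (-1)*f x+1*F k) y<=BT s G y.
  by apply: BT_le => // c; have:= FG c; rewrite ler_norml => /andP[? ?]; lra.
 move: l1 l2; rewrite (BT_lin s (fun=> f x) F) (BT_lin s (fun=> f x) F) BT_cst => l1 l2.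
 by rewrite ler_norml; apply/andP; split; lra.
have B0: 0<=L*(#|I|%:R*(A^+2/Pp+2*Pp/q%:R)).
 by rewrite !mulr_ge0// addr_ge0 ?divr_ge0 ?mulr_ge0 ?sqr_ge0// ltW.
have [/existsP[i Ai]|/existsPn nA]:= boolP [exists i, A <= `|x i|].
 apply: le_trans (dB (fun=> 2*K) _) _ => [c|].
  by apply: le_trans (ler_normB _ _) _; have:= fK x; have:= fK (fun i => Pp*(2*(c i)%:R/(q*q)%:R-1)); rewrite /F; lra.
 rewrite BT_cst (bigD1 i)//= Ai /=.
 have: 0<=\sum_(j | j != i) (A <= `|x j|)%R%:R :> R by apply: sumr_ge0.
 by move: (\sum_(j | _) _) (L*_) B0 => S v v0 S0; have KS: 0<=K*S by [exact: mulr_ge0]; rewrite mulrDr mulr1; lra.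
have S0: 0<=2*K*\sum_i (A <= `|x i|)%R%:R by rewrite !mulr_ge0// sumr_ge0.
apply: (@le_trans _ _ (e+L*(#|I|%:R*(A^+2/Pp+2*Pp/q%:R)))); last by rewrite lerDl.
apply: le_trans (dB (fun c => e+L*\sum_i `|x i-Pp*(2*(c i)%:R/(q*q)%:R-1)|) _) _ => [c|]; first exact: fm.
have BB (G: (I -> nat) -> R): BT s (fun c => e+L*G c) y = e+L*BT s G y.
 by have:= BT_lin s (fun=> e) G y 1 L; rewrite BT_cst mul1r.
rewrite BB lerD2l ler_wpM2l// BT_sum; apply: le_trans (ler_sum _ (G:= fun=> A^+2/Pp+2*Pp/q%:R) _) _ => [i _|]; last first.
 by rewrite sumr_const [X in _<=X]mulr_natl.
apply: (@le_trans _ _ (BT s (fun c => 1*(fun=> A^+2/Pp) c+2*Pp/(q*q)%:R * `|(c i)%:R-(q*q)%:R*y i|) y)).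
 apply: BT_le => // c; rewrite mul1r.
 have -> : x i-Pp*(2*(c i)%:R/(q*q)%:R-1) = Pp*(Pp^-1*x i-sin (Pp^-1*x i)) -
   2*Pp/(q*q)%:R*((c i)%:R-(q*q)%:R*y i).
  by rewrite /y /ysin natrM; field; rewrite !gt_eqF.
 apply: le_trans (ler_normB _ _) _; apply: lerD.
  rewrite normrM (gtr0_norm P0); apply: le_trans (ler_wpM2l (ltW P0) (sin_sub_le _)) _.
  rewrite (_: Pp*(Pp^-1*x i)^+2 = `|x i| ^+ 2/Pp); last by rewrite real_normK ?num_real//; field; rewrite gt_eqF.
  by rewrite ler_pM2r ?invr_gt0// ler_pXn2r ?nnegrE//; have:= nA i; rewrite -ltNge => /ltW.
 by rewrite normrM ger0_norm// divr_ge0 ?mulr_ge0// ltW.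
rewrite (BT_lin s (fun=> A^+2/Pp) (fun c => `|(c i)%:R-(q*q)%:R*y i|)) BT_cst mul1r lerD2l.
have c0: 0<=2*Pp/(q*q)%:R by rewrite divr_ge0 ?mulr_ge0// ltW.
apply: le_trans (ler_wpM2l c0 (BT_abs y01 q0 (count_blocks _ _))) _.
by rewrite natrM; apply: eq_le_imp; field; rewrite gt_eqF.
Qed.

Hypothesis bX: forall n, bm (fun w => f ((X n)^~ w)).
Hypothesis bY: bm (fun w => f (Y^~ w)).
Hypothesis tX: forall eta: R, 0<eta -> exists2 A: R, 0<=A & forall n i, Ex P (fun w => (A <= `|X n i w|)%R%:R)<=eta.
Hypothesis tY: forall eta: R, 0<eta -> exists2 A: R, 0<=A & forall i, Ex P (fun w => (A <= `|Y i w|)%R%:R)<=eta.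

Lemma levy_continuity: Ex P (fun w => f ((X n)^~ w)) @[n --> \oo] --> Ex P (fun w => f (Y^~ w)).
Proof.
have bI (A: R) (Z: Om -> R): mfunT Z -> bm (fun w => (A <= `|Z w|)%R%:R: R):= @bm_geind _ _ _ Z A.
apply/cvgrPdist_lt => /= e e0; have K0: 0<=K by apply: le_trans (fK (fun=> 0)).
have [L L0 fm]:= f_mod (divr_gt0 e0 (ltr0n _ 8): 0<e/8).
set n:= #|I|%:R: R; have n0: 0<=n by rewrite /n.
have h0: 0<e/(16*(K+1)*(n+1)) by rewrite divr_gt0// !mulr_gt0//; lra.
have [A1 A10 t1]:= tX h0; have [A2 A20 t2]:= tY h0; set eta:= e / _ in h0 t1 t2.
pose A:= A1+A2; have A0: 0<=A by rewrite addr_ge0.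
(* [Pp] brings the error of replacing [x] by [Pp*sin (x/Pp)] on [-A, A] below [e/16]; then [q] does
   the same for the sampling error. *)
pose Pp:= 1+16*L*n*A^+2/e.
have P0: 0<Pp by rewrite /Pp ltr_pwDl// divr_ge0 ?(ltW e0)// !mulr_ge0// sqr_ge0.
have [q qb]: exists q: nat, (0<q)%N /\ 32*L*n*Pp/e<=q%:R.
 exists (Num.truncn (32*L*n*Pp/e)).+1; split => //; apply: ltW; exact: truncnS_gt.
have [q0 q1]:= qb; have q0': 0<q%:R :> R by rewrite ltr0n.
have bnd: L*(n*(A^+2/Pp+2*Pp/q%:R))<=e/8.
 have -> : L*(n*(A^+2/Pp+2*Pp/q%:R)) = L*n*A^+2/Pp+2*(L*n*Pp)/q%:R by ring.
 have a1: L*n*A^+2/Pp<=e/16.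
  rewrite ler_pdivrMr// /Pp (_: e/16*_ = e/16+L*n*A^+2); last by field; rewrite gt_eqF.
  by rewrite lerDr divr_ge0// ltW.
 have a2: 2*(L*n*Pp)/q%:R<=e/16.
  by rewrite ler_pdivrMr//; move: q1; rewrite ler_pdivrMr// -!mulrA; move: (L*(n*Pp)) => a; rewrite [_*(_*q%:R)](_: _ = q%:R*e/16); [move: (q%:R*e) => b|ring]; lra.
 lra.
pose s:= flatten [seq nseq (q*q) j | j <- enum I].
pose F (c: I -> nat):= f (fun i => Pp*(2*(c i)%:R/(q*q)%:R-1)).
have cl (Z: I -> Om -> R): (forall i, mfunT (Z i)) -> bm (fun w => f (Z^~ w)) ->
  (forall i, Ex P (fun w => (A <= `|Z i w|)%R%:R)<=eta) ->
  `|Ex P (fun w => f (Z^~ w))-Ex P (fun w => BT s F (ysin Pp^-1 (Z^~ w)))| <= 3*e/8.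
 move=> mZ bZ tZ.
 have bS: bm (fun w => \sum_i (A <= `|Z i w|)%R%:R: R) by apply: bm_sum => i; exact: bI.
 apply: le_trans (Ex_diff_le P bZ (bm_BT s F Pp^-1 mZ) (h:= fun w => (e/8+e/8)+2*K*\sum_i (A <= `|Z i w|)%R%:R) _ _) _.
 - by apply: bmD; [exact: bm_cst|exact: bmZ].
 - move=> w; apply: le_trans (BT_approx (Z^~ w) L0 P0 q0 fm (ltac:(lra)) A0) _.
  by rewrite lerD2r lerD2l.
 rewrite (ExD P (bm_cst _ _) (bmZ _ bS)) Ex_cst (ExZ P _ bS) Ex_sum; last by move=> i; exact: bI.
 have hS: \sum_i Ex P (fun w => (A <= `|Z i w|)%R%:R)<=n*eta.
  by apply: le_trans (ler_sum _ (fun i _ => tZ i)) _; rewrite sumr_const /n mulr_natl.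
 have hE: 2*K*(n*eta)<=e/8.
  rewrite /eta (_: 2*K*(n*(e/(16*(K+1)*(n+1)))) = e/8*(K/(K+1)*(n/(n+1)))).
   have fr (z: R): 0<=z -> 0<=z/(z+1)<=1 by [move=> z0; rewrite divr_ge0 ?addr_ge0//= ler_pdivrMr; lra].
   have /andP[? ?]:= fr _ K0; have /andP[? ?]:= fr _ n0.
   by apply: ler_piMr; [lra|exact: mulr_ile1].
  by field; rewrite !gt_eqF//; lra.
 have: 2*K*\sum_i Ex P (fun w => (A <= `|Z i w|)%R%:R)<=e/8.
  by apply: le_trans hE; rewrite ler_wpM2l// mulr_ge0.
 lra.
have mono (B C: R) (Z: Om -> R): mfunT Z -> B<=C ->
  Ex P (fun w => (C <= `|Z w|)%R%:R)<=Ex P (fun w => (B <= `|Z w|)%R%:R).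
 move=> mZ BC; apply: le_Ex; [exact: bI|exact: bI|move=> w].
 by case: (leP C `|Z w|) => // h; rewrite (le_trans BC h).
have clY:= cl _ mY bY (fun i => le_trans (mono _ _ _ (mY i) (ltac:(rewrite /A lerDr//): A2<=A)) (t2 i)).
have clX k:= cl _ (mX k) (bX k) (fun i => le_trans (mono _ _ _ (mX k i) (ltac:(rewrite /A lerDl//): A1<=A)) (t1 k i)).
have E (Z: I -> Om -> R): (fun w => BT s F (ysin Pp^-1 (Z^~ w))*cos (\sum_j 0*Z j w+0)) =
  fun w => BT s F (ysin Pp^-1 (Z^~ w)).
 by apply/funext => w; rewrite big1 ?addr0 ?cos0 ?mulr1// => j _; rewrite mul0r.
have:= @BT_conv Pp^-1 s F (fun=> 0) 0; rewrite E (funext (fun k => congr1 (Ex P) (E (X k)))).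
move=> /cvgrPdist_lt/(_ (e/4) (ltac:(lra))); apply: filterS => k; move: (clX k) clY.
by rewrite !ltr_norml !ler_norml => /andP[? ?] /andP[? ?] /andP[? ?]; apply/andP; split; lra.
Qed.

End Convergence.
End LevyContinuity.

(** * Chaining over dyadic points *)

Section Chaining.
Variable R: realType.

Definition fl (k: nat) (t: R): nat:= Num.truncn (t*2^+k).

Lemma fl_itv k (t: R): 0<=t -> (fl k t)%:R<=t*2^+k<(fl k t).+1%:R.
Proof. by move=> t0; apply: truncn_itv; rewrite mulr_ge0// exprn_ge0. Qed.

Lemma fl_step k (t: R): 0<=t -> fl k.+1 t = (2*fl k t)%N \/ fl k.+1 t = (2*fl k t).+1.
Proof.
move=> t0; have /andP[a b]:= fl_itv k t0; have /andP[c e]:= fl_itv k.+1 t0.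
have h1: (2*fl k t<(fl k.+1 t).+1)%N by rewrite -(ltr_nat R) natrM; move: e c; rewrite exprS; lra.
have h2: (fl k.+1 t<2*(fl k t).+1)%N by rewrite -(ltr_nat R) natrM; move: e c; rewrite exprS; lra.
by lia.
Qed.

Lemma fl_lt k (t: R) (T: nat): 0<=t<T%:R -> (fl k t<T*2 ^ k)%N.
Proof.
move=> /andP[t0 tT]; have /andP[a b]:= fl_itv k t0; rewrite -(ltr_nat R) natrM natrX.
by apply: le_lt_trans a _; rewrite ltr_pM2r// exprn_gt0.
Qed.

Lemma fl_near k (s t: R): 0<=s -> s<=t -> t-s<(2^+k)^-1 -> fl k t = fl k s \/ fl k t = (fl k s).+1.
Proof.
move=> s0 st h; have t0:= le_trans s0 st; have p0: 0<2^+k :> R by rewrite exprn_gt0.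
have /andP[a b]:= fl_itv k s0; have /andP[c e]:= fl_itv k t0.
have h': t*2^+k-s*2^+k<1 by rewrite -mulrBl -ltr_pdivlMr// mul1r.
have h3: s*2^+k<=t*2^+k by rewrite ler_pM2r.
have h1: (fl k s<(fl k t).+1)%N by rewrite -(ltr_nat R); lra.
have h2: (fl k t<(fl k s).+2)%N by rewrite -(ltr_nat R) -[(fl k s).+2]addn1 natrD; lra.
by move: h1 h2; clear; lia.
Qed.

Lemma fl_cvg (t: R): 0<=t -> (fl k t)%:R/2^+k @[k --> \oo] --> t.
Proof.
move=> t0; apply/cvgrPdist_lt => /= e e0.
have /cvgrPdist_lt/(_ _ e0):= @cvg_half R.
apply: filterS => k; rewrite sub0r normrN ger0_norm ?exprn_ge0 ?invr_ge0// exprVn => h.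
have /andP[a b]:= fl_itv k t0; have p0: 0<2^+k :> R by rewrite exprn_gt0.
apply: le_lt_trans h; have -> : t-(fl k t)%:R/2^+k = (t*2^+k-(fl k t)%:R)/2^+k by field; rewrite gt_eqF.
rewrite normrM [X in _*X]ger0_norm ?invr_ge0 ?(ltW p0)// ler_piMl ?invr_ge0 ?(ltW p0)//; move: b; rewrite -natr1 => b.
by rewrite ler_norml; apply/andP; split; lra.
Qed.

(** [D k n] stands for the value at the dyadic point n/2^k, and [inc] bounds the increments between
    neighbours from level [K0] on. *)
Variables (D: nat -> nat -> R) (r C: R) (T K0: nat).
Hypothesis Dc: forall k n, D k.+1 (2*n) = D k n.
Hypothesis r01: 0<r<1.
Hypothesis C0: 0<=C.
Hypothesis inc: forall k i, (K0<=k)%N -> (i<T*2 ^ k)%N -> `|D k i.+1-D k i| <= C*r^+k.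

(** The point of level [n.+1] preceding [t] is the one of level [n] or its right neighbour on the
    finer level, so each level costs one increment. *)
Lemma chain_fl k n t: 0<=t<T%:R -> (K0<=k<=n)%N -> `|D n (fl n t)-D k (fl k t)| <= C*(r^+k-r^+n)/(1-r).
Proof using Dc r01 inc C0.
move=> tT /andP[K0k]; have /andP[t0 _]:= tT; have /andP[r0 r1]:= r01.
elim: n => [|n IH]; first by rewrite leqn0 => /eqP ->; rewrite !subrr normr0 mulr0 mul0r.
rewrite leq_eqVlt => /orP[/eqP ->|]; first by rewrite !subrr normr0 mulr0 mul0r.
rewrite ltnS => kn; have {}IH:= IH kn.
have st: `|D n.+1 (fl n.+1 t)-D n (fl n t)| <= C*r^+n.
 have [->|e]:= fl_step n t0; first by rewrite Dc subrr normr0 mulr_ge0// exprn_ge0// ltW.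
 rewrite e -(Dc n); apply: le_trans (inc _ _) _.
 - by apply: leq_trans (leq_trans K0k kn) _.
 - by have:= fl_lt n tT; rewrite expnS; lia.
 by rewrite ler_wpM2l// exprS ler_piMl ?exprn_ge0// ltW.
have -> : C*(r^+k-r^+n.+1)/(1-r) = C*(r^+k-r^+n)/(1-r)+C*r^+n.
 by rewrite exprS; field; rewrite subr_eq0 gt_eqF.
apply: le_trans (ler_distD (D n (fl n t)) _ _) _; rewrite addrC; exact: lerD.
Qed.

Lemma chain_fl' k n t: 0<=t<T%:R -> (K0<=k<=n)%N -> `|D n (fl n t)-D k (fl k t)| <= C*r^+k/(1-r).
Proof using Dc r01 inc C0.
move=> tT kn; have /andP[r0 r1]:= r01; apply: le_trans (chain_fl tT kn) _.
by rewrite ler_pM2r ?invr_gt0 ?subr_gt0// ler_wpM2l// gerBl exprn_ge0// ltW.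
Qed.

Lemma geo_small (e: R): 0<e -> exists k, (K0<=k)%N /\ 3*C*r^+k/(1-r)<e.
Proof using r01 C0.
move=> e0; have /andP[r0 r1]:= r01.
have h: 3*C*r^+k/(1-r) @[k --> \oo] --> 3*C*0/(1-r).
 by apply: cvgMl; apply: cvgMr; apply: cvg_expr; rewrite ger0_norm// ltW.
rewrite mulr0 mul0r in h; have /cvgrPdist_lt/(_ _ e0)[N _ Nh]:= h.
exists (maxn K0 N); split; first exact: leq_maxl.
by have:= Nh _ (leq_maxr K0 N); rewrite sub0r normrN; apply: le_lt_trans; exact: ler_norm.
Qed.

Lemma chain_cvg t: 0<=t<T%:R -> cvgn (fun k => D k (fl k t)).
Proof using Dc r01 inc C0.
move=> tT; have /andP[r0 r1]:= r01; apply: cauchy_cvg; apply: cauchy_exP => e e0.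
have [k [Kk h]]:= geo_small e0; exists (D k (fl k t)); exists k => // n /= kn.
rewrite /ball /= distrC; apply: le_lt_trans (chain_fl' tT (_: (K0<=k<=n)%N)) _; first by rewrite Kk.
have: 0<=C*r^+k/(1-r) by rewrite divr_ge0 ?mulr_ge0 ?exprn_ge0 ?subr_ge0// ltW.
by move: h; rewrite (_: 3*C*r^+k/(1-r) = 3*(C*r^+k/(1-r))); [move: (C*_ / _) => g; lra|ring].
Qed.

(** The 3 counts two passages from the limit to level [k] and one increment between neighbours of
    that level. *)
Lemma chain_mod (X: R -> R) k s t: (forall t, 0<=t<T%:R -> D k (fl k t) @[k --> \oo] --> X t) -> (K0<=k)%N ->
 0<=s<T%:R -> 0<=t<T%:R -> `|t-s| < (2^+k)^-1 -> `|X t-X s| <= 3*C*r^+k/(1-r).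
Proof using Dc r01 inc C0.
move=> XD K0k; have /andP[r0 r1]:= r01; wlog st: s t/s<=t => [H sT tT h|sT tT h].
 have [st|st]:= leP s t; first exact: H.
 by rewrite distrC; apply: H => //; [exact: ltW|rewrite distrC].
have cl t': 0<=t'<T%:R -> `|X t'-D k (fl k t')| <= C*r^+k/(1-r).
 move=> tT'; have c:= XD _ tT'.
 have c2: `|D n (fl n t')-D k (fl k t')| @[n --> \oo] --> `|X t'-D k (fl k t')|.
  by apply: cvg_norm; apply: cvgB => //; exact: cvg_cst.
 rewrite -(cvg_lim _ c2)//; apply: limr_le; first by apply/cvg_ex; exists `|X t'-D k (fl k t')|.
 by exists k => // n /= kn; apply: chain_fl' => //; rewrite K0k.
have md: `|D k (fl k t)-D k (fl k s)| <= C*r^+k/(1-r).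
 have g0: 0<=C*r^+k by rewrite mulr_ge0// exprn_ge0// ltW.
 have b: C*r^+k<=C*r^+k/(1-r) by rewrite ler_pdivlMr ?subr_gt0// ler_piMr//; lra.
 have [s0 t0]:= (andP sT, andP tT); move: h; rewrite ger0_norm ?subr_ge0// => h.
 have [->|->]:= fl_near s0.1 st h; first by rewrite subrr normr0; exact: le_trans b.
 by apply: le_trans (inc K0k (fl_lt k sT)) b.
have:= cl s sT; have:= cl t tT; rewrite distrC => c1 c2.
have -> : X t-X s = (X t-D k (fl k t))+(D k (fl k t)-D k (fl k s))+(D k (fl k s)-X s) by ring.
apply: le_trans (ler_normD _ _) _; apply: le_trans (lerD (ler_normD _ _) (lexx _)) _.
rewrite distrC in c1; rewrite distrC in c2; move: c1 c2 md.
rewrite (_: 3*C*r^+k/(1-r) = 3*(C*r^+k/(1-r))); last ring.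
by move: (C*_ / _) => g; lra.
Qed.

End Chaining.

(** * Gaussian families are determined by their characteristic function *)

Section GaussianLaw.
Variables (R: realType) (dO: measure_display) (Om: measurableType dO) (P: probability Om R).
Variable b: nat -> Om -> bool.
Hypothesis bmb: forall k (h: bool -> R), bm (fun w => h (b k w)).
Hypothesis indb: forall (I: finType) (io: I -> nat) (h: I -> bool -> R), injective io ->
 Ex P (fun w => \prod_i h i (b (io i) w)) = \prod_i ((h i true+h i false)/2).

Definition GZ (s: nat -> R):= ZZ (Om:= Om) (fun n => normal_prob 0 (s n)) b.

Lemma measurable_GZ s n: mfunT (GZ s n). Proof using bmb. exact: measurable_ZZ. Qed.

Lemma trg_max c (x: R): `|trg c x| <= 1. Proof. by case: c; [exact: cos_max|exact: sin_max]. Qed.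
Lemma continuous_trg c (a: R): continuous (fun x: R => trg c (a*x)).
Proof.
move=> x; apply: continuous_comp; first by apply: continuousM; [exact: cst_continuous|exact: cvg_id].
by case: c; [exact: continuous_cos|exact: continuous_sin].
Qed.

Lemma gauss_lin (T: countType) (s: nat -> R) (r: seq T) (tau: T -> R): (forall n, s n != 0) -> uniq r ->
 Ex P (fun w => cos (\sum_(x <- r) tau x*GZ s (pickle x) w)) = expR (- (\sum_(x <- r) (s (pickle x) * tau x)^+2)/2) /\
 Ex P (fun w => sin (\sum_(x <- r) tau x*GZ s (pickle x) w)) = 0.
Proof using bmb indb.
move=> s0 ur; pose t n:= if unpickle n is Some x then tau x else 0.
have tE x: t (pickle x) = tau x by rewrite /t pickleK.
pose A n w:= t n*GZ s n w.
have mA k: mfunT (A k) by apply: measurable_funM => //; exact: measurable_GZ.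
have EA c k: Ex P (fun w => trg c (A k w)) = Ex (normal_prob 0 (s k)) (fun x: R => trg c (t k*x)).
 rewrite (@Ex_ZZ _ _ _ P _ b bmb indb k (fun x => trg c (t k*x)) 1)// => [|x]; last exact: trg_max.
 by apply: continuous_measurable_fun; exact: continuous_trg.
have ind (r': seq nat) (g: nat -> bool): uniq r' ->
  Ex P (fun w => \prod_(k <- r') trg (g k) (A k w)) = \prod_(k <- r') Ex P (fun w => trg (g k) (A k w)).
 move=> ur'; under eq_fun do rewrite (big_nth 0%N) big_mkord.
 rewrite (big_nth 0%N) big_mkord.
 rewrite (@ZZ_indep _ _ _ P _ b bmb indb 'I_(size r') (fun i => nth 0%N r' i) (fun i x => trg (g (nth 0%N r' i)) (t (nth 0%N r' i)*x))).
 - by apply: eq_bigr => i _; rewrite EA.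
 - by move=> i j /eqP; rewrite nth_uniq// => /eqP/val_inj.
 - by move=> i; exact: continuous_trg.
 - by move=> i x; exact: trg_max.
have A0 k: Ex P (fun w => sin (A k w)) = 0 by rewrite (EA false) Ex_normal_sin.
have ur': uniq (map pickle r) by rewrite map_inj_uniq//; exact: pcan_inj pickleK.
have []:= cf_sum mA ind A0 ur'.
have E (h: R -> R): (fun w => h (\sum_(k <- map pickle r) A k w)) = fun w => h (\sum_(x <- r) tau x*GZ s (pickle x) w).
 by apply/funext => w; congr h; rewrite big_map; apply: eq_bigr => x _; rewrite /A tE.
rewrite (E cos) (E sin) => -> ->; split => //; rewrite big_map.
rewrite mulNr mulr_suml -sumrN expR_sum; apply: eq_bigr => x _.
by rewrite (EA true) Ex_normal_cos// tE exprMn.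
Qed.

(** For positive [N]: 0 below [c], 1 above c+1/N and affine in between. *)
Definition ramp (N c x: R): R:= (`|N*(x-c)| - `|N*(x-c)-1| + 1)/2.

Lemma ramp01 N c x: 0<=ramp N c x<=1.
Proof.
rewrite /ramp; move: (N*_) => z; have:= ler_normD z (-1); have:= ler_normD (z-1) 1; rewrite normrN normr1 subrK.
have:= ler_normB z (z-1); have: `|1: R| <= `|z| + `|z-1| by rewrite {1}(_: 1 = z-(z-1)); [exact: ler_normB|ring].
by rewrite normr1 => a a' c' e; apply/andP; split; lra.
Qed.
Lemma ramp_lip N c x y: 0<=N -> `|ramp N c x-ramp N c y| <= N * `|x-y|.
Proof.
move=> N0; have -> : N * `|x-y| = `|N*(x-c)-N*(y-c)|.
 by rewrite -mulrBr normrM (ger0_norm N0); congr (_ * `|_|); ring.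
rewrite /ramp; move: (N*(x-c)) (N*(y-c)) => a e.
have:= lerB_dist a e; have:= lerB_dist e a; have:= lerB_dist (a-1) (e-1); have:= lerB_dist (e-1) (a-1).
have -> : e-1-(a-1) = e-a by ring.
have -> : a-1-(e-1) = a-e by ring.
rewrite (distrC e a) => h1 h2 h3 h4; rewrite ler_norml; apply/andP; split; lra.
Qed.
Lemma continuous_ramp N c: continuous (ramp N c).
Proof.
move=> x; have k: {for x, continuous (fun x: R => N*(x-c))}.
 by apply: cvgMr; apply: cvgB; [exact: cvg_id|exact: cvg_cst].
apply: cvgMl; apply: cvgD; last exact: cvg_cst.
by apply: cvgB; apply: cvg_norm => //; apply: cvgB => //; exact: cvg_cst.
Qed.
Lemma ramp_cvg c x: ramp n%:R c x @[n --> \oo] --> (\1_(`]c, +oo[) x: R).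
Proof.
have [cx|xc]:= ltP c x; last first.
 rewrite indicE memNset /=; last by rewrite in_itv/= andbT => /(le_lt_trans xc); rewrite ltxx.
 apply: cvg_near_cst; apply: nearW => n; rewrite /ramp.
 have: n%:R*(x-c)<=0 by rewrite mulr_ge0_le0// subr_le0.
 by move: (_*_) => z z0; rewrite !ler0_norm; lra.
rewrite indicE mem_set /=; last by rewrite in_itv/= andbT.
apply: cvg_near_cst; have d0: 0<x-c by rewrite subr_gt0.
exists (Num.truncn (x-c)^-1).+1 => // n /= nb; rewrite /ramp.
have: 1<=n%:R*(x-c).
 rewrite -ler_pdivrMr// mul1r; apply: le_trans (ltW (truncnS_gt _)) _; by rewrite ler_nat.
by move: (_*_) => z z0; rewrite !ger0_norm; lra.
Qed.

Lemma prod_dist (I: Type) (r: seq I) (x y: I -> R): (forall i, `|x i| <= 1) -> (forall i, `|y i| <= 1) ->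
 `|\prod_(i <- r) x i-\prod_(i <- r) y i| <= \sum_(i <- r) `|x i-y i|.
Proof.
move=> x1 y1; have n1 (z: I -> R) (s: seq I): (forall i, `|z i| <= 1) -> `|\prod_(i <- s) z i| <= 1.
 by move=> z1; rewrite normr_prod; apply: prodr_ile1 => i; rewrite normr_ge0 z1.
elim: r => [|i r IH]; first by rewrite !big_nil subrr normr0.
rewrite !big_cons (_: x i*_-_ = (x i-y i)*\prod_(j <- r) x j+y i*(\prod_(j <- r) x j-\prod_(j <- r) y j)); last ring.
apply: le_trans (ler_normD _ _) _; rewrite !normrM; apply: lerD; first by rewrite ler_piMr//; exact: n1.
by apply: le_trans IH; rewrite ler_piMl.
Qed.

Lemma tight_fin (I: finType) (X: I -> Om -> R): (forall i, mfunT (X i)) ->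
 forall eta: R, 0<eta -> exists2 A: R, 0<=A & forall i, Ex P (fun w => (A <= `|X i w|)%R%:R)<=eta.
Proof.
move=> mX eta e0.
have bI (A: R) i: bm (fun w => (A <= `|X i w|)%R%:R: R) by exact: bm_geind.
have one i: exists n: nat, Ex P (fun w => (n%:R <= `|X i w|)%R%:R)<=eta.
 have: Ex P (fun w => (n%:R <= `|X i w|)%R%:R) @[n --> \oo] --> Ex P (fun=> 0).
  apply: (@Ex_dct _ _ _ P (fun n w => (n%:R <= `|X i w|)%R%:R) _ 1) => [n||n w|]; [exact: bm_meas|exact: measurable_cst| |].
  - by case: (n%:R <= `|X i w|); rewrite ?normr1 ?normr0.
  apply: nearW => w; apply: cvg_near_cst; exists (Num.truncn `|X i w|).+1 => // n /= nb.
  by rewrite leNgt (lt_le_trans (truncnS_gt _))// ler_nat.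
 by rewrite Ex_cst => /cvgrPdist_lt/(_ _ e0)[n _ /(_ n (leqnn n))]; rewrite sub0r normrN => h; exists n; apply: le_trans (ltW h); exact: ler_norm.
have [N hN]:= choice one; exists (\sum_i N i)%:R => // i; apply: le_trans (hN i); apply: le_Ex => // w.
case: (leP (\sum_i N i)%:R `|X i w|) => // h; rewrite (le_trans _ h)//.
by rewrite ler_nat (bigD1 i)//= leq_addr.
Qed.

(** The continuity theorem for the constant sequence [X] identifies it with an explicit independent
    family [Y] on products of ramps. Ramps converge to rays, and rays are exchanged for Borel sets
    one coordinate at a time by [law_ext]. *)
Lemma gauss_law (I: finType) (X: I -> Om -> R) (v: I -> R): (forall i, mfunT (X i)) ->
 (forall i, v i != 0) ->
 (forall th, Ex P (fun w => cos (\sum_i th i*X i w)) = expR (- (\sum_i (v i * th i)^+2)/2)) ->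
 (forall th, Ex P (fun w => sin (\sum_i th i*X i w)) = 0) ->
 forall A: I -> set R, (forall i, measurable (A i)) ->
 Ex P (fun w => \prod_i \1_(A i) (X i w)) = \prod_i Ex (normal_prob 0 (v i)) \1_(A i).
Proof using bmb indb.
move=> mX v0 cX sX A mA.
pose s n:= if unpickle n is Some i then v i else 1.
have sE (i: I): s (pickle i) = v i by rewrite /s pickleK.
have s0 n: s n != 0 by rewrite /s; case: (unpickle n) => [i|]; [exact: v0|exact: oner_neq0].
pose Y (i: I):= GZ s (pickle i); have mY i: mfunT (Y i) by exact: measurable_GZ.
have eqc (th: I -> R): Ex P (fun w => cos (\sum_i th i*Y i w)) = expR (- (\sum_i (v i * th i)^+2)/2) /\
  Ex P (fun w => sin (\sum_i th i*Y i w)) = 0.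
 have [c1 c2]:= @gauss_lin I s (index_enum I) th s0 (index_enum_uniq _); rewrite c1 c2.
 by split => //; congr (expR (- _/2)); apply: eq_bigr => i _; rewrite sE.
have inj: injective (fun i: I => pickle i) by exact: pcan_inj pickleK.
have rampE (q: pred I) (c: I -> R) (N: nat): Ex P (fun w => \prod_(i | q i) ramp N%:R (c i) (X i w)) =
  \prod_(i | q i) Ex (normal_prob 0 (v i)) (ramp N%:R (c i)).
 pose g i x:= if q i then ramp N%:R (c i) x else 1: R.
 have r1 i x: `|g i x| <= 1.
  by rewrite /g; case: ifP => _; rewrite ?normr1//; have /andP[a e]:= ramp01 N%:R (c i) x; rewrite ger0_norm.
 have cg i: continuous (g i) by rewrite /g; case: (q i); [exact: continuous_ramp|exact: cst_continuous].
 have bR (Z: I -> Om -> R): (forall i, mfunT (Z i)) -> bm (fun w => \prod_i g i (Z i w)).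
  move=> mZ; apply: bm_prod => i; apply: (@bm_comp _ _ _ _ _ 1) => //.
  exact: continuous_measurable_fun.
 have:= @levy_continuity _ _ _ P I (fun=> X) Y (fun=> mX) mY _ _ (fun x => \prod_i g i (x i)) 1 _ _ (fun=> bR _ mX) (bR _ mY) _ (tight_fin mY).
 have cst1 (u u': R): u = u' -> (fun=> u) @ \oo --> u' by move=> ->; exact: cvg_cst.
 move=> /(_ (fun th => cst1 _ _ (etrans (cX th) (esym (eqc th).1))) (fun th => cst1 _ _ (etrans (sX th) (esym (eqc th).2)))) H.
 have {}H: (fun=> Ex P (fun w => \prod_i g i (X i w))) @ \oo --> Ex P (fun w => \prod_i g i (Y i w)).
  apply: H => [x|e e0|eta e0].
  - by rewrite normr_prod; apply: prodr_ile1 => i; rewrite normr_ge0 r1.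
  - exists N%:R => // x y; apply: le_trans (prod_dist _ _ _) _ => //.
   rewrite mulr_sumr -[leLHS]add0r; apply: lerD; first exact: ltW.
   apply: ler_sum => i _; rewrite /g; case: (q i); first exact: ramp_lip.
   by rewrite subrr normr0 mulr_ge0.
  by have [A0 A00 h]:= tight_fin mX e0; exists A0 => // _.
 have:= cvg_lim (@Rhausdorff R) H; rewrite lim_cst => [H'|]; last exact: Rhausdorff.
 under eq_fun do rewrite big_mkcond; rewrite [LHS]H'.
 have zi:= @ZZ_indep _ _ _ P (fun n => normal_prob 0 (s n)) b bmb indb I (fun i => pickle i) g inj cg r1.
 apply: eq_trans zi _; rewrite [RHS]big_mkcond.
 by apply: eq_bigr => i _; rewrite sE /g; case: (q i) => //; exact: Ex_cst.
have rays (q: pred I) (c: I -> R): Ex P (fun w => \prod_(i | q i) \1_(`]c i, +oo[) (X i w)) =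
  \prod_(i | q i) Ex (normal_prob 0 (v i)) \1_(`]c i, +oo[).
 have r1 N i x: `|ramp N%:R (c i) x| <= 1 by have /andP[a e]:= ramp01 N%:R (c i) x; rewrite ger0_norm.
 have mr N i: mfunT (ramp N%:R (c i)) by apply: continuous_measurable_fun; exact: continuous_ramp.
 have h1: Ex P (fun w => \prod_(i | q i) ramp N%:R (c i) (X i w)) @[N --> \oo] --> Ex P (fun w => \prod_(i | q i) \1_(`]c i, +oo[) (X i w)).
  apply: (@Ex_dct _ _ _ P _ _ 1) => [N||N w|].
  - by apply: bm_meas; apply: bm_prod => i; apply: (@bm_comp _ _ _ _ _ 1).
  - by apply: bm_meas; apply: bm_prod => i; exact: bm_indic_comp.
  - by rewrite normr_prod; apply: prodr_ile1 => i; rewrite normr_ge0 r1.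
  by apply: nearW => w; apply: cvg_big => [|i _]; [exact: mul_continuous|exact: ramp_cvg].
 have h2: \prod_(i | q i) Ex (normal_prob 0 (v i)) (ramp N%:R (c i)) @[N --> \oo] --> \prod_(i | q i) Ex (normal_prob 0 (v i)) \1_(`]c i, +oo[).
  apply: cvg_big => [|i _]; first exact: mul_continuous.
  apply: (@Ex_dct _ _ _ (normal_prob 0 (v i)) (fun N => ramp N%:R (c i)) _ 1) => [N||N x|]; [exact: mr| |exact: r1|].
   by apply: bm_meas; exact: (bm_indic_comp (X:= fun x: measurableTypeR R => x)).
  by apply: nearW => x; exact: ramp_cvg.
 rewrite (funext (rampE q c)) in h1; rewrite -(cvg_lim (@Rhausdorff R) h1).
 exact: (cvg_lim (@Rhausdorff R) h2).
(* [r1] lists the coordinates already carrying Borel sets, [r2] those still carrying rays. *)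
suff main r1: forall r2 (c: I -> R), uniq (r1 ++ r2) ->
  Ex P (fun w => \prod_(i <- r1) \1_(A i) (X i w)*\prod_(i <- r2) \1_(`]c i, +oo[) (X i w)) =
  \prod_(i <- r1) Ex (normal_prob 0 (v i)) \1_(A i)*\prod_(i <- r2) Ex (normal_prob 0 (v i)) \1_(`]c i, +oo[).
 have:= main (index_enum I) [::] (fun=> 0); rewrite cats0 index_enum_uniq big_nil mulr1 => <-//.
 by congr Ex; apply/funext => w; rewrite big_nil mulr1.
elim: r1 => [|i r1 IH] r2 c ur.
 rewrite big_nil mul1r big_uniq// -rays; congr Ex; apply/funext => w.
 by rewrite big_nil mul1r big_uniq.
have ur': uniq (r1 ++ i :: r2) by rewrite -cat1s uniq_catCA /=.
have ur'': uniq (r1 ++ r2) by move: ur => /= /andP[].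
pose W w: R:= \prod_(i <- r1) \1_(A i) (X i w)*\prod_(i <- r2) \1_(`]c i, +oo[) (X i w).
have bW: bm W by apply: bmM; apply: bm_prod => j; exact: bm_indic_comp.
have ir2: i \notin r2 by move: ur; rewrite /= mem_cat negb_or => /andP[/andP[]].
have:= @law_ext _ _ _ P (normal_prob 0 (v i)) (X i) W _ (mX i) bW (IH r2 c ur'') _ (A i) (mA i).
rewrite [X in _ -> _ = X*_]big_cons -[X in _ -> _ = X]mulrA [X in _ -> _ = X]mulrC => <-; first by congr Ex; apply/funext => w; rewrite big_cons /W mulrA.
move=> x; pose c' j:= if j == i then x else c j.
have cE (F: I -> R -> R): \prod_(k <- i :: r2) F k (c' k) = F i x*\prod_(k <- r2) F k (c k).
 rewrite big_cons /c' eqxx; congr (_*_); rewrite big_seq [RHS]big_seq; apply: eq_bigr => k kr.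
 by case: eqP => // ki; rewrite ki (negbTE ir2) in kr.
have:= IH _ c' ur'; rewrite (cE (fun k y => Ex (normal_prob 0 (v k)) \1_(`]y, +oo[))) => h.
rewrite mulrC mulrCA -h; congr Ex; apply/funext => w.
by rewrite (cE (fun k y => \1_(`]y, +oo[) (X k w))) /W mulrCA.
Qed.

End GaussianLaw.

(** * A Borel-Cantelli bound and sums over blocks *)

Lemma borel_cantelli_geo (R: realType) (dO: measure_display) (Om: measurableType dO) (P: probability Om R)
 (A: nat -> set Om) (C rho: R): (forall k, measurable (A k)) -> 0<=C -> 0<rho<1 ->
 (forall k, P (A k)<=(C*rho^+k)%:E)%E -> P (lim_sup_set A) = 0%E.
Proof.
move=> mA C0 /andP[r0 r1] h; apply: lim_sup_set_cvg0 => //.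
apply: (@le_lt_trans _ _ (C/(1-rho))%:E); last exact: ltry.
apply: lime_le; first by apply: is_cvg_nneseries => n _ _; exact: measure_ge0.
apply: nearW => n; apply: le_trans (lee_sum _ (fun i _ => h i)) _; rewrite sumEFin lee_fin.
have H:= @geometric_le_lim R n _ _ C0 r0 (ltac:(rewrite ger0_norm// ltW)); exact: H.
Qed.

Section Blocks.
Variables (R: realType) (M n N: nat) (a: nat -> nat) (th: 'I_n * 'I_M -> R).
Hypothesis am: forall l, (a l<=a l.+1)%N.
Hypothesis aN: forall l: 'I_n, (a l.+1<=N)%N.

Let on (l: 'I_n) i: R:= (a l<=i<a l.+1)%N%:R.
(** The weight of step [i] in direction [j] when the increments over the blocks [a l, a l.+1[ are
    combined with coefficients [th]. *)
Definition bw i j: R:= \sum_(l<n) th (l, j) * on l i.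

Lemma block_mono k l: (k<=l)%N -> (a k<=a l)%N.
Proof using am.
by move=> /subnKC <-; elim: (l-k)%N => [|q IH]; rewrite ?addn0// addnS; exact: leq_trans IH (am _).
Qed.

Lemma block_sum (l: 'I_n) (F: nat -> R): \sum_(0<=i<N) on l i*F i = \sum_(a l<=i<a l.+1) F i.
Proof using aN.
rewrite [RHS](big_nat_widen _ _ _ _ _ (aN l)) [RHS](big_nat_widenl _ 0%N)// [RHS]big_mkcond/=.
by apply: eq_bigr => i _; rewrite /on andbC; case: (_ && _); rewrite ?mul1r ?mul0r.
Qed.

Lemma sum_pair_swap (F: 'I_n -> 'I_M -> R): \sum_(x: 'I_n * 'I_M) F x.1 x.2 = \sum_(j<M) \sum_(l<n) F l j.
Proof using. by rewrite exchange_big (pair_bigA _ F). Qed.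

Lemma bw_sum (G: nat -> 'I_M -> R): \sum_(0<=i<N) \sum_j bw i j*G i j =
 \sum_(x: 'I_n * 'I_M) th x*\sum_(a x.1<=i<a x.1.+1) G i x.2.
Proof using aN.
rewrite (eq_bigr (fun x: 'I_n * 'I_M => th (x.1, x.2)*\sum_(a x.1<=i<a x.1.+1) G i x.2)); last by case.
rewrite (sum_pair_swap (fun l j => th (l, j)*\sum_(a l<=i<a l.+1) G i j)).
rewrite exchange_big/=; apply: eq_bigr => j _; under eq_bigr do rewrite /bw mulr_suml.
rewrite exchange_big/=; apply: eq_bigr => l _; rewrite -block_sum mulr_sumr; apply: eq_bigr => i _; by rewrite mulrA.
Qed.

(** The blocks are disjoint, so the squares have no cross terms. *)
Lemma bw_sq: \sum_(0<=i<N) \sum_j bw i j^+2 = \sum_(x: 'I_n * 'I_M) th x^+2*((a x.1.+1)%:R-(a x.1)%:R).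
Proof using am aN.
have sq i j: bw i j^+2 = \sum_(l<n) th (l, j)^+2 * on l i.
 rewrite expr2 /bw big_distrlr/=; apply: eq_bigr => l _; rewrite (bigD1 l)//= big1 ?addr0.
  by rewrite /on; case: (_ && _); rewrite ?mulr1 ?mulr0.
 move=> l' ll'; have: on l i * on l' i = 0.
  rewrite /on; case: (boolP (_<=i<_)%N) => [/andP[h1 h2]|_]; last by rewrite mul0r.
  case: (boolP (_<=i<_)%N) => [/andP[h3 h4]|_]; last by rewrite mulr0.
  have [lt|lt|/val_inj e]:= ltngtP l l'; last by rewrite e eqxx in ll'.
  - by have:= leq_trans h2 (leq_trans (block_mono lt) h3); rewrite ltnn.
  - by have:= leq_trans h4 (leq_trans (block_mono lt) h1); rewrite ltnn.
 by move=> h; rewrite mulrACA h mulr0.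
rewrite (eq_bigr (fun x: 'I_n * 'I_M => th (x.1, x.2)^+2*((a x.1.+1)%:R-(a x.1)%:R))); last by case.
rewrite (sum_pair_swap (fun l j => th (l, j)^+2*((a l.+1)%:R-(a l)%:R))).
under eq_bigr => i _ do under eq_bigr => j _ do rewrite sq.
rewrite exchange_big/=; apply: eq_bigr => j _; rewrite exchange_big/=; apply: eq_bigr => l _.
under eq_bigr do rewrite -[on _ _]mulr1; rewrite -mulr_sumr (block_sum l (fun=> 1)) sumr_const_nat natrB//.
Qed.

Lemma bw_le i j: `|bw i j| <= \sum_x `|th x|.
Proof using.
apply: le_trans (ler_norm_sum _ _ _) _.
rewrite (eq_bigr (fun x: 'I_n * 'I_M => `|th (x.1, x.2)|)); last by case.
rewrite (sum_pair_swap (fun l j => `|th (l, j)|)) (bigD1 j)//= -[leLHS]addr0; apply: lerD; last first.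
 by apply: sumr_ge0 => j' _; apply: sumr_ge0.
apply: ler_sum => l _; rewrite normrM ler_piMr// /on; by case: (_ && _); rewrite ?normr1 ?normr0.
Qed.

End Blocks.

(** * Levy's construction of Brownian motion *)

Section BrownianMotion.
Variables (R: realType) (dO: measure_display) (Om: measurableType dO) (P: probability Om R) (M: nat).
Variable b: nat -> Om -> bool.
Hypothesis bmb: forall k (h: bool -> R), bm (fun w => h (b k w)).
Hypothesis indb: forall (I: finType) (io: I -> nat) (h: I -> bool -> R), injective io ->
 Ex P (fun w => \prod_i h i (b (io i) w)) = \prod_i ((h i true+h i false)/2).

Local Notation T3:= (nat*nat * 'I_M)%type.
Definition LZ (x: T3): Om -> R:= GZ b (fun=> 1) (pickle x).
(** [rt^+k] is the standard deviation of an increment over a dyadic interval of level [k]. *)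
Definition rt: R:= Num.sqrt 2^-1.

Lemma rt2: rt*rt = 2^-1. Proof using. by rewrite -expr2 sqr_sqrtr// invr_ge0. Qed.
Lemma rt_gt0: 0<rt. Proof using. by rewrite sqrtr_gt0 invr_gt0. Qed.
Lemma rtX k: rt^+k*rt^+k = (2^-1)^+k. Proof using. by rewrite -exprMn rt2. Qed.

(* The increments over dyadic intervals of level [k]; refining [k] displaces each midpoint by an
   independent Gaussian variable. *)
Fixpoint Inc (k i: nat) (j: 'I_M) (w: Om): R :=
 if k is k'.+1 then Inc k' i./2 j w/2+(if odd i then -1 else 1)*(rt^+k'/2*LZ (k'.+1, i./2, j) w)
 else LZ (0, i, j) w.

Lemma Inc2 k i j w: Inc k.+1 (2 * i) j w = Inc k i j w/2+rt^+k/2*LZ (k.+1, i, j) w.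
Proof using. by rewrite /= mul2n odd_double doubleK mul1r. Qed.
Lemma Inc2S k i j w: Inc k.+1 (2 * i).+1 j w = Inc k i j w/2-rt^+k/2*LZ (k.+1, i, j) w.
Proof using. by rewrite /= mul2n odd_double uphalf_double mulN1r. Qed.

Arguments Inc: simpl never.

Lemma sum_double (F: nat -> R) n: \sum_(0<=i<2*n) F i = \sum_(0<=i<n) (F (2 * i)%N+F (2 * i).+1).
Proof using.
elim: n => [|n IH]; first by rewrite muln0 !big_geq.
by rewrite [RHS]big_nat_recr//= -IH mulnS addSn addSn add0n !big_nat_recr//= addrA.
Qed.

Definition lev k N: seq T3:= [seq (k, i, j) | i <- index_iota 0 N, j <- enum 'I_M].

Lemma big_lev k N (F: T3 -> R): \sum_(x <- lev k N) F x = \sum_(0<=i<N) \sum_j F (k, i, j).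
Proof using. by rewrite big_allpairs_dep; apply: eq_bigr => i _; rewrite big_enum. Qed.

Lemma uniq_lev k N: uniq (lev k N).
Proof using. by apply: allpairs_uniq; rewrite ?iota_uniq ?enum_uniq// => -[a c] [a' c'] _ _ /= [-> ->]. Qed.

Lemma lev_lv k N x: x \in lev k N -> x.1.1 = k.
Proof using. by move=> /allpairsP[[i j] [_ _ ->]]. Qed.

(** Splitting an interval replaces coefficients u, v by (u+v)/2 on the old increment and (u-v)/2 on
    the new Gaussian; as ((u+v)/2)^2 + ((u-v)/2)^2 = (u^2+v^2)/2, the variance remains that of
    independent increments. *)
Lemma Inc_lin k N (th: nat -> 'I_M -> R): exists (r: seq T3) (tau: T3 -> R),
 [/\ uniq r, forall x, x \in r -> (x.1.1<=k)%N,
   forall w, \sum_(0<=i<N*2 ^ k) \sum_j th i j*Inc k i j w = \sum_(x <- r) tau x*LZ x w &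
   \sum_(x <- r) tau x^+2 = (2^-1)^+k*\sum_(0<=i<N*2 ^ k) \sum_j th i j^+2].
Proof using.
elim: k th => [|k IH] th.
 exists (lev 0 N), (fun x => th x.1.2 x.2); split; first exact: uniq_lev.
 - by move=> x /lev_lv ->.
 - by move=> w; rewrite big_lev expn0 muln1.
 by rewrite big_lev expn0 muln1 expr0 mul1r.
have [r [tau [ur lr Er Vr]]]:= IH (fun i j => (th (2 * i)%N j+th (2 * i).+1 j)/2).
pose tau' (x: T3):= if x.1.1 == k.+1 then (th (2*x.1.2)%N x.2-th (2*x.1.2).+1 x.2)*(rt^+k/2) else tau x.
have tr (F: T3 -> R -> R): \sum_(x <- r) F x (tau' x) = \sum_(x <- r) F x (tau x).
 rewrite big_seq [RHS]big_seq; apply: eq_bigr => x /lr; rewrite /tau'; case: eqP => // ->.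
 by rewrite ltnn.
have E2: (N*2 ^ k.+1 = 2*(N*2 ^ k))%N by rewrite expnS mulnCA.
exists (r ++ lev k.+1 (N*2 ^ k)), tau'; split.
- rewrite cat_uniq ur uniq_lev andbT /=; apply/hasPn => x /lev_lv e; apply/negP => /lr.
 by rewrite e ltnn.
- by move=> x; rewrite mem_cat => /orP[/lr/leqW|/lev_lv ->].
- move=> w; rewrite big_cat/= (tr (fun x t => t*LZ x w)) -Er big_lev E2 sum_double -big_split.
 apply: eq_bigr => i _; rewrite -!big_split; apply: eq_bigr => j _ /=.
 by rewrite Inc2 Inc2S /tau' /= eqxx; field.
rewrite big_cat/= (tr (fun x t => t^+2)) Vr big_lev E2 sum_double mulr_sumr -big_split mulr_sumr.
apply: eq_bigr => i _; rewrite mulr_sumr -!big_split mulr_sumr; apply: eq_bigr => j _ /=.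
rewrite /tau' /= eqxx [(_*(rt^+k/2))^+2]exprMn (_: (rt^+k/2)^+2 = (2^-1)^+k/4); last by rewrite -rtX; field.
by rewrite [(2^-1)^+k.+1]exprS; move: ((2^-1)^+k) => q; field.
Qed.

Lemma measurable_LZ x: mfunT (LZ x). Proof using bmb. exact: measurable_GZ. Qed.

Lemma measurable_Inc k i j: mfunT (Inc k i j).
Proof using bmb.
elim: k i => [|k IH] i /=; first exact: measurable_LZ.
apply: measurable_funD; first by apply: measurable_funM.
by apply: measurable_funM => //; apply: measurable_funM => //; exact: measurable_LZ.
Qed.

Lemma cf_Inc k N (th: nat -> 'I_M -> R) (v:= (2^-1)^+k*\sum_(0<=i<N*2 ^ k) \sum_j th i j^+2) :
 Ex P (fun w => cos (\sum_(0<=i<N*2 ^ k) \sum_j th i j*Inc k i j w)) = expR (- v/2) /\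
 Ex P (fun w => sin (\sum_(0<=i<N*2 ^ k) \sum_j th i j*Inc k i j w)) = 0.
Proof using bmb indb.
have [r [tau [ur _ Er Vr]]]:= Inc_lin k N th.
have E (h: R -> R): (fun w => h (\sum_(0<=i<N*2 ^ k) \sum_j th i j*Inc k i j w)) =
  fun w => h (\sum_(x <- r) tau x*GZ b (fun=> 1) (pickle x) w) by apply/funext => w; rewrite Er.
rewrite (E cos) (E sin); have [-> ->]:= @gauss_lin _ _ _ P b bmb indb _ (fun=> 1) r tau (fun=> oner_neq0 R) ur.
split => //; congr (expR (- _/2)); rewrite /v -Vr; apply: eq_bigr => x _; by rewrite mul1r.
Qed.

Definition LD k n j w: R:= \sum_(0<=i<n) Inc k i j w.

Lemma LD_cons k n j w: LD k.+1 (2*n) j w = LD k n j w.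
Proof using. by rewrite /LD sum_double; apply: eq_bigr => i _; rewrite Inc2 Inc2S; field. Qed.

Lemma measurable_LD k n j: mfunT (LD k n j).
Proof using bmb. by apply: measurable_sumr => i; exact: measurable_Inc. Qed.

(** The ratio 9/10 is below 1, so that increments are summable; above [rt], so that the thresholds
    [thr k] grow; and its fourth power is above 1/2, so that about 2^k tails of order (4 rr^4)^(-k)
    have a convergent sum. *)
Local Notation rr:= (9/10: R).
Lemma cnt_ge0 (i k: nat) (x: R): 0<=i%:R*k%:R*(2*expR x*256).
Proof using.
exact: mulr_ge0 (mulr_ge0 (ler0n _ _) (ler0n _ _)) (mulr_ge0 (mulr_ge0 (ler0n _ 2) (expR_ge0 _)) (ler0n _ 256)).
Qed.

Definition thr k: R:= (rr/rt)^+k.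
(** From [expR_ge4], as the fourth power of [rt] is 1/4. *)
Lemma expR_thr k: (expR (thr k))^-1<=256/(4*rr^+4)^+k.
Proof using.
have t0: 0<thr k by rewrite exprn_gt0// divr_gt0 ?rt_gt0//; lra.
have -> : (4*rr^+4)^+k = thr k^+4.
 rewrite /thr -exprM mulnC exprM; congr (_^+k); rewrite [(rr/rt)^+4]expr_div_n.
 have -> : rt^+4 = 4^-1 by rewrite (exprM rt 2 2) [rt^+2]expr2 rt2; field.
 by field.
have t40: 0<thr k^+4/256:= divr_gt0 (exprn_gt0 4 t0) (ltr0Sn _ 255).
by rewrite -[256 / _]invf_div lef_pV2 ?posrE ?expR_gt0//; exact: expR_ge4 (ltW t0).
Qed.

Definition cnt T k (w: Om): R:= \sum_(x <- lev k.+1 (T*2 ^ k)) (thr k <= `|LZ x w|)%R%:R.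
Definition bad T k: set Om:= [set w | 1<=cnt T k w].

Lemma measurable_bad T k: measurable (bad T k).
Proof using bmb.
by apply: measurable_leset => //; apply: measurable_sumr => x; apply: bm_meas; apply: bm_geind; exact: measurable_LZ.
Qed.

Lemma P_bad T k: (P (bad T k)<=(T%:R*M%:R*(2*expR (1/2)*256)*(1/(2*rr^+4))^+k)%:E)%E.
Proof using bmb indb.
rewrite (Ex_indic P (measurable_bad T k)) lee_fin.
have bc: bm (cnt T k) by apply: bm_sum => x; apply: bm_geind; exact: measurable_LZ.
have h1: Ex P \1_(bad T k)<=Ex P (cnt T k).
 apply: le_Ex => //; first exact: bm_indic (measurable_bad T k).
 move=> w; rewrite indicE; case: (boolP (w \in _)) => [/set_mem//|_].
 by apply: sumr_ge0 => x _.
apply: le_trans h1 _; rewrite /cnt Ex_sum => [|x]; last by apply: bm_geind; exact: measurable_LZ.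
have tl x: Ex P (fun w => (thr k <= `|LZ x w|)%R%:R)<=2*expR (1/2)*(256/(4*rr^+4)^+k).
 rewrite (@Ex_ZZ _ _ _ P _ b bmb indb (pickle x) (fun y => (thr k <= `|y|)%R%:R) 1).
 - apply: le_trans (Ex_normal_tail (oner_neq0 R) (thr k)) _.
  by rewrite expr1n ler_wpM2l ?mulr_ge0 ?expR_ge0// expRN expR_thr.
 - exact: (bm_meas (bm_geind (thr k) (f:= id) (@measurable_id _ R setT))).
 by move=> y; case: (thr k <= `|y|); rewrite ?normr1 ?normr0.
apply: le_trans (ler_sum _ (fun x _ => tl x)) _; rewrite big_lev !sumr_const_nat subn0.
rewrite sumr_const card_ord -mulrnA -[_ *+ (M*_)]mulr_natr !natrM natrX.
apply: eq_le_imp.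
have -> : (4*rr^+4)^+k = 2^+k*(2*rr^+4)^+k :> R by rewrite -exprMn; congr (_^+k); ring.
rewrite [(1 / _)^+k]expr_div_n expr1n; have: (2*rr^+4)^+k != 0 by rewrite expf_neq0//; lra.
have: 2^+k != 0 :> R by rewrite expf_neq0.
by move: (2^+k) ((2*_)^+k) (expR _) => u v e u0 v0; field; rewrite u0 v0.
Qed.

Definition badset: set Om:= \bigcup_T lim_sup_set (bad T).

Lemma measurable_badset: measurable badset.
Proof using bmb.
apply: bigcup_measurable => T _; apply: bigcap_measurable; first by exists 0%N.
by move=> n _; apply: bigcup_measurable => k _; exact: measurable_bad.
Qed.

Lemma P_badset: P badset = 0%E.
Proof using bmb indb.
have: P.-negligible badset.
 apply: negligible_bigcup => T; exists (lim_sup_set (bad T)); split => //.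
  apply: bigcap_measurable; first by exists 0%N.
  by move=> n _; apply: bigcup_measurable => k _; exact: measurable_bad.
 apply: (borel_cantelli_geo (measurable_bad T) _ _ (P_bad T)).
  exact: cnt_ge0.
 by apply/andP; split; lra.
by move=> /negligibleP; apply; exact: measurable_badset.
Qed.

(** Outside the bad event every new Gaussian is below [thr k], which contributes at most [rr^+k/2].
    With [C>=2] one has C/2 + 1/2 <= C rr, which closes the induction; [C] also dominates the
    increments of the starting level. *)
Lemma good_Inc w T: ~ badset w -> exists (K0: nat) (C: R), 0<=C /\
 forall k i j, (K0<=k)%N -> (i<T*2 ^ k)%N -> `|Inc k i j w| <= C*rr^+k.
Proof using.
move=> nb; have: ~ lim_sup_set (bad T) w by move=> h; apply: nb; exists T.
rewrite /lim_sup_set => /existsNP[K0 hK]; have {}hK: ~ (\bigcup_(k in [set k | (K0<=k)%N]) bad T k) w.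
 by move=> h; apply: hK => _.
pose C:= 2+(\sum_(0<=i<T*2 ^ K0) \sum_j `|Inc K0 i j w|)/rr^+K0.
have S0: 0<=\sum_(0<=i<T*2 ^ K0) \sum_j `|Inc K0 i j w| by apply: sumr_ge0 => i _; apply: sumr_ge0.
have rX k: 0<rr^+k :> R by apply: exprn_gt0; lra.
have C2: 2<=C by rewrite lerDl divr_ge0// ltW.
exists K0, C; split; first by lra.
have LZb k i j: (K0<=k)%N -> (i<T*2 ^ k)%N -> `|LZ (k.+1, i, j) w| <= thr k.
 move=> Kk iT; rewrite leNgt; apply/negP => h; apply: hK; exists k => //=; rewrite /bad /= /cnt.
 have inl: (k.+1, i, j) \in lev k.+1 (T*2 ^ k).
  by apply/allpairsP; exists (i, j); split; rewrite ?mem_index_iota ?mem_enum.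
 rewrite (big_rem _ inl)/= (ltW h) lerDl; by apply: sumr_ge0.
have step k i j: (K0<=k)%N -> (i<T*2 ^ k.+1)%N -> (forall i j, (i<T*2 ^ k)%N -> `|Inc k i j w| <= C*rr^+k) ->
  `|Inc k.+1 i j w| <= C*rr^+k.+1.
 move=> Kk iT IH; have i2: (i./2<T*2 ^ k)%N by move: iT; rewrite expnS mulnCA; lia.
 rewrite /Inc -/Inc; apply: le_trans (ler_normD _ _) _; rewrite !normrM.
 have -> : `|if odd i then -1 else 1: R| = 1 by case: (odd i); rewrite ?normrN normr1.
 have n2: `|2^-1: R| = 2^-1 by rewrite ger0_norm.
 have nr: `|rt^+k| = rt^+k by rewrite ger0_norm// exprn_ge0// ltW// rt_gt0.
 rewrite mul1r n2 nr.
 have h1:= IH _ j i2; have h2:= LZb k _ j Kk i2.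
 have h3: rt^+k/2 * `|LZ (k.+1, i./2, j) w| <= rr^+k/2.
  have -> : rr^+k/2 = rt^+k/2 * thr k.
   rewrite /thr [(rr/rt)^+k]expr_div_n; have: rt^+k != 0 by rewrite expf_neq0// gt_eqF// rt_gt0.
   by move: (rr^+k) (rt^+k) => x y y0; field.
  by rewrite ler_wpM2l// divr_ge0// exprn_ge0// ltW// rt_gt0.
 by move: (rX k) h1 h3 C2; rewrite exprS; move: (rr^+k) `|Inc _ _ _ _| (rt^+k/2*_) (C) => x y z c x0 h1 h3 c2; nra.
suff main n i j: (i<T*2 ^ (K0+n))%N -> `|Inc (K0+n) i j w| <= C*rr^+(K0+n).
 by move=> k i j Kk; have:= main (k-K0)%N i j; rewrite subnKC.
elim: n i j => [|n IH] i j iT; last by rewrite addnS; apply: step; rewrite ?leq_addr// -addnS.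
rewrite addn0 in iT *; rewrite /C mulrDl divfK ?gt_eqF//.
have: `|Inc K0 i j w| <= \sum_(0<=i<T*2 ^ K0) \sum_j `|Inc K0 i j w|.
 rewrite (big_rem i) ?mem_index_iota//= (bigD1 j)//= -addrA lerDl addr_ge0//; first exact: sumr_ge0.
 by apply: sumr_ge0 => l _; exact: sumr_ge0.
by have:= rX K0; lra.
Qed.

Lemma good_cvg w (t: R): ~ badset w -> forall j, cvgn (fun k => LD k (fl k t) j w).
Proof using.
move=> nb j; have [t0|t0]:= leP 0 t; last first.
 have f0 k: fl k t = 0%N by apply/eqP; rewrite -leqn0 -(truncn0 R); apply: le_truncn; rewrite mulr_le0_ge0 ?exprn_ge0// ltW.
 by rewrite (_: (fun k => _) = fun=> 0); [exact: is_cvg_cst|apply/funext => k; rewrite f0 /LD big_geq].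
have [K0 [C [C0 h]]]:= good_Inc (Num.truncn t).+1 nb.
apply: (@chain_cvg R (fun k n => LD k n j w) rr C (Num.truncn t).+1 K0) => //; last by rewrite t0 truncnS_gt.
- by move=> k n; exact: LD_cons.
- by apply/andP; split; lra.
by move=> k i Kk iT; rewrite /LD big_nat_recr//= addrC addrK; exact: h.
Qed.

(** The value 0 on the null set [badset] makes every path continuous, not just almost every one. *)
Definition BMn n (j: 'I_M) (t: R) (w: Om): R:= if w \in badset then 0 else LD n (fl n t) j w.
Definition BM (j: 'I_M) (t: R) (w: Om): R:= lim (BMn n j t w @[n --> \oo]).

Lemma BMn_cvg j t w: BMn n j t w @[n --> \oo] --> BM j t w.
Proof using.
have: cvgn (fun n => BMn n j t w).
 rewrite /BMn; have [bw|/negP]:= boolP (w \in badset); first exact: is_cvg_cst.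
 by rewrite inE => nb; exact: good_cvg.
by [].
Qed.

Lemma measurable_BM j t: mfunT (BM j t).
Proof using bmb.
apply: (@measurable_fun_cvg _ _ _ _ (fun n => BMn n j t)) => [n|w _]; last exact: BMn_cvg.
rewrite /BMn (_: (fun w => _) = fun w => (1-\1_badset w)*LD n (fl n t) j w).
 apply: measurable_funM; last exact: measurable_LD.
 by apply: measurable_funB => //; apply: measurable_indic; exact: measurable_badset.
by apply/funext => w; rewrite indicE; case: (w \in badset); rewrite ?subrr ?mul0r// subr0 mul1r.
Qed.

Lemma BM0 j w: BM j 0 w = 0.
Proof using.
apply: cvg_lim; first exact: Rhausdorff.
have E n: BMn n j 0 w = 0 by rewrite /BMn /fl mul0r truncn0 /LD big_geq//; case: ifP.
by rewrite (funext E); exact: cvg_cst.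
Qed.

Lemma BM_unif (T: nat) w (e: R): 0<e -> exists2 del: R, 0<del & forall j s t, 0<=s<T%:R -> 0<=t<T%:R ->
 `|t-s| < del -> `|BM j t w-BM j s w| < e.
Proof using.
move=> e0; have [bw|/negP nb]:= boolP (w \in badset).
 exists 1 => // j s t _ _ _.
 have B0 t': BM j t' w = 0.
  apply: cvg_lim; first exact: Rhausdorff.
  by rewrite /BMn bw; exact: cvg_cst.
 by rewrite !B0 subrr normr0.
have {}nb: ~ badset w by move: nb; rewrite inE.
have [K0 [C [C0 h]]]:= good_Inc T nb.
have r01: 0<rr<1 by apply/andP; split; lra.
have [k [Kk hk]]:= @geo_small R rr C K0 r01 C0 e e0.
exists (2^+k)^-1; first by rewrite invr_gt0 exprn_gt0.
move=> j s t sT tT st; apply: le_lt_trans hk.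
apply: (@chain_mod R (fun k n => LD k n j w) rr C T K0 _ r01 C0 _ (fun t => BM j t w)) => //.
- by move=> k' n; exact: LD_cons.
- by move=> k' i Kk' iT; rewrite /LD big_nat_recr//= addrC addrK; exact: h.
move=> t' _; have:= @BMn_cvg j t' w; by rewrite /BMn memNset.
Qed.

Lemma fl_mono k (s t: R): 0<=s<=t -> (fl k s<=fl k t)%N.
Proof using.
by move=> /andP[s0 st]; apply: le_truncn; rewrite ler_pM2r// exprn_gt0.
Qed.

(** At dyadic approximations of the times the increments are sums of [Inc] over disjoint blocks;
    then the level tends to infinity. *)
Lemma cf_BM n (t: nat -> R) (th: 'I_n * 'I_M -> R): 0<=t 0%N -> (forall k, t k<=t k.+1) ->
 Ex P (fun w => cos (\sum_(x: 'I_n * 'I_M) th x*(BM x.2 (t x.1.+1) w-BM x.2 (t x.1) w))) =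
  expR (- (\sum_(x: 'I_n * 'I_M) (t x.1.+1-t x.1) * th x^+2)/2) /\
 Ex P (fun w => sin (\sum_(x: 'I_n * 'I_M) th x*(BM x.2 (t x.1.+1) w-BM x.2 (t x.1) w))) = 0.
Proof using bmb indb.
move=> t00 tS; have tm a c: (a<=c)%N -> t a<=t c.
 move=> /subnKC <-; elim: (c-a)%N => [|l IH]; first by rewrite addn0.
 by rewrite addnS; exact: le_trans IH (tS _).
have t0 l: 0<=t l by apply: le_trans t00 (tm _ _ _).
pose N:= (Num.truncn (t n)).+1.
pose S k w:= \sum_(x: 'I_n * 'I_M) th x*(LD k (fl k (t x.1.+1)) x.2 w-LD k (fl k (t x.1)) x.2 w).
have am k l: (fl k (t l)<=fl k (t l.+1))%N by rewrite fl_mono ?t0 ?tS.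
have aN k (l: 'I_n): (fl k (t l.+1)<=N*2 ^ k)%N.
 apply: ltnW; apply: fl_lt; rewrite t0 /=; apply: le_lt_trans (tm _ n _) (truncnS_gt _); exact: ltn_ord.
pose et k:= bw (fun l => fl k (t l)) th.
have SE k w: S k w = \sum_(0<=i<N*2 ^ k) \sum_j et k i j*Inc k i j w.
 rewrite (bw_sum th (aN k)); apply: eq_bigr => x _; congr (_*_); rewrite /LD.
 by rewrite (@big_cat_nat _ _ _ (fl k (t x.1)) 0 (fl k (t x.1.+1)))//= addrC addrK.
have VE k: (2^-1)^+k*\sum_(0<=i<N*2 ^ k) \sum_j et k i j^+2 =
  \sum_(x: 'I_n * 'I_M) ((fl k (t x.1.+1))%:R/2^+k-(fl k (t x.1))%:R/2^+k) * th x^+2.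
 rewrite (bw_sq th (am k) (aN k)) mulr_sumr; apply: eq_bigr => x _; rewrite exprVn; ring.
have mS k: mfunT (S k).
 apply: measurable_sumr => x; apply: measurable_funM => //; apply: measurable_funB; exact: measurable_LD.
have mB: mfunT (fun w => \sum_(x: 'I_n * 'I_M) th x*(BM x.2 (t x.1.+1) w-BM x.2 (t x.1) w)).
 apply: measurable_sumr => x; apply: measurable_funM => //; apply: measurable_funB; exact: measurable_BM.
have cS (c: bool): Ex P (fun w => trg c (S k w)) @[k --> \oo] -->
  Ex P (fun w => trg c (\sum_(x: 'I_n * 'I_M) th x*(BM x.2 (t x.1.+1) w-BM x.2 (t x.1) w))).
 apply: (@Ex_dct _ _ _ P _ _ 1) => [k||k w|]; [exact: (bm_meas (bm_trg c (mS k)))|exact: (bm_meas (bm_trg c mB))|exact: trg_max|].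
 exists badset; split; [exact: measurable_badset|exact: P_badset|].
 move=> w /= nc; apply: contrapT => nb; apply: nc.
 have cc: S k w @[k --> \oo] --> \sum_(x: 'I_n * 'I_M) th x*(BM x.2 (t x.1.+1) w-BM x.2 (t x.1) w).
  have lc j s: LD k (fl k s) j w @[k --> \oo] --> BM j s w.
   by have:= @BMn_cvg j s w; rewrite /BMn memNset.
  by apply: cvg_big => [|x _]; [exact: add_continuous|apply: cvgMr; apply: cvgB].
 by case: c; [apply: (continuous_cvg _ _ cc); exact: continuous_cos|apply: (continuous_cvg _ _ cc); exact: continuous_sin].
have cfS k: Ex P (fun w => trg true (S k w)) = expR (- (\sum_(x: 'I_n * 'I_M) ((fl k (t x.1.+1))%:R/2^+k-(fl k (t x.1))%:R/2^+k) * th x^+2)/2) /\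
  Ex P (fun w => trg false (S k w)) = 0.
 rewrite -VE; have [<- h2]:= cf_Inc k N (et k).
 by split; [|rewrite -[RHS]h2]; congr Ex; apply/funext => w; rewrite SE.
split.
 have h: expR (- (\sum_(x: 'I_n * 'I_M) ((fl k (t x.1.+1))%:R/2^+k-(fl k (t x.1))%:R/2^+k) * th x^+2)/2) @[k --> \oo] -->
   expR (- (\sum_(x: 'I_n * 'I_M) (t x.1.+1-t x.1) * th x^+2)/2).
  apply: continuous_cvg; first exact: continuous_expR.
  apply: cvgMl; apply: cvgN; apply: cvg_big => [|x _]; first exact: add_continuous.
  by apply: cvgMl; apply: cvgB; exact: fl_cvg.
 have h':= cS true; rewrite (funext (fun k => (cfS k).1)) in h'.
 by rewrite -(cvg_lim (@Rhausdorff R) h') -(cvg_lim (@Rhausdorff R) h).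
have h':= cS false; rewrite (funext (fun k => (cfS k).2)) in h'.
by rewrite -(cvg_lim (@Rhausdorff R) h'); exact: lim_cst.
Qed.

Lemma BM_brownian: brownian_motion P BM.
Proof using bmb indb.
split; first exact: measurable_BM.
split.
 apply: nearW => w j; split; first exact: BM0.
 apply/subspace_continuousP => t /= t0; apply/cvgrPdist_lt => /= e e0.
 have [del d0 h]:= BM_unif (Num.truncn (t+1)).+1 w e0.
 have m0: 0<Num.min del 1 by rewrite lt_min d0 ltr01.
 apply: (filterS _ (nbhsx_ballx t _ m0)) => s; rewrite /ball /= lt_min => /andP[s1 s2] s0.
 have T1:= truncnS_gt (t+1); apply: h => //; first by rewrite s0 /=; move: s2 T1; rewrite ltr_norml => /andP[? ?]; lra.
 by rewrite t0 /=; lra.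
move=> n t A t00 tS mA.
(* The times are known to increase only up to index [n]; freezing them afterwards gives a monotone
   sequence. *)
pose t' k:= t (minn k n).
have t'S k: t' k<=t' k.+1.
 rewrite /t'; case: (boolP (k<n)%N) => [kn|]; last rewrite -leqNgt => nk; first by rewrite [minn k n](minn_idPl (ltnW kn)) [minn k.+1 n](minn_idPl kn) ltW// tS.
 by rewrite [minn k n](minn_idPr nk) [minn k.+1 n](minn_idPr (leqW nk)).
have t'E (l: 'I_n): t' l = t l /\ t' l.+1 = t l.+1.
 by rewrite /t' [minn l n](minn_idPl (ltnW (ltn_ord l))) [minn l.+1 n](minn_idPl (ltn_ord l)).
pose X (x: 'I_n * 'I_M) w:= BM x.2 (t x.1.+1) w-BM x.2 (t x.1) w.
have mX x: mfunT (X x) by apply: measurable_funB; exact: measurable_BM.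
pose v (x: 'I_n * 'I_M):= Num.sqrt (t x.1.+1-t x.1).
have v0 x: v x != 0 by rewrite gt_eqF// sqrtr_gt0 subr_gt0 tS.
have t'0: 0<=t' 0%N by rewrite /t' min0n t00.
have XE (h: R -> R) th: (fun w => h (\sum_x th x*X x w)) = fun w => h (\sum_(x: 'I_n * 'I_M) th x*(BM x.2 (t' x.1.+1) w-BM x.2 (t' x.1) w)).
 by apply/funext => w; congr h; apply: eq_bigr => x _; have [-> ->]:= t'E x.1.
have GL:= @gauss_law _ _ _ P b bmb indb _ X v mX v0 _ _ (fun x => A x.1 x.2) (fun x => mA _ _).
have {}GL: Ex P (fun w => \prod_(x: 'I_n * 'I_M) \1_(A x.1 x.2) (X x w)) = \prod_(x: 'I_n * 'I_M) Ex (normal_prob 0 (v x)) \1_(A x.1 x.2).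
 apply: GL => th; rewrite XE; have [c1 c2]:= cf_BM th t'0 t'S; last exact: c2.
 rewrite c1; congr (expR (- _/2)); apply: eq_bigr => x _; have [-> ->]:= t'E x.1.
 by rewrite exprMn sqr_sqrtr// subr_ge0 ltW// tS.
set S:= [set w | _]; have SE w: \1_S w = \prod_(x: 'I_n * 'I_M) \1_(A x.1 x.2) (X x w) :> R.
 rewrite indicE; have [/set_mem Sw|nS]:= boolP (w \in S).
  by rewrite big1// => x _; rewrite indicE /X (Sw x.1 x.2 (ltn_ord x.1)).
 have [/existsP[x nx]|/existsPn al]:= boolP [exists x: 'I_n * 'I_M, X x w \notin A x.1 x.2].
  by rewrite (bigD1 x)//= indicE (negbTE nx) mul0r.
 move: nS; rewrite notin_setE => nS; exfalso; apply: nS => k j kn.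
 by have:= al (Ordinal kn, j); rewrite negbK.
have mS: measurable S.
 rewrite (_: S = [set w | 1<=\prod_(x: 'I_n * 'I_M) \1_(A x.1 x.2) (X x w) :> R]).
  by apply: measurable_leset => //; apply: bm_meas; apply: bm_prod => x; exact: bm_indic_comp.
 apply/seteqP; split=> w /=; rewrite -SE indicE; first by move=> Sw; rewrite mem_set.
 by case: (boolP (w \in S)) => [/set_mem//|_]; rewrite lt_geF.
rewrite (Ex_indic P mS) (_: Ex P \1_S = Ex P (fun w => \prod_(x: 'I_n * 'I_M) \1_(A x.1 x.2) (X x w))); last by congr Ex; apply/funext.
rewrite GL (pair_bigA _ (fun (k: 'I_n) j => fine (normal_prob 0 (Num.sqrt (t k.+1-t k)) (A k j))))/=; congr EFin.
by apply: eq_bigr => x _; rewrite -[LHS]/(fine (Ex (normal_prob 0 (v x)) \1_(A x.1 x.2))%:E) -(Ex_indic (normal_prob 0 (v x)) (mA x.1 x.2)).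
Qed.

End BrownianMotion.

(** * Polygonal interpolation and functionals of paths *)

Section Interpolation.
Variables (R: realType) (M: nat).
Implicit Types z: 'I_M -> R -> R.

Definition npath z: Prop:= (forall T, cont_path z T) /\ forall j, z j 0 = 0.

(** The polygonal path with increments [x] over the dyadic intervals of level [n], hence a function
    of finitely many reals. *)
Definition Lp (n N: nat) (x: 'I_N * 'I_M -> R) (j: 'I_M) (t: R): R :=
 \sum_(l<N) ramp (2^+n) (l%:R/2^+n) t*x (l, j).

Definition dinc (n N: nat) z (x: 'I_N * 'I_M): R:= z x.2 (x.1.+1%:R/2^+n)-z x.2 (x.1%:R/2^+n).

Lemma ramp_lo (N c x: R): 0<=N -> x<=c -> ramp N c x = 0.
Proof.
move=> N0 xc; rewrite /ramp; have: N*(x-c)<=0 by rewrite mulr_ge0_le0// subr_le0.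
by move: (N*_) => u u0; rewrite !ler0_norm; lra.
Qed.
Lemma ramp_hi (N c x: R): 0<N -> c+N^-1<=x -> ramp N c x = 1.
Proof.
move=> N0 xc; rewrite /ramp; have: 1<=N*(x-c) by rewrite -ler_pdivrMl// mulr1; lra.
by move: (N*_) => u u0; rewrite !ger0_norm; lra.
Qed.

Lemma p2gt0 n: 0<2^+n :> R. Proof. exact: exprn_gt0. Qed.

Lemma Lp_dist n N x y j t: `|@Lp n N x j t-Lp n y j t| <= \sum_i `|x i-y i|.
Proof.
rewrite /Lp -sumrB; apply: le_trans (ler_norm_sum _ _ _) _.
rewrite (eq_bigr (fun i: 'I_N * 'I_M => `|x (i.1, i.2)-y (i.1, i.2)|)); last by case.
rewrite -(pair_bigA _ (fun l j => `|x (l, j)-y (l, j)|))/=; apply: ler_sum => l _.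
rewrite (bigD1 j)//= -mulrBr normrM -[leLHS]addr0; apply: lerD; last by apply: sumr_ge0.
by have /andP[a b]:= ramp01 (2^+n) (l%:R/2^+n) t; rewrite ler_piMl// ger0_norm.
Qed.

Lemma Lp_npath n N x: npath (@Lp n N x).
Proof.
split=> [T j t e _ e0|j]; last first.
 by rewrite /Lp big1// => l _; rewrite ramp_lo ?mul0r// ?divr_ge0// ltW// p2gt0.
pose K:= 2^+n*\sum_(l<N) `|x (l, j)|; have K0: 0<=K by rewrite mulr_ge0 ?sumr_ge0// ltW// p2gt0.
exists (e/(K+1)); first by rewrite divr_gt0// ltr_wpDl.
move=> s _; rewrite ltr_pdivlMr ?ltr_wpDl// => st; apply: le_lt_trans st.
apply: (@le_trans _ _ (`|s-t| * K)); last by rewrite ler_wpM2l// lerDl.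
rewrite /Lp -sumrB /K mulrA mulr_sumr; apply: le_trans (ler_norm_sum _ _ _) _; apply: ler_sum => l _.
by rewrite -mulrBl normrM ler_wpM2r// [_*2^+n]mulrC; apply: ramp_lip; rewrite ltW// p2gt0.
Qed.

Lemma Lp_close (n T N: nat) z (om: R): (forall j, z j 0 = 0) -> (T*2 ^ n<=N)%N ->
 (forall j s t, 0<=s<=T%:R -> 0<=t<=T%:R -> `|t-s| <= (2^+n)^-1 -> `|z j t-z j s| <= om) ->
 forall j t, 0<=t<T%:R -> `|Lp n (dinc n z: 'I_N * 'I_M -> R) j t-z j t| <= 2 * om.
Proof.
move=> z0 TN zm j t tT; have /andP[t0 tT']:= tT; have p0:= p2gt0 n.
have lN:= fl_lt n tT; set l:= fl n t in lN; have lN':= leq_trans lN TN; have /andP[fa fb]:= fl_itv n t0.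
have a1: l%:R/2^+n<=t by rewrite ler_pdivrMr.
have a2: t<=l.+1%:R/2^+n by rewrite ler_pdivlMr// ltW.
have st: l.+1%:R/2^+n-l%:R/2^+n = (2^+n)^-1 :> R by rewrite -mulrBl -natr1 addrC addKr mul1r.
have nT i: (i<=T*2 ^ n)%N -> 0<=(i%:R: R)/2^+n<=T%:R.
 by move=> h; rewrite divr_ge0 ?(ltW p0)//= ler_pdivrMr// -natrX -natrM ler_nat.
have [r [/andP[r0 r1] E]]: exists r: R, 0<=r<=1 /\ Lp n (dinc n z: 'I_N * 'I_M -> R) j t =
  z j (l%:R/2^+n)+r*(z j (l.+1%:R/2^+n)-z j (l%:R/2^+n)).
 exists (ramp (2^+n) (l%:R/2^+n) t); split; first exact: ramp01.
 pose G i:= ramp (2^+n) (i%:R/2^+n) t*(z j (i.+1%:R/2^+n)-z j (i%:R/2^+n)).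
 rewrite /Lp /dinc /= -(big_mkord xpredT G) (@big_cat_nat _ _ _ l)//= ?(ltnW lN')//.
 rewrite [X in _+X]big_ltn// [X in _+(_+X)]big_nat_cond [X in _+(_+X)]big1 ?addr0; last first.
  move=> i /andP[/andP[li _] _]; rewrite /G ramp_lo ?mul0r// ?(ltW p0)//.
  by apply: le_trans a2 _; rewrite ler_pM2r ?invr_gt0// ler_nat.
 congr (_+_); rewrite big_nat_cond (eq_bigr (fun i => z j (i.+1%:R/2^+n)-z j (i%:R/2^+n))).
  rewrite -big_nat_cond; elim: {lN lN' fa fb a1 a2 st}l => [|i IH]; first by rewrite big_geq// mul0r z0.
  by rewrite big_nat_recr//= IH addrC subrK.
 move=> i /andP[/andP[_ il] _]; rewrite /G ramp_hi ?mul1r//.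
 by rewrite -{2}[(2^+n)^-1]mul1r -mulrDl natr1; apply: le_trans a1; rewrite ler_pM2r ?invr_gt0// ler_nat.
rewrite E; have h1: `|z j t-z j (l%:R/2^+n)| <= om.
 by apply: zm; rewrite ?nT ?(ltnW lN)//; [rewrite t0 ltW|rewrite ger0_norm; lra].
have h2: `|z j (l.+1%:R/2^+n)-z j (l%:R/2^+n)| <= om.
 by apply: zm; rewrite ?nT ?(ltnW lN)// st ger0_norm// invr_ge0 ltW.
have -> : z j (l%:R/2^+n)+r*(z j (l.+1%:R/2^+n)-z j (l%:R/2^+n))-z j t =
 r*(z j (l.+1%:R/2^+n)-z j (l%:R/2^+n))-(z j t-z j (l%:R/2^+n)) by ring.
apply: le_trans (ler_normB _ _) _; rewrite normrM (ger0_norm r0).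
have: r * `|z j (l.+1%:R/2^+n)-z j (l%:R/2^+n)| <= om by apply: le_trans h2; rewrite ler_piMl.
by lra.
Qed.

Definition fcont (G: ('I_M -> R -> R) -> R): Prop:= forall z, npath z -> forall e: R, 0<e ->
 exists T del: R, 0<del /\ forall z', npath z' -> (forall j t, 0<=t<=T -> `|z' j t-z j t| <= del) -> `|G z'-G z| <= e.

Definition fucont (G: ('I_M -> R -> R) -> R): Prop:= forall e: R, 0<e ->
 exists T del: R, 0<del /\ forall z z', npath z -> npath z' ->
  (forall j t, 0<=t<=T -> `|z' j t-z j t| <= del) -> `|G z'-G z| <= e.

Lemma fucont_fcont G: fucont G -> fcont G.
Proof. by move=> uG z nz e /uG[T [del [d0 h]]]; exists T, del; split => // z' nz'; exact: h. Qed.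

Lemma Lp_unif z (T: nat) (e: R): npath z -> 0<e -> exists n0, forall n, (n0<=n)%N ->
 forall j s t, 0<=s<=T%:R -> 0<=t<=T%:R -> `|t-s| <= (2^+n)^-1 -> `|z j t-z j s| <= e.
Proof.
move=> [cz _] e0; have [del d0 h]:= @path_unif R 0%N M z T%:R e (ler0n _ _) (cz _) e0.
have /cvgrPdist_lt/(_ _ d0)[n0 _ hn]:= @cvg_half R.
exists n0 => n nn j s t sT tT st; apply: h => //; apply: le_lt_trans st _.
by have:= hn n nn; rewrite sub0r normrN ger0_norm ?exprn_ge0 ?invr_ge0// exprVn.
Qed.

Lemma Lp_cvg (G: ('I_M -> R -> R) -> R) z: fcont G -> npath z ->
 G (Lp n (dinc n z: 'I_(n*2 ^ n) * 'I_M -> R)) @[n --> \oo] --> G z.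
Proof.
move=> cG nz; apply/cvgrPdist_le => e e0; have [T [del [d0 h]]]:= cG _ nz _ e0.
pose T':= (Num.truncn T).+1; have TT': T<T'%:R:= truncnS_gt T.
have [n0 hn]:= @Lp_unif z T' (del/2) nz (divr_gt0 d0 (ltr0n _ 2)).
exists (maxn n0 T') => // n /=; rewrite geq_max => /andP[nn nT]; rewrite distrC; apply: h; first exact: Lp_npath.
move=> j t /andP[t0 tT]; apply: le_trans (Lp_close (T:= T') (om:= del/2) _ _ (hn _ nn) _ _) _.
- by case: nz.
- by rewrite leq_mul2r nT orbT.
- by rewrite t0 (le_lt_trans tT).
- lra.
Qed.

Variables (dO: measure_display) (Om: measurableType dO).

Lemma measurable_Lp (G: ('I_M -> R -> R) -> R) n N (X: 'I_N * 'I_M -> Om -> R): fcont G ->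
 (forall i, mfunT (X i)) -> mfunT (fun w => G (Lp n (X^~ w))).
Proof.
move=> cG mX; apply: (measurable_countable mX) => w e e0.
have [T [del [d0 h]]]:= cG _ (Lp_npath n (X^~ w)) _ (divr_gt0 e0 (ltr0n _ 2)).
exists (enum {: 'I_N * 'I_M}), (del/(#|{: 'I_N * 'I_M}|%:R+1)).
have k0: 0 < #|{: 'I_N * 'I_M}|%:R+1 :> R by rewrite ltr_wpDl.
split; first exact: divr_gt0.
move=> w' hw; apply: (@le_lt_trans _ _ (e/2)); last by rewrite ltr_pdivrMr//; lra.
apply: h; first exact: Lp_npath.
move=> j t _; apply: le_trans (Lp_dist _ _ _ _ _) _.
apply: le_trans (ler_sum _ (G:= fun=> del/(#|{: 'I_N * 'I_M}|%:R+1)) _) _.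
 by move=> i _; apply: ltW; apply: hw; rewrite mem_enum.
by rewrite sumr_const -[_ *+ _]mulr_natl mulrCA ler_piMr ?(ltW d0)// ler_pdivrMr// mul1r lerDl.
Qed.

(** A continuous functional is the limit of its values at polygonal interpolations, each of which
    depends on finitely many values of the path. *)
Lemma measurable_path (G: ('I_M -> R -> R) -> R) (Z: Om -> 'I_M -> R -> R): fcont G -> (forall w, npath (Z w)) ->
 (forall j t, 0<=t -> mfunT (fun w => Z w j t)) -> mfunT (fun w => G (Z w)).
Proof.
move=> cG nZ mZ.
apply: (@measurable_fun_cvg _ _ _ _ (fun n w => G (Lp n (dinc n (Z w): 'I_(n*2 ^ n) * 'I_M -> R)))) => [n|w _].
 apply: (measurable_Lp n cG (X:= fun i w => dinc n (Z w) i)) => i; apply: measurable_funB; apply: mZ; rewrite divr_ge0// ltW// p2gt0.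
exact: Lp_cvg.
Qed.

End Interpolation.

(** * The random walk: exponential moments and modulus of continuity *)

Section Walk.
Variables (R: realType) (dO: measure_display) (Om: measurableType dO) (P: probability Om R) (M: nat).
Variables (J: nat -> Om -> 'I_M) (sg: nat -> Om -> R).
Hypothesis M0: (0<M)%N.
Hypothesis bmw: forall k (g: 'I_M -> R -> R), bm (fun w => g (J k w) (sg k w)).
Hypothesis sg1: forall k w, `|sg k w| = 1.
Definition avJ (g: 'I_M -> R -> R): R:= (2*M%:R)^-1*\sum_j (g j 1+g j (-1)).
Hypothesis indw: forall (r: seq nat) (g: nat -> 'I_M -> R -> R), uniq r ->
 Ex P (fun w => \prod_(k <- r) g k (J k w) (sg k w)) = \prod_(k <- r) avJ (g k).

(** [si] stands for eps^gamma: steps of size [si] during times [si*si]. *)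
Definition zw (si: R) (w: Om): 'I_M -> R -> R:= gridz (si*si) (J^~ w) (fun k => sg k w*si).
Definition mz (si t: R): nat:= Num.truncn (t/(si*si)).
Definition WS (si: R) (a c: nat) (j: 'I_M) (w: Om): R:= \sum_(a<=k<c) (J k w == j)%:R*(sg k w*si).

Lemma Mgt0: 0<M%:R :> R. Proof using M0. by rewrite ltr0n. Qed.

Lemma Ex_step k (g: 'I_M -> R -> R): Ex P (fun w => g (J k w) (sg k w)) = avJ g.
Proof using indw.
have:= @indw [:: k] (fun=> g) isT; rewrite big_seq1 => <-; congr Ex; apply/funext => w.
by rewrite big_seq1.
Qed.

Lemma measurable_WS si a c j: mfunT (WS si a c j).
Proof using bmw.
apply: measurable_sumr => k; exact: (bm_meas (bmw k (fun i s => (i == j)%:R*(s*si)))).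
Qed.

Lemma mz_itv si t: 0<si -> 0<=t -> (mz si t)%:R*(si*si)<=t<(mz si t).+1%:R*(si*si).
Proof using.
move=> s0 t0; have h0: 0<si*si by exact: mulr_gt0.
have:= truncn_itv (divr_ge0 t0 (ltW h0)); rewrite -/(mz si t) => /andP[a c].
by rewrite -ler_pdivlMr// a -ltr_pdivrMr.
Qed.

Lemma mz_mono si s t: 0<si -> 0<=s<=t -> (mz si s<=mz si t)%N.
Proof using. by move=> s0 /andP[_ st]; apply: le_truncn; rewrite ler_pM2r// invr_gt0 mulr_gt0. Qed.

Lemma mz_diff si s t: 0<si -> 0<=s<=t ->
 `|((mz si t)%:R-(mz si s)%:R)*(si*si)-(t-s)| <= si*si.
Proof using.
move=> s0 /andP[t0 st]; have /andP[a c]:= mz_itv s0 t0; have /andP[a' c']:= mz_itv s0 (le_trans t0 st).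
move: c c'; rewrite -!natr1 !mulrDl !mul1r => c c'; rewrite mulNr ler_norml; apply/andP; split; lra.
Qed.

Lemma zw_inc si a c j w: 0<si -> 0<=a<=c ->
 `|zw si w j c-zw si w j a-WS si (mz si a) (mz si c) j w| <= 2*si.
Proof using sg1.
move=> s0 /[dup] ac /andP[a0 ac']; have h0: 0<si*si by exact: mulr_gt0.
have st t: 0<=t -> `|zw si w j t-gridP (J^~ w) (fun k => sg k w*si) (mz si t) j| <= si.
 move=> t0; have /andP[u v]:= mz_itv s0 t0.
 have:= gridz_step_le (J^~ w) (fun k => sg k w*si) h0 j (_: (mz si t)%:R*(si*si)<=t<=(mz si t).+1%:R*(si*si)).
 by rewrite u (ltW v) normrM sg1 mul1r (gtr0_norm s0); apply.
have E: WS si (mz si a) (mz si c) j w = gridP (J^~ w) (fun k => sg k w*si) (mz si c) j-gridP (J^~ w) (fun k => sg k w*si) (mz si a) j.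
 rewrite /gridP -!(big_mkord xpredT (fun k => (J k w == j)%:R*(sg k w*si))).
 by rewrite [X in _ = X-_](@big_cat_nat _ _ _ (mz si a) 0 (mz si c))//= ?mz_mono// [RHS]addrC addKr.
rewrite E; have:= st _ a0; have:= st _ (le_trans a0 ac').
move: (zw si w j c) (zw si w j a) (gridP _ _ _ _) (gridP _ _ _ _) => x y u v.
by rewrite !ler_norml => /andP[? ?] /andP[? ?]; apply/andP; split; lra.
Qed.

(** A time span of at most one step meets at most two cells, each with slope at most 1/si. *)
Lemma zw_lip si a c j w: 0<si -> 0<=a<=c -> c-a<=si*si -> `|zw si w j c-zw si w j a| <= (c-a)/si.
Proof using sg1.
move=> s0 /andP[a0 ac] ca; have h0: 0<si*si by exact: mulr_gt0.
have cell k s t: k%:R*(si*si)<=s<=k.+1%:R*(si*si) -> k%:R*(si*si)<=t<=k.+1%:R*(si*si) -> s<=t ->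
  `|zw si w j t-zw si w j s| <= (t-s)/si.
 move=> sI tI st; rewrite /zw (gridz_E _ _ h0 _ sI) (gridz_E _ _ h0 _ tI) opprD addrACA subrr add0r -mulrBr.
 have -> : t-k%:R*(si*si)-(s-k%:R*(si*si)) = t-s by ring.
 rewrite normrM (ger0_norm (_: 0<=t-s)) ?subr_ge0// [leRHS]mulrC ler_wpM2r ?subr_ge0//.
 rewrite !normrM sg1 mul1r normfV (gtr0_norm h0) (gtr0_norm s0).
 have -> : si^-1 = 1*si/(si*si) by field; rewrite gt_eqF.
 apply: ler_wpM2r; first by rewrite invr_ge0 ltW.
 by apply: ler_wpM2r; [exact: ltW|case: (_ == j); rewrite ?normr1 ?normr0].
have /andP[u v]:= mz_itv s0 a0; set k:= mz si a in u v; have vE:= v; rewrite -natr1 mulrDl mul1r in vE.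
have [cv|cv]:= leP c (k.+1%:R*(si*si)); first by apply: (cell k); rewrite ?u ?(ltW v)// (le_trans u ac).
have kE: k.+2%:R*(si*si) = k.+1%:R*(si*si)+si*si by rewrite -natr1 mulrDl mul1r.
have h1:= cell k a (k.+1%:R*(si*si)) _ _ (ltW v); have h2:= cell k.+1 (k.+1%:R*(si*si)) c _ _ (ltW cv).
have {}h1: `|zw si w j (k.+1%:R*(si*si))-zw si w j a| <= (k.+1%:R*(si*si)-a)/si.
 by apply: h1; rewrite ?u ?(ltW v)// lexx andbT ler_pM2r// ler_nat.
have {}h2: `|zw si w j c-zw si w j (k.+1%:R*(si*si))| <= (c-k.+1%:R*(si*si))/si.
 by apply: h2; rewrite ?lexx ?(ltW cv)/= ?ler_pM2r ?ler_nat// kE; lra.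
apply: le_trans (ler_distD (zw si w j (k.+1%:R*(si*si))) _ _) _.
apply: le_trans (lerD h2 h1) _; rewrite -mulrDl ler_wpM2r ?invr_ge0 ?(ltW s0)//; lra.
Qed.

Lemma zw_npath si w: 0<si -> npath (zw si w).
Proof using.
move=> s0; have h0: 0<si*si by exact: mulr_gt0.
split; first by move=> T; exact: (@gridz_cont R 0%N M _ _ _ h0 T).
move=> j; have:= @gridz_grid R M _ (J^~ w) (fun k => sg k w*si) h0 0 j.
by rewrite mul0r /zw => ->; rewrite /gridP big_ord0.
Qed.

Lemma measurable_zw si j t: 0<si -> 0<=t -> mfunT (fun w => zw si w j t).
Proof using bmw.
move=> s0 t0; have h0: 0<si*si by exact: mulr_gt0.
have /andP[u v]:= mz_itv s0 t0.
rewrite (_: (fun w => _) = fun w => \sum_(i<mz si t) (J i w == j)%:R*(sg i w*si) +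
 (J (mz si t) w == j)%:R*(sg (mz si t) w*si)/(si*si)*(t-(mz si t)%:R*(si*si))); last first.
 by apply/funext => w; rewrite /zw (gridz_E _ _ h0 _ (_: (mz si t)%:R*(si*si)<=t<=(mz si t).+1%:R*(si*si)))// u ltW.
apply: measurable_funD.
 by apply: measurable_sumr => k; exact: (bm_meas (bmw k (fun i s => (i == j)%:R*(s*si)))).
exact: (bm_meas (bmw (mz si t) (fun i s => (i == j)%:R*(s*si)/(si*si)*(t-(mz si t)%:R*(si*si))))).
Qed.

(** Independence together with [cosh_le]; a step in a direction other than [j] contributes the
    factor 1. *)
Lemma WS_exp si a c j (mu: R): Ex P (fun w => expR (mu*WS si a c j w))<=expR (2*(mu*si)^+2*(c-a)%:R).
Proof using M0 bmw indw.
pose g (i: 'I_M) (s: R):= expR (mu*((i == j)%:R*(s*si))).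
have E w: expR (mu*WS si a c j w) = \prod_(a<=k<c) g (J k w) (sg k w).
 by rewrite /WS mulr_sumr expR_sum.
rewrite (funext E) (@indw (index_iota a c) (fun=> g) (iota_uniq _ _)).
have -> : expR (2*(mu*si)^+2*(c-a)%:R) = \prod_(a<=k<c) expR (2*(mu*si)^+2).
 by rewrite -expR_sum sumr_const_nat mulr_natr.
apply: ler_prod => k _; apply/andP; split.
 by rewrite /avJ mulr_ge0 ?invr_ge0 ?mulr_ge0// sumr_ge0// => i _; rewrite addr_ge0 ?expR_ge0.
rewrite /avJ ler_pdivrMl ?mulr_gt0 ?Mgt0//.
apply: le_trans (ler_sum _ (G:= fun=> 2*expR (2*(mu*si)^+2)) _) _ => [i _|].
 rewrite /g; case: (i == j).
  have:= cosh_le (mu*si); rewrite ler_pdivrMr// => h.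
  by rewrite /= !mul1r mulN1r mulrN [2*expR _]mulrC.
 rewrite mul0r mulr0 expR0 mul0r mulr0 expR0.
 have:= expR_ge1Dx (2*(mu*si)^+2); have:= sqr_ge0 (mu*si); lra.
by rewrite sumr_const card_ord -[_ *+ M]mulr_natl mulrCA mulrA.
Qed.

Lemma WS_tail si a c j (x lam: R): 0<lam ->
 Ex P (fun w => (x <= `|WS si a c j w|)%R%:R)<=2*(expR (- (lam*x))*expR (2*(lam*si)^+2*(c-a)%:R)).
Proof using M0 bmw indw.
move=> l0; have mW:= measurable_WS si a c j.
have bE mu: bm (fun w => expR (mu*WS si a c j w)).
 pose g (i: 'I_M) (s: R):= expR (mu*((i == j)%:R*(s*si))).
 rewrite (_: (fun w => _) = fun w => \prod_(a<=k<c) g (J k w) (sg k w)); first by apply: bm_prod => k; exact: bmw.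
 by apply/funext => w; rewrite /WS mulr_sumr expR_sum.
have bI:= bm_geind x mW.
have bS: bm (fun w => expR (- (lam*x))*(expR (lam*WS si a c j w)+expR (- lam*WS si a c j w))).
 by apply: bmZ; apply: bmD.
apply: (@le_trans _ _ (Ex P (fun w => expR (- (lam*x))*(expR (lam*WS si a c j w)+expR (- lam*WS si a c j w))))).
 apply: le_Ex => // w; case: (leP x _) => [h|_]; last by rewrite mulr_ge0 ?addr_ge0 ?expR_ge0.
 have: 1<=expR (- (lam*x))*expR (lam * `|WS si a c j w|).
  rewrite -expRD -[leLHS]expR0 ler_expR; have:= ler_wpM2l (ltW l0) h; lra.
 move=> /le_trans; apply; rewrite ler_wpM2l ?expR_ge0//.
 have [W0|W0]:= leP 0 (WS si a c j w); first by rewrite (ger0_norm W0) lerDl expR_ge0.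
 by rewrite (ltr0_norm W0) mulrN -mulNr lerDr expR_ge0.
rewrite (ExZ P _ (bmD (bE lam) (bE (- lam)))) (ExD P (bE lam) (bE (- lam))) mulrCA.
rewrite ler_wpM2l ?expR_ge0//; have:= WS_exp si a c j lam; have:= WS_exp si a c j (- lam).
by rewrite mulNr sqrrN; lra.
Qed.

Local Notation rr:= (9/10: R).
(** Counts the large increments over dyadic intervals longer than a step of the walk; on shorter
    intervals the slope of the polygon gives the bound. *)
Definition cntw (si: R) (T K0 K1: nat) (w: Om): R :=
 \sum_(K0<=k<K1 | si*si<(2^+k)^-1) \sum_(0<=i<T*2 ^ k) \sum_(j<M)
  (rr^+k <= `|WS si (mz si (i%:R/2^+k)) (mz si (i.+1%:R/2^+k)) j w|)%R%:R.
Definition cntC (T: nat): R:= T%:R*M%:R*(2*expR 4*256).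
Definition rho: R:= 1/(2*rr^+4).

Lemma bm_WSind si a c j (x: R): bm (fun w => (x <= `|WS si a c j w|)%R%:R: R).
Proof using bmw.
by apply: bm_geind; exact: measurable_WS.
Qed.

Lemma bm_cntw si T K0 K1: bm (cntw si T K0 K1).
Proof using bmw. by do 3!apply: bm_sum => ?; exact: bm_WSind. Qed.

Lemma dyad_step k i: 0<=(i%:R/2^+k: R)<=i.+1%:R/2^+k.
Proof using. by rewrite divr_ge0 ?exprn_ge0//= ler_pM2r ?invr_gt0 ?exprn_gt0// ler_nat. Qed.

Lemma dyad_len k i: i.+1%:R/2^+k-i%:R/2^+k = (2^+k)^-1 :> R.
Proof using. by rewrite -mulrBl -natr1 addrC addKr mul1r. Qed.

(** Chernoff's bound with [lam] the inverse of [rt^+k]. An interval of length 2^-k, longer than a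
    step, contains steps of total duration at most twice its length, whence the exponent 4. *)
Lemma WS_level si k i j: 0<si -> si*si<(2^+k)^-1 ->
 Ex P (fun w => (rr^+k <= `|WS si (mz si (i%:R/2^+k)) (mz si (i.+1%:R/2^+k)) j w|)%R%:R) <=
 2*expR 4*(256/(4*rr^+4)^+k).
Proof using M0 bmw indw.
move=> s0 hk; have r0: 0<rt R^+k by exact: exprn_gt0 (rt_gt0 R).
have l0: 0<(rt R^+k)^-1 by rewrite invr_gt0.
apply: le_trans (WS_tail _ _ _ _ _ l0) _; rewrite -[X in _<=X]mulrA ler_pM2l// [X in X<=_]mulrC.
apply: ler_pM; rewrite ?expR_ge0//.
 rewrite ler_expR natrB; last by apply: mz_mono => //; exact: dyad_step.
 have:= mz_diff s0 (dyad_step k i); rewrite dyad_len ler_norml => /andP[_]; rewrite lerBlDr.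
 rewrite exprMn (_: (rt R^+k)^-1^+2 = 2^+k); last first.
  by rewrite exprVn expr2 rtX exprVn invrK.
 rewrite -[2*_*_]mulrA -[2^+k*_*_]mulrA [si^+2*_]mulrC expr2; move: (_*(si*si)) => u hu.
 have p0:= p2gt0 R k; have: 2^+k*u<=2^+k*(2*(2^+k)^-1) by rewrite ler_pM2l//; lra.
 by rewrite mulrCA divff ?gt_eqF//; lra.
by rewrite expRN (_: (rt R^+k)^-1*rr^+k = thr R k) ?expR_thr// /thr [(rr/rt R)^+k]expr_div_n mulrC.
Qed.

Lemma rho01: 0<rho<1. Proof using. by rewrite /rho; apply/andP; split; lra. Qed.

Lemma Ex_cntw si T K0 K1: 0<si -> Ex P (cntw si T K0 K1)<=cntC T*rho^+K0/(1-rho).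
Proof using M0 bmw indw.
move=> s0; rewrite /cntw Ex_sum => [|k]; last by do 2!apply: bm_sum => ?; exact: bm_WSind.
have /andP[p0 p1]:= rho01; have c0: 0<=cntC T:= cnt_ge0 _ _ _.
apply: (@le_trans _ _ (\sum_(K0<=k<K1) cntC T*rho^+k)).
 rewrite big_mkcond; apply: ler_sum => k _; case: ifPn => hk; last by rewrite mulr_ge0// exprn_ge0// ltW.
 rewrite Ex_sum => [|i]; last by apply: bm_sum => ?; exact: bm_WSind.
 apply: (@le_trans _ _ (\sum_(0<=i<T*2 ^ k) \sum_(j<M) 2*expR 4*(256/(4*rr^+4)^+k))).
  apply: ler_sum => i _; rewrite Ex_sum => [|j]; last exact: bm_WSind.
  by apply: ler_sum => j _; exact: WS_level.
 rewrite sumr_const card_ord sumr_const_nat subn0 -mulrnA -[_ *+ (M*_)]mulr_natr !natrM natrX.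
 apply: eq_le_imp.
 have -> : (4*rr^+4)^+k = 2^+k*(2*rr^+4)^+k :> R by rewrite -exprMn; congr (_^+k); ring.
 rewrite /cntC /rho [(1 / _)^+k]expr_div_n expr1n; have: (2*rr^+4)^+k != 0 by rewrite expf_neq0//; lra.
 have: 2^+k != 0 :> R by rewrite expf_neq0.
 by move: (2^+k) ((2*_)^+k) (expR _) => u v e u0 v0; field; rewrite u0 v0.
have q0: 0<1-rho by lra.
have main n: \sum_(K0<=k<K0+n) cntC T*rho^+k<=cntC T*(rho^+K0-rho^+(K0+n))/(1-rho).
 elim: n => [|n IH]; first by rewrite addn0 big_geq// subrr mulr0 mul0r.
 rewrite addnS big_nat_recr/= ?leq_addr//; apply: le_trans (lerD IH (lexx _)) _.
 apply: eq_le_imp; rewrite exprS.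
 by move: (rho^+(K0+n)) (rho^+K0) => x y; field; rewrite gt_eqF.
have [KK|KK]:= leqP K1 K0; first by rewrite big_geq//; exact: divr_ge0 (mulr_ge0 c0 (exprn_ge0 _ (ltW p0))) (ltW q0).
have:= main (K1-K0)%N; rewrite subnKC; last exact: ltnW.
move=> /le_trans; apply; rewrite ler_pM2r ?invr_gt0//.
by rewrite ler_wpM2l// gerBl exprn_ge0// ltW.
Qed.

(** Chaining with constant 3: one unit from the walk, two from the gap [2*si] between path and walk
    when [si] is below [rt^+k]. The 90 is 3*3/(1-9/10). *)
Lemma zw_mod si (T K0 K1: nat) w: 0<si -> (2^+K1)^-1<=si*si -> cntw si T K0 K1 w<1 ->
 forall j s t, 0<=s<T%:R -> 0<=t<T%:R -> `|t-s| < (2^+K0)^-1 -> `|zw si w j t-zw si w j s| <= 90*rr^+K0.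
Proof using sg1.
move=> s0 hK cw j s t sT tT st; have h0: 0<si*si by exact: mulr_gt0.
have inc k i: (K0<=k)%N -> (i<T*2 ^ k)%N -> `|zw si w j (i.+1%:R/2^+k)-zw si w j (i%:R/2^+k)| <= 3*rr^+k.
 move=> Kk iT; have rk0: 0<rr^+k by apply: exprn_gt0; lra.
 have r0: 0<rt R^+k by exact: exprn_gt0 (rt_gt0 R).
 have rtr: rt R^+k<=rr^+k.
  have: rt R<=rr by have:= rt2 R; have:= rt_gt0 R; nra.
  by apply: lerXn2r; rewrite ?nnegrE ?(ltW (rt_gt0 R))//; lra.
 have rk2: rt R^+k*rt R^+k = (2^+k)^-1 by rewrite rtX exprVn.
 have [hk|hk]:= ltP (si*si) (2^+k)^-1; last first.
  apply: le_trans (zw_lip j w s0 (dyad_step k i) _) _; rewrite dyad_len//.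
  have: (2^+k)^-1/si<=rt R^+k.
   rewrite ler_pdivrMr// -rk2 ler_pM2l//; move: hk; rewrite -rk2; nra.
  lra.
 have sr: si<rt R^+k by move: hk; rewrite -rk2; nra.
 have kK1: (k<K1)%N.
  rewrite ltnNge; apply/negP => K1k; have: (2^+k)^-1<=(2^+K1)^-1 :> R.
   by rewrite lef_pV2 ?posrE ?exprn_gt0// ler_eXn2l// ltr1n.
  by move=> /le_trans/(_ hK); rewrite leNgt hk.
 have Wl: `|WS si (mz si (i%:R/2^+k)) (mz si (i.+1%:R/2^+k)) j w| < rr^+k.
  rewrite ltNge; apply/negP => h; move: cw; rewrite ltNge => /negP; apply; rewrite /cntw.
  have g0 k' i' j': 0<=(rr^+k' <= `|WS si (mz si (i'%:R/2^+k')) (mz si (i'.+1%:R/2^+k')) j' w|)%R%:R :> R by [].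
  rewrite big_mkcond (big_rem k) ?mem_index_iota ?Kk//= hk (big_rem i) ?mem_index_iota//= (bigD1 j)//= h.
  rewrite -!addrA lerDl !addr_ge0//; first by apply: sumr_ge0.
   by apply: sumr_ge0 => i' _; apply: sumr_ge0.
  by apply: sumr_ge0 => k' _; case: ifP => // _; apply: sumr_ge0 => i' _; apply: sumr_ge0.
 have:= zw_inc j w s0 (dyad_step k i); move: Wl.
 move: (WS _ _ _ _ _) (zw _ _ _ _-zw _ _ _ _) => u v.
 by rewrite ltr_norml !ler_norml => /andP[? ?] /andP[? ?]; apply/andP; split; lra.
have:= @chain_mod R (fun k i => zw si w j (i%:R/2^+k)) rr 3 T K0 _ _ _ inc (zw si w j) K0 s t _ (leqnn _) sT tT st.
rewrite (_: 3*3*rr^+K0/(1-rr) = 90*rr^+K0); last by field; lra.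
apply; [|by apply/andP; split; lra|by []|].
- by move=> k n; congr (zw si w j _); rewrite natrM exprS; field; rewrite gt_eqF// p2gt0.
move=> u /andP[u0 _]; apply/cvgrPdist_lt => e e0.
have [cz _]:= zw_npath w s0; have [r r0 h]:= cz u j u e (ltac:(rewrite u0 lexx//)) e0.
have /cvgrPdist_lt/(_ _ r0):= fl_cvg u0; apply: filterS => k hk; rewrite distrC; apply: h; last by rewrite distrC.
have /andP[a _]:= fl_itv k u0; rewrite divr_ge0 ?exprn_ge0//=.
by rewrite ler_pdivrMr// p2gt0.
Qed.

End Walk.

(** * Gaussian approximation for a single step *)

Section TrigLipschitz.
Variable R: realType.

Lemma trg_lip c (x y: R): `|trg c x-trg c y| <= `|x-y|.
Proof.
pose a:= (x+y)/2; pose e:= (x-y)/2.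
have -> : x = a+e by rewrite /a /e; field.
have -> : y = a-e by rewrite /a /e; field.
have ee: `|a+e-(a-e)| = 2 * `|e| by rewrite -normr_nat -normrM; congr `|_|; ring.
have n2 (u v: R): `|u| <= 1 -> `|2*u*sin v| <= 2 * `|v|.
 move=> u1; rewrite !normrM (normr_nat _ 2) -mulrA ler_pM2l//; apply: le_trans (norm_sin_le v).
 by rewrite ler_piMl.
rewrite ee; case: c => /=.
 by rewrite cosD cosB (_: _-_ = 2*(- sin a)*sin e); [apply: n2; rewrite normrN; exact: sin_max|ring].
by rewrite sinD sinB (_: _-_ = 2*cos a*sin e); [apply: n2; exact: cos_max|ring].
Qed.

Lemma expRN_le (y: R): 0<=y -> 1-y<=expR (- y)<=1-y+y^+2.
Proof.
move=> y0; apply/andP; split; first exact: expR_ge1Dx.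
rewrite expRN; have h:= expR_ge1Dx y; have e0:= expR_gt0 y.
rewrite -[leLHS]div1r ler_pdivrMr//; have: (1-y+y^+2)*(1+y)<=(1-y+y^+2)*expR y.
 by rewrite ler_wpM2l//; nra.
have -> : (1-y+y^+2)*(1+y) = 1+y^+3 by ring.
by move=> /(le_trans _); apply; rewrite lerDl exprn_ge0.
Qed.

(** Both terms equal 1-y up to fourth order, where y is half the mean of the squares. *)
Lemma psi_est (M: nat) (x: 'I_M -> R) (B: R): (0<M)%N -> (forall j, `|x j| <= B) ->
 `|M%:R^-1*\sum_j cos (x j)-expR (- (M%:R^-1*\sum_j x j^+2/2))| <= B^+4.
Proof.
move=> M0 xB; have m0: 0<M%:R :> R by rewrite ltr0n.
have B0: 0<=B by apply: le_trans (xB (Ordinal M0)).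
have x2 j: x j^+2<=B^+2 by rewrite -real_normK ?num_real// ler_pXn2r ?nnegrE.
have x4 j: x j^+4<=B^+4 by rewrite !(exprM _ 2 2) ler_pXn2r ?nnegrE ?sqr_ge0.
have avl (F G: 'I_M -> R): (forall j, F j<=G j) -> M%:R^-1*\sum_j F j<=M%:R^-1*\sum_j G j.
 by move=> FG; rewrite ler_pM2l ?invr_gt0//; apply: ler_sum.
have avc (a: R): M%:R^-1*\sum_(j<M) a = a by rewrite sumr_const card_ord -[a *+ M]mulr_natl mulKf ?gt_eqF.
set y:= M%:R^-1*\sum_j x j^+2/2.
have y0: 0<=y by rewrite mulr_ge0 ?invr_ge0// sumr_ge0// => j _; rewrite divr_ge0// sqr_ge0.
have yB: y<=B^+2/2 by rewrite -[leRHS]avc; apply: avl => j; rewrite ler_pM2r.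
have lo: 1-y<=M%:R^-1*\sum_j cos (x j).
 have -> : 1-y = M%:R^-1*\sum_j (1-x j^+2/2) by rewrite sumrB mulrBr avc.
 apply: avl => j; exact: cos_ge2.
have hi: M%:R^-1*\sum_j cos (x j)<=1-y+B^+4/24.
 have -> : 1-y+B^+4/24 = M%:R^-1*\sum_j (1-x j^+2/2+B^+4/24).
  by rewrite big_split/= mulrDr avc sumrB mulrBr avc.
 apply: avl => j.
 by apply: le_trans (cos_le4 (x j)) _; rewrite lerD2l ler_pM2r.
have /andP[e1 e2]:= expRN_le y0.
have yy: y^+2<=B^+4/4.
 rewrite (_: B^+4/4 = (B^+2/2)^+2); last by field.
 by rewrite ler_pXn2r ?nnegrE// divr_ge0// sqr_ge0.
have b4: 0<=B^+4 by exact: exprn_ge0.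
by rewrite ler_norml; apply/andP; split; lra.
Qed.

End TrigLipschitz.

(** * Donsker's theorem *)

Section Donsker.
Variables (R: realType) (dO: measure_display) (Om: measurableType dO) (P: probability Om R) (M: nat).
Variables (J: nat -> Om -> 'I_M) (sg: nat -> Om -> R).
Hypothesis M0: (0<M)%N.
Hypothesis bmw: forall k (g: 'I_M -> R -> R), bm (fun w => g (J k w) (sg k w)).
Hypothesis sg1: forall k w, `|sg k w| = 1.
Hypothesis indw: forall (r: seq nat) (g: nat -> 'I_M -> R -> R), uniq r ->
 Ex P (fun w => \prod_(k <- r) g k (J k w) (sg k w)) = \prod_(k <- r) avJ (g k).
Local Notation zw:= (zw J sg).
Local Notation dm n l:= (l%:R/2^+n: R).

(** Increments of the path and of the walk differ by at most [2*si]. For the walk the characteristic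
    function is a product whose factors are within [(Th*si)^+4] of Gaussian ones, and their number
    times [si*si] is at most [dm n N]. *)
Lemma cf_walk (si: R) n N (th: 'I_N * 'I_M -> R) (Th:= \sum_x `|th x|): 0<si ->
 `|Ex P (fun w => cos (\sum_x th x*dinc n (zw si w) x)) -
  expR (- (M%:R^-1*\sum_x th x^+2*(((mz si (dm n x.1.+1))%:R-(mz si (dm n x.1))%:R)*(si*si))/2))| <=
  2*si*Th+dm n N*Th^+4*(si*si) /\
 `|Ex P (fun w => sin (\sum_x th x*dinc n (zw si w) x))| <= 2*si*Th.
Proof using M0 bmw sg1 indw.
move=> s0; have h0: 0<si*si by exact: mulr_gt0.
have Th0: 0<=Th by apply: sumr_ge0.
pose a l:= mz si (dm n l); have am l: (a l<=a l.+1)%N by apply: mz_mono => //; exact: dyad_step.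
have aN (l: 'I_N): (a l.+1<=a N)%N.
 by apply: mz_mono => //; rewrite divr_ge0 ?exprn_ge0//= ler_pM2r ?invr_gt0 ?p2gt0// ler_nat.
pose A k w:= bw a th k (J k w)*(sg k w*si).
pose S w:= \sum_(k <- index_iota 0 (a N)) A k w.
have SE w: S w = \sum_(x: 'I_N * 'I_M) th x*WS J sg si (a x.1) (a x.1.+1) x.2 w.
 rewrite /WS -(bw_sum th aN (fun k j => (J k w == j)%:R*(sg k w*si))); apply: eq_bigr => k _.
 rewrite (bigD1 (J k w))//= eqxx mul1r big1 ?addr0// => j; rewrite eq_sym => /negbTE ->.
 by rewrite mul0r mulr0.
have mA k: mfunT (A k):= bm_meas (bmw k (fun j s => bw a th k j*(s*si))).
have EA c k: Ex P (fun w => trg c (A k w)) = avJ (fun j s => trg c (bw a th k j*(s*si))).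
 exact: (Ex_step indw k (fun j s => trg c (bw a th k j*(s*si)))).
have indA (r: seq nat) (g: nat -> bool): uniq r -> Ex P (fun w => \prod_(k <- r) trg (g k) (A k w)) =
  \prod_(k <- r) Ex P (fun w => trg (g k) (A k w)).
 move=> ur; rewrite (indw (fun k j s => trg (g k) (bw a th k j*(s*si))) ur).
 by apply: eq_bigr => k _; rewrite EA.
have A0 k: Ex P (fun w => sin (A k w)) = 0.
 rewrite (EA false) /avJ big1 ?mulr0// => j _ /=.
 by rewrite mul1r mulN1r mulrN sinN subrr.
have [cS sS]:= cf_sum mA indA A0 (iota_uniq 0 (a N-0)).
have mX x: mfunT (fun w => dinc n (zw si w) x).
 by apply: measurable_funB; apply: measurable_zw => //; rewrite divr_ge0// exprn_ge0.
have mT: mfunT (fun w => \sum_x th x*dinc n (zw si w) x).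
 by apply: measurable_sumr => x; exact: measurable_funM.
have mS: mfunT S by exact: measurable_sumr.
have near c: `|Ex P (fun w => trg c (\sum_x th x*dinc n (zw si w) x))-Ex P (fun w => trg c (S w))| <= 2*si*Th.
 rewrite -[leRHS](Ex_cst P); apply: Ex_diff_le; [exact: bm_trg|exact: bm_trg|exact: bm_cst|move=> w].
 apply: le_trans (trg_lip _ _ _) _; rewrite SE -sumrB; apply: le_trans (ler_norm_sum _ _ _) _.
 rewrite mulr_sumr; apply: ler_sum => x _; rewrite -mulrBr normrM mulrC ler_wpM2r//.
 apply: zw_inc => //; exact: dyad_step.
split; last by have:= near false; rewrite /= sS subr0.
rewrite -[X in `|X-_|](subrK (Ex P (fun w => cos (S w)))) -addrA; apply: le_trans (ler_normD _ _) _.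
apply: lerD; first exact: (near true).
have EC k: Ex P (fun w => cos (A k w)) = M%:R^-1*\sum_j cos (bw a th k j*si).
 rewrite (EA true) /avJ invfM -mulrA mulrCA; congr (_*_); rewrite mulr_sumr; apply: eq_bigr => j _ /=.
 by rewrite mul1r mulN1r mulrN cosN; field.
have ps k:= psi_est (x:= fun j => bw a th k j*si) M0 (fun j => (ltac:(by rewrite normrM (gtr0_norm s0) ler_pM2r// bw_le): `|bw a th k j*si| <= Th*si)).
have e1 (y: R): 0<=y -> `|expR (- y)| <= 1.
 by move=> y0; rewrite ger0_norm ?expR_ge0// -expR0 ler_expR oppr_le0.
have cS': Ex P (fun w => cos (S w)) = \prod_(0<=k<a N) (M%:R^-1*\sum_j cos (bw a th k j*si)).
 by rewrite cS; apply: eq_bigr => k _; rewrite EC.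
rewrite cS' (_: expR _ = \prod_(0<=k<a N) expR (- (M%:R^-1*\sum_j (bw a th k j*si)^+2/2))); last first.
 rewrite -expR_sum; congr expR; rewrite sumrN -mulr_sumr; congr (- (_*_)).
 have E: \sum_(0<=k<a N) \sum_j (bw a th k j*si)^+2/2 = si*si/2*\sum_(0<=k<a N) \sum_j bw a th k j^+2.
  by rewrite mulr_sumr; apply: eq_bigr => k _; rewrite mulr_sumr; apply: eq_bigr => j _; rewrite exprMn; field.
 by rewrite E (bw_sq th am aN) mulr_sumr; apply: eq_bigr => x _; rewrite /a; field.
apply: le_trans (prod_dist _ _ _) _ => [k|k|].
- by rewrite -EC; apply: (@Ex_norm_le _ _ _ P _ 1); [exact: bm_cos|move=> w; exact: cos_max].
- by apply: e1; rewrite mulr_ge0 ?invr_ge0// sumr_ge0// => j _; rewrite divr_ge0// sqr_ge0.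
apply: le_trans (ler_sum _ (fun k _ => ps k)) _; rewrite sumr_const_nat subn0 -[_ *+ a N]mulr_natl.
have aT: (a N)%:R*(si*si)<=dm n N.
 by have /andP[]:= mz_itv s0 (divr_ge0 (ler0n R N) (exprn_ge0 n (ler0n R 2))).
have:= ler_wpM2r (mulr_ge0 (exprn_ge0 4 Th0) (ltW h0)) aT.
by rewrite [X in X<=_ -> _](_: _ = (a N)%:R*(Th*si)^+4) ?mulrA//; ring.
Qed.

Lemma walk_cf_cvg (sq: nat -> R) n N (th: 'I_N * 'I_M -> R): (forall q, 0<sq q) -> sq @ \oo --> 0 ->
 Ex P (fun w => cos (\sum_x th x*dinc n (zw (sq q) w) x)) @[q --> \oo] -->
  expR (- (M%:R^-1*\sum_x th x^+2*(2^+n)^-1/2)) /\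
 Ex P (fun w => sin (\sum_x th x*dinc n (zw (sq q) w) x)) @[q --> \oo] --> 0.
Proof using M0 bmw sg1 indw.
move=> s0 sc; set Th:= \sum_x `|th x|.
have s2: sq q*sq q @[q --> \oo] --> 0 by rewrite -(mul0r (0: R)); exact: cvgM.
have e1: 2*sq q*Th @[q --> \oo] --> 0.
 rewrite (_: 0 = 2*0*Th); last by rewrite mulr0 mul0r.
 by apply: cvgMl; apply: cvgMr.
have e2: 2*sq q*Th+dm n N*Th^+4*(sq q*sq q) @[q --> \oo] --> 0.
 rewrite (_: 0 = 0+dm n N*Th^+4*0); last by rewrite mulr0 addr0.
 by apply: cvgD => //; apply: cvgMr.
split; last first.
 apply/cvgrPdist_lt => e e0; have /cvgrPdist_lt/(_ _ e0):= e1; apply: filterS => q; rewrite !sub0r !normrN.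
 apply: le_lt_trans; apply: le_trans (ler_norm _); exact: (cf_walk n th (s0 q)).2.
have mc (l: nat): ((mz (sq q) (dm n l.+1))%:R-(mz (sq q) (dm n l))%:R)*(sq q*sq q) @[q --> \oo] --> ((2^+n)^-1: R).
 apply/cvgrPdist_lt => e e0; have /cvgrPdist_lt/(_ _ e0):= s2; apply: filterS => q; rewrite sub0r normrN distrC.
 apply: le_lt_trans; have:= mz_diff (s0 q) (dyad_step R n l); rewrite dyad_len => /le_trans; apply; exact: ler_norm.
have ec: expR (- (M%:R^-1*\sum_x th x^+2*(((mz (sq q) (dm n x.1.+1))%:R-(mz (sq q) (dm n x.1))%:R)*(sq q*sq q))/2)) @[q --> \oo] -->
  expR (- (M%:R^-1*\sum_x th x^+2*(2^+n)^-1/2)).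
 apply: continuous_cvg; first exact: continuous_expR.
 apply: cvgN; apply: cvgMr; apply: cvg_big => [|x _]; first exact: add_continuous.
 by apply: cvgMl; apply: cvgMr; exact: mc.
apply/cvgrPdist_lt => e e0; have e20: 0<e/2 by rewrite divr_gt0.
have /cvgrPdist_lt/(_ _ e20) h1:= ec; have /cvgrPdist_lt/(_ _ e20) h2:= e2.
apply: filterS2 h1 h2 => q h1; rewrite sub0r normrN => h2; have h3:= (cf_walk n th (s0 q)).1.
have {}h3:= le_lt_trans (le_trans h3 (ler_norm _)) h2.
apply: le_lt_trans (ler_distD _ _ _) _; last first.
 rewrite [e]splitr; apply: ltrD; first exact: h1.
 by rewrite distrC; exact: h3.
Qed.

Variable b: nat -> Om -> bool.
Hypothesis bmb: forall k (h: bool -> R), bm (fun w => h (b k w)).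
Hypothesis indb: forall (I: finType) (io: I -> nat) (h: I -> bool -> R), injective io ->
 Ex P (fun w => \prod_i h i (b (io i) w)) = \prod_i ((h i true+h i false)/2).

(** Each step goes in a given direction with probability 1/M, so a coordinate of the walk has
    variance about t/M at time t. *)
Definition kap: R:= (Num.sqrt M%:R)^-1.
Definition kB (w: Om) (j: 'I_M) (t: R): R:= kap*BM b j t w.

Lemma kap2: kap^+2 = M%:R^-1. Proof using. by rewrite /kap exprVn sqr_sqrtr. Qed.

Lemma kB_npath w: npath (kB w).
Proof using.
split=> [T j t e tT e0|j]; last by rewrite /kB BM0 mulr0.
have k1: 0 < `|kap| + 1 by rewrite ltr_wpDl.
have [del d0 h]:= @BM_unif _ _ Om M b (Num.truncn T).+1 w (e/(`|kap| + 1)) (divr_gt0 e0 k1).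
have TT:= truncnS_gt T; exists del => // s sT st; rewrite /kB -mulrBr normrM.
have lt u: 0<=u<=T -> 0<=u<(Num.truncn T).+1%:R by move=> /andP[-> /le_lt_trans]; apply.
have:= h j t s (lt _ tT) (lt _ sT) st; rewrite ltr_pdivlMr//; apply: le_lt_trans.
by rewrite mulrC ler_wpM2l// lerDl.
Qed.

Lemma measurable_kB j t: mfunT (fun w => kB w j t).
Proof using bmb. by apply: measurable_funM => //; exact: measurable_BM. Qed.

Variables (G: ('I_M -> R -> R) -> R) (K: R).
Hypothesis GK: forall z, `|G z| <= K.
Hypothesis ucG: fucont G.
Let ucG_fcont:= fucont_fcont ucG.

Variable sq: nat -> R.
Hypotheses (sq0: forall q, 0<sq q) (sq1: forall q, sq q<=1) (sqc: sq @ \oo --> 0).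

(** On polygonal paths of a fixed level [G] depends on finitely many increments, so the continuity
    theorem applies; tightness comes from the exponential moments of the walk. *)
Lemma fdd_cvg n N: Ex P (fun w => G (Lp n (dinc n (zw (sq q) w): 'I_N * 'I_M -> R))) @[q --> \oo] -->
 Ex P (fun w => G (Lp n (dinc n (kB w): 'I_N * 'I_M -> R))).
Proof using All.
have K0: 0<=K by apply: le_trans (GK (fun _ _ => 0)).
have dge l: 0<=dm n l by rewrite divr_ge0// exprn_ge0.
have mX q (i: 'I_N * 'I_M): mfunT (fun w => dinc n (zw (sq q) w) i).
 by apply: measurable_funB; apply: measurable_zw.
have mY (i: 'I_N * 'I_M): mfunT (fun w => dinc n (kB w) i).
 by apply: measurable_funB; exact: measurable_kB.
have YE th: Ex P (fun w => cos (\sum_x th x*dinc n (kB w) x)) = expR (- (M%:R^-1*\sum_(x: 'I_N * 'I_M) th x^+2*(2^+n)^-1/2)) /\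
  Ex P (fun w => sin (\sum_x th x*dinc n (kB w) x)) = 0.
 have [c1 c2]:= @cf_BM _ _ _ P M b bmb indb N (fun l => dm n l) (fun x => th x*kap) (dge 0) (fun l => (andP (dyad_step R n l)).2).
 have E (h: R -> R): (fun w => h (\sum_(x: 'I_N * 'I_M) th x*dinc n (kB w) x)) =
  fun w => h (\sum_(x: 'I_N * 'I_M) th x*kap*(BM b x.2 (dm n x.1.+1) w-BM b x.2 (dm n x.1) w)).
  by apply/funext => w; congr h; apply: eq_bigr => x _; rewrite /dinc /kB; ring.
 rewrite (E cos) (E sin) c1 c2; split => //; congr expR; rewrite mulNr mulr_suml mulr_sumr; congr (- _); apply: eq_bigr => x _.
 by rewrite dyad_len exprMn kap2; ring.
have cc (th: 'I_N * 'I_M -> R):= walk_cf_cvg n th sq0 sqc.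
apply: (@levy_continuity _ _ _ P _ (fun q i w => dinc n (zw (sq q) w) i) (fun i w => dinc n (kB w) i) mX mY _ _ (fun x => G (Lp n x)) K).
- by move=> th; have [h _]:= cc th; rewrite -(YE th).1 in h; exact: h.
- by move=> th; have [_ h]:= cc th; rewrite (YE th).2; exact: h.
- by move=> x; exact: GK.
(* Where the increments differ by more than [del] in total, the trivial bound [2*K] is covered by
   the slope [2*K/del]. *)
- move=> e e0; have [T [del [d0 h]]]:= ucG e0; exists (2*K/del); first by rewrite divr_ge0 ?mulr_ge0// ltW.
 move=> x y; set S:= \sum_i _; have S0: 0<=S by apply: sumr_ge0.
 have [Sd|Sd]:= leP S del.
  apply: (@le_trans _ _ e); last by rewrite lerDl mulr_ge0 ?divr_ge0 ?mulr_ge0// ltW.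
  by apply: h => [||j t _]; [exact: Lp_npath|exact: Lp_npath|apply: le_trans Sd; exact: Lp_dist].
 apply: (@le_trans _ _ (2*K)).
  by apply: le_trans (ler_normB _ _) _; have:= GK (Lp n x); have:= GK (Lp n y); lra.
 by rewrite -[leLHS]add0r; apply: lerD; [exact: ltW|rewrite mulrAC ler_pdivlMr// ler_wpM2l ?mulr_ge0// ltW].
- by move=> q; split; [exact: (measurable_Lp n ucG_fcont (mX q))|exists K].
- by split; [exact: (measurable_Lp n ucG_fcont mY)|exists K].
- move=> eta e0; pose y:= 2*expR 4/eta; have y0: 0<y by rewrite divr_gt0// mulr_gt0// expR_gt0.
 have alg (d s p: R): p<=1 -> 0<s -> s<=1 -> d*(s*s)-p<=s*s -> 2*(1*s)^+2*d<=4.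
  move=> p1 s0 s1 h; have: s*s<=1 by [nra].
  by rewrite (_: 2*(1*s)^+2*d = 2*(d*(s*s))); [lra|ring].
 have key (u v s: R): 2+y <= `|u| -> s<=1 -> `|u-v| <= 2*s -> y <= `|v|.
  by move=> h s1 uv; have:= ler_normD (u-v) v; rewrite subrK; lra.
 exists (2+y) => [|q i]; first by lra.
 apply: (@le_trans _ _ (Ex P (fun w => (y <= `|WS J sg (sq q) (mz (sq q) (dm n i.1)) (mz (sq q) (dm n i.1.+1)) i.2 w|)%R%:R))).
  apply: le_Ex; [exact: bm_geind|exact: bm_WSind|].
  move=> w; case: (leP (2+y) _) => // h.
  have:= zw_inc J sg1 i.2 w (sq0 q) (dyad_step R n i.1); rewrite -/(dinc n (zw (sq q) w) i).
  by move=> uv; rewrite (key _ _ _ h (sq1 q) uv).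
 apply: le_trans (WS_tail M0 bmw indw _ _ _ _ _ ltr01) _.
 have e4: expR (2*(1*sq q)^+2*(mz (sq q) (dm n i.1.+1)-mz (sq q) (dm n i.1))%:R)<=expR 4.
  rewrite ler_expR natrB; last by apply: mz_mono => //; exact: dyad_step.
  have:= mz_diff (sq0 q) (dyad_step R n i.1); rewrite dyad_len ler_norml => /andP[_].
  have p1: (2^+n)^-1<=1 :> R by rewrite invf_le1 ?exprn_gt0// exprn_ege1// ler1n.
  by apply: alg.
 have ey: expR (- (1*y))<=y^-1.
  by rewrite mul1r expRN lef_pV2 ?posrE ?expR_gt0//; have:= expR_ge1Dx y; lra.
 apply: le_trans (ler_wpM2l (ler0n R 2) (ler_pM (expR_ge0 _) (expR_ge0 _) ey e4)) _.
 rewrite /y invf_div; have:= expR_gt0 (4: R); move: (expR 4) => v v0.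
 by apply: eq_le_imp; field; rewrite gt_eqF.
exact: tight_fin.
Qed.

(** The walk is close to its interpolation except where its modulus is bad, an event of small
    probability uniformly in [q]; interpolations converge in law by [fdd_cvg]; the Brownian path is
    compared with its interpolation by dominated convergence. *)
Theorem donsker: Ex P (fun w => G (zw (sq q) w)) @[q --> \oo] --> Ex P (fun w => G (kB w)).
Proof using All.
have K0: 0<=K by apply: le_trans (GK (fun _ _ => 0)).
apply/cvgrPdist_lt => /= e e0; have e16: 0<e/16 by rewrite divr_gt0.
have [T [del [d0 uc]]]:= ucG e16; pose T':= (Num.truncn T).+1; have TT: T<T'%:R:= truncnS_gt T.
have bB n N: bm (fun w => G (Lp n (dinc n (kB w): 'I_N * 'I_M -> R))).
 split; last by exists K.
 by apply: (measurable_Lp n ucG_fcont (X:= fun i w => dinc n (kB w) i)) => i; apply: measurable_funB; exact: measurable_kB.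
have bGB: bm (fun w => G (kB w)).
 by split; [apply: (measurable_path ucG_fcont kB_npath) => j t _; exact: measurable_kB|exists K].
have c1: Ex P (fun w => G (Lp n (dinc n (kB w): 'I_(n*2 ^ n) * 'I_M -> R))) @[n --> \oo] --> Ex P (fun w => G (kB w)).
 apply: (@Ex_dct _ _ _ P _ _ K) => [n||n w|]; [exact: bm_meas (bB _ _)|exact: bm_meas|exact: GK|].
 by apply: nearW => w; apply: Lp_cvg; [exact: ucG_fcont|exact: kB_npath].
have /cvgrPdist_lt/(_ _ (divr_gt0 e0 (ltr0n R 8)))[n1 _ h1]:= c1.
have geo (r c: R): 0<r<1 -> c*r^+n @[n --> \oo] --> 0.
 by move=> /andP[r0 r1]; rewrite -(mulr0 c); apply: cvgMr; apply: cvg_expr; rewrite ger0_norm// ltW.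
have rr01: 0<(9/10: R)<1 by apply/andP; split; lra.
have /cvgrPdist_lt/(_ _ d0)[n2 _ h2]:= geo (9/10) 180 rr01.
have /cvgrPdist_lt/(_ _ e16)[n3 _ h3]:= geo _ (2*K*cntC R M T'.+1/(1-rho R)) (rho01 R).
(* Past [n1], [n2] and [n3] the interpolation error of the Brownian path, the modulus of the walk
   and the expected count of bad increments are small. Level [n.+1] leaves room for the strict
   inequality in [zw_mod], and [T'] makes the grid cover [0, T']. *)
pose n:= (n1+n2+n3+T')%N; pose N:= (n.+1*2 ^ n.+1)%N.
have k2: 2*(90*(9/10)^+n)<=del.
 have /= := h2 n (ltac:(rewrite /= /n; lia)); rewrite sub0r normrN => h; apply: le_trans (ltW h); apply: le_trans (ler_norm _); lra.
have k3: 2*K*(cntC R M T'.+1*rho R^+n/(1-rho R))<=e/16.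
 have /= := h3 n (ltac:(rewrite /= /n; lia)); rewrite sub0r normrN => h; apply: le_trans (ltW h); apply: le_trans (ler_norm _).
 by apply: eq_le_imp; ring.
have dW q: `|Ex P (fun w => G (zw (sq q) w))-Ex P (fun w => G (Lp n.+1 (dinc n.+1 (zw (sq q) w): 'I_N * 'I_M -> R)))| <= e/8.
 have h0: 0<sq q*sq q by rewrite mulr_gt0.
 (* From level [K1] on, dyadic intervals are no longer than a step; the bound of [Ex_cntw] does not
    depend on [K1]. *)
 have [K1 hK1]: exists K1: nat, (2^+K1)^-1<=sq q*sq q.
  have /cvgrPdist_lt/(_ _ h0)[K1 _ hK]:= @cvg_half R.
  by exists K1; have:= hK K1 (leqnn _); rewrite sub0r normrN ger0_norm ?exprn_ge0 ?invr_ge0// exprVn => /ltW.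
 have bc:= bm_cntw bmw (sq q) T'.+1 n K1.
 have bz: bm (fun w => G (zw (sq q) w)).
  by split; [apply: (measurable_path ucG_fcont (fun w => zw_npath J sg w (sq0 q))) => j t t0; exact: measurable_zw|exists K].
 have bL: bm (fun w => G (Lp n.+1 (dinc n.+1 (zw (sq q) w): 'I_N * 'I_M -> R))).
  split; last by exists K.
  apply: (measurable_Lp n.+1 ucG_fcont (X:= fun i w => dinc n.+1 (zw (sq q) w) i)) => i; apply: measurable_funB; apply: measurable_zw => //; by rewrite divr_ge0// exprn_ge0.
 apply: le_trans (Ex_diff_le P bz bL (h:= fun w => e/16+2*K*cntw J sg (sq q) T'.+1 n K1 w) _ _) _.
 - by apply: bmD; [exact: bm_cst|exact: bmZ].
 - move=> w; have cw0: 0<=cntw J sg (sq q) T'.+1 n K1 w by do 3!apply: sumr_ge0 => ? _.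
  have [cw|cw]:= ltP (cntw J sg (sq q) T'.+1 n K1 w) 1; last first.
   apply: (@le_trans _ _ (2*K*1)); last by rewrite -[leLHS]add0r lerD ?(ltW e16)// ler_wpM2l// mulr_ge0.
   by apply: le_trans (ler_normB _ _) _; have:= GK (zw (sq q) w); have:= GK (Lp n.+1 (dinc n.+1 (zw (sq q) w): 'I_N * 'I_M -> R)); lra.
  apply: (@le_trans _ _ (e/16)); last by rewrite lerDl !mulr_ge0.
  rewrite distrC; apply: uc; [exact: zw_npath|exact: Lp_npath|move=> j t /andP[t0 tT]].
  apply: le_trans k2; apply: (Lp_close (T:= T')).
  + by case: (zw_npath J sg w (sq0 q)).
  + by rewrite /N leq_mul2r; apply/orP; right; apply: leqW; rewrite /n leq_addl.
  + move=> j' s' t' /andP[s0' sT'] /andP[t0' tT'] st.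
   have T1: T'%:R<T'.+1%:R :> R by rewrite ltr_nat.
   apply: (zw_mod sg1 (sq0 q) hK1 cw); rewrite ?s0' ?t0'/= ?(le_lt_trans _ T1)//.
   by apply: le_lt_trans st _; rewrite ltf_pV2 ?posrE ?exprn_gt0// ltr_eXn2l// ltr1n.
  + by rewrite t0 (le_lt_trans tT).
 rewrite (ExD P (bm_cst _ _) (bmZ _ bc)) Ex_cst (ExZ P _ bc).
 have:= ler_wpM2l (mulr_ge0 (ler0n R 2) K0) (Ex_cntw M0 bmw indw T'.+1 n K1 (sq0 q)); lra.
have /cvgrPdist_lt/(_ _ (divr_gt0 e0 (ltr0n R 8))):= @fdd_cvg n.+1 N; apply: filterS => q hq.
have hn:= h1 n.+1 (leqW (leq_trans (leq_addr _ _) (leq_trans (leq_addr _ _) (leq_addr _ _)))); rewrite /= -/N in hn; move: (dW q) hq hn.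
by rewrite !ltr_norml ler_norml => /andP[? ?] /andP[? ?] /andP[? ?]; apply/andP; split; lra.
Qed.

End Donsker.

(** * Bounds and sign of a periodic nonvanishing speed *)

Section PeriodicSpeeds.
Variables (R: realType) (d: nat) (f: 'rV[R]_d -> R) (L: R).
Hypotheses (L0: 0<=L) (fl: forall x y, `|f x-f y| <= L*enorm (x-y)) (fp: Zd_periodic f).

Lemma periodic_bdd x: `|f x| <= `|f 0| + L*d%:R.
Proof using L0 fl fp.
have [k pk xk]:= period_near fp x; rewrite -(subrK k x) pk -{1}(subrK (f 0) (f (x-k))) addrC.
apply: le_trans (ler_normD _ _) _; rewrite lerD2l; apply: le_trans (fl _ _) _.
by rewrite subr0 ler_wpM2l.
Qed.

Lemma lip_cont: continuous f.
Proof using L0 fl.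
move=> x; apply/cont_enormP => e e0; exists (e/(L+1)); first by rewrite divr_gt0// ltr_wpDl.
move=> y; rewrite ltr_pdivlMr ?ltr_wpDl// => h; apply: le_lt_trans (fl _ _) _.
by have:= enorm_ge0 (y-x); nra.
Qed.

Hypothesis f0: forall x, f x != 0.

Lemma periodic_min: exists2 cm: R, 0<cm & forall x, cm <= `|f x|.
Proof using L0 fl fp f0.
have [||c _ hc]:= @EVT_min_rV R d (fun x => `|f x|) [set x | enorm x<=d%:R] _ (@closed_ball_compact R d d%:R).
- by exists 0; rewrite /= enorm0.
- by apply: continuous_subspaceT => y; apply: (@continuous_comp _ _ _ f (fun u => `|u|)); [exact: lip_cont|exact: norm_continuous].
exists `|f c|; first by rewrite normr_gt0.
by move=> x; have [k pk xk]:= period_near fp x; rewrite -(subrK k x) pk; apply: hc; rewrite inE.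
Qed.

(** Intermediate value theorem on the segment between two points of opposite sign. *)
Lemma nonvanishing_sign: exists2 s: R, s = 1 \/ s = -1 & forall x, f x = s * `|f x|.
Proof using L0 fl f0.
have opp x y: 0<f x -> f y<0 -> False.
 move=> fx fy; pose g (t: R):= f (x+t *: (y-x)).
 have cg: continuous g.
  move=> t; apply: (@continuous_comp _ _ _ (fun t: R => x+t *: (y-x)) f); last exact: lip_cont.
  by apply: cvgD; [exact: cvg_cst|exact: scalel_continuous].
 have [|c _ gc]:= @IVT R g 0 1 0 ler01 (continuous_subspaceT cg).
  by rewrite /g scale0r scale1r addr0 addrCA subrr addr0 ge_min (ltW fy) orbT le_max (ltW fx).
 by have:= f0 (x+c *: (y-x)); rewrite -/(g c) gc eqxx.
have [p|n]:= ltP 0 (f 0).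
 exists 1; first by left.
 by move=> x; rewrite mul1r ger0_norm// leNgt; apply/negP => h; exact: opp p h.
exists (-1); first by right.
have n0: f 0<0 by rewrite lt_neqAle f0.
by move=> x; rewrite mulN1r ler0_norm ?opprK// leNgt; apply/negP => h; exact: opp h n0.
Qed.

End PeriodicSpeeds.

(** * Coding of the letters by a pattern and a sign *)

Section LetterCoding.
Variables (R: realType) (m: nat).
Local Notation M:= (2 ^ m)%N.

Lemma card_ratio: #|{: {ffun 'I_m -> bool}}| = M. Proof. by rewrite card_ffun card_bool card_ord. Qed.

(* A letter is coded by its first sign and by which of its signs agree with the first one. *)
Definition ratio (j: 'I_M): {ffun 'I_m -> bool} := enum_val (cast_ord (esym card_ratio) j).
Definition vec (p: 'I_M*bool): letter m.+1 :=
 [ffun i => if unlift ord0 i is Some k then ratio p.1 k == p.2 else p.2].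
Definition unvec (l: letter m.+1): 'I_M*bool :=
 (cast_ord card_ratio (enum_rank [ffun k => l (lift ord0 k) == l ord0]), l ord0).

Lemma vec0 p: vec p ord0 = p.2. Proof. by rewrite ffunE unlift_none. Qed.

Lemma vecK: cancel vec unvec.
Proof.
move=> [j c]; rewrite /unvec vec0 /=; congr (_, _); rewrite (_: [ffun k => _] = ratio j).
 by rewrite /ratio enum_valK; apply: val_inj.
by apply/ffunP => k; rewrite !ffunE liftK /=; case: (ratio _ _); case: c.
Qed.

Lemma unvecK: cancel unvec vec.
Proof.
move=> l; apply/ffunP => i; rewrite ffunE; case: unliftP => [k|] -> //=.
by rewrite /ratio cast_ordK enum_rankK ffunE; case: (l _); case: (l _).
Qed.

(** Changing the first sign flips the whole letter and hence the speed, which is why 2^m patterns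
    suffice for 2^(m+1) letters. *)
Lemma sgb_vec j c i: sgb R (vec (j, c) i) = sgb R c*sgb R (vec (j, true) i).
Proof.
rewrite !ffunE; case: (unlift _ _) => [k|] /=; last by rewrite mulr1.
by case: (ratio _ _); case: c; rewrite /= ?mul1r ?mulN1r ?opprK.
Qed.

Lemma avg_vec (h: 'I_M -> bool -> R) :
 avg (fun l: letter m.+1 => h (unvec l).1 (unvec l).2) = (2*M%:R)^-1*\sum_j (h j true+h j false).
Proof.
rewrite /avg exprVn exprS natrX; congr (_*_).
rewrite (reindex vec); last by apply: onW_bij; exists unvec; [exact: vecK|exact: unvecK].
under eq_bigr do rewrite vecK; rewrite -(pair_bigA _ (fun j c => h j c))/=; apply: eq_bigr => j _.
by rewrite big_bool.
Qed.

Lemma avg_first (h: bool -> R): avg (fun l: letter m.+1 => h (l ord0)) = (h true+h false)/2.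
Proof.
rewrite (avg_vec (fun _ c => h c)) sumr_const card_ord -[_ *+ M]mulr_natl.
by field; rewrite pnatr_eq0 expn_eq0.
Qed.

End LetterCoding.

(** * Regularisation of continuous functionals *)

Definition fcts (R: realType) (d: nat) (F: ('rV[R]_d -> R -> R) -> R): Prop :=
 forall f, cont_on_half f -> forall e: R, 0<e -> exists r del: R, [/\ 0<r, 0<del &
 forall g, cont_on_half g -> (forall x t, enorm x<=r -> 0<=t<=r -> `|g x t-f x t| < del) -> `|F g-F f| < e].

Section Regularization.
Variables (R: realType) (d: nat) (F: ('rV[R]_d -> R -> R) -> R) (C: R).
Local Notation sol:= ('rV[R]_d -> R -> R).
Hypothesis FC: forall g, cont_on_half g -> `|F g| <= C.
Hypothesis Fc: fcts F.

(** Plays the part of a distance at most [r] for local uniform convergence: closeness [r] on a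
    domain of size 1/r. *)
Definition nearf (r: R) (f g: sol): Prop:= forall x t, enorm x<=r^-1 -> 0<=t<=r^-1 -> `|f x t-g x t| <= r.
(** Inf-convolution of [F] with slope [k] for this notion of distance. *)
Definition Fk (k: nat) (f: sol): R :=
 inf [set y | exists g r, [/\ cont_on_half g, 0<r, nearf r f g & y = F g+k%:R*r]].

Lemma Fk_lb k f g r: cont_on_half g -> 0<r -> nearf r f g -> Fk k f<=F g+k%:R*r.
Proof using FC.
move=> cg r0 n; apply: ge_inf; last by exists g, r.
by exists (- C) => _ [g' [r' [cg' r'0 _ ->]]]; have:= FC cg'; have: 0<=k%:R*r' by [rewrite mulr_ge0// ltW]; rewrite ler_norml => ? /andP[? ?]; lra.
Qed.

Lemma Fk_glb k f y: cont_on_half f -> (forall g r, cont_on_half g -> 0<r -> nearf r f g -> y<=F g+k%:R*r) -> y<=Fk k f.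
Proof using.
move=> cf h; apply: lb_le_inf => [|_ [g [r [cg r0 n ->]]]]; last exact: h.
by exists (F f+k%:R*1), f, 1; split => // x t _ _; rewrite subrr normr0.
Qed.

Lemma Fk_le k f: cont_on_half f -> Fk k f<=F f.
Proof using FC.
move=> cf; apply/ler_addgt0Pr => e e0; have k1: 0<k%:R+1 :> R by rewrite ltr_wpDl.
apply: le_trans (Fk_lb k cf (divr_gt0 e0 k1) _) _.
 by move=> x t _ _; rewrite subrr normr0 ltW// divr_gt0.
by rewrite lerD2l mulrCA ler_piMr ?(ltW e0)// ler_pdivrMr// mul1r lerDl.
Qed.

Lemma Fk_bdd k f: cont_on_half f -> `|Fk k f| <= C.
Proof using FC.
move=> cf; have:= FC cf; rewrite !ler_norml => /andP[_ h]; rewrite (le_trans (Fk_le k cf) h) andbT.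
apply: Fk_glb => // g r cg r0 _; have:= FC cg; have: 0<=k%:R*r by [rewrite mulr_ge0// ltW].
by rewrite ler_norml => ? /andP[? ?]; lra.
Qed.

(** A competitor farther than [q] pays at least [k%:R*q>=2*C], more than the range of [F] allows to
    gain; the others lie where [F] varies by less than [e]. *)
Lemma Fk_cvg f: cont_on_half f -> Fk k f @[k --> \oo] --> F f.
Proof using FC Fc.
move=> cf; apply/cvgrPdist_le => /= e e0; have [r [del [r0 d0 h]]]:= Fc cf e0.
pose q:= Num.min r^-1 (del/2); have q0: 0<q by rewrite lt_min invr_gt0 r0 divr_gt0.
exists (Num.truncn (2*C/q)).+1 => // k /= kk.
have kq: 2*C<=k%:R*q by rewrite -ler_pdivrMr//; apply: le_trans (ltW (truncnS_gt _)) _; rewrite ler_nat.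
rewrite ger0_norm ?subr_ge0 ?Fk_le// lerBlDr addrC -lerBlDr; apply: Fk_glb => // g s cg s0 n.
have ks: 0<=k%:R*s by rewrite mulr_ge0// ltW.
have [sq|qs]:= leP s q; last first.
 have:= FC cg; have:= FC cf; rewrite !ler_norml => /andP[? ?] /andP[? ?].
 have: k%:R*q<=k%:R*s by rewrite ler_wpM2l// ltW.
 by lra.
have:= h g cg; move=> /(_ _)h'; have: `|F g-F f| < e.
 apply: h' => x t xr tr; move: sq; rewrite /q le_min => /andP[s1 s2].
 have rs: r<=s^-1 by rewrite -[r]invrK lef_pV2 ?posrE// invr_gt0.
 rewrite distrC; apply: le_lt_trans (n x t _ _) _; [exact: le_trans xr rs|by case/andP: tr => -> /le_trans; apply|lra].
by rewrite ltr_norml => /andP[? ?]; lra.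
Qed.

(** Triangle inequality for [nearf]: the tolerances [r] and [s] add up, on the smaller domain of
    size 1/(r+s). *)
Lemma Fk_lip k f g s: cont_on_half f -> cont_on_half g -> 0<s -> nearf s f g -> `|Fk k f-Fk k g| <= k%:R*s.
Proof using FC.
have one f' g': cont_on_half g' -> 0<s -> nearf s f' g' -> Fk k f'-k%:R*s<=Fk k g'.
 move=> cg s0 n; apply: Fk_glb => // g1 r c1 r0 n1; rewrite lerBlDr -addrA -mulrDr; apply: Fk_lb => //.
  by rewrite addr_gt0.
 have mono a: 0<a -> a<=r+s -> (r+s)^-1<=a^-1 by move=> a0 h; rewrite lef_pV2 ?posrE// addr_gt0.
 have ms:= mono s s0 (ltac:(lra)); have mr:= mono r r0 (ltac:(lra)).
 move=> x t xr /andP[t0 tr]; apply: le_trans (ler_distD (g' x t) _ _) _; rewrite addrC; apply: lerD.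
  by apply: n1; rewrite ?t0/=; [exact: le_trans xr mr|exact: le_trans tr mr].
 by apply: n; rewrite ?t0/=; [exact: le_trans xr ms|exact: le_trans tr ms].
move=> cf cg s0 n; have n': nearf s g f by move=> x t xr tr; rewrite distrC; exact: n.
by have:= one _ _ cg s0 n; have:= one _ _ cf s0 n'; rewrite ler_norml => ? ?; apply/andP; split; lra.
Qed.

End Regularization.

Section RealInequalities.
Variables (R: realType) (x y z c e: R).
Lemma le_maxh: x<=2^-1*(x+y + `|x-y|).
Proof. by have:= ler_norm (x-y); lra. Qed.
Lemma maxh_eq: x<=y -> 2^-1*(x+y + `|x-y|) = y.
Proof. by move=> xy; rewrite ler0_norm ?subr_le0//; lra. Qed.
Lemma dist_le_chain: c<=e -> x<=y -> `|x-z| <= c -> z-e<=y.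
Proof. by rewrite ler_norml => ? ? /andP[? ?]; lra. Qed.
Lemma dist_lt_chain: `|x-y| < e/4 -> `|y-z| < e/4 -> z-e/4<=c -> x-e<=c.
Proof. by rewrite !ltr_norml => /andP[? ?] /andP[? ?]; lra. Qed.
End RealInequalities.

(** * Convergence in law of the solutions *)

Section Assembly.
Variables (R: realType) (d m: nat) (dO: measure_display) (Om: measurableType dO) (P: probability Om R).
Variables (gamma: R) (u0: 'rV[R]_d -> R) (a: 'I_m.+1 -> 'rV[R]_d -> R) (xi: nat -> 'I_m.+1 -> Om -> R)
 (u: R -> Om -> 'rV[R]_d -> R -> R).
Local Notation M:= (2 ^ m)%N.
Hypotheses (gI: 0<gamma<6^-1) (ucu0: unif_cont u0) (aL: forall i, lipschitz_fun (a i) /\ Zd_periodic (a i)).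
Hypothesis a0: forall y: 'I_m.+1 -> R, (forall i, y i = 1 \/ y i = -1) -> forall x, \sum_i a i x*y i != 0.
Hypothesis mxi: forall k i, mfunT (xi k i).
Hypothesis Pxi: forall (n: nat) (y: nat -> 'I_m.+1 -> R), (forall k i, y k i = 1 \/ y k i = -1) ->
 P [set w | forall k i, (k<=n)%N -> xi k i w = y k i] = ((2^-1)^+(m.+1*n.+1))%:E.
Hypothesis usol: forall (eps: R) (w: Om), 0<eps -> uc_class u0 (u eps w) /\ forall k: nat,
 visc_sol (fun x t p => (eps `^ gamma)^-1*(\sum_i a i (eps^-1 *: x)*xi k i w)*enorm p) (u eps w)
  [set t | k%:R*eps `^ (2 * gamma)<t<k.+1%:R*eps `^ (2 * gamma)].

Lemma q0: qlip u0. Proof using ucu0. exact: unif_cont_qlip. Qed.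
Lemma M0: (0<M)%N. Proof using. by rewrite expn_gt0. Qed.

Lemma a_lip: exists2 La: R, 0<=La & forall i x y, `|a i x-a i y| <= La*enorm (x-y).
Proof using aL.
have [La hL]:= choice (fun i => (aL i).1); exists (\sum_i `|La i|); first by apply: sumr_ge0.
move=> i x y; apply: le_trans (hL i x y) _; rewrite ler_wpM2r// (bigD1 i)//=.
by apply: le_trans (ler_norm _) _; rewrite lerDl sumr_ge0.
Qed.

Lemma a_bdd: exists2 A: R, 0<=A & forall i x, `|a i x| <= A.
Proof using aL.
have [La L0 hL]:= a_lip; exists (\sum_i (`|a i 0| + La*d%:R)); first by apply: sumr_ge0 => i _; rewrite addr_ge0// mulr_ge0.
move=> i x; apply: le_trans (periodic_bdd L0 (hL i) (aL i).2 x) _.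
by rewrite (bigD1 i)//= lerDl sumr_ge0// => k _; rewrite addr_ge0// mulr_ge0.
Qed.

(** The speed produced by the letter of pattern [j] whose first sign is positive. *)
Definition phi (j: 'I_M) x: R:= \sum_i a i x*sgb R (vec (j, true) i).
Definition cj (j: 'I_M) x: R:= `|phi j x|.

Lemma phi0 j x: phi j x != 0.
Proof using a0. by apply: a0 => i; case: (vec _ _); [left|right]. Qed.

Lemma phi_lip: exists2 L: R, 0<=L & forall j x y, `|phi j x-phi j y| <= L*enorm (x-y).
Proof using aL.
have [La L0 hL]:= a_lip; exists (m.+1%:R*La); first by rewrite mulr_ge0.
move=> j x y; rewrite /phi -sumrB; apply: le_trans (ler_norm_sum _ _ _) _.
apply: le_trans (ler_sum _ (G:= fun=> La*enorm (x-y)) _) _ => [i _|].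
 by rewrite -mulrBl normrM sgb_norm mulr1.
by rewrite sumr_const card_ord -[_ *+ _]mulr_natl mulrA.
Qed.

Lemma phi_per j: Zd_periodic (phi j).
Proof using aL. by move=> x k; apply: eq_bigr => i _; rewrite (aL i).2. Qed.

Lemma speeds: exists (cmin cmax Lc: R) (sig: 'I_M -> R), [/\ 0<cmin, 0<=Lc, forall j x, cmin<=cj j x<=cmax,
 forall j x y, `|cj j x-cj j y| <= Lc*enorm (x-y) & forall j, (sig j = 1 \/ sig j = -1) /\ forall x, phi j x = sig j*cj j x].
Proof using aL a0.
have [L L0 hL]:= phi_lip.
have [cm hcm]:= choice (fun j => (let: ex_intro2 c c0 hc:= periodic_min L0 (hL j) (phi_per j) (phi0 j) in ex_intro _ c (conj c0 hc)): exists c, 0<c /\ forall x, c<=cj j x).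
have [sg hsg]:= choice (fun j => (let: ex_intro2 s s1 hs:= nonvanishing_sign L0 (hL j) (phi0 j) in ex_intro _ s (conj s1 hs)): exists s, (s = 1 \/ s = -1) /\ forall x, phi j x = s*cj j x).
pose j0: 'I_M:= Ordinal M0.
exists (\big[Num.min/cm j0]_j cm j), (\sum_j (`|phi j 0| + L*d%:R)), L, sg; split => //.
- by elim/big_ind: _ => [|x y x0 y0|j _]; rewrite ?lt_min ?x0//; exact: (hcm _).1.
- move=> j x; apply/andP; split; first by apply: le_trans ((hcm j).2 x); exact: bigmin_le.
 apply: le_trans (periodic_bdd L0 (hL j) (phi_per j) x) _.
 by rewrite (bigD1 j)//= lerDl sumr_ge0// => k _; rewrite addr_ge0// mulr_ge0.
- by move=> j x y; apply: le_trans (ler_dist_dist _ _) (hL j x y).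
Qed.

Variables (cmin cmax Lc: R) (sig: 'I_M -> R).
Hypotheses (cmin0: 0<cmin) (Lc0: 0<=Lc) (cb: forall j x, cmin<=cj j x<=cmax).
Hypothesis clip: forall j x y, `|cj j x-cj j y| <= Lc*enorm (x-y).
Hypothesis sigE: forall j, (sig j = 1 \/ sig j = -1) /\ forall x, phi j x = sig j*cj j x.

Let cl j x: cmin<=cj j x. Proof. by have /andP[]:= cb j x. Qed.
Let cu j x: cj j x<=cmax. Proof. by have /andP[]:= cb j x. Qed.
Let cper j: Zd_periodic (cj j). Proof. by move=> x k; rewrite /cj phi_per. Qed.
Let cx0: 0<=cmax. Proof. exact: le_trans (ltW cmin0) (le_trans (cl (Ordinal M0) 0) (cu (Ordinal M0) 0)). Qed.

Definition Heff:= HB cj cmin cmax Lc.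
Let sl:= HB_sl cmin0 cl cu Lc0 clip cper.

(** The fair coins from which the Brownian motion is built. They enter the walk as well, but only
    laws are compared. *)
Definition bit k w: bool:= lett xi k w ord0.
Definition Jw k w: 'I_M:= (unvec (lett xi k w)).1.
(** The sign of [phi] is included, so that the actual speed is [sgw] times the positive [cj]; the
    product is still a fair sign independent of the pattern. *)
Definition sgw k w: R:= sgb R (unvec (lett xi k w)).2*sig (Jw k w).

Let bmb k (h: bool -> R): bm (fun w => h (bit k w)).
Proof. exact: (bm_letter mxi k (fun l => h (l ord0))). Qed.

Let indb (I: finType) (io: I -> nat) (h: I -> bool -> R): injective io ->
 Ex P (fun w => \prod_i h i (bit (io i) w)) = \prod_i ((h i true+h i false)/2).
Proof.
move=> ii; rewrite (Ex_letters_inj mxi Pxi (fun i l => h i (l ord0)) ii).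
by apply: eq_bigr => i _; exact: avg_first.
Qed.

Let bmw k (g: 'I_M -> R -> R): bm (fun w => g (Jw k w) (sgw k w)).
Proof. exact: (bm_letter mxi k (fun l => g (unvec l).1 (sgb R (unvec l).2*sig (unvec l).1))). Qed.

Let sg1 k w: `|sgw k w| = 1.
Proof. by rewrite normrM sgb_norm mul1r; case: (sigE (Jw k w)).1 => ->; rewrite ?normrN normr1. Qed.

Let indw (r: seq nat) (g: nat -> 'I_M -> R -> R): uniq r ->
 Ex P (fun w => \prod_(k <- r) g k (Jw k w) (sgw k w)) = \prod_(k <- r) avJ (g k).
Proof.
move=> ur; pose h (i: 'I_(size r)) (l: letter m.+1):= g (nth 0%N r i) (unvec l).1 (sgb R (unvec l).2*sig (unvec l).1).
have:= Ex_letters_inj mxi Pxi (io:= fun i: 'I_(size r) => nth 0%N r i) h.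
rewrite (big_nth 0%N) big_mkord => H; rewrite -[RHS](_: \prod_i avg (h i) = _); last first.
 apply: eq_bigr => i _; rewrite (avg_vec (fun j c => g (nth 0%N r i) j (sgb R c*sig j))) /avJ; congr (_*_).
 by apply: eq_bigr => j _; case: (sigE j).1 => -> /=; rewrite ?mul1r ?mulr1 ?mulN1r ?opprK// addrC.
rewrite -H => [|i j /eqP]; last by rewrite nth_uniq// => /eqP/val_inj.
by congr Ex; apply/funext => w; rewrite (big_nth 0%N) big_mkord.
Qed.

(** For paths in [npath] the limit exists by [SolP]; the default 0 makes [Sol z] continuous for
    every [z]. *)
Definition Sol (z: 'I_M -> R -> R): 'rV[R]_d -> R -> R :=
 if pselect (exists v, Lim Heff u0 z v) is left h then projT1 (cid h) else fun _ _ => 0.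

Let SolP z: npath z -> Lim Heff u0 z (Sol z).
Proof.
move=> [cz z0]; rewrite /Sol; case: pselect => [h|[]]; first by case: (cid h).
apply: (Lim_exists cx0 sl (QB_rf cmin0 cl cu Lc0 clip cper) _ q0 M0 cz z0) => j p.
exact: HB_even.
Qed.

Let Sol_cont z: cont_on_half (Sol z).
Proof.
rewrite /Sol; case: pselect => [h|_]; last by apply: continuous_subspaceT => ?; exact: cvg_cst.
by case: (cid h) => v lv; apply: UCall_cont => T; exact: Lim_UC lv.
Qed.

Let Sol_stab (e T: R): 0<e -> 0<T -> exists2 del: R, 0<del & forall z z', npath z -> npath z' ->
 (forall j t, 0<=t<=T -> `|z' j t-z j t| <= del) -> forall x t, 0<=t<=T -> `|Sol z' x t-Sol z x t| <= e.
Proof.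
move=> e0 T0; have [L L0 hL]:= q0 (divr_gt0 e0 (ltr0n R 2)); set K:= cmax*L*M%:R.
have K0: 0<=K by rewrite !mulr_ge0.
have K1: 0<4*(K+1) by rewrite mulr_gt0// ltr_wpDl.
exists (e/(4*(K+1))) => [|z z' nz nz' zz x t tT]; first exact: divr_gt0.
apply: le_trans (Lim_stab cx0 sl (SolP nz') (SolP nz) T0 L0 (ltW (divr_gt0 e0 K1)) hL zz x tT) _.
rewrite -/K (_: K*(2*(e/(4*(K+1)))) = e/2*(K/(K+1))); last by field; rewrite gt_eqF// ltr_wpDl.
have: K/(K+1)<=1 by rewrite ler_pdivrMr ?ltr_wpDl// mul1r lerDl.
by move: (K / _) => v v1; nra.
Qed.

Let zwh (s: R):= zw Jw sgw s.
Let kBb:= @kB R dO Om M bit.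

Lemma ucell (eps: R) w: 0<eps ->
 cell_sol (eps `^ (2 * gamma)) (fun k x => (eps `^ gamma)^-1*(\sum_i a i (eps^-1 *: x)*xi k i w)) u0 (u eps w).
Proof using usol.
by move=> e0; have [uc vs]:= usol w e0; split => //; [exact: uc_class_UC uc|case: uc => _ []].
Qed.

Let hom_w (Tm e: R): 0<=Tm -> 0<e -> exists2 eps0: R, 0<eps0 & forall eps w, 0<eps -> eps<eps0 ->
 goodxi xi w -> forall x t, 0<=t<=Tm -> `|u eps w x t-Sol (zwh (eps `^ gamma) w) x t| <= e.
Proof.
move=> Tm0 e0; have g4: 0<gamma<4^-1 by move: gI => /andP[-> h]; apply: lt_trans h _; lra.
have [eps0 p0 h]:= hom_approx cmin0 cl cu Lc0 clip cper g4 q0 Tm0 e0; exists eps0 => // eps w ep ee gw x t tT.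
have E2: eps `^ (2 * gamma) = eps `^ gamma*eps `^ gamma by rewrite mulr_natl mulr2n powRD// (gt_eqF ep) implybT.
apply: (h eps (Jw^~ w) (sgw^~ w)) => //; first by move=> k; rewrite sg1.
 have [uc ui vs]:= ucell w ep; split => // k; have:= vs k; congr visc_sol.
 apply/funext => x'; apply/funext => t'; apply/funext => p; congr (_*_*_).
 (* The letter is its first sign times its pattern; [sigE] then extracts the sign of the speed of
    that pattern. *)
 under eq_bigr => i _ do rewrite gw -(unvecK (lett xi k w)) (surjective_pairing (unvec _)) sgb_vec mulrCA.
 by rewrite -mulr_sumr -/(phi _ _) (sigE _).2 mulrA.
rewrite E2; apply: SolP; apply: zw_npath; exact: powR_gt0.
Qed.

Section Functional.
Variables (F: ('rV[R]_d -> R -> R) -> R) (C: R).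
Hypothesis FC: forall g, cont_on_half g -> `|F g| <= C.
Hypothesis Fc: fcts F.

(** For fixed [eps], continuity of [F] at a solution involves times up to [r] only, hence [K] time
    steps, and [speed_cont] makes the solution there continuous in finitely many entries
    [xi k i]. *)
Lemma bm_u (eps: R): 0<eps -> bm (fun w => F (u eps w)).
Proof using FC Fc usol mxi aL ucu0.
move=> ep; have cu' w: cont_on_half (u eps w) by have [[]]:= usol w ep.
split; last by exists C => w; exact: FC.
pose I:= (nat * 'I_m.+1)%type; apply: (@measurable_countable _ _ _ I (fun i => xi i.1 i.2)) => [i|w e e0]; first exact: mxi.
have [r [del [r0 d0 h]]]:= Fc (cu' w) e0; have h0: 0<eps `^ (2 * gamma) by exact: powR_gt0.
have g0: 0<eps `^ gamma by exact: powR_gt0.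
have [La L0 hL]:= a_lip; have [A A0 hA]:= a_bdd.
pose K:= (Num.truncn (r/eps `^ (2 * gamma))).+1; have rK: r<=K%:R*eps `^ (2 * gamma).
 by rewrite -ler_pdivrMr// ltW// truncnS_gt.
pose X k:= \sum_i `|xi k i w|; have X0 k: 0<=X k by apply: sumr_ge0.
have spd (D: R) (f: 'I_m.+1 -> R) k: (forall i, `|f i| <= D) -> `|(eps `^ gamma)^-1*\sum_i f i*xi k i w| <= (eps `^ gamma)^-1*(D*X k).
 move=> fD; rewrite normrM (gtr0_norm (_: 0<(eps `^ gamma)^-1)) ?invr_gt0// ler_pM2l ?invr_gt0// mulr_sumr.
 by apply: le_trans (ler_norm_sum _ _ _) _; apply: ler_sum => i _; rewrite normrM ler_wpM2r.
have [|del' d'0 hs]:= @speed_cont _ _ _ _ (fun k => (eps `^ gamma)^-1*(La*eps^-1*X k)) (fun k => (eps `^ gamma)^-1*(A*X k)) _ _ h0 q0 _ (ucell w ep) K (del/2) (divr_gt0 d0 (ltr0n R 2)).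
 move=> k; split=> [|| x y | x]; rewrite ?mulr_ge0 ?invr_ge0 ?(ltW g0) ?(ltW ep)//; last exact: spd.
 rewrite -mulrBr -sumrB; under eq_bigr do rewrite -mulrBl.
 rewrite [leRHS](_: _ = (eps `^ gamma)^-1*(La*eps^-1*enorm (x-y)*X k)); last ring.
 apply: spd => i; apply: le_trans (hL i _ _) _; rewrite -scalerBr enormZ gtr0_norm ?invr_gt0// mulrA//.
pose de:= del'*eps `^ gamma/(m.+1%:R*(A+1)); have A1: 0<A+1 by rewrite ltr_wpDl.
exists [seq (k, i) | k <- iota 0 K, i <- enum 'I_m.+1], de; split.
 by rewrite divr_gt0// mulr_gt0.
move=> w' hw; apply: h; first exact: cu'.
move=> x t xr /andP[t0 tr]; rewrite distrC; apply: (@le_lt_trans _ _ (0+del/2)); last by rewrite add0r ltr_pdivrMr//; lra.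
apply: (hs 0 _ _ _ (lexx 0) (ucell w' ep)) => [y|k y kK|]; [by rewrite subrr normr0| |by rewrite t0 (le_trans tr)].
rewrite -mulrBr -sumrB; under eq_bigr do rewrite -mulrBr.
rewrite normrM gtr0_norm ?invr_gt0// mulrC ler_pdivrMr//; apply: le_trans (ler_norm_sum _ _ _) _.
apply: le_trans (ler_sum _ (G:= fun=> (A+1)*de) _) _ => [i _|].
 rewrite normrM; apply: ler_pM => //; first by apply: le_trans (hA i _) _; rewrite lerDl.
 by rewrite distrC; apply: ltW; apply: (hw (k, i)); apply/allpairsP; exists (k, i); rewrite mem_iota mem_enum.
rewrite sumr_const card_ord -[_ *+ _]mulr_natl /de; apply: eq_le_imp.
have m1: (m.+1%:R: R) != 0 by rewrite pnatr_eq0.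
have A2: A+1 != 0 by rewrite gt_eqF.
by move: (m.+1%:R: R) (A+1) m1 A2 => p q p0 q0; field; rewrite p0 q0.
Qed.

Let F_fcont: fcont (fun z => F (Sol z)).
Proof.
move=> z nz e e0; have [r [del [r0 d0 h]]]:= Fc (@Sol_cont z) e0.
have [dl dl0 hs]:= Sol_stab (divr_gt0 d0 (ltr0n R 2)) r0; exists r, dl; split => // z' nz' zz.
apply: ltW; apply: h => // x t _ tr; apply: le_lt_trans (hs z z' nz nz' zz x t tr) _.
by rewrite ltr_pdivrMr//; lra.
Qed.

Lemma bm_ubar: bm (fun w => F (Sol (kBb w))).
Proof.
split; last by exists C => w; exact: FC.
by apply: (measurable_path F_fcont (@kB_npath _ _ _ _ _)) => j t _; exact: measurable_kB.
Qed.

(** Being below [F], the functionals [Fk] give lower bounds only; [weak_cvg] applies them to [F] and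
    to [- F]. *)
Lemma lower_cvg (eps: nat -> R) (e: R): (forall q, 0<eps q) -> eps @ \oo --> 0 -> 0<e ->
 \forall q \near \oo, Ex P (fun w => F (Sol (kBb w)))-e<=Ex P (fun w => F (u (eps q) w)).
Proof.
move=> ep ec e0; have e4: 0<e/4 by rewrite divr_gt0.
have fB k: fucont (fun z => Fk F k (Sol z)).
 move=> e' e'0; have k1: 0<k%:R+1 :> R by rewrite ltr_wpDl.
 have s0: 0<e'/(k%:R+1) by exact: divr_gt0.
 have i0: 0<(e'/(k%:R+1))^-1 by rewrite invr_gt0.
 have [del d0 hs]:= Sol_stab s0 i0.
 exists (e'/(k%:R+1))^-1, del; split => // z z' nz nz' zz.
 apply: le_trans (Fk_lip FC k (@Sol_cont z') (@Sol_cont z) s0 _) _; first by move=> x t _ tT; exact: hs.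
 by rewrite mulrCA ler_piMr ?(ltW e'0)// ler_pdivrMr// mul1r lerDl.
have bK k (Z: Om -> 'I_M -> R -> R): (forall w, npath (Z w)) -> (forall j t, 0<=t -> mfunT (fun w => Z w j t)) ->
  bm (fun w => Fk F k (Sol (Z w))).
 by move=> nZ mZ; split; [exact: (measurable_path (fucont_fcont (fB k)) nZ mZ)|exists C => w; exact: (Fk_bdd FC k (@Sol_cont _))].
have bkB k: bm (fun w => Fk F k (Sol (kBb w))).
 by apply: bK => [w|j t _]; [exact: kB_npath|exact: measurable_kB].
have ck: Ex P (fun w => Fk F k (Sol (kBb w))) @[k --> \oo] --> Ex P (fun w => F (Sol (kBb w))).
 apply: (@Ex_dct _ _ _ P _ _ C) => [k||k w|]; [exact: bm_meas|exact: bm_meas bm_ubar|exact: (Fk_bdd FC k (@Sol_cont _))|].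
 by apply: nearW => w; exact: (Fk_cvg FC Fc (@Sol_cont _)).
have /cvgrPdist_lt/(_ _ e4)[k _ /(_ k (leqnn k)) hk]:= ck.
have k1: 0<k%:R+1 :> R by rewrite ltr_wpDl.
pose s:= e/4/(k%:R+1); have s0: 0<s by exact: divr_gt0.
have i0: 0<=s^-1 by rewrite invr_ge0 ltW.
have [eps0 p0 hom]:= hom_w i0 s0.
(* [donsker] asks for scales at most 1 at every index; eventually the minimum is eps q to the power
   [gamma]. *)
pose sq q:= Num.min (eps q `^ gamma) 1.
have sq0 q: 0<sq q by rewrite lt_min powR_gt0//=.
have sq1 q: sq q<=1 by rewrite ge_min lexx orbT.
have g0: 0<gamma by case/andP: gI.
have pc: eps q `^ gamma @[q --> \oo] --> 0.
 by move: (powR_cvg0 g0) => /cvg_at_rightP; apply.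
have sqc: sq @ \oo --> 0.
 apply/cvgrPdist_lt => e' e'0; have /cvgrPdist_lt/(_ _ e'0):= pc; apply: filterS => q; rewrite !sub0r !normrN.
 by rewrite !ger0_norm ?(ltW (sq0 q)) ?powR_ge0//; apply: le_lt_trans; rewrite ge_min lexx.
have dk:= @donsker _ _ _ P M Jw sgw M0 bmw sg1 indw bit bmb indb (fun z => Fk F k (Sol z)) C
 (fun z => Fk_bdd FC k (@Sol_cont z)) (fB k) sq sq0 sq1 sqc.
have /cvgrPdist_lt/(_ _ e4) hd:= dk; have /cvgrPdist_lt/(_ _ ltr01) hp:= pc; have /cvgrPdist_lt/(_ _ p0) he:= ec.
near=> q; have h1: `|Ex P (fun w => Fk F k (Sol (kBb w)))-Ex P (fun w => Fk F k (Sol (zwh (sq q) w)))| < e/4 by near: q.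
have sqE: sq q = eps q `^ gamma.
 have: `|0-eps q `^ gamma| < 1 by near: q.
 by rewrite sub0r normrN ger0_norm ?powR_ge0// /sq => h; apply/min_idPl; exact: ltW.
have ee: eps q<eps0.
 have: `|0-eps q| < eps0 by near: q.
 by rewrite sub0r normrN; apply: le_lt_trans; exact: ler_norm.
have bz: bm (fun w => Fk F k (Sol (zwh (sq q) w))-e/4).
 by apply: bmB (bm_cst _ _); apply: bK => [w|j t t0]; [exact: zw_npath|exact: measurable_zw].
have bu:= bm_u (ep q).
have h2: Ex P (fun w => Fk F k (Sol (zwh (sq q) w))-e/4)<=Ex P (fun w => F (u (eps q) w)).
 (* The inequality holds only for good letters. [mx] is the maximum of the two sides: above the left
    one everywhere, equal to the right one almost surely. *)
 pose mx w:= 2^-1*(Fk F k (Sol (zwh (sq q) w))-e/4+F (u (eps q) w) + `|Fk F k (Sol (zwh (sq q) w))-e/4-F (u (eps q) w)|).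
 have bmx: bm mx by apply: bmZ; apply: bmD; [exact: bmD|apply: bm_norm; exact: bmB].
 rewrite -(@Ex_ae _ _ _ P mx _ bmx bu).
  by apply: le_Ex => // w; exact: le_maxh.
 apply: filterS (good_ae mxi Pxi) => w gw; apply: maxh_eq.
 have cu': cont_on_half (u (eps q) w) by have [[]]:= usol w (ep q).
 have nr: nearf s (u (eps q) w) (Sol (zwh (sq q) w)) by move=> x t _ tT; rewrite sqE; exact: hom.
 have:= Fk_lip FC k cu' (@Sol_cont _) s0 nr; have:= Fk_le FC k cu'.
 have: k%:R*s<=e/4 by rewrite /s mulrCA ler_piMr ?(ltW e4)// ler_pdivrMr// mul1r lerDl.
 exact: dist_le_chain.
rewrite (ExB P _ (bm_cst _ _)) in h2; last by apply: bK => [w|j t t0]; [exact: zw_npath|exact: measurable_zw].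
by rewrite Ex_cst in h2; exact: dist_lt_chain hk h1 h2.
Unshelve. all: by end_near.
Qed.

End Functional.

Lemma weak_cvg (F: ('rV[R]_d -> R -> R) -> R): bdd_cont_functional F ->
 [/\ mfunT (fun w => F (Sol (kBb w))),
   (forall eps: R, 0<eps -> mfunT (fun w => F (u eps w))) &
   (fun eps => (\int[P]_w (F (u eps w))%:E)%E) @ 0^'+ --> (\int[P]_w (F (Sol (kBb w)))%:E)%E].
Proof.
move=> [[C FC] Fc]; have bB:= bm_ubar FC Fc; have bU eps:= @bm_u F C FC Fc eps.
split => [|eps ep|]; [exact: bm_meas|exact: bm_meas (bU _ ep)|].
have FCN g: cont_on_half g -> `|- F g| <= C by rewrite normrN; exact: FC.
have FcN: fcts (fun g => - F g).
 move=> f cf e /(Fc f cf)[r [del [r0 d0 h]]]; exists r, del; split => // g cg gf.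
 by rewrite -opprD normrN; exact: h.
have ExN (f: Om -> R): bm f -> Ex P (fun w => - f w) = - Ex P f.
 by move=> bf; rewrite -mulN1r -(ExZ P _ bf); congr Ex; apply/funext => w; rewrite mulN1r.
have cR: Ex P (fun w => F (u eps w)) @[eps --> 0^'+] --> Ex P (fun w => F (Sol (kBb w))).
 apply/cvg_at_rightP => eps [ep ec]; apply/cvgrPdist_le => e e0.
 have h1:= lower_cvg FC Fc ep ec e0; have h2:= @lower_cvg (fun g => - F g) C FCN FcN eps e ep ec e0.
 apply: filterS2 h1 h2 => q; rewrite !ExN//; last exact: bU.
 by move=> h1 h2; rewrite ler_norml; apply/andP; split; lra.
rewrite Ex_E//; apply: (@cvg_EFin _ _ _ _ (fun eps => \int[P]_w (F (u eps w))%:E)%E).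
 by near=> eps; rewrite Ex_E//; apply: bU; near: eps; exact: nbhs_right_gt.
apply: cvg_trans cR; apply: near_eq_cvg; near=> eps; rewrite /= Ex_E//; apply: bU.
by near: eps; exact: nbhs_right_gt.
Unshelve. all: by end_near.
Qed.

Lemma assembled: exists (Abar: 'rV[R]_d -> 'I_M -> R) (B: 'I_M -> R -> Om -> R) (ubar: Om -> 'rV[R]_d -> R -> R),
 [/\ forall j, {within [set e | enorm e = 1], continuous (fun e => Abar e j)}, brownian_motion P B,
   {ae P, forall w, stoch_visc_sol Abar u0 (fun j t => B j t w) (ubar w)} &
   forall F: ('rV[R]_d -> R -> R) -> R, bdd_cont_functional F ->
    [/\ mfunT (fun w => F (ubar w)),
      (forall eps: R, 0<eps -> mfunT (fun w => F (u eps w))) &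
      (fun eps => (\int[P]_w (F (u eps w))%:E)%E) @ 0^'+ --> (\int[P]_w (F (ubar w))%:E)%E]].
Proof.
exists (fun e j => kap R M*Heff j e), (BM bit), (fun w => Sol (kBb w)); split => [j|||F bF]; last exact: weak_cvg.
- exact: (sublinear_sphere_cont cx0 sl).
- exact: (@BM_brownian R dO Om P M bit bmb indb).
by apply: nearW => w; apply: (Lim_stoch cx0 sl q0); apply: SolP; exact: kB_npath.
Qed.

End Assembly.

Theorem theorem1p4 (R : realType) (d m : nat) (dO : measure_display)
  (Omega : measurableType dO) (P : probability Omega R)
  (gamma : R) (u0 : 'rV[R]_d -> R) (a : 'I_m -> 'rV[R]_d -> R)
  (xi : nat -> 'I_m -> Omega -> R) (u : R -> Omega -> 'rV[R]_d -> R -> R) :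
  (0 < d)%N -> (0 < m)%N ->
  0 < gamma < 6^-1 ->
  unif_cont u0 ->
  (forall i, lipschitz_fun (a i) /\ Zd_periodic (a i)) ->
  (forall y : 'I_m -> R, (forall i, y i = 1 \/ y i = -1) ->
     forall x, \sum_i a i x * y i != 0) ->
  (forall k i, measurable_fun setT (xi k i)) ->
  (forall (n : nat) (y : nat -> 'I_m -> R), (forall k i, y k i = 1 \/ y k i = -1) ->
     P [set w | forall k i, (k <= n)%N -> xi k i w = y k i] =
     ((2^-1) ^+ (m * n.+1))%:E) ->
  (forall (eps : R) (w : Omega), 0 < eps ->
     uc_class u0 (u eps w) /\
     forall k : nat,
       visc_sol (fun x t p =>
           (eps `^ gamma)^-1 * (\sum_i a i (eps^-1 *: x) * xi k i w) * enorm p)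
         (u eps w)
         [set t | k%:R * eps `^ (2 * gamma) < t < k.+1%:R * eps `^ (2 * gamma)]) ->
  exists (Abar : 'rV[R]_d -> 'I_(2 ^ m.-1) -> R)
         (B : 'I_(2 ^ m.-1) -> R -> Omega -> R)
         (ubar : Omega -> 'rV[R]_d -> R -> R),
    [/\ forall j, {within [set e | enorm e = 1], continuous (fun e => Abar e j)},
        brownian_motion P B,
        {ae P, forall w, stoch_visc_sol Abar u0 (fun j t => B j t w) (ubar w)} &
        forall F : ('rV[R]_d -> R -> R) -> R, bdd_cont_functional F ->
          [/\ measurable_fun setT (fun w => F (ubar w)),
              (forall eps : R, 0 < eps -> measurable_fun setT (fun w => F (u eps w))) &
              (fun eps => (\int[P]_w (F (u eps w))%:E)%E) @ 0^'+ -->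
                (\int[P]_w (F (ubar w))%:E)%E]].
Proof.
(* With [m] positive the letters are indexed by ['I_m.+1], where [ord0] marks the first sign. *)
case: m a xi => [//|m] a xi _ _ gI uc aL a0 mxi Pxi us.
have [cmin [cmax [Lc [sig [c0 L0 cb cl sE]]]]] := speeds aL a0.
exact: (assembled gI uc aL mxi Pxi us c0 L0 cb cl sE).
Qed.
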